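(* Let $X$ be a manifold with corners and let $\mathcal E$ be an index family on $X$ all of whose exponents are real. Suppose that $u\in\mathcal A^{\mathcal E}_{\mathrm{phg}}(X)$ is real-valued and that for any boundary hypersurface $\mathcal F\subseteq X$, one of the following two things happens: (1) $\mathcal F$ is a type 1 boundary hypersurface for $u$, meaning that $\inf E_{\mathcal F}\ge0$; (2) $\mathcal F$ is a type 2 boundary hypersurface for $u$: there exist positive constants $c$ and $\epsilon$ for which, in a neighborhood of $\mathcal F$, $u\ge c\rho_{\mathcal F}^{-\epsilon}$. Then $e^{-u}\in\mathcal A^{\mathcal E'}_{\mathrm{phg}}(X)$, where $\mathcal E'$ is a non-negative index family (i.e. $\inf\mathcal E'\ge0$) which is empty at each type 2 boundary hypersurface.
   Context: Manifolds with corners have embedded boundary hypersurfaces, each with a boundary defining function $\rho_{\mathcal F}$. An index set is a (possibly empty) $E\subseteq\mathbb C\times\mathbb N_0$ (here with real exponents: $E\subseteq\mathbb R\times\mathbb N_0$) such that: the (real parts of the) exponents $s$ have a finite minimum and tend to $\infty$ when arranged in increasing order; for each $s$ only finitely many $p$ have $(s,p)\in E$; $(s,p)\in E$ implies $(s+1,p)\in E$ and, if $p>0$, $(s,p-1)\in E$. An index family $\mathcal E$ on $X$ assigns an index set $E_{\mathcal F}$ to each boundary hypersurface $\mathcal F$. $\mathcal A^{\mathcal E}_{\mathrm{phg}}(X)$, the space of polyhomogeneous conormal (pc) functions with index family $\mathcal E$, consists (inductively on $\dim X$) of functions $u$ such that near each $\mathcal F$, $u\sim\sum_{(s,p)\in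 E_{\mathcal F}}a_{s,p}\rho_{\mathcal F}^s(\log\rho_{\mathcal F})^p$ with coefficients $a_{s,p}$ pc on $\mathcal F$ with the index sets of the hypersurfaces $\mathcal F_i$ meeting $\mathcal F$, and, for all $r$ and all vector fields $V_1,\dots,V_k$ tangent to the boundary, $|V_1\cdots V_k(u-\sum_{\Re s\le r}a_{s,p}\rho_{\mathcal F}^s(\log\rho_{\mathcal F})^p)|\le C\rho_{\mathcal F}^r\prod_i\rho_{\mathcal F_i}^{-N}$ with $C,N$ depending on $r,V_1,\dots,V_k$ (uniformly on compact sets). For an index set $E$, $\inf E=(s,p)$ is the element with $s$ minimal and, for that $s$, $p$ maximal. $\inf E\ge0$ means $s>0$, or $s=0$ and $p=0$ (an empty index set counts as satisfying this). $\inf\mathcal E\ge0$ means $\inf E\ge0$ for every index set $E$ of $\mathcal E$.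
   Formalization: In the definition of pc functions the exponent N in the remainder estimate may depend on the vector fields and the compact set but not on r (C still may); with N depending on r the claim fails, e.g. for u=-x^{-10}χ(x/y) on [0,∞)^2, χ a bump near 1. *)

(* Defs.v *)
(* MathComp / MathComp-Analysis. *)
From HB Require Import structures.
From mathcomp Require Import all_boot all_order all_algebra.
From mathcomp Require Import boolp classical_sets cardinality fsbigop.
From mathcomp Require Import reals topology normedtype derive exp.

Set Implicit Arguments.
Unset Strict Implicit.
Unset Printing Implicit Defensive.

Import Order.TTheory GRing.Theory Num.Theory.
Import numFieldNormedType.Exports.

Local Open Scope classical_set_scope.
Local Open Scope ring_scope.

Section Smooth.
Variables (R : realType) (n : nat).

Definition pderiv (i : 'I_n) (h : 'rV[R]_n -> R) (y : 'rV[R]_n) : R :=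
  'D_(delta_mx 0 i) h y.

(* C^oo on an open set: all iterated partial derivatives exist and are
   continuous. *)
Definition Cinf (O : set 'rV[R]_n) (h : 'rV[R]_n -> R) : Prop :=
  forall (l : seq 'I_n) (y : 'rV[R]_n), O y ->
    {for y, continuous (foldr pderiv h l)} /\
    forall i, derivable (foldr pderiv h l) y (delta_mx 0 i).

(* On a set which need not be open, smooth means: locally the restriction of a
   smooth function defined on an open set of R^n. *)
Definition smooth_on (S : set 'rV[R]_n) (h : 'rV[R]_n -> R) : Prop :=
  forall y, S y -> exists (O : set 'rV[R]_n) (g : 'rV[R]_n -> R),
    [/\ open O, O y, Cinf O g & forall z, O z -> S z -> g z = h z].

Definition orthant : set 'rV[R]_n := [set y | forall i, 0 <= y ord0 i].

End Smooth.

Section Manifold.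
Variables (R : realType) (T : topologicalType).

Record chart (n : nat) := Chart { dom : set T; crd : T -> 'rV[R]_n }.

(* A set of points of T with an atlas.  Working with subsets of one ambient
   type lets boundary hypersurfaces (and their open subsets) be objects of the
   same kind, of dimension one less. *)
Record mfd (n : nat) := Mfd { pts : set T; atlas : set (chart n) }.

Definition relopen (S : topologicalType) (A B : set S) : Prop :=
  exists2 O, open O & B = O `&` A.

(* f o phi^-1 for a chart phi; it is 0 off the image of phi. *)
Definition rep n (c : chart n) (f : T -> R) (y : 'rV[R]_n) : R :=
  xget 0 (f @` [set x | dom c x /\ crd c x = y]).

(* A homeomorphism of an open set of M onto a relatively open subset of the
   model with corners [0, +oo[^n (open sets of [0, +oo[^k x R^(n-k) are locally
   of this form, since R is diffeomorphic to ]0, +oo[). *)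
Definition is_chart n (A : set T) (c : chart n) : Prop :=
  [/\ relopen A (dom c),
      {in dom c &, injective (crd c)},
      crd c @` dom c `<=` @orthant R n &
      forall B, B `<=` dom c ->
        (relopen A B <-> relopen (@orthant R n) (crd c @` B))].

Definition smooth_transition n (c d : chart n) : Prop :=
  forall j, smooth_on (crd c @` (dom c `&` dom d))
                      (rep c (fun x => crd d x ord0 j)).

(* Membership in the maximal atlas. *)
Definition schart n (M : mfd n) (c : chart n) : Prop :=
  is_chart (pts M) c /\
  forall d, atlas M d -> smooth_transition c d /\ smooth_transition d c.

Definition smooth_fun n (M : mfd n) (A : set T) (f : T -> R) : Prop :=
  forall c, schart M c -> smooth_on (crd c @` (A `&` dom c)) (rep c f).

(* Points of codimension k: exactly k coordinates vanish. *)
Definition stratum n (M : mfd n) (k : nat) : set T :=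
  [set x | exists c, [/\ schart M c, dom c x &
                         #|[set i | crd c x ord0 i == 0]%SET| = k]].

Definition interior_pts n (M : mfd n) : set T := stratum M 0.

(* Boundary hypersurfaces: closures of the connected components of the set of
   points of codimension 1. *)
Definition bhs n (M : mfd n) (F : set T) : Prop :=
  exists2 x, stratum M 1 x &
    F = closure (connected_component (stratum M 1) x) `&` pts M.

Definition embedded n (M : mfd n) (F : set T) : Prop :=
  forall x, F x -> exists (c : chart n) (i : 'I_n),
    [/\ schart M c, dom c x &
        forall y, dom c y -> (F y <-> crd c y ord0 i = 0)].

Definition manifold_with_corners n (M : mfd n) : Prop :=
  [/\ hausdorff_space T /\ @second_countable T,
      pts M = setT,
      forall c, atlas M c -> schart M c,
      forall x, exists2 c, atlas M c & dom c x &
      forall F, bhs M F -> embedded M F].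

(* rho is a boundary defining function for F on the open set U of M: smooth,
   nonnegative, vanishing exactly on F, with nonzero differential on F. *)
Definition is_bdf n (M : mfd n) (U F : set T) (rho : T -> R) : Prop :=
  [/\ smooth_fun M U rho,
      forall x, U x -> 0 <= rho x,
      forall x, U x -> (rho x = 0 <-> F x) &
      forall x, U x -> F x ->
        exists (c : chart n) (O : set 'rV[R]_n) (h : 'rV[R]_n -> R) (i : 'I_n),
          [/\ schart M c /\ dom c x, open O /\ O (crd c x), Cinf O h,
              forall y, U y -> dom c y -> O (crd c y) -> rho y = h (crd c y) &
              pderiv i h (crd c x) != 0]].

(* A vector field on the open set U of M, smooth up to the boundary and tangent
   to every boundary hypersurface, as an operator on functions which are smooth
   in the interior: V = \sum_j b_j d/dx_j in every chart, with b_j = 0 where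
   x_j = 0.  Only the values of V f at interior points are meaningful. *)
Definition tangent_field n (M : mfd n) (U : set T)
    (V : (T -> R) -> (T -> R)) : Prop :=
  forall c, schart M c -> exists b : T -> 'rV[R]_n,
    [/\ forall j, smooth_fun M (U `&` dom c) (fun x => b x ord0 j),
        forall x j, U x -> dom c x -> crd c x ord0 j = 0 -> b x ord0 j = 0 &
        forall f, smooth_fun M (U `&` interior_pts M) f ->
          forall x, U x -> dom c x -> interior_pts M x ->
            V f x = \sum_j b x ord0 j * pderiv j (rep c f) (crd c x)].

(* The open subset W of the boundary hypersurface F, as a manifold: a chart of M
   in which F is {x_i = 0} restricts to F by dropping the coordinate x_i. *)
Definition face n (M : mfd n.+1) (F W : set T) : mfd n :=
  Mfd W [set c | exists (d : chart n.+1) (i : 'I_n.+1),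
    [/\ schart M d,
        forall y, dom d y -> (F y <-> crd d y ord0 i = 0),
        dom c = dom d `&` W &
        forall y, crd c y = col' i (crd d y)]].

(* A trivialization (pr, rho) : U -> (F `&` U) x [0, eps[ of M near F, i.e. a
   diffeomorphism with pr = id and rho = 0 on F; in particular rho is a
   boundary defining function of F on U.  U may be a neighborhood of all of F,
   or of any open part of F. *)
Definition trivialization n (M : mfd n.+1) (F U : set T)
    (pr : T -> T) (rho : T -> R) : Prop :=
  [/\ relopen (pts M) U,
      forall x, U x -> F (pr x) /\ U (pr x),
      forall x, U x -> F x -> pr x = x /\ rho x = 0,
      exists2 eps, 0 < eps &
        (forall x, U x -> rho x < eps) /\
        (forall w t, F w -> U w -> 0 <= t -> t < eps ->
           exists x, [/\ U x, pr x = w & rho x = t]) &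
      forall c : chart n, atlas (face M F (F `&` U)) c ->
        schart M (@Chart n.+1 (U `&` pr @^-1` dom c)
          (fun x => row_mx (const_mx (rho x) : 'rV[R]_1) (crd c (pr x))))].

End Manifold.

Section Phg.
Variables (R : realType) (T : topologicalType).

(* For every r only finitely many exponents are <= r: the exponents form a
   finite set or an increasing sequence tending to +oo, and so have a minimum
   when E is nonempty. *)
Definition index_set (E : set (R * nat)) : Prop :=
  [/\ forall r, finite_set [set s | s <= r /\ exists p, E (s, p)],
      forall s, finite_set [set p | E (s, p)],
      forall s p, E (s, p) -> E (s + 1, p) &
      forall s p, E (s, p) -> (0 < p)%N -> E (s, p.-1)].

Definition index_family n (M : mfd R T n) (E : set T -> set (R * nat)) : Prop :=
  forall F, bhs M F -> index_set (E F).

Definition is_inf (E : set (R * nat)) (s : R) (p : nat) : Prop :=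
  E (s, p) /\
  forall s' p', E (s', p') -> s < s' \/ (s' = s /\ (p' <= p)%N).

Definition inf_ge0 (E : set (R * nat)) : Prop :=
  forall s p, is_inf E s p -> 0 < s \/ (s = 0 /\ p = 0%N).

(* Index family on (an open part of) F: a boundary hypersurface H of F lies in
   exactly one boundary hypersurface G <> F of M, and gets the index set of G. *)
Definition face_index n (M : mfd R T n) (F : set T)
    (E : set T -> set (R * nat)) : set T -> set (R * nat) :=
  fun H => [set sp | exists G, [/\ bhs M G, G <> F, H `<=` G & E G sp]].

Definition partial_expansion (E : set (R * nat)) (a : R -> nat -> T -> R)
    (pr : T -> T) (rho : T -> R) (r : R) (x : T) : R :=
  \sum_(sp \in [set sp | E sp /\ sp.1 <= r])
    a sp.1 sp.2 (pr x) * (rho x `^ sp.1) * ln (rho x) ^+ sp.2.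

(* Polyhomogeneous conormal functions, by induction on the dimension.  They are
   functions on the interior (the values of u elsewhere are irrelevant) and are
   real-valued, the exponents being real.  The expansion at F is required in
   every trivialization of M over an open part of F; the condition does not
   depend on the trivialization because (s, p) \in E implies (s + 1, p) \in E.
   The constant N may depend on the vector fields and on the compact set, but
   not on r: if N could grow with r, then u = x^-10 chi(x / y) on [0, +oo[^2
   (chi a bump function supported in ]1/2, 2[) would be polyhomogeneous with
   empty index sets, although it is unbounded. *)
Fixpoint phg n : mfd R T n -> (set T -> set (R * nat)) -> (T -> R) -> Prop :=
  match n return mfd R T n -> (set T -> set (R * nat)) -> (T -> R) -> Prop with
  | 0 => fun M E u => smooth_fun M (interior_pts M) u
  | m.+1 => fun M E u =>
    smooth_fun M (interior_pts M) u /\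
    forall (F U : set T) (pr : T -> T) (rho : T -> R),
    bhs M F -> trivialization M F U pr rho ->
    exists a : R -> nat -> T -> R,
      (forall s p, E F (s, p) ->
         phg (face M F (F `&` U)) (face_index M F E) (a s p)) /\
      forall rhos : set T -> T -> R,
      (forall G, bhs M G -> is_bdf M U G (rhos G)) ->
      forall K : set T, compact K -> K `<=` U ->
      exists (k : nat) (G : 'I_k -> set T),
        (forall i, [/\ bhs M (G i), G i <> F & G i `&` F !=set0]) /\
        forall Vs : seq ((T -> R) -> (T -> R)),
        (forall j, (j < size Vs)%N -> tangent_field M U (nth id Vs j)) ->
        exists N : nat, forall r : R, exists C : R,
        forall x, K x -> interior_pts M x ->
          `|foldr (fun V f => V f)
              (fun z => u z - partial_expansion (E F) a pr rho r z) Vs x|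
          <= C * (rho x `^ r) * \prod_(i < k) rhos (G i) x ^- N
  end.

Definition type1 (E : set T -> set (R * nat)) (F : set T) : Prop :=
  inf_ge0 (E F).

Definition type2 n (M : mfd R T n) (rho : set T -> T -> R) (u : T -> R)
    (F : set T) : Prop :=
  exists c eps : R, [/\ 0 < c, 0 < eps &
    exists O : set T, [/\ open O, F `<=` O &
      forall x, O x -> interior_pts M x -> c * (rho F x `^ (- eps)) <= u x]].

End Phg.

(* Main.v *)
Require Import Defs.
From HB Require Import structures.
From mathcomp Require Import all_boot all_order all_algebra all_fingroup.
From mathcomp Require Import ring lra.
From mathcomp Require Import boolp classical_sets functions cardinality fsbigop.
From mathcomp Require finmap landau.
From mathcomp Require Import reals topology normedtype derive exp sequences.

(* The proof is by induction on the dimension.  At a type 2 hypersurface exp(-u)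
   decays faster than any power of rho, and so does each of its tangent
   derivatives, which are exp(-u) times polynomials in tangent derivatives of u.
   At a type 1 hypersurface F let a be the coefficient of rho^0 (it is 0 if (0, 0)
   is not in the index set): it is polyhomogeneous on F and inherits from u the
   lower bounds at the type 2 hypersurfaces, so exp(-a) is polyhomogeneous by
   induction.  Since u - a = O(rho^delta q^-N), where q is a product of defining
   functions of type 2 hypersurfaces, and exp(-a) and exp(-u) are O(q^m) for every
   m, the Taylor expansion of exp(-(u - a)), multiplied by exp(-a), yields the
   expansion of exp(-u) at F; its exponents lie in the semigroup generated by the
   positive exponents of u and (1, 0). *)

Set Implicit Arguments.
Unset Strict Implicit.
Unset Printing Implicit Defensive.

Import Order.TTheory GRing.Theory Num.Theory.
Import numFieldNormedType.Exports.
Import Defs.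

Local Open Scope classical_set_scope.
Local Open Scope ring_scope.

(** * Smooth functions on subsets of R^n *)

Section Calculus.
Variable R : realType.

(** The exponent N in the remainder bounds of [phg] must not depend on the order r, whereas the
    Taylor expansion of exp(-(u - a)) needs more terms as r grows, and each factor u - a brings its
    own loss P^-m, where P is the product of the defining functions of hypersurfaces meeting F. The
    way out is interpolation: the remainder of u at a very high order is also bounded without any
    loss in P, only in q. A geometric mean of the two bounds costs P^(-theta m), and with theta J <=
    1 none of the J Taylor terms loses more than P^-m. Losses in q are free because exp(-a) absorbs
    them. Bounds without loss in P come from expansions at corners: at a given point one expands at
    the nearest type 1 hypersurface, where a high power of the smallest coordinate pays for the
    negative powers of all other type 1 coordinates. For u - a, the values of u at a point and at
    half its distance to F are compared, and a geometric series is summed. Tangent derivatives are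
    charged separately, each with rho^-eta P^-m for a small eta; the gap after r in the exponents of
    the result pays for eta. *)

Lemma line_quotientE (n : nat) (h : 'rV[R]_n -> R) (z e : 'rV[R]_n) (t : R) :
  (fun k : R => k^-1 *: (((fun s => h (z + s *: e)) \o shift t) (k *: 1) - h (z + t *: e)))
  = (fun k => k^-1 *: ((h \o shift (z + t *: e)) (k *: e) - h (z + t *: e))).
Proof.
apply/funext => k /=; congr (_ *: (h _ - _)).
by rewrite [k *: 1]mulr1 scalerDl addrCA addrC -addrA addrC.
Qed.

Lemma is_derive_line (n : nat) (h : 'rV[R]_n -> R) (z e : 'rV[R]_n) (t : R) :
  derivable h (z + t *: e) e ->
  is_derive t 1 (fun s : R => h (z + s *: e)) ('D_e h (z + t *: e)).
Proof.
move=> dh; split.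
  by rewrite /derivable line_quotientE.
by rewrite /derive line_quotientE.
Qed.


Lemma mvt_line (n : nat) (h : 'rV[R]_n -> R) (z e : 'rV[R]_n) (s : R) :
  (forall t : R, `|t| <= `|s| -> derivable h (z + t *: e) e) ->
  exists2 t : R, `|t| <= `|s| & h (z + s *: e) - h z = 'D_e h (z + t *: e) * s.
Proof.
move=> dh; pose g (t : R) : R := h (z + t *: e).
have dg (t : R) : `|t| <= `|s| -> is_derive t 1 g ('D_e h (z + t *: e)).
  by move=> ts; apply: is_derive_line; apply: dh.
have cg (t : R) : `|t| <= `|s| -> {for t, continuous g}.
  move=> ts; apply: differentiable_continuous; apply/derivable1_diffP.
  by case: (dg t ts).
have g0 : h z = g 0 by rewrite /g scale0r addr0.
have [s0|s0] := leP 0 s.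
  have ins t : t \in `[0, s] -> `|t| <= `|s|.
    by rewrite in_itv /= => /andP[t0 ts]; rewrite !ger0_norm.
  have [t ti||t ts E] := @MVT_segment _ g (fun t => 'D_e h (z + t *: e)) 0 s s0.
  - by apply: dg; apply: ins; apply: subset_itv_oo_cc.
  - have H : {in `[0, s]%classic, continuous g} by move=> t /set_mem ti; apply: cg; apply: ins.
    exact: continuous_in_subspaceT H.
  - by exists t; [exact: ins|rewrite g0 -/(g s) E subr0].
have ins t : t \in `[s, 0] -> `|t| <= `|s|.
  by rewrite in_itv /= => /andP[t0 ts]; rewrite ler0_norm // ltr0_norm // lerN2.
have [t ti||t ts E] := @MVT_segment _ g (fun t => 'D_e h (z + t *: e)) s 0 (ltW s0).
- by apply: dg; apply: ins; apply: subset_itv_oo_cc.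
- have H : {in `[s, 0]%classic, continuous g} by move=> t /set_mem ti; apply: cg; apply: ins.
  exact: continuous_in_subspaceT H.
- exists t; first exact: ins.
  by rewrite g0 -/(g s) -opprB E sub0r mulrN opprK.
Qed.

Lemma le_coord_norm (n : nat) (v : 'rV[R]_n) (j : 'I_n) : `|v ord0 j| <= `|v|.
Proof.
have := @ball_normE R 'rV[R]_n => _.
rewrite -[leRHS]/(mx_norm v) mx_normrE.
by apply: (@le_bigmax _ _ _ 0 (fun i : 'I_1 * 'I_n => `|v i.1 i.2|) (ord0, j)).
Qed.

Lemma ball_rVP (n : nat) (x y : 'rV[R]_n) (e : R) : 0 < e ->
  ball x e y <-> forall j, `|x ord0 j - y ord0 j| < e.
Proof.
move=> e0; split=> [[_ h] j|h]; first exact: h.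
by split=> // i j; rewrite ord1; apply: h.
Qed.

(** Extracts differentiability from [Cinf], which only speaks of partial derivatives. The increment
    of h is split into steps along one coordinate each; on every step the mean value theorem
    produces a partial derivative at a nearby point, and continuity of the partial derivatives
    bounds the error. *)
Lemma differentiable_C1 (n : nat) (h : 'rV[R]_n -> R) (y : 'rV[R]_n) :
  (\forall z \near y, forall i, derivable h z (delta_mx 0 i)) ->
  (forall i, {for y, continuous (pderiv i h)}) ->
  differentiable h y.
Proof.
move=> dh ch.
pose L (v : 'rV[R]_n) : R := \sum_i v ord0 i * pderiv i h y.
have Llin : linear L.
  move=> a u v; rewrite /L scaler_sumr -big_split /=; apply: eq_bigr => i _.
  by rewrite !mxE mulrDl -scalerAl.
pose Lm := GRing.isLinear.Build _ _ _ _ L Llin.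
pose L' : {linear 'rV[R]_n -> R} := HB.pack L Lm.
have Lc : continuous (L' : 'rV[R]_n -> R^o).
  move=> v; apply: differentiable_continuous.
  have -> : (L' : 'rV[R]_n -> R) = \sum_i (fun v : 'rV[R]_n => v ord0 i * pderiv i h y).
    by apply/funext => w; rewrite fct_sumE.
  apply: differentiable_sum => i.
  exact: (differentiableM (differentiable_coord _ _ _) (differentiable_cst _ _)).
have H (eps : R) : 0 < eps -> \forall x \near (0 : 'rV[R]_n),
    `|(((h : 'rV[R]_n -> R^o) \o shift y) - (cst (h y : R^o) + L')) x| <= eps * `|x|.
  move=> eps0.
  (* The n coordinate steps share the error eps; the successor keeps the divisor positive when n =
     0. *)
  pose e1 := eps / n.+1%:R.
  have e10 : 0 < e1 by rewrite divr_gt0.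
  have : \forall z \near y, forall i, `|pderiv i h y - pderiv i h z| < e1.
    apply: (@filter_forall _ 'I_n (fun i z => `|pderiv i h y - pderiv i h z| < e1) (nbhs y)) => i.
    by have /cvgr_dist_lt := ch i; apply.
  move/(filterI dh); rewrite nbhs_ballP => -[d /= d0 dP].
  apply/nbhs_ballP; exists d => //= v; rewrite mx_norm_ball /ball_ /= sub0r normrN => vd.
  rewrite !fctE /=.
  (* [w k] keeps the coordinates of v of index below k, so that the points y + [w k] lead from y to
     y + v by coordinate steps. *)
  pose w k : 'rV[R]_n := \row_j (if (j < k)%N then v ord0 j else 0).
  have wS (k : 'I_n) : w k.+1 = w k + v ord0 k *: delta_mx 0 k.
    apply/rowP => j; rewrite !mxE eqxx /= ltnS leq_eqVlt.
    have [->|jk] := eqVneq j k; first by rewrite eqxx ltnn add0r mulr1.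
    by rewrite -val_eqE in jk; rewrite (negbTE jk) mulr0 addr0.
  have step (k : 'I_n) : `|h (y + w k.+1) - h (y + w k) - v ord0 k * pderiv k h y|
      <= e1 * `|v|.
    have near t : `|t| <= `|v ord0 k| -> ball y d (y + w k + t *: delta_mx 0 k).
      move=> tv; apply/ball_rVP => // j; rewrite !mxE eqxx /= -addrA opprD addrA subrr sub0r normrN.
      apply: le_lt_trans vd; have := le_coord_norm v j.
      have [->|jk] := eqVneq j k; last by rewrite mulr0 addr0; case: ifP => // _; rewrite normr0.
      by rewrite ltnn add0r mulr1; move=> _; apply: le_trans tv (le_coord_norm _ _).
    have [t /near tb|t tv E] := @mvt_line n h (y + w k) (delta_mx 0 k) (v ord0 k).
      by have [+ _] := dP _ tb; apply.
    rewrite wS addrA E mulrC -mulrBr normrM mulrC ler_pM //; last exact: le_coord_norm.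
    by rewrite distrC ltW //; have [_] := dP _ (near _ tv); apply.
  have -> : h (v + y) - (h y + L v) =
     \sum_(k < n) (h (y + w k.+1) - h (y + w k) - v ord0 k * pderiv k h y).
    rewrite sumrB -/(L v) opprD addrA; congr (_ - _).
    have -> : v + y = y + w n.
      by rewrite addrC; congr (_ + _); apply/rowP => j; rewrite mxE ltn_ord.
    have {2}-> : y = y + w 0%N.
      by rewrite -[LHS]addr0; congr (_ + _); apply/rowP => j; rewrite !mxE.
    rewrite -(big_mkord predT (fun k => h (y + w k.+1) - h (y + w k))).
    by rewrite telescope_sumr.
  apply: le_trans (ler_norm_sum _ _ _) _.
  apply: (@le_trans _ _ (\sum_(k < n) (e1 * `|v|))); first by apply: ler_sum => k _.
  rewrite sumr_const card_ord -mulrnAl ler_wpM2r // /e1 -mulrnAr -[leRHS]mulr1.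
  rewrite ler_wpM2l //; first exact: ltW.
  by rewrite -mulr_natl ler_pdivrMr // mul1r ler_nat.
have {}H := (landau.eqaddoP (nbhs_filter_on (0 : 'rV[R]_n)) ((h : 'rV[R]_n -> R^o) \o shift y) (cst (h y : R^o) + L') id).2 H.
apply/diff_locallyP; have D := diff_unique Lc H.
split; first by rewrite D.
by rewrite {1}H; congr (_ + _ + _); rewrite D.
Qed.

Lemma foldr_pderiv_rcons (n : nat) (h : 'rV[R]_n -> R) l i :
  foldr (@pderiv R n) h (rcons l i) = foldr (@pderiv R n) (pderiv i h) l.
Proof. by rewrite -cats1 foldr_cat. Qed.

Lemma Cinf_pderiv (n : nat) O (h : 'rV[R]_n -> R) i : Cinf O h -> Cinf O (pderiv i h).
Proof. by move=> Ch l y Oy; rewrite -foldr_pderiv_rcons; apply: Ch. Qed.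

Lemma Cinf_sub (n : nat) (O O' : set 'rV[R]_n) (h : 'rV[R]_n -> R) :
  O' `<=` O -> Cinf O h -> Cinf O' h.
Proof. by move=> s Ch l y O'y; apply: Ch; apply: s. Qed.

Lemma Cinf_differentiable (n : nat) O (h : 'rV[R]_n -> R) y :
  open O -> Cinf O h -> O y -> differentiable h y.
Proof.
move=> oO Ch Oy; apply: differentiable_C1.
  near=> z; have Oz : O z by near: z; exact: open_nbhs_nbhs.
  by move=> i; have [_] := Ch [::] z Oz.
by move=> i; have [] := Ch [:: i] y Oy.
Unshelve. all: end_near. Qed.


(** A syntactic class of functions, closed under the operations needed later and, up to equality on
    O, under partial derivatives ([sexp_pderiv]). Since its members are differentiable, induction on
    the word of derivatives shows that they are all [Cinf] ([sexp_Cinf]); higher derivatives of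
    products and composites are never written down. *)
Inductive sexp (n : nat) (O : set 'rV[R]_n) : ('rV[R]_n -> R) -> Prop :=
| sx_base f : Cinf O f -> sexp O f
| sx_cst c : sexp O (cst c)
| sx_add f g : sexp O f -> sexp O g -> sexp O (fun y => f y + g y)
| sx_mul f g : sexp O f -> sexp O g -> sexp O (fun y => f y * g y)
| sx_exp f : sexp O f -> sexp O (fun y => expR (f y))
| sx_inv f : sexp O f -> (forall y, O y -> f y != 0) -> sexp O (fun y => (f y)^-1)
| sx_ln f : sexp O f -> (forall y, O y -> 0 < f y) -> sexp O (fun y => ln (f y))
| sx_comp m (O' : set 'rV[R]_m) g (phi : 'I_m -> 'rV[R]_n -> R) :
    open O' -> Cinf O' g -> (forall j, sexp O (phi j)) ->
    (forall y, O y -> O' (\row_j phi j y)) ->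
    sexp O (fun y => g (\row_j phi j y)).

Lemma pderiv_comp1 (n : nat) (g : R -> R) (f : 'rV[R]_n -> R) y i :
  derivable g (f y) 1 -> differentiable f y ->
  differentiable (g \o f) y /\
  pderiv i (g \o f) y = derive1 g (f y) * pderiv i f y.
Proof.
move=> dg df; have dg' : differentiable g (f y) by apply/derivable1_diffP.
have dc : differentiable (g \o f) y by apply: differentiable_comp.
split=> //; rewrite /pderiv [LHS]deriveE // diff_comp //= deriv1E //= -deriveE //.
by rewrite /GRing.scale /= mulrC.
Qed.

Lemma differentiable_row (n m : nat) (phi : 'I_m -> 'rV[R]_n -> R) y :
  (forall j, differentiable (phi j) y) ->
  differentiable (fun z => \row_j phi j z) y.
Proof.
move=> dphi.
have -> : (fun z => \row_j phi j z) = \sum_j (fun z => phi j z *: (delta_mx 0 j : 'rV[R]_m)).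
  apply/funext => z; rewrite fct_sumE; apply/rowP => k; rewrite summxE !mxE.
  rewrite (bigD1 k) //= big1 ?addr0; first by rewrite !mxE !eqxx mulr1.
  by move=> j jk; rewrite !mxE eqxx /= [k == j]eq_sym (negbTE jk) mulr0.
by apply: differentiable_sum => j; apply: differentiableZl.
Qed.

Lemma pderiv_comp (n m : nat) (g : 'rV[R]_m -> R) (phi : 'I_m -> 'rV[R]_n -> R) y i :
  differentiable g (\row_j phi j y) -> (forall j, differentiable (phi j) y) ->
  differentiable (fun z => g (\row_j phi j z)) y /\
  pderiv i (fun z => g (\row_j phi j z)) y =
    \sum_j pderiv j g (\row_j phi j y) * pderiv i (phi j) y.
Proof.
move=> dg dphi; have dG := differentiable_row dphi.
have dc : differentiable (g \o (fun z => \row_j phi j z)) y by apply: differentiable_comp.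
split; first exact: dc.
rewrite /pderiv -[LHS]/('D_(delta_mx 0 i) (g \o (fun z => \row_j phi j z)) y) deriveE //.
rewrite diff_comp //= -[X in 'd g _ X]deriveE // derive_mx; last exact: diff_derivable.
rewrite [X in 'd g _ X = _]matrix_sum_delta big_ord1 linear_sum; apply: eq_bigr => j _; rewrite linearZ /= mulrC -deriveE //; congr (_ * _).
by rewrite mxE; congr (derive _ _ _); apply/funext => z; rewrite mxE.
Qed.

Lemma sexp_differentiable (n : nat) (O : set 'rV[R]_n) f : open O -> sexp O f ->
  forall y, O y -> differentiable f y.
Proof.
move=> oO; elim=> {f} [f Cf|c|f g _ hf _ hg|f g _ hf _ hg|f _ hf|f _ hf h0|f _ hf h0
   |m O' g phi oO' Cg _ hphi h] y Oy.
- exact: Cinf_differentiable Cf Oy.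
- exact: differentiable_cst.
- exact: (differentiableD (hf y Oy) (hg y Oy)).
- exact: (differentiableM (hf y Oy) (hg y Oy)).
- apply: (differentiable_comp (hf y Oy) (g := @expR R)).
  by apply/derivable1_diffP; apply: derivable_expR.
- by apply: differentiableV; [exact: hf|exact: h0].
- apply: (differentiable_comp (hf y Oy) (g := @ln R)); apply/derivable1_diffP.
  by case: (is_derive1_ln (h0 y Oy)).
- have dg := Cinf_differentiable oO' Cg (h y Oy).
  apply: (differentiable_comp (differentiable_row (fun j => hphi j y Oy)) dg).
Qed.

Lemma sexp_sum (n : nat) (O : set 'rV[R]_n) (I : Type) (r : seq I) (F : I -> 'rV[R]_n -> R) :
  (forall i, sexp O (F i)) -> sexp O (fun y => \sum_(i <- r) F i y).
Proof.
move=> hF; elim: r => [|i r IH].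
  rewrite (_ : (fun _ => _) = cst 0); first exact: sx_cst.
  by apply/funext => y; rewrite big_nil.
rewrite (_ : (fun _ => _) = (fun y => F i y + \sum_(i <- r) F i y)); first exact: sx_add.
by apply/funext => y; rewrite big_cons.
Qed.

Lemma sexp_pderiv (n : nat) (O : set 'rV[R]_n) f i : open O -> sexp O f ->
  exists2 f', sexp O f' & forall y, O y -> pderiv i f y = f' y.
Proof.
move=> oO; elim=> {f} [f Cf|c|f g sf [f' sf' hf] sg [g' sg' hg]|f g sf [f' sf' hf] sg [g' sg' hg]
   |f sf [f' sf' hf]|f sf [f' sf' hf] h0|f sf [f' sf' hf] h0
   |m O' g phi oO' Cg sphi hphi h].
- by exists (pderiv i f) => //; apply/sx_base/Cinf_pderiv.
- by exists (cst 0); [exact: sx_cst|move=> y _; rewrite /pderiv derive_cst].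
- exists (fun y => f' y + g' y) => [|y Oy]; first exact: sx_add.
  rewrite /pderiv -hf // -hg //; apply: deriveD; apply: diff_derivable;
  exact: (sexp_differentiable oO).
- exists (fun y => f y * g' y + g y * f' y) => [|y Oy]; first by apply: sx_add; exact: sx_mul.
  rewrite /pderiv -hf // -hg //; apply: deriveM; apply: diff_derivable;
  exact: (sexp_differentiable oO).
- exists (fun y => expR (f y) * f' y) => [|y Oy]; first by apply: sx_mul => //; exact: sx_exp.
  have [_ ->] := pderiv_comp1 i (@derivable_expR R (f y)) (sexp_differentiable oO sf Oy).
  by rewrite derive1E (congr1 (fun g => g (f y)) (@derive_expR R)) hf.
- exists (fun y => (cst (-1) y * ((f y)^-1 * (f y)^-1)) * f' y) => [|y Oy].
    by do !apply: sx_mul => //; [exact: sx_cst|exact: sx_inv|exact: sx_inv].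
  rewrite /pderiv -hf //= mulN1r -invfM -expr2.
  by rewrite deriveV //; [exact: h0|apply: diff_derivable; exact: (sexp_differentiable oO)].
- exists (fun y => (f y)^-1 * f' y) => [|y Oy].
    by apply: sx_mul => //; apply: sx_inv => // y Oy; rewrite gt_eqF // h0.
  have [d1 d2] := is_derive1_ln (h0 y Oy).
  have [_ ->] := pderiv_comp1 i d1 (sexp_differentiable oO sf Oy).
  by rewrite derive1E d2 hf.
- have /choice[phi' /all_and2[sphi' hphi']] : forall j, exists g',
     sexp O g' /\ forall y, O y -> pderiv i (phi j) y = g' y.
    by move=> j; have [g' ? ?] := hphi j; exists g'.
  exists (fun y => \sum_j pderiv j g (\row_j phi j y) * phi' j y) => [|y Oy].
    apply: sexp_sum => j; apply: sx_mul => //.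
    exact: (@sx_comp _ O m O' _ phi oO' (Cinf_pderiv j Cg) sphi h).
  have dg := Cinf_differentiable oO' Cg (h y Oy).
  have [_ ->] := pderiv_comp i dg (fun j => sexp_differentiable oO (sphi j) Oy).
  by apply: eq_bigr => j _; rewrite hphi'.
Qed.

Lemma pderiv_eq_on (n : nat) (O : set 'rV[R]_n) (f g : 'rV[R]_n -> R) i y :
  open O -> (forall z, O z -> f z = g z) -> O y -> pderiv i f y = pderiv i g y.
Proof.
move=> oO fg Oy; apply: near_eq_derive.
by near=> z; apply: fg; near: z; exact: open_nbhs_nbhs.
Unshelve. all: end_near. Qed.

Lemma sexp_Cinf (n : nat) (O : set 'rV[R]_n) f : open O -> sexp O f -> Cinf O f.
Proof.
move=> oO sf.
have H l : exists2 f', sexp O f' & forall y, O y -> foldr (@pderiv R n) f l y = f' y.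
  elim: l => [|i l [f' sf' hf]] /=; first by exists f.
  have [f'' sf'' hf''] := sexp_pderiv i oO sf'.
  by exists f'' => // y Oy; rewrite (pderiv_eq_on i oO hf Oy) hf''.
move=> l y Oy; have [f' sf' hf] := H l.
have df := sexp_differentiable oO sf' Oy.
have N : \forall z \near y, f' z = foldr (@pderiv R n) f l z.
  by near=> z; rewrite hf //; near: z; exact: open_nbhs_nbhs.
split.
  rewrite /prop_for /continuous_at hf //.
  apply: cvg_trans (differentiable_continuous df).
  move=> A NA; rewrite nbhs_simpl /=; near=> z.
  have E : f' z = foldr (@pderiv R n) f l z by near: z.
  rewrite /preimage /= -E.
  by near: z; exact: NA.
by move=> i; apply: near_eq_derivable N _; apply: diff_derivable.
Unshelve. all: end_near. Qed.


Lemma Cinf_coord (n : nat) (O : set 'rV[R]_n) j : Cinf O (fun y => y ord0 j).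
Proof.
have d y : differentiable (fun y : 'rV[R]_n => y ord0 j) y.
  exact: differentiable_coord.
move=> l y _; case/lastP: l => [|l i].
  split=> [|i]; [exact: differentiable_continuous|exact: diff_derivable].
rewrite foldr_pderiv_rcons.
have -> : pderiv i (fun y : 'rV[R]_n => y ord0 j) = cst ((delta_mx 0 i : 'rV[R]_n) ord0 j).
  apply/funext => z; rewrite /pderiv /derive.
  apply: lim_near_cst => //; near=> t; rewrite /= mxE addrK mxE /GRing.scale /= mulrA mulVf ?mul1r //.
  by near: t; exact: nbhs_dnbhs_neq.
by apply: (sexp_Cinf openT (sx_cst _ _)).
Unshelve. all: end_near. Qed.

(** * Smooth functions on sets that need not be open *)

Lemma smooth_on_eq (n : nat) (S : set 'rV[R]_n) f g :
  (forall z, S z -> f z = g z) -> smooth_on S f -> smooth_on S g.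
Proof.
move=> fg sf y Sy; have [O [h [oO Oy Ch hf]]] := sf y Sy.
by exists O, h; split=> // z Oz Sz; rewrite -fg // hf.
Qed.

Lemma smooth_on_sub (n : nat) (S S' : set 'rV[R]_n) f :
  S' `<=` S -> smooth_on S f -> smooth_on S' f.
Proof.
move=> ss sf y Sy; have [O [h [oO Oy Ch hf]]] := sf y (ss _ Sy).
by exists O, h; split=> // z Oz Sz; apply: hf => //; apply: ss.
Qed.

Lemma smooth_on_local (n : nat) (S : set 'rV[R]_n) f :
  (forall y, S y -> exists O, [/\ open O, O y & smooth_on (S `&` O) f]) -> smooth_on S f.
Proof.
move=> H y Sy; have [O [oO Oy sf]] := H y Sy.
have [O' [h [oO' Oy' Ch hf]]] := sf y (conj Sy Oy).
exists (O' `&` O), h; split=> //; first exact: openI.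
  by apply: Cinf_sub Ch => z [].
by move=> z [O'z Oz] Sz; apply: hf.
Qed.

Lemma smooth_on_base (n : nat) (S O : set 'rV[R]_n) f :
  open O -> S `<=` O -> Cinf O f -> smooth_on S f.
Proof. by move=> oO SO Cf y Sy; exists O, f; split=> //; exact: SO. Qed.

Lemma smooth_on_coord (n : nat) (S : set 'rV[R]_n) j : smooth_on S (fun y => y ord0 j).
Proof. by apply: (smooth_on_base openT) => //; apply: Cinf_coord. Qed.

Lemma smooth_on_cst (n : nat) (S : set 'rV[R]_n) c : smooth_on S (fun=> c).
Proof.
apply: (smooth_on_base openT) => //.
exact: (sexp_Cinf openT (sx_cst _ c)).
Qed.

Lemma smooth_on_comp (n m : nat) (S : set 'rV[R]_n) (S' : set 'rV[R]_m)
    (phi : 'I_m -> 'rV[R]_n -> R) f :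
  (forall j, smooth_on S (phi j)) -> (forall y, S y -> S' (\row_j phi j y)) ->
  smooth_on S' f -> smooth_on S (fun y => f (\row_j phi j y)).
Proof.
move=> sphi SS' sf y Sy.
have /choice[OG hOG] : forall j, exists Og : set 'rV[R]_n * ('rV[R]_n -> R),
   [/\ open Og.1, Og.1 y, Cinf Og.1 Og.2 & forall z, Og.1 z -> S z -> Og.2 z = phi j z].
  by move=> j; have [O [g H]] := sphi j y Sy; exists (O, g).
have [O' [h [oO' O'y Ch hf]]] := sf _ (SS' y Sy).
pose G z := \row_j (OG j).2 z.
have nO : nbhs y (\bigcap_j (OG j).1).
  apply: (@filterS _ (nbhs y) _ (fun z => forall j, (OG j).1 z)) => [z Hz j _|]; first exact: Hz.
  apply: (@filter_forall _ 'I_m (fun j z => (OG j).1 z) (nbhs y)) => j.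
  by have [oO Oy _ _] := hOG j; exact: open_nbhs_nbhs.
pose O1 := (\bigcap_j (OG j).1)°.
have oO1 : open O1 by exact: open_interior.
have O1s z : O1 z -> forall j, (OG j).1 z by move=> /interior_subset h1 j; exact: h1.
have CG j : Cinf O1 (OG j).2.
  by have [_ _ C _] := hOG j; apply: Cinf_sub C => z /O1s.
have GO' : nbhs y (G @^-1` O').
  have GY : G y = \row_j phi j y.
    by apply/rowP => j; rewrite !mxE; have [_ Oy _ ->] := hOG j.
  have : {for y, continuous G}.
    apply: differentiable_continuous; apply: differentiable_row => j.
    by apply: (Cinf_differentiable oO1 (CG j)).
  by apply; rewrite GY; exact: open_nbhs_nbhs.
pose O2 := O1 `&` (G @^-1` O')°.
have oO2 : open O2 by apply: openI => //; exact: open_interior.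
exists O2, (fun z => h (G z)); split=> //.
  apply: sexp_Cinf => //; apply: (sx_comp (O' := O')) => //.
    by move=> j; apply/sx_base; apply: Cinf_sub (CG j) => z [].
  by move=> z [_ /interior_subset].
move=> z [ O1z /interior_subset O'z] Sz.
have E : G z = \row_j phi j z.
  by apply/rowP => j; rewrite !mxE; have [_ _ _ ->] := hOG j => //; exact: O1s.
by rewrite hf ?E // -?E //; rewrite E; exact: SS'.
Qed.

Lemma smooth_on_add (n : nat) (S : set 'rV[R]_n) f g :
  smooth_on S f -> smooth_on S g -> smooth_on S (fun y => f y + g y).
Proof.
move=> sf sg y Sy.
have [O [h [oO Oy Ch hf]]] := sf y Sy; have [O' [k [oO' Oy' Ck kg]]] := sg y Sy.
exists (O `&` O'), (fun y => h y + k y); split=> //; first exact: openI.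
  by apply: sexp_Cinf; [exact: openI|apply: sx_add; apply: sx_base;
    [apply: Cinf_sub Ch|apply: Cinf_sub Ck] => z []].
by move=> z [Oz Oz'] Sz; rewrite hf // kg.
Qed.

Lemma smooth_on_mul (n : nat) (S : set 'rV[R]_n) f g :
  smooth_on S f -> smooth_on S g -> smooth_on S (fun y => f y * g y).
Proof.
move=> sf sg y Sy.
have [O [h [oO Oy Ch hf]]] := sf y Sy; have [O' [k [oO' Oy' Ck kg]]] := sg y Sy.
exists (O `&` O'), (fun y => h y * k y); split=> //; first exact: openI.
  by apply: sexp_Cinf; [exact: openI|apply: sx_mul; apply: sx_base;
    [apply: Cinf_sub Ch|apply: Cinf_sub Ck] => z []].
by move=> z [Oz Oz'] Sz; rewrite hf // kg.
Qed.

Lemma smooth_on_exp (n : nat) (S : set 'rV[R]_n) f :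
  smooth_on S f -> smooth_on S (fun y => expR (f y)).
Proof.
move=> sf y Sy; have [O [h [oO Oy Ch hf]]] := sf y Sy.
exists O, (fun y => expR (h y)); split; [exact: oO|exact: Oy| |].
  by apply: sexp_Cinf => //; apply: sx_exp; apply: sx_base.
by move=> z Oz Sz; rewrite hf.
Qed.

Lemma smooth_on_ln (n : nat) (S : set 'rV[R]_n) f : (forall y, S y -> 0 < f y) ->
  smooth_on S f -> smooth_on S (fun y => ln (f y)).
Proof.
move=> f0 sf y Sy; have [O [h [oO Oy Ch hf]]] := sf y Sy.
pose O' := O `&` [set z | 0 < h z]°.
have oO' : open O' by apply: openI => //; exact: open_interior.
exists O', (fun y => ln (h y)); split=> //.
- split=> //; have : {for y, continuous h} by apply: differentiable_continuous;
    exact: (Cinf_differentiable oO).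
  move/cvgr_gt; apply; rewrite hf //; exact: f0.
- apply: sexp_Cinf => //; apply: sx_ln; first by apply: sx_base; apply: Cinf_sub Ch => z [].
  by move=> z [_ /interior_subset].
by move=> z [Oz _] Sz; rewrite hf.
Qed.


(** * Derivatives at boundary points and the invariance of corners *)

Lemma derive_right0 (n : nat) (h : 'rV[R]_n -> R) (y e : 'rV[R]_n) :
  derivable h y e -> (\forall t \near (0 : R)^'+, h (y + t *: e) = h y) -> 'D_e h y = 0.
Proof.
move=> dh h0; rewrite /derive cvg_at_rightE //; apply: lim_near_cst => //.
by apply: filterS h0 => t ht /=; rewrite [_ *: e + y]addrC ht subrr scaler0.
Qed.

Lemma near_right_ball (n : nat) (O : set 'rV[R]_n) (y : 'rV[R]_n) i :
  open O -> O y -> \forall t \near (0 : R)^'+, O (y + t *: delta_mx 0 i).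
Proof.
move=> oO Oy; have : nbhs y O by exact: open_nbhs_nbhs.
rewrite nbhs_ballP => -[e /= e0 eO].
near=> t; apply: eO; apply/ball_rVP => // j; rewrite !mxE opprD addrA subrr sub0r normrN.
rewrite normrM [X in _ * X]ger0_norm ?ler0n //.
apply: (@le_lt_trans _ _ `|t|); first by rewrite ler_piMr // lern1 leq_b1.
by rewrite gtr0_norm //; near: t; exact: nbhs_right_lt.
Unshelve. all: end_near. Qed.

Lemma orthant_right (n : nat) (y : 'rV[R]_n) i t :
  orthant y -> 0 < t -> orthant (y + t *: delta_mx 0 i).
Proof. by move=> oy t0 j; rewrite !mxE addr_ge0 // mulr_ge0 ?ler0n // ltW. Qed.

(** From a boundary point of the orthant one can still move in each positive coordinate direction,
    and right-hand difference quotients determine a derivative that exists. Hence the first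
    derivatives of a smooth extension do not depend on the extension. *)
Lemma pderiv_orthant_eq (n : nat) (O : set 'rV[R]_n) (f g : 'rV[R]_n -> R) y i :
  open O -> O y -> orthant y -> differentiable f y -> differentiable g y ->
  (forall z, O z -> orthant z -> f z = g z) -> pderiv i f y = pderiv i g y.
Proof.
move=> oO Oy oy df dg fg; apply/eqP; rewrite -subr_eq0; apply/eqP.
have df' := diff_derivable (v := delta_mx 0 i) df.
have dg' := diff_derivable (v := delta_mx 0 i) dg.
rewrite /pderiv -deriveB //; apply: derive_right0; first exact: derivableB.
near=> t; have t0 : 0 < t by [].
rewrite !fctE !fg ?subrr //; last exact: orthant_right.
by near: t; exact: near_right_ball.
Unshelve. all: end_near. Qed.

(** Chain rule for psi after phi. The composite is the identity on the orthant only, so its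
    derivatives are compared with those of the coordinates by [pderiv_orthant_eq]. *)
Lemma jac_inverse (n : nat) (phi psi : 'I_n -> 'rV[R]_n -> R) (O O' : set 'rV[R]_n) y :
  open O -> open O' -> (forall j, Cinf O (phi j)) -> (forall j, Cinf O' (psi j)) ->
  O y -> orthant y ->
  O' (\row_j phi j y) ->
  (forall z, O z -> orthant z -> forall k, psi k (\row_j phi j z) = z ord0 k) ->
  forall k m, \sum_j pderiv j (psi k) (\row_j phi j y) * pderiv m (phi j) y = (m == k)%:R.
Proof.
move=> oO oO' Cphi Cpsi Oy oy O'y inv k m.
have dphi j := Cinf_differentiable oO (Cphi j) Oy.
have dpsi := Cinf_differentiable oO' (Cpsi k) O'y.
have [dc <-] := pderiv_comp m dpsi dphi.
have dco := Cinf_differentiable openT (@Cinf_coord n setT k) (I : setT y).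
rewrite (pderiv_orthant_eq m oO Oy oy dc dco) //; last by move=> z Oz oz; exact: inv.
rewrite /pderiv /derive; apply: lim_near_cst => //; near=> t.
rewrite /= mxE addrK !mxE /GRing.scale /= mulrA mulVf ?mul1r.
  by rewrite eq_sym.
by near: t; exact: nbhs_dnbhs_neq.
Unshelve. all: end_near. Qed.

(** As the i-th coordinate of y is positive, y can be moved both ways in this direction within the
    orthant, and f has a two-sided minimum there. *)
Lemma pderiv_min0 (n : nat) (f : 'rV[R]_n -> R) (O : set 'rV[R]_n) y i :
  open O -> O y -> orthant y -> 0 < y ord0 i -> Cinf O f ->
  (forall z, O z -> orthant z -> 0 <= f z) -> f y = 0 -> pderiv i f y = 0.
Proof.
move=> oO Oy oy yi Cf f0 fy.
have : nbhs y O by exact: open_nbhs_nbhs.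
rewrite nbhs_ballP => -[e /= e0 eO].
pose d := Num.min e (y ord0 i).
have d0 : 0 < d by rewrite lt_min e0.
have B (t : R) : `|t| < d -> O (y + t *: delta_mx 0 i).
  rewrite lt_min => /andP[te _]; apply: eO; apply/ball_rVP => // j.
  rewrite !mxE opprD addrA subrr sub0r normrN normrM [X in _ * X]ger0_norm ?ler0n //.
  by apply: le_lt_trans te; rewrite ler_piMr // lern1 leq_b1.
have Q (t : R) : `|t| < d -> orthant (y + t *: delta_mx 0 i).
  rewrite lt_min => /andP[_ ty] j; rewrite !mxE eqxx /=.
  have [->|_] := eqVneq j i; last by rewrite mulr0 addr0.
  by rewrite mulr1 -lerBlDl sub0r ltW //; move: ty; rewrite ltr_norml => /andP[].
have L (t : R) : `|t| < d -> is_derive t 1 (fun s : R => f (y + s *: delta_mx 0 i))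
     ('D_(delta_mx 0 i) f (y + t *: delta_mx 0 i)).
  move=> td; apply: is_derive_line; apply: diff_derivable.
  by apply: (Cinf_differentiable oO Cf); exact: B.
have nt (t : R) : t \in `]- d, d[ -> `|t| < d by rewrite in_itv /= ltr_norml.
have [||||_ E] := @derive1_at_min R (fun s => f (y + s *: delta_mx 0 i)) (- d) d 0.
- by rewrite (@le_trans _ _ 0) ?oppr_le0 ?ltW.
- by move=> t /nt td; case: (L t td).
- by rewrite in_itv /= oppr_lt0 d0.
- by move=> t /nt td; rewrite scale0r addr0 fy f0 //; [exact: B|exact: Q].
have [|_] := L 0; first by rewrite normr0.
by rewrite E scale0r addr0.
Qed.

(** Otherwise every term of the Leibniz expansion of the determinant of A would contain a zero
    factor, although A is invertible. *)
Lemma jac_perm (n : nat) (A B : 'M[R]_n) : B *m A = 1%:M ->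
  exists s : 'S_n, forall j, A j (s j) != 0.
Proof.
move=> BA; have : \det A != 0.
  by apply/eqP => d0; have := congr1 determinant BA; rewrite det_mulmx d0 mulr0 det1 => /eqP;
    rewrite eq_sym oner_eq0.
have [//|H] := pselect (exists s : 'S_n, forall j, A j (s j) != 0).
 rewrite /determinant big1 ?eqxx // => s _.
have [j] : exists j, ~~ (A j (s j) != 0).
  by apply: contrapT => K; apply: H; exists s => j; apply: contrapT => /negP ?; apply: K; exists j.
by rewrite negbK => /eqP E; rewrite (bigD1 j) //= E mul0r mulr0.
Qed.

Section Corner.
Variables (n : nat) (phi psi : 'I_n -> 'rV[R]_n -> R) (O O' : set 'rV[R]_n) (y : 'rV[R]_n).
Hypotheses (oO : open O) (oO' : open O').
Hypotheses (Cphi : forall j, Cinf O (phi j)) (Cpsi : forall j, Cinf O' (psi j)).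
Hypotheses (Oy : O y) (oy : orthant y) (O'y : O' (\row_j phi j y)).
Hypothesis inv : forall z, O z -> orthant z -> forall k, psi k (\row_j phi j z) = z ord0 k.
Hypothesis phi0 : forall z, O z -> orthant z -> forall k, 0 <= phi k z.

Lemma corner_perm : exists s : 'S_n, forall j, pderiv (s j) (phi j) y != 0.
Proof.
have [|s hs] := @jac_perm n (\matrix_(j, m) pderiv m (phi j) y)
    (\matrix_(k, j) pderiv j (psi k) (\row_j phi j y)).
  apply/matrixP => k m; rewrite !mxE eq_sym.
  rewrite -(jac_inverse oO oO' Cphi Cpsi Oy oy O'y inv).
  by apply: eq_bigr => j _; rewrite !mxE.
by exists s => j; have := hs j; rewrite mxE.
Qed.

(** If [phi j] vanishes at y it has a minimum there, so its derivatives in the directions of the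
    positive coordinates of y vanish ([pderiv_min0]). The permutation with nonzero Jacobian entries
    therefore maps the zeros of phi injectively to zeros of y. Used both ways, this is the
    invariance of the codimension of a corner. *)
Lemma corner_card :
  leq #|[set j | phi j y == 0]%SET| #|[set j | y ord0 j == 0]%SET|.
Proof.
have [s hs] := corner_perm.
rewrite -(card_imset (mem [set j | phi j y == 0]%SET) (@perm_inj _ s)).
apply: subset_leq_card; apply/fintype.subsetP => m /imsetP[j]; rewrite !inE => /eqP pj ->.
apply: contraT => ysj; have := hs j; rewrite (pderiv_min0 oO Oy oy _ (Cphi j)) ?eqxx //.
  by rewrite lt0r ysj; apply: oy.
by move=> z Oz oz; apply: phi0.
Qed.

Lemma corner_row j : exists m, pderiv m (phi j) y != 0.
Proof. by have [s hs] := corner_perm; exists (s j). Qed.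

End Corner.

Lemma Cinf_bounded (n : nat) (O : set 'rV[R]_n) f y : open O -> O y -> Cinf O f ->
  exists e C : R, [/\ 0 < e, 0 < C, ball y e `<=` O & forall z, ball y e z -> `|f z| <= C].
Proof.
move=> oO Oy Cf.
have cf : {for y, continuous f} by apply: differentiable_continuous; exact: (Cinf_differentiable oO).
have N : nbhs y O by exact: open_nbhs_nbhs.
have : nbhs y [set z | `|f y - f z| < 1].
  by have /cvgr_dist_lt := cf; apply.
move/(filterI N); rewrite nbhs_ballP => -[e /= e0 eO].
exists e, (`|f y| + 1); split=> // [|z /eO []//|z /eO [_ /= fz]].
  by rewrite ltr_wpDl.
rewrite -lerBlDl; apply: le_trans (ltW fz); rewrite distrC.
exact: lerB_dist.
Qed.

(** Mean value theorem between z and its projection to the j-th coordinate hyperplane; the segment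
    stays in the ball because the centre y lies on that hyperplane. *)
Lemma Cinf_vanish_le (n : nat) (O : set 'rV[R]_n) f y j :
  open O -> O y -> Cinf O f -> y ord0 j = 0 ->
  exists e C : R, [/\ 0 < e, 0 < C, ball y e `<=` O &
    forall z, ball y e z -> orthant z ->
      f (\row_k (if k == j then 0 else z ord0 k)) = 0 -> `|f z| <= C * z ord0 j].
Proof.
move=> oO Oy Cf yj.
have [e [C [e0 C0 eO bC]]] := Cinf_bounded oO Oy (Cinf_pderiv j Cf).
exists e, C; split=> // z ze oz fz0.
set z0 := (\row_k _) in fz0.
have zE : z = z0 + z ord0 j *: delta_mx 0 j.
  apply/rowP => k; rewrite !mxE eqxx /=; have [->|_] := eqVneq k j; last by rewrite mulr0 addr0.
  by rewrite add0r mulr1.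
have B (t : R) : `|t| <= `|z ord0 j| -> ball y e (z0 + t *: delta_mx 0 j).
  move=> tz; apply/ball_rVP => // k; rewrite !mxE eqxx /=.
  move/ball_rVP : ze => /(_ e0 k); have [->|_] := eqVneq k j; last by rewrite mulr0 addr0.
  by rewrite add0r mulr1 yj !sub0r !normrN; apply: le_lt_trans.
have [t tz|t tz E] := @mvt_line n f z0 (delta_mx 0 j) (z ord0 j).
  apply: diff_derivable; apply: (Cinf_differentiable oO Cf); apply: eO; exact: B.
rewrite zE -[f _]subr0 -fz0 E normrM -zE [`|z ord0 j|]ger0_norm; last exact: oz.
by rewrite ler_wpM2r //; apply: bC; apply: B.
Qed.

End Calculus.

(** * Charts, corners and frames *)

Section Charts.
Variables (R : realType) (T : topologicalType).

Lemma ball_coord n (x y : 'rV[R]_n) (e : R) : ball x e y -> forall j, `|x ord0 j - y ord0 j| < e.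
Proof. by move=> [_ h] j; apply: h. Qed.

Lemma repE n (c : chart R T n) (f : T -> R) x :
  {in dom c &, injective (crd c)} -> dom c x -> rep c f (crd c x) = f x.
Proof.
move=> ci dx; rewrite /rep; case: xgetP => [_ -> [x' [dx' ex'] <-]|/(_ (f x)) []].
  by rewrite (ci x' x) // inE.
by exists x.
Qed.

Lemma relopenE (S : topologicalType) (A B : set S) : relopen A B ->
  (B `<=` A) /\ (forall x, B x -> exists O, [/\ open O, O x & O `&` A `<=` B]).
Proof.
move=> [O oO ->]; split=> [x []//|x [Ox Ax]].
by exists O; split=> //; exact: subset_refl.
Qed.

Lemma mk_relopen (S : topologicalType) (A B : set S) : (B `<=` A) ->
  (forall x, B x -> exists O, [/\ open O, O x & O `&` A `<=` B]) -> relopen A B.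
Proof.
move=> BA H; exists (\bigcup_(O in [set O | open O /\ O `&` A `<=` B]) O).
  by apply: bigcup_open => O [].
apply/seteqP; split=> [x Bx|x [[O [oO OB] Ox] Ax]]; last exact: OB.
by have [O [oO Ox OB]] := H x Bx; split; [exists O|exact: BA].
Qed.

Lemma chart_ball n A (c : chart R T n) x O : is_chart A c -> dom c x -> open O -> O x ->
  exists2 e : R, 0 < e & forall z, ball (crd c x) e z -> orthant z ->
    exists x', [/\ dom c x', O x' & crd c x' = z].
Proof.
move=> [domo ci co ch] dx oO Ox.
have [+ _] := ch (dom c `&` O) (@subIsetl _ _ _).
case.
  move/relopenE: domo => [dA H]; apply: mk_relopen => [y [/dA]//|y [dy Oy]].
  have [O' [oO' O'y sO']] := H y dy; exists (O' `&` O); split; [exact: openI|by []|].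
  by move=> w [[O'w Ow] Aw]; split=> //; apply: sO'.
move=> Q oQ QE.
have Qx : Q (crd c x).
  have : (crd c @` (dom c `&` O)) (crd c x) by exists x.
  by rewrite QE => -[].
have : nbhs (crd c x) Q by exact: open_nbhs_nbhs.
rewrite nbhs_ballP => -[e /= e0 eQ]; exists e => // z ze oz.
have : (Q `&` @orthant R n) z by split=> //; apply: eQ.
by rewrite -QE => -[x' [dx' Ox'] <-]; exists x'.
Qed.

Lemma chart_nbhs n A (c : chart R T n) x Q : is_chart A c -> dom c x -> open Q ->
  Q (crd c x) ->
  exists O, [/\ open O, O x & forall x', O x' -> A x' -> dom c x' /\ Q (crd c x')].
Proof.
move=> [domo ci co ch] dx oQ Qx.
pose B := dom c `&` (crd c @^-1` Q).
have [_ H] := ch B (@subIsetl _ _ _).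
have : relopen (@orthant R n) (crd c @` B).
  have [H1 _] := ch (dom c) (@subset_refl _ _).
  have {H1}[_ H1] := relopenE (H1 domo).
  apply: mk_relopen => [z [x' [dx' _] <-]|z [x' [dx' Qx'] <-]]; first by apply: co; exists x'.
  have [|O [oO Oz OB]] := H1 (crd c x'); first by exists x'.
  exists (O `&` Q); split; [exact: openI|by []|].
  move=> w [[Ow Qw] ow]; have [|x2 dx2 ex2] := OB w; first by split.
  by exists x2 => //; split => //; rewrite /preimage /= ex2.
move/H => /relopenE[_ HB]; have [|O [oO Ox OB]] := HB x; first by split.
by exists O; split=> // x' Ox' Ax'; apply: OB.
Qed.

(** Replaces the quantification over all subsets B of the domain in [is_chart] by two pointwise
    conditions: the coordinate map is open into the orthant, and it is continuous. *)
Lemma mk_chart n A (c : chart R T n) :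
  relopen A (dom c) -> {in dom c &, injective (crd c)} ->
  crd c @` dom c `<=` @orthant R n ->
  (forall x O, dom c x -> open O -> O x ->
    exists2 e : R, 0 < e & forall z, ball (crd c x) e z -> orthant z ->
      exists x', [/\ dom c x', O x' & crd c x' = z]) ->
  (forall x (e : R), dom c x -> 0 < e -> exists O, [/\ open O, O x &
     forall x', O x' -> dom c x' -> ball (crd c x) e (crd c x')]) ->
  is_chart A c.
Proof.
move=> domo ci co H1 H2; split=> // B Bd; move/relopenE: domo => [dA domo].
split=> /relopenE [sB HB]; apply: mk_relopen.
- by move=> z [x /Bd dx <-]; apply: co; exists x.
- move=> z [x Bx <-]; have [O [oO Ox OB]] := HB x Bx.
  have [e e0 He] := H1 x O (Bd _ Bx) oO Ox.
  exists (ball (crd c x) e)°; split; first exact: open_interior.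
    by apply: nbhsx_ballx.
  move=> w [/interior_subset we ow]; have [x' [dx' Ox' <-]] := He w we ow.
  by exists x' => //; apply: OB; split=> //; apply: dA.
- by move=> x /Bd/dA.
- move=> x Bx; have [|Q [oQ Qx QB]] := HB (crd c x); first by exists x.
  have : nbhs (crd c x) Q by exact: open_nbhs_nbhs.
  rewrite nbhs_ballP => -[e /= e0 eQ].
  have [O [oO Ox OQ]] := H2 x e (Bd _ Bx) e0.
  have [O' [oO' Ox' OQ']] := domo x (Bd _ Bx).
  exists (O `&` O'); split=> [||x' [[Ox2 Ox2'] Ax']]; [exact: openI|by []|].
  have dx' : dom c x' by apply: OQ'.
  have [|x2 Bx2 ex2] := QB (crd c x').
    by split; [apply: eQ; exact: OQ|apply: co; exists x'].
  by rewrite -(ci x2 x') // ?inE //; exact: Bd.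
Qed.

Definition restr n (c : chart R T n) (W : set T) : chart R T n := Chart (dom c `&` W) (crd c).

Lemma restr_is_chart n A (c : chart R T n) W :
  is_chart A c -> relopen A W -> is_chart A (restr c W).
Proof.
move=> [domo ci co ch] oW; split.
- move/relopenE: domo => [dA H]; move/relopenE: oW => [WA HW].
  apply: mk_relopen => [x [/dA]//|x [dx Wx]].
  have [O [oO Ox OB]] := H x dx; have [O' [oO' Ox' OB']] := HW x Wx.
  exists (O `&` O'); split; [exact: openI|by []|].
  by move=> y [[Oy Oy'] Ay]; split; [exact: OB|exact: OB'].
- by move=> x y; rewrite !inE => -[dx _] [dy _]; apply: ci; rewrite inE.
- by move=> z [x [dx _] <-]; apply: co; exists x.
- by move=> B Bd; apply: ch => x /Bd[].
Qed.

Lemma smooth_on_image_eq n (c : chart R T n) (A : set T) (f g : T -> R) :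
  {in dom c &, injective (crd c)} -> A `<=` dom c -> (forall x, A x -> f x = g x) ->
  smooth_on (crd c @` A) (rep c f) -> smooth_on (crd c @` A) (rep c g).
Proof.
move=> ci Ad fg; apply: smooth_on_eq => z [x Ax <-].
by rewrite !repE ?fg //; exact: Ad.
Qed.

Lemma smooth_on_restr n (c : chart R T n) (A W : set T) (f : T -> R) :
  {in dom c &, injective (crd c)} -> A `<=` dom c `&` W ->
  smooth_on (crd c @` A) (rep (restr c W) f) <-> smooth_on (crd c @` A) (rep c f).
Proof.
move=> ci Ad; have ci' : {in dom (restr c W) &, injective (crd (restr c W))}.
  by move=> x y; rewrite !inE => -[dx _] [dy _]; apply: ci; rewrite inE.
have E x : A x -> rep (restr c W) f (crd c x) = rep c f (crd c x).
  move=> Ax; have [dx Wx] := Ad x Ax.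
  by rewrite (@repE _ (restr c W)) // repE.
by split; apply: smooth_on_eq => z [x Ax <-]; rewrite E.
Qed.

Lemma smooth_on_change n (c d : chart R T n) (A : set T) (f : T -> R) :
  {in dom c &, injective (crd c)} -> {in dom d &, injective (crd d)} ->
  smooth_transition c d -> A `<=` dom c `&` dom d ->
  smooth_on (crd d @` A) (rep d f) -> smooth_on (crd c @` A) (rep c f).
Proof.
move=> ci di scd Acd sf.
have E x : A x -> (\row_j rep c (fun x => crd d x ord0 j) (crd c x)) = crd d x.
  by move=> Ax; have [dcx ddx] := Acd x Ax; apply/rowP => j; rewrite mxE repE.
pose g y := rep d f (\row_j rep c (fun x => crd d x ord0 j) y).
apply: (@smooth_on_eq _ _ _ g).
  move=> z [x Ax <-]; rewrite /g E //; have [dcx ddx] := Acd x Ax.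
  by rewrite !repE.
apply: smooth_on_comp sf.
  move=> j; apply: smooth_on_sub (scd j) => z [x /Acd Ax <-]; by exists x.
by move=> z [x Ax <-]; rewrite E //; exists x.
Qed.

Lemma smooth_ext n A (c : chart R T n) x (D : set T) (W : set T) (f : T -> R) :
  is_chart A c -> dom c x -> D x -> open W -> W x -> (forall x', W x' -> A x' -> D x') ->
  smooth_on (crd c @` (D `&` dom c)) (rep c f) ->
  exists O g, [/\ open O, O (crd c x), Cinf O g &
    forall z, O z -> orthant z ->
      exists x', [/\ dom c x', W x', crd c x' = z & g z = f x']].
Proof.
move=> ic dx Dx oW Wx WD sf; have [/relopenE[dA _] ci co _] := ic.
have [|O [g [oO Ox Cg gf]]] := sf (crd c x); first by exists x.
have [e e0 He] := chart_ball ic dx oW Wx.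
pose O' := O `&` (ball (crd c x) e)°.
have oO' : open O' by apply: openI => //; exact: open_interior.
exists O', g; split=> //; first by split=> //; exact: nbhsx_ballx.
  by apply: Cinf_sub Cg => z [].
move=> z [Oz /interior_subset ze] oz; have [x' [dx' Wx' ex']] := He z ze oz.
exists x'; split=> //; rewrite gf //; first by rewrite -ex' repE.
by exists x' => //; split=> //; apply: WD => //; exact: dA.
Qed.

End Charts.

Section Manifolds.
Variables (R : realType) (T : topologicalType).

Definition presm n (M : mfd R T n) :=
  (forall c, atlas M c -> schart M c) /\
  (forall x, pts M x -> exists2 c, atlas M c & dom c x).

Section Presm.
Variables (n : nat) (M : mfd R T n).
Hypothesis pM : presm M.

Lemma schart_pts c x : schart M c -> dom c x -> pts M x.
Proof. by move=> [ic _]; have [/relopenE[dA _] _ _ _] := ic => /dA. Qed.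

Lemma schart_inj c : schart M c -> {in dom c &, injective (crd c)}.
Proof. by move=> [[]]. Qed.

Lemma schart_orthant c x : schart M c -> dom c x -> orthant (crd c x).
Proof. by move=> [[_ _ co _] _] dx; apply: co; exists x. Qed.

Lemma dom_open c x : schart M c -> dom c x ->
  exists O, [/\ open O, O x & forall x', O x' -> pts M x' -> dom c x'].
Proof.
move=> [ic _] dx; have [/relopenE[_ H] _ _ _] := ic; have [O [oO Ox OB]] := H x dx.
by exists O; split=> // x' Ox' px'; apply: OB.
Qed.

Lemma smooth_on_chart_local c (A : set T) f : schart M c -> A `<=` dom c ->
  (forall x, A x -> exists O, [/\ open O, O x & smooth_on (crd c @` (A `&` O)) (rep c f)]) ->
  smooth_on (crd c @` A) (rep c f).
Proof.
move=> sc Ac H; apply: smooth_on_local => z [x Ax <-].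
have [O [oO Ox sf]] := H x Ax.
have [e e0 He] := chart_ball (proj1 sc) (Ac _ Ax) oO Ox.
exists (ball (crd c x) e)°; split; [exact: open_interior|exact: nbhsx_ballx|].
apply: smooth_on_sub sf => w [[x' Ax' <-] /interior_subset we].
have [x2 [dx2 Ox2 ex2]] := He _ we (schart_orthant sc (Ac _ Ax')).
have E : x2 = x' by apply: (schart_inj sc) ex2; rewrite inE //; exact: Ac.
by rewrite E in Ox2; exists x'.
Qed.

(** Membership in the maximal atlas only provides compatibility with the atlas; near a common point
    the transition factors through a chart of the atlas. *)
Lemma schart_trans c d : schart M c -> schart M d -> smooth_transition c d.
Proof.
move=> sc sd j; apply: (smooth_on_chart_local sc) => [x []//|x [cx dx]].
have [e ae ex] := pM.2 x (schart_pts sc cx).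
have [O [oO Ox Oe]] := dom_open (pM.1 _ ae) ex; exists O; split=> //.
have se := pM.1 _ ae; have [sce sec] := sc.2 _ ae; have [sde sed] := sd.2 _ ae.
have sub : dom c `&` dom d `&` O `<=` dom c `&` dom e.
  by move=> w [[cw dw] Ow]; split=> //; apply: Oe => //; exact: schart_pts cw.
apply: smooth_on_change sub _ => //; [exact: schart_inj|exact: schart_inj|].
apply: smooth_on_sub (sed j) => z [w [[cw dw] Ow] <-]; exists w => //; split=> //.
by apply: Oe => //; exact: schart_pts cw.
Qed.

Lemma schart_restr c W : schart M c -> relopen (pts M) W -> schart M (restr c W).
Proof.
move=> sc oW; split; first by apply: restr_is_chart => //; exact: (proj1 sc).
move=> d ad; have [scd sdc] := sc.2 d ad; have ci := schart_inj sc; split=> j.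
  have sub : dom (restr c W) `&` dom d `<=` dom c `&` dom d by move=> x [[]].
  apply/(smooth_on_restr (W := W) _ ci); first by move=> x [[]].
  by apply: smooth_on_sub (scd j) => z [x /sub dx <-]; exists x.
by apply: smooth_on_sub (sdc j) => z [x [dx [cx _]] <-]; exists x.
Qed.

Lemma schart_via c d : schart M d -> is_chart (pts M) c -> dom c `<=` dom d ->
  smooth_transition c d -> smooth_transition d c -> schart M c.
Proof.
move=> sd ic cd scd sdc; split=> // e ae; have se := pM.1 e ae.
have ci : {in dom c &, injective (crd c)} by case: ic.
split=> j.
  apply: (smooth_on_change ci (schart_inj sd) scd).
    by move=> x [cx ex]; split=> //; exact: cd.
  by apply: smooth_on_sub (schart_trans sd se j) => z [x [/cd dx ex] <-]; exists x.
apply: (smooth_on_change (schart_inj se) (schart_inj sd) (schart_trans se sd)).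
  by move=> x [ex /cd].
by apply: smooth_on_sub (sdc j) => z [x [ex cx] <-]; exists x => //; split=> //; exact: cd.
Qed.

Lemma smooth_funP (A : set T) f :
  (forall x, A x -> pts M x -> exists d O, [/\ schart M d, dom d x, open O, O x &
     smooth_on (crd d @` (A `&` O `&` dom d)) (rep d f)]) -> smooth_fun M A f.
Proof.
move=> H c sc; apply: (smooth_on_chart_local sc) => [x []//|x [Ax cx]].
have [d [O [sd dx oO Ox sf]]] := H x Ax (schart_pts sc cx).
have [O' [oO' Ox' O'd]] := dom_open sd dx.
exists (O `&` O'); split; [exact: openI|by []|].
have sub : A `&` dom c `&` (O `&` O') `<=` dom c `&` dom d.
  by move=> w [[_ cw] [_ Ow]]; split=> //; apply: O'd => //; exact: schart_pts cw.
apply: (smooth_on_change (schart_inj sc) (schart_inj sd) (schart_trans sc sd) sub).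
apply: smooth_on_sub sf => z [w [[Aw cw] [Ow O'w]] <-]; exists w => //; split=> //.
by apply: O'd => //; exact: schart_pts cw.
Qed.

Lemma smooth_fun_sub (A A' : set T) f : A' `<=` A -> smooth_fun M A f -> smooth_fun M A' f.
Proof.
by move=> ss sf c sc; apply: smooth_on_sub (sf c sc) => z [x [/ss Ax cx] <-]; exists x.
Qed.

Lemma smooth_fun_eq (A : set T) f g : (forall x, A x -> f x = g x) ->
  smooth_fun M A f -> smooth_fun M A g.
Proof.
move=> fg sf c sc; apply: smooth_on_image_eq (sf c sc).
- exact: schart_inj.
- by move=> x [].
- by move=> x [Ax _]; exact: fg.
Qed.

Lemma smooth_fun_cst (A : set T) c : smooth_fun M A (fun=> c).
Proof.
move=> d sd; apply: (@smooth_on_eq _ _ _ (fun=> c)); last exact: smooth_on_cst.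
move=> z [x [_ dx] <-].
by rewrite repE //; exact: schart_inj.
Qed.

Lemma smooth_fun_add (A : set T) f g : smooth_fun M A f -> smooth_fun M A g ->
  smooth_fun M A (fun x => f x + g x).
Proof.
move=> sf sg d sd; apply: smooth_on_eq (smooth_on_add (sf d sd) (sg d sd)) => z [x [_ dx] <-].
by have di := schart_inj sd; rewrite !repE.
Qed.

Lemma smooth_fun_mul (A : set T) f g : smooth_fun M A f -> smooth_fun M A g ->
  smooth_fun M A (fun x => f x * g x).
Proof.
move=> sf sg d sd; apply: smooth_on_eq (smooth_on_mul (sf d sd) (sg d sd)) => z [x [_ dx] <-].
by have di := schart_inj sd; rewrite !repE.
Qed.

Lemma smooth_fun_exp (A : set T) f : smooth_fun M A f -> smooth_fun M A (fun x => expR (f x)).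
Proof.
move=> sf d sd; apply: smooth_on_eq (smooth_on_exp (sf d sd)) => z [x [_ dx] <-].
by have di := schart_inj sd; rewrite !repE.
Qed.

Lemma smooth_fun_ln (A : set T) f : (forall x, A x -> 0 < f x) -> smooth_fun M A f ->
  smooth_fun M A (fun x => ln (f x)).
Proof.
move=> f0 sf d sd; have di := schart_inj sd.
apply: (@smooth_on_eq _ _ _ (fun y => ln (rep d f y))).
  by move=> z [x [_ dx] <-]; rewrite !repE.
apply: smooth_on_ln (sf d sd) => z [x [Ax dx] <-]; rewrite repE //; exact: f0.
Qed.

Lemma smooth_fun_sum (A : set T) (I : Type) (r : seq I) (F : I -> T -> R) :
  (forall i, smooth_fun M A (F i)) -> smooth_fun M A (fun x => \sum_(i <- r) F i x).
Proof.
move=> H; elim: r => [|i r IH].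
  by apply: (@smooth_fun_eq _ (fun=> 0)) => [x _|]; [rewrite big_nil|exact: smooth_fun_cst].
by apply: smooth_fun_eq (smooth_fun_add (H i) IH) => x _; rewrite big_cons.
Qed.

Lemma smooth_fun_coord (c : chart R T n) A j : schart M c -> A `<=` dom c ->
  smooth_fun M A (fun x => crd c x ord0 j).
Proof.
move=> sc Ac d sd; apply: smooth_on_sub (schart_trans sd sc j).
by move=> z [x [/Ac cx dx] <-]; exists x.
Qed.

Lemma trans_ext c d x : schart M c -> schart M d -> dom c x -> dom d x ->
  exists O phi, [/\ open O, O (crd c x), forall j, Cinf O (phi j) &
    forall z, O z -> orthant z -> exists x', [/\ dom c x', dom d x', crd c x' = z &
      \row_j phi j z = crd d x']].
Proof.
move=> sc sd cx dx; have [W [oW Wx Wd]] := dom_open sd dx.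
have /choice[Og HOg] : forall j, exists Og : set 'rV[R]_n * ('rV[R]_n -> R),
   [/\ open Og.1, Og.1 (crd c x), Cinf Og.1 Og.2 &
    forall z, Og.1 z -> orthant z ->
      exists x', [/\ dom c x', W x', crd c x' = z & Og.2 z = crd d x' ord0 j]].
  move=> j; have [|O [g H]] := @smooth_ext _ _ n (pts M) c x (dom d) W
     (fun x => crd d x ord0 j) (proj1 sc) cx dx oW Wx Wd.
    by apply: smooth_on_sub (schart_trans sc sd j) => z [w [dw cw] <-]; exists w.
  by exists (O, g).
have [e e0 He] := chart_ball (proj1 sc) cx oW Wx.
pose O := ((\bigcap_j (Og j).1) `&` ball (crd c x) e)°.
have Os z : O z -> (forall j, (Og j).1 z) /\ ball (crd c x) e z.
  by move=> /interior_subset[H ?]; split=> // j; exact: H.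
exists O, (fun j => (Og j).2); split; first exact: open_interior.
- rewrite /O /interior /=; apply: filterI; last exact: nbhsx_ballx.
  apply: (@filterS _ (nbhs _) _ (fun z => forall j, (Og j).1 z)) => [z Hz j _|]; first exact: Hz.
  apply: (@filter_forall _ 'I_n (fun j z => (Og j).1 z) (nbhs (crd c x))) => j.
  by have [oO Oy _ _] := HOg j; exact: open_nbhs_nbhs.
- by move=> j; have [_ _ C _] := HOg j; apply: Cinf_sub C => z /Os[+ _]; apply.
move=> z /Os[Oz ze] oz; have [x' [cx' Wx' ex']] := He z ze oz.
exists x'; split=> //; first by apply: Wd => //; exact: schart_pts cx'.
apply/rowP => j; rewrite mxE; have [_ _ _ /(_ z (Oz j) oz)[x2 [cx2 _ ex2 ->]]] := HOg j.
by rewrite (schart_inj sc (x := x2) (y := x')) ?inE // ex'.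
Qed.

Definition zeros (c : chart R T n) x : {set 'I_n} := [set i | crd c x ord0 i == 0]%SET.

(** Smooth extensions of both transition maps, with O shrunk so that phi carries its orthant part
    into the domain of psi. These are the data on which the section [Corner] rests. *)
Lemma trans_corner c d x : schart M c -> schart M d -> dom c x -> dom d x ->
  exists O phi psi O', [/\ [/\ open O, open O', O (crd c x) & O' (\row_j phi j (crd c x))],
   forall j, Cinf O (phi j), forall j, Cinf O' (psi j),
   forall z, O z -> orthant z -> forall k, psi k (\row_j phi j z) = z ord0 k &
   forall z, O z -> orthant z -> exists x', [/\ dom c x', dom d x', crd c x' = z &
      \row_j phi j z = crd d x'] ].
Proof.
move=> sc sd cx dx.
have [O1 [phi [oO1 O1x C1 H1]]] := trans_ext sc sd cx dx.
have [O2 [psi [oO2 O2x C2 H2]]] := trans_ext sd sc dx cx.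
have Ex : \row_j phi j (crd c x) = crd d x.
  have [x' [cx' dx' ex' ->]] := H1 _ O1x (schart_orthant sc cx).
  by rewrite (schart_inj sc (x := x') (y := x)) ?inE.
have [W [oW Wx WO2]] := chart_nbhs (proj1 sd) dx oO2 O2x.
have [e e0 He] := chart_ball (proj1 sc) cx oW Wx.
pose O := O1 `&` (ball (crd c x) e)°.
have key z : O z -> orthant z -> exists x', [/\ dom c x', dom d x', crd c x' = z &
      \row_j phi j z = crd d x' /\ O2 (crd d x')].
  move=> [O1z /interior_subset ze] oz.
  have [x' [cx' dx' ex' Ex']] := H1 z O1z oz; exists x'; split=> //; split=> //.
  have [x2 [cx2 Wx2 ex2]] := He z ze oz.
  have E : x2 = x' by apply: (schart_inj sc); rewrite ?inE // ex2.
  rewrite E in Wx2; by have [] := WO2 x' Wx2 (schart_pts sc cx').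
exists O, phi, psi, O2; split.
- split=> //; first by apply: openI => //; exact: open_interior.
    by split=> //; exact: nbhsx_ballx.
  by rewrite Ex.
- by move=> j; apply: Cinf_sub (C1 j) => z [].
- exact: C2.
- move=> z Oz oz k; have [x' [cx' dx' ex' [-> O2x']]] := key z Oz oz.
  have [x2 [dx2 cx2 ex2 Ex2]] := H2 _ O2x' (schart_orthant sd dx').
  have -> : psi k (crd d x') = (\row_j psi j (crd d x')) ord0 k by rewrite mxE.
  by rewrite Ex2 (schart_inj sd (x := x2) (y := x')) ?inE // ex'.
- by move=> z Oz oz; have [x' [? ? ? []]] := key z Oz oz; exists x'.
Qed.

Lemma zeros_le c d x : schart M c -> schart M d -> dom c x -> dom d x ->
  leq #|zeros d x| #|zeros c x|.
Proof.
move=> sc sd cx dx.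
have [O [phi [psi [O' [[oO oO' Ox O'x] C1 C2 inv H]]]]] := trans_corner sc sd cx dx.
have ox := schart_orthant sc cx.
have := corner_card oO oO' C1 C2 Ox ox O'x inv.
have [x' [cx' dx' ex' Ex']] := H _ Ox ox.
have xx' : x' = x by apply: (schart_inj sc); rewrite ?inE.
rewrite (_ : [set j | phi j (crd c x) == 0]%SET = zeros d x).
  apply => z Oz oz k; have [x2 [_ dx2 _ E]] := H z Oz oz.
  have -> : phi k z = (\row_j phi j z) ord0 k by rewrite mxE.
  by rewrite E; exact: schart_orthant.
by apply/setP => j; rewrite !inE -xx' -Ex' mxE ex'.
Qed.

(** [stratum] asks for some chart; since the number of vanishing coordinates is the same in all
    charts, any chart at the point decides. *)
Lemma stratumE c x k : schart M c -> dom c x -> stratum M k x <-> #|zeros c x| = k.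
Proof.
move=> sc cx; split=> [[d [sd dx <-]]|<-]; last by exists c.
by apply/eqP; rewrite eqn_leq !zeros_le.
Qed.

Lemma interiorE c x : schart M c -> dom c x ->
  interior_pts M x <-> forall i, 0 < crd c x ord0 i.
Proof.
move=> sc cx; rewrite /interior_pts (stratumE _ sc cx); split=> [/cards0_eq H i|H].
  rewrite lt0r (schart_orthant sc cx i) andbT.
  by apply/eqP => E; have : i \in zeros c x; [rewrite inE E eqxx|rewrite H inE].
by apply/eqP; rewrite cards_eq0; apply/eqP/setP => i; rewrite !inE gt_eqF.
Qed.


Lemma component_segment (S : set T) c x1 x2 : schart M c -> dom c x1 -> dom c x2 ->
  (forall t : R, 0 <= t <= 1 -> exists x', [/\ dom c x', S x' &
     crd c x' = crd c x1 + t *: (crd c x2 - crd c x1)]) ->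
  connected_component S x1 x2.
Proof.
move=> sc c1 c2 H.
have /choice[f Hf] : forall t : R, exists y, 0 <= t <= 1 -> [/\ dom c y, S y &
     crd c y = crd c x1 + t *: (crd c x2 - crd c x1)].
  move=> t; have [t01|nt] := boolP (0 <= t <= 1); last by exists x1.
  by have [y Hy] := H t t01; exists y.
have ci := schart_inj sc.
have f0 : f 0 = x1.
  have [|d0 _ e0] := Hf 0; first by rewrite lexx ler01.
  by apply: ci; rewrite ?inE // e0 scale0r addr0.
have f1 : f 1 = x2.
  have [|d0 _ e0] := Hf 1; first by rewrite lexx ler01.
  by apply: ci; rewrite ?inE // e0 scale1r addrC subrK.
set v := crd c x2 - crd c x1 in Hf.
have cf : {within `[0, 1]%classic, continuous f}.
  apply/subspace_continuousP => t /=; rewrite in_itv /= => t01.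
  have [dt _ et] := Hf t t01.
  move=> B; rewrite nbhsE => -[O [oO Ot] OB].
  have [e e0 He] := chart_ball (proj1 sc) dt oO Ot.
  suff : \forall s \near t, `[0, 1]%classic s -> B (f s) by [].
  near=> s; rewrite /= in_itv /= => s01.
  have [ds _ es] := Hf s s01.
  have [|y [dy Oy ey]] := He _ _ (schart_orthant sc ds).
    rewrite es et; apply/ball_rVP => // j; rewrite !mxE opprD addrACA subrr add0r -mulrBl normrM.
    apply: (@le_lt_trans _ _ (`|t - s| * `|v|)); first by rewrite ler_wpM2l //; have := le_coord_norm v j; rewrite !mxE.
    apply: (@le_lt_trans _ _ (`|t - s| * (`|v| + 1))); first by rewrite ler_wpM2l // lerDl.
    rewrite -ltr_pdivlMr ?ltr_wpDl //; near: s.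
    have N : 0 < e / (`|v| + 1) by rewrite divr_gt0 // ltr_wpDl.
    by exists (e / (`|v| + 1)).
  by apply: OB; rewrite -(ci y (f s)) // ?inE.
have cc := connected_continuous_connected (@segment_connected R 0 1) cf.
apply: (connected_component_max _ _ cc).
- by exists 0 => //=; rewrite in_itv /= lexx ler01.
- by move=> y [t]; rewrite /= in_itv /= => t01 <-; have [] := Hf t t01.
- by exists 1 => //=; rewrite in_itv /= lexx ler01.
Unshelve. all: end_near. Qed.

(** * Frames: coordinate balls together with the hypersurfaces through them *)

Definition nb (c : chart R T n) x e x' := dom c x' /\ ball (crd c x) e (crd c x').

Definition locdef c x e i (G : set T) := forall x', nb c x e x' -> (G x' <-> crd c x' ord0 i = 0).

Definition piece c x e i := [set x' | nb c x e x' /\ forall j, crd c x' ord0 j = 0 <-> j = i].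

(* Gf i is meaningful only if the i-th coordinate of x vanishes. *)
Record frame c x e (Gf : 'I_n -> set T) : Prop := Frame {
  fr_e0 : 0 < e;
  fr_box : forall z, ball (crd c x) e z -> orthant z -> exists2 x', dom c x' & crd c x' = z;
  fr_nz : forall x' j, nb c x e x' -> crd c x' ord0 j = 0 -> crd c x ord0 j = 0;
  fr_loc : forall i, crd c x ord0 i = 0 -> bhs M (Gf i) /\ locdef c x e i (Gf i);
  fr_bhs : forall G x', bhs M G -> nb c x e x' -> G x' ->
    exists2 i, crd c x ord0 i = 0 & G = Gf i }.

Lemma nb_sub c x e e' x' : e <= e' -> nb c x e x' -> nb c x e' x'.
Proof. by move=> ee [cx' bx']; split=> //; apply: le_ball bx'. Qed.

Lemma nb_refl c x e : 0 < e -> dom c x -> nb c x e x.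
Proof. by move=> e0 cx; split=> //; exact: ballxx. Qed.

Lemma nb_in_open c x O : schart M c -> dom c x -> open O -> O x ->
  exists2 e : R, 0 < e & forall x', nb c x e x' -> O x'.
Proof.
move=> sc cx oO Ox; have [e e0 He] := chart_ball (proj1 sc) cx oO Ox.
exists e => // x' [cx' bx']; have [y [cy Oy ey]] := He _ bx' (schart_orthant sc cx').
by rewrite -(schart_inj sc (x := y) (y := x')) // inE.
Qed.

Lemma open_in_nb c x e x' : schart M c -> nb c x e x' ->
  exists O, [/\ open O, O x' & forall y, O y -> pts M y -> nb c x e y].
Proof.
move=> sc [cx' bx'].
have [||O [oO Ox HO]] := @chart_nbhs _ _ _ _ c x' (ball (crd c x) e)° (proj1 sc) cx'.
- exact: open_interior.
- have oB : open (ball (crd c x) e) by apply: ball_open; apply: ball_gt0 bx'.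
  by rewrite /interior /=; apply: open_nbhs_nbhs.
by exists O; split=> // y Oy py; have [dy /interior_subset] := HO y Oy py.
Qed.

(** Any e below all nonzero coordinates of x keeps these coordinates positive on the ball. *)
Lemma frame_exists_e c x : schart M c -> dom c x -> exists e : R, [/\ 0 < e,
  forall z, ball (crd c x) e z -> orthant z -> exists2 x', dom c x' & crd c x' = z &
  forall x' j, nb c x e x' -> crd c x' ord0 j = 0 -> crd c x ord0 j = 0].
Proof.
move=> sc cx; have [e1 e10 He1] := chart_ball (proj1 sc) cx openT (I : setT x).
have : \forall e \near (0 : R)^'+, forall j, crd c x ord0 j = 0 \/ e < crd c x ord0 j.
  apply: (@filter_forall _ 'I_n (fun j e => crd c x ord0 j = 0 \/ e < crd c x ord0 j) (at_right 0)) => j.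
  have [->|nz] := eqVneq (crd c x ord0 j) 0; first by near=> e; left.
  have p : 0 < crd c x ord0 j by rewrite lt0r nz (schart_orthant sc cx j).
  by near=> e; right; near: e; exact: nbhs_right_lt.
move=> N; near (0 : R)^'+ => e.
have Ne : forall j, crd c x ord0 j = 0 \/ e < crd c x ord0 j by near: e; exact: N.
exists e; split=> //.
  move=> z ze oz; have [|y [cy _ ey]] := He1 z _ oz; last by exists y.
  by apply: le_ball ze; apply/ltW; near: e; exact: nbhs_right_lt.
move=> x' j [cx' /ball_rVP bx'] ej.
have [//|ec] := Ne j.
have /bx'/(_ j) : 0 < e by [].
by rewrite ej subr0 ger0_norm ?(schart_orthant sc cx) // ltNge (ltW ec).
Unshelve. all: end_near. Qed.

Section Pieces.
Variables (c : chart R T n) (x : T) (e : R).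
Hypotheses (sc : schart M c) (cx : dom c x) (e0 : 0 < e).
Hypothesis box : forall z, ball (crd c x) e z -> orthant z -> exists2 x', dom c x' & crd c x' = z.
Hypothesis nz : forall x' j, nb c x e x' -> crd c x' ord0 j = 0 -> crd c x ord0 j = 0.

Lemma piece_stratum i x' : piece c x e i x' -> stratum M 1 x'.
Proof.
move=> [[cx' _] H]; apply/(stratumE _ sc cx').
rewrite -(cards1 i); apply: eq_card => j; rewrite !inE.
by apply/eqP/eqP => [/H|/H].
Qed.

Lemma stratum_piece x' : nb c x e x' -> stratum M 1 x' -> exists2 i, crd c x ord0 i = 0 & piece c x e i x'.
Proof.
move=> nx' s1; have [cx' _] := nx'.
move/(stratumE _ sc cx') : s1 => /eqP/cards1P[i Hi].
have Ei j : crd c x' ord0 j = 0 <-> j = i.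
  have : (j \in zeros c x') = (j == i) by rewrite Hi inE.
  rewrite inE => E; split=> [/eqP|/eqP]; [rewrite E|rewrite -E]; by move/eqP.
by exists i => //; apply: nz nx' _; apply/Ei.
Qed.

(** A piece is convex in coordinates: the ball, the orthant and, by nonnegativity, the pattern of
    vanishing coordinates are preserved by convex combinations. *)
Lemma piece_connected i x1 x2 : piece c x e i x1 -> piece c x e i x2 ->
  connected_component (stratum M 1) x1 x2.
Proof.
move=> [[c1 b1] H1] [[c2 b2] H2]; apply: (component_segment sc) => // t /andP[t0 t1].
set z := _ + _.
have zj j : z ord0 j = (1 - t) * crd c x1 ord0 j + t * crd c x2 ord0 j by rewrite !mxE; ring.
have oz : orthant z.
  by move=> j; rewrite zj addr_ge0 // mulr_ge0 ?subr_ge0 //; exact: schart_orthant.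
have bz : ball (crd c x) e z.
  move: b1 b2 => /ball_rVP-/(_ e0) b1 /ball_rVP-/(_ e0) b2.
  apply/ball_rVP => // j; rewrite zj.
  have -> : crd c x ord0 j - ((1 - t) * crd c x1 ord0 j + t * crd c x2 ord0 j) =
     (1 - t) * (crd c x ord0 j - crd c x1 ord0 j) + t * (crd c x ord0 j - crd c x2 ord0 j) by ring.
  apply: le_lt_trans (ler_normD _ _) _; rewrite !normrM [ `|t|]ger0_norm // [ `|1 - t|]ger0_norm ?subr_ge0 //.
  have [->|tp] := eqVneq t 0; first by rewrite subr0 mul1r mul0r addr0.
  rewrite -[ltRHS]mul1r -[X in X * e](subrK t) [ltRHS]mulrDl.
  by rewrite ler_ltD // ?ltr_pM2l ?lt0r ?tp // ler_wpM2l ?subr_ge0 // ltW.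
have [y cy ey] := box bz oz; exists y; split=> //.
apply: (@piece_stratum i); split; first by rewrite /nb ey.
move=> j; rewrite ey zj; split=> [|->]; last by rewrite (H1 i).2 // (H2 i).2 // !mulr0 addr0.
have := schart_orthant sc c1 j; have := schart_orthant sc c2 j => y20 y10.
move/eqP; rewrite paddr_eq0 ?mulr_ge0 ?subr_ge0 // !mulf_eq0 subr_eq0.
move=> /andP[/orP[/eqP t1'|/eqP/H1//] /orP[/eqP t0'|/eqP/H2//]].
by move: t1'; rewrite t0' => /eqP; rewrite oner_eq0.
Qed.

(** Raising all other vanishing coordinates to a small s > 0 moves x' into the piece. *)
Lemma piece_dense i x' O : nb c x e x' -> crd c x' ord0 i = 0 -> open O -> O x' ->
  exists2 y, piece c x e i y & O y.
Proof.
move=> nx' ci oO Ox'; have [cx' bx'] := nx'.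
have [e1 e10 He1] := chart_ball (proj1 sc) cx' oO Ox'.
have oB : open (ball (crd c x) e) by apply: ball_open.
have : nbhs (crd c x') (ball (crd c x) e) by exact: open_nbhs_nbhs.
rewrite nbhs_ballP => -[e2 /= e20 He2].
near (0 : R)^'+ => s.
have s0 : 0 < s by [].
pose z : 'rV[R]_n := \row_j (if (crd c x' ord0 j == 0) && (j != i) then s else crd c x' ord0 j).
have oz : orthant z.
  by move=> j; rewrite mxE; case: ifP => _; [exact: ltW|exact: schart_orthant].
have zb e' : s < e' -> ball (crd c x') e' z.
  move=> se; apply/ball_rVP; first exact: lt_trans se.
  move=> j; rewrite mxE; case: ifP => [/andP[/eqP-> _]|_].
    by rewrite sub0r normrN gtr0_norm.
  by rewrite subrr normr0; apply: lt_trans se.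
have [|y [cy Oy ey]] := He1 z _ oz; first by apply: zb; near: s; exact: nbhs_right_lt.
exists y => //; split.
  by split=> //; rewrite ey; apply: He2; apply: zb; near: s; exact: nbhs_right_lt.
move=> j; rewrite ey mxE; split=> [|->]; last by rewrite eqxx andbF.
have [//|ji] := eqVneq j i; rewrite andbT.
by case: ifP => [_ E|/eqP//]; move: s0; rewrite E ltxx.
Unshelve. all: end_near. Qed.

Lemma piece_nonempty i : crd c x ord0 i = 0 -> exists y, piece c x e i y.
Proof.
move=> ci; have [y py _] := piece_dense (nb_refl e0 cx) ci openT I.
by exists y.
Qed.

End Pieces.

(* Two coordinate hyperplanes through x never lie in the same boundary
   hypersurface. *)
Definition separated_at c x := forall G i j e, bhs M G -> i != j ->
  crd c x ord0 i = 0 -> crd c x ord0 j = 0 -> 0 < e ->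
  (forall x', nb c x e x' -> crd c x' ord0 i = 0 -> G x') ->
  (forall x', nb c x e x' -> crd c x' ord0 j = 0 -> G x') -> False.

(** A base point [q i] is chosen on each piece at x, and [Gf i] is the hypersurface of its
    component. Separation shows that this component meets no other piece. So no point of [Gf i] in
    the ball has a positive i-th coordinate: near such a point, points of the component would lie on
    piece i, where that coordinate is 0. *)
Lemma frame_exists c x : schart M c -> dom c x -> separated_at c x ->
  exists e Gf, frame c x e Gf.
Proof.
move=> sc cx sep; have [e [e0 box nz]] := frame_exists_e sc cx.
pose S1 := stratum M 1.
have /choice[q Hq] : forall i, exists q, crd c x ord0 i = 0 -> piece c x e i q.
  move=> i; have [ci|ni] := pselect (crd c x ord0 i = 0); last by exists x.
  by have [q Hq] := piece_nonempty sc cx e0 ci; exists q.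
pose Gf i := closure (connected_component S1 (q i)) `&` pts M.
have bG i : crd c x ord0 i = 0 -> bhs M (Gf i).
  by move=> ci; exists (q i); [exact: piece_stratum sc _ _ (Hq i ci)|].
have Gsub i j x' : crd c x ord0 j = 0 -> connected_component S1 (q i) `&` piece c x e j !=set0 ->
    nb c x e x' -> crd c x' ord0 j = 0 -> Gf i x'.
  move=> cj [r [Cr pr]] nx' ci'; split; last exact: schart_pts nx'.1.
  move=> B; rewrite nbhsE => -[O [oO Ox'] OB].
  have [y py Oy] := piece_dense sc nx' ci' oO Ox'.
  exists y; split; last exact: OB.
  apply: connected_component_trans Cr _.
  exact: piece_connected pr py.
have dis i j : crd c x ord0 i = 0 -> crd c x ord0 j = 0 ->
    connected_component S1 (q i) `&` piece c x e j !=set0 -> i = j.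
  move=> ci cj ne; apply: contrapT => /eqP ij.
  apply: (sep (Gf i) i j e) => //; first exact: bG.
    move=> x' nx' ci'; apply: (Gsub i i) => //.
    exists (q i); split; last exact: Hq.
    by apply: connected_component_refl; exact: piece_stratum sc _ _ (Hq i ci).
  by move=> x' nx' cj'; apply: (Gsub i j).
exists e, Gf; split=> //.
  move=> i ci; split; first exact: bG.
  move=> x' nx'; split=> [[clo _]|ci']; last first.
    apply: (Gsub i i) => //; exists (q i); split; last exact: Hq.
    by apply: connected_component_refl; exact: piece_stratum sc _ _ (Hq i ci).
  apply: contrapT => ci'.
  have [ O1 [oO1 O1x H1]] := open_in_nb sc nx'.
  have pc : 0 < crd c x' ord0 i.
    by rewrite lt0r (schart_orthant sc nx'.1 i) andbT; apply/eqP.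
  have [e2 e20 He2] : exists2 e2, 0 < e2 & e2 <= crd c x' ord0 i by exists (crd c x' ord0 i).
  have [ O2 [oO2 O2x H2]] := open_in_nb sc (nb_refl e20 nx'.1).
  have : nbhs x' (O1 `&` O2) by apply: open_nbhs_nbhs; split=> //; exact: openI.
  move/clo => [r [Cr [O1r O2r]]].
  have s1r : S1 r by exact: connected_component_sub Cr.
  have [cs ss] : S1 r /\ pts M r.
    by split=> //; have [d [sd dr _]] := s1r; exact: schart_pts dr.
  have [j cj pj] := stratum_piece sc nz (H1 r O1r ss) s1r.
  have E : i = j by apply: dis => //; exists r.
  have [_ /ball_coord/(_ i)] := H2 r O2r ss.
  rewrite (pj.2 i).2 // subr0 gtr0_norm //.
  by rewrite ltNge He2.
move=> G x' [p sp GE] nx'; rewrite GE => -[clo _].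
have [ O1 [oO1 O1x H1]] := open_in_nb sc nx'.
have : nbhs x' O1 by apply: open_nbhs_nbhs.
move/clo => [r [Cr O1r]].
have s1r : S1 r by exact: connected_component_sub Cr.
have pr : pts M r by have [d [sd dr _]] := s1r; exact: schart_pts dr.
have [j cj pj] := stratum_piece sc nz (H1 r O1r pr) s1r.
exists j => //; rewrite /Gf.
have C2 : connected_component S1 r (q j) by apply: piece_connected pj (Hq j cj).
by rewrite (same_connected_component (connected_component_trans Cr C2)).
Qed.

End Presm.

(** What the induction on the dimension carries along: frames are built from [separated_at], a
    consequence of embeddedness that passes to faces ([face_good]). *)
Definition good n (M : mfd R T n) := presm M /\
  forall c x, schart M c -> dom c x -> separated_at M c x.

(* Otherwise the differential at x of the k-th coordinate of d, which vanishes
   on two different coordinate hyperplanes of c, would be zero. *)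
Lemma separated_of_chart n (M : mfd R T n) c x d k (G : set T) i j e : presm M ->
  schart M c -> dom c x -> schart M d -> dom d x ->
  (forall y, dom d y -> G y -> crd d y ord0 k = 0) -> i != j ->
  crd c x ord0 i = 0 -> crd c x ord0 j = 0 -> 0 < e ->
  (forall x', nb c x e x' -> crd c x' ord0 i = 0 -> G x') ->
  (forall x', nb c x e x' -> crd c x' ord0 j = 0 -> G x') -> False.
Proof.
move=> pM sc cx sd dx dG ij ci cj e0 Hi Hj.
have [O [phi [psi [O' [[oO oO' Ox O'x] C1 C2 inv H]]]]] := trans_corner pM sc sd cx dx.
have ox := schart_orthant sc cx.
have [m /eqP] := corner_row oO oO' C1 C2 Ox ox O'x inv k; apply.
have oB : open (ball (crd c x) e) by apply: ball_open.
have key z : O z -> orthant z -> ball (crd c x) e z -> (z ord0 i = 0 \/ z ord0 j = 0) -> phi k z = 0.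
  move=> Oz oz bz zz; have [x' [cx' dx' ex' Ex']] := H z Oz oz.
  have -> : phi k z = (\row_l phi l z) ord0 k by rewrite mxE.
  rewrite Ex'; apply: dG => //; case: zz => zz; [apply: Hi|apply: Hj]; rewrite /nb ex' //.
apply: derive_right0; first by apply: diff_derivable; exact: Cinf_differentiable oO (C1 k) Ox.
near=> t; have t0 : 0 < t by [].
rewrite !key //.
- exact: ballxx.
- by left.
- near: t; exact: near_right_ball.
- exact: orthant_right.
- near: t; apply: near_right_ball => //; exact: ballxx.
rewrite !mxE eqxx /=; have [E|mi] := eqVneq m i.
  right; rewrite cj add0r [j == m]eq_sym E (negbTE ij) mulr0 //.
by left; rewrite ci add0r mulr0.
Unshelve. all: end_near. Qed.

Lemma embedded_separated n (M : mfd R T n) c x : presm M ->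
  (forall F, bhs M F -> embedded M F) -> schart M c -> dom c x -> separated_at M c x.
Proof.
move=> pM emb sc cx G i j e bG ij ci cj e0 Hi Hj.
have Gx : G x by apply: Hi => //; exact: nb_refl.
have [d [k [sd dx dG]]] := emb G bG x Gx.
apply: (separated_of_chart pM sc cx sd dx _ ij ci cj e0 Hi Hj).
by move=> y dy Gy; apply/(dG y dy).
Qed.

End Manifolds.

(** * Boundary hypersurfaces as manifolds *)

Section Frames.
Variables (R : realType) (T : topologicalType) (n : nat) (M : mfd R T n).
Hypothesis gM : good M.
Let pM : presm M := gM.1.

Lemma good_frame c x : schart M c -> dom c x -> exists e Gf, frame M c x e Gf.
Proof. by move=> sc cx; apply: frame_exists => //; exact: gM.2. Qed.

Lemma frame_piece c x e Gf e' i : schart M c -> dom c x -> frame M c x e Gf -> 0 < e' ->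
  crd c x ord0 i = 0 -> exists2 y, nb c x e y /\ nb c x e' y &
    forall j, crd c y ord0 j = 0 <-> j = i.
Proof.
move=> sc cx fr e'0 ci; have e0 := fr_e0 fr.
pose e2 := Num.min e e'.
have e20 : 0 < e2 by rewrite lt_min e0.
have [y [ny py]] := piece_nonempty sc cx e20 ci.
by exists y => //; split; apply: nb_sub ny; rewrite ge_min lexx ?orbT.
Qed.

Lemma frame_inj c x e Gf i j : schart M c -> dom c x -> frame M c x e Gf ->
  crd c x ord0 i = 0 -> crd c x ord0 j = 0 -> Gf i = Gf j -> i = j.
Proof.
move=> sc cx fr ci cj E; have [y [ny _] py] := frame_piece sc cx fr (fr_e0 fr) ci.
have [_ li] := fr_loc fr ci; have [_ lj] := fr_loc fr cj.
by apply/esym/py; apply/(lj y ny); rewrite -E; apply/(li y ny)/py.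
Qed.

(** G contains points near x where only the i-th coordinate vanishes, and among the hypersurfaces of
    the frame only [Gf i] passes through such a point. *)
Lemma frame_locdef c x e Gf e' i G : schart M c -> dom c x -> frame M c x e Gf -> 0 < e' ->
  bhs M G -> crd c x ord0 i = 0 -> locdef c x e' i G -> G = Gf i.
Proof.
move=> sc cx fr e'0 bG ci lG; have [y [ny n'y] py] := frame_piece sc cx fr e'0 ci.
have Gy : G y by apply/(lG y n'y)/py.
have [j cj GE] := fr_bhs fr bG ny Gy.
have [_ lj] := fr_loc fr cj.
suff <- : j = i by [].
by apply/py; apply/(lj y ny); rewrite -GE.
Qed.

Lemma frame_through c x e Gf G : dom c x -> frame M c x e Gf -> bhs M G -> G x ->
  exists2 i, crd c x ord0 i = 0 & G = Gf i.
Proof. by move=> cx fr bG Gx; apply: fr_bhs fr _ _ bG (nb_refl (fr_e0 fr) cx) Gx. Qed.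

Lemma bhs_pts G : bhs M G -> G `<=` pts M.
Proof. by move=> [p _ ->] x []. Qed.

Lemma bhs_closure G A : bhs M G -> A `<=` G -> closure A `&` pts M `<=` G.
Proof.
move=> [p _ ->] AG x [clx px]; split=> //.
have /closure_id -> := @closed_closure _ (connected_component (stratum M 1) p).
by apply: closure_subset clx => y /AG[].
Qed.

End Frames.

(** * Inserting and deleting a coordinate *)

Section Insert.
Variables (R : realType) (n : nat).

Definition ins (i : 'I_n.+1) (z : 'rV[R]_n) : 'rV[R]_n.+1 :=
  \row_j (if unlift i j is Some k then z ord0 k else 0).

Lemma ins_lift i z k : ins i z ord0 (lift i k) = z ord0 k.
Proof. by rewrite mxE liftK. Qed.

Lemma ins_id i z : ins i z ord0 i = 0.
Proof. by rewrite mxE unlift_none. Qed.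

Lemma ins_col' i (y : 'rV[R]_n.+1) : y ord0 i = 0 -> ins i (col' i y) = y.
Proof.
move=> yi; apply/rowP => j; rewrite mxE; case: unliftP => [k ->|->//].
by rewrite mxE.
Qed.

Lemma col'_ins i z : col' i (ins i z) = z.
Proof. by apply/rowP => j; rewrite mxE ins_lift. Qed.

Lemma orthant_ins i z : orthant z -> orthant (ins i z).
Proof. by move=> oz j; rewrite mxE; case: unliftP. Qed.

Lemma orthant_col' i (y : 'rV[R]_n.+1) : orthant y -> orthant (col' i y).
Proof. by move=> oy j; rewrite mxE. Qed.

Lemma ball_ins i (y : 'rV[R]_n.+1) (z : 'rV[R]_n) (e : R) : y ord0 i = 0 -> ball (col' i y) e z -> ball y e (ins i z).
Proof.
move=> yi b; have [e0 _] := b.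
apply/ball_rVP => // j; rewrite mxE; case: unliftP => [k ->|->].
  by have := ball_coord b k; rewrite mxE.
by rewrite yi subrr normr0.
Qed.

Lemma ball_col' i (y z : 'rV[R]_n.+1) e : ball y e z -> ball (col' i y) e (col' i z).
Proof.
move=> b; have [e0 _] := b.
by apply/ball_rVP => // j; rewrite !mxE; exact: ball_coord b _.
Qed.

End Insert.

Section FaceGood.
Variables (R : realType) (T : topologicalType) (n : nat) (M : mfd R T n.+1).
Hypothesis gM : good M.
Let pM : presm M := gM.1.
Variables (F U : set T).
Hypotheses (bF : bhs M F) (oU : relopen (pts M) U).
Let W := F `&` U.
Let N := face M F W.

Definition adapted (d : chart R T n.+1) i := forall y, dom d y -> (F y <-> crd d y ord0 i = 0).

Definition fch (d : chart R T n.+1) i : chart R T n :=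
  Chart (dom d `&` W) (fun y => col' i (crd d y)).

Lemma face_atlasP c : atlas N c -> exists d i, [/\ schart M d, adapted d i & c = fch d i].
Proof.
move=> [d [i [sd ad dE cE]]]; exists d, i; split=> //.
by case: c dE cE => dc cc /= -> cE; congr Chart; apply/funext.
Qed.

Lemma fch_atlas d i : schart M d -> adapted d i -> atlas N (fch d i).
Proof. by move=> sd ad; exists d, i. Qed.

Lemma W_nbhs x : W x -> exists O, [/\ open O, O x & forall y, O y -> F y -> W y].
Proof.
move=> [Fx Ux]; have [Up HU] := relopenE oU; have [O [oO Ox OU]] := HU x Ux.
exists O; split=> // y Oy Fy; split=> //; apply: OU; split=> //; exact: bhs_pts bF _ Fy.
Qed.

Lemma W_pts : W `<=` pts M.
Proof. by move=> x [Fx _]; exact: bhs_pts bF _ Fx. Qed.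

Lemma fch_inj d i : schart M d -> adapted d i -> {in dom (fch d i) &, injective (crd (fch d i))}.
Proof.
move=> sd ad x y; rewrite !inE => -[dx [Fx _]] [dy [Fy _]] /= E.
apply: (schart_inj sd); rewrite ?inE //.
by rewrite -(ins_col' (i := i) (y := crd d x)) ?E ?ins_col' //; apply/ad.
Qed.

Lemma fch_is_chart d i : schart M d -> adapted d i -> is_chart W (fch d i).
Proof.
move=> sd ad; apply: mk_chart.
- apply: mk_relopen => [x []//|x [dx Wx]].
  have [O [oO Ox Od]] := dom_open sd dx.
  exists O; split=> // y [Oy Wy]; split=> //; apply: Od => //; exact: W_pts.
- exact: fch_inj.
- by move=> z [x [dx _] <-]; apply: orthant_col'; exact: schart_orthant sd dx.
- move=> x O [dx Wx] oO Ox; have [O' [oO' Ox' O'W]] := W_nbhs Wx.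
  have [e e0 He] := chart_ball (proj1 sd) dx (openI oO oO') (conj Ox Ox').
  have xi : crd d x ord0 i = 0 by apply/ad => //; case: Wx.
  exists e => // z ze oz.
  have [y [dy [Oy O'y] ey]] := He _ (ball_ins xi ze) (orthant_ins i oz).
  exists y; split=> //=; last by rewrite ey col'_ins.
  by split=> //; apply: O'W => //; apply/ad => //; rewrite ey ins_id.
move=> x e [dx Wx] e0; have [O [oO Ox HO]] := open_in_nb sd (nb_refl e0 dx).
exists O; split=> // y Oy [dy Wy] /=; apply: ball_col'.
by have [] := HO y Oy (W_pts Wy).
Qed.

Lemma fch_trans d i d' i' : schart M d -> adapted d i -> schart M d' -> adapted d' i' ->
  smooth_transition (fch d i) (fch d' i').
Proof.
move=> sd ad sd' ad' j.
pose g (z : 'rV[R]_n) := rep d (fun x => crd d' x ord0 (lift i' j)) (\row_k ins i z ord0 k).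
have E x : dom (fch d i) x -> \row_k ins i (crd (fch d i) x) ord0 k = crd d x.
  move=> [dx [Fx _]]; rewrite -[RHS](ins_col' (i := i)); last exact/ad.
  by apply/rowP => k; rewrite mxE.
apply: (@smooth_on_eq _ _ _ g).
  move=> z [x [dx dx'] <-]; rewrite /g E // (repE _ (schart_inj sd) dx.1) (repE _ (fch_inj sd ad) dx) /=.
  by rewrite mxE.
apply: (smooth_on_comp _ _ (schart_trans pM sd sd' (lift i' j))).
  move=> k; case: (unliftP i k) => [l ->|->].
    by apply: (@smooth_on_eq _ _ _ (fun z => z ord0 l)) => [z _|]; [rewrite ins_lift|exact: smooth_on_coord].
  by apply: (@smooth_on_eq _ _ _ (fun=> 0)) => [z _|]; [rewrite ins_id|exact: smooth_on_cst].
move=> z [x [dx dx'] <-]; rewrite E //; exists x => //.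
by split; [case: dx|case: dx'].
Qed.

Lemma fch_schart d i : schart M d -> adapted d i -> schart N (fch d i).
Proof.
move=> sd ad; split; first exact: fch_is_chart.
by move=> c /face_atlasP[d' [i' [sd' ad' ->]]]; split; exact: fch_trans.
Qed.

Lemma adapted_restr d x e Gf i : schart M d -> dom d x -> frame M d x e Gf -> F = Gf i ->
  crd d x ord0 i = 0 -> exists d', [/\ schart M d', dom d' x, adapted d' i &
    crd d' = crd d /\ dom d' `<=` nb d x e].
Proof.
move=> sd dx fr FE di.
have oB : open (ball (crd d x) e) by apply: ball_open.
have rB : relopen (pts M) (nb d x e).
  apply: mk_relopen => [y [dy _]|y ny]; first exact: schart_pts dy.
  by have [O [oO Oy HO]] := open_in_nb sd ny; exists O; split=> // w [Ow pw]; exact: HO.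
exists (restr d (nb d x e)); split=> //.
- exact: schart_restr.
- by split=> //; exact: nb_refl (fr_e0 fr) dx.
- by move=> y [dy ny]; have [_ l] := fr_loc fr di; rewrite FE; exact: l.
- by split=> // y [].
Qed.

Lemma face_frame x : W x -> exists d i e Gf, [/\ schart M d, dom d x, adapted d i,
   frame M d x e Gf & F = Gf i /\ crd d x ord0 i = 0].
Proof.
move=> Wx; have [d ad dx] := pM.2 x (W_pts Wx); have sd := pM.1 _ ad.
have [e [Gf fr]] := good_frame gM sd dx.
have [i di FE] := frame_through dx fr bF Wx.1.
have [d' [sd' dx' ad' [cE dE]]] := adapted_restr sd dx fr FE di.
have [e' [Gf' fr']] := good_frame gM sd' dx'.
have di' : crd d' x ord0 i = 0 by rewrite cE.
exists d', i, e', Gf'; split=> //; split=> //.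
apply: (frame_locdef sd' dx' fr' (fr_e0 fr') bF di') => y [dy _]; exact: ad'.
Qed.

Lemma face_presm : presm N.
Proof.
split=> [c /face_atlasP[d [i [sd ad ->]]]|x Wx]; first exact: fch_schart.
have [d [i [e [Gf [sd dx ad _ _]]]]] := face_frame Wx.
by exists (fch d i); [exact: fch_atlas|].
Qed.

Lemma face_stratum1 d i x : schart M d -> adapted d i -> dom d x -> W x ->
  stratum N 1 x -> exists k, [/\ k != i, crd d x ord0 k = 0 &
    forall l, crd d x ord0 l = 0 -> l = i \/ l = k].
Proof.
move=> sd ad dx Wx; have dx' : dom (fch d i) x by [].
move/(stratumE face_presm _ (fch_schart sd ad) dx') => /eqP/cards1P[j Hj].
have Hz k : crd d x ord0 (lift i k) = 0 <-> k = j.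
  have : (k \in zeros (fch d i) x) = (k == j) by rewrite Hj inE.
  by rewrite inE /= mxE => E; split=> [/eqP|/eqP]; [rewrite E|rewrite -E]; move/eqP.
exists (lift i j); split; [by rewrite eq_sym neq_lift|exact/Hz|].
by move=> l; case: (unliftP i l) => [k ->|->]; [move/Hz ->; right|left].
Qed.

(** Let G be the second hypersurface of M through p. Its trace on the component C is closed because
    G is closed in M. It is open because exactly two coordinates of an adapted chart vanish at a
    point of C, and at nearby points of C the same two vanish, so that the same second hypersurface
    passes through them. Connectedness puts C inside G. *)
Lemma face_component_sub p : stratum N 1 p -> W p -> exists G, [/\ bhs M G, G <> F,
   connected_component (stratum N 1) p `<=` G &
   forall G', bhs M G' -> G' <> F -> G' p -> G' = G].
Proof.
move=> s1p Wp; have [d [i [e [Gf [sd dx ad fr [FE di]]]]]] := face_frame Wp.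
have [k [ki dk Hk]] := face_stratum1 sd ad dx Wp s1p.
have [bG lG] := fr_loc fr dk.
set C := connected_component _ _.
have subW : C `<=` W.
  by move=> y /connected_component_sub [c [sc cy _]]; exact: schart_pts sc cy.
exists (Gf k); split=> //.
- by move=> E; move: ki; rewrite (frame_inj sd dx fr dk di) ?eqxx // -FE.
- have -> : C = C `&` Gf k; last by [].
  apply/esym; apply: (@component_connected _ (stratum N 1) p).
  + exists p; split; first exact: connected_component_refl.
    by apply/(lG p _) => //; exact: nb_refl (fr_e0 fr) dx.
  + exists (\bigcup_(O in [set O | open O /\ O `&` C `<=` Gf k]) O).
      by apply: bigcup_open => O [].
    apply/seteqP; split=> [z [Cz Gz]|z [Cz [O [oO OC] Oz]]]; last by split=> //; apply: OC.
    split=> //; have Wz := subW z Cz.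
    have [d' [i' [e' [Gf' [sd' dz ad' fr' [FE' di']]]]]] := face_frame Wz.
    have s1z : stratum N 1 z by exact: connected_component_sub Cz.
    have [l [li' dl Hl]] := face_stratum1 sd' ad' dz Wz s1z.
    have [k' dk' GE] := frame_through dz fr' bG Gz.
    have kl : k' = l.
      have [E|//] := Hl k' dk'; move: ki; rewrite (frame_inj sd dx fr dk di) ?eqxx //.
      by rewrite -FE GE FE' E.
    have [O [oO Oz HO]] := open_in_nb sd' (nb_refl (fr_e0 fr') dz).
    exists O => //; split=> // q [Oq Cq]; have Wq := subW q Cq.
    have nq := HO q Oq (W_pts Wq); have [dq _] := nq.
    have s1q : stratum N 1 q by exact: connected_component_sub Cq.
    have [l' [l'i' dl' _]] := face_stratum1 sd' ad' dq Wq s1q.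
    have [E|E] := Hl l' (fr_nz fr' nq dl'); first by rewrite E eqxx in l'i'.
    by rewrite GE; have [_ lk] := fr_loc fr' dk'; apply/(lk q nq); rewrite kl -E.
  + have [r _ GE] := bG; exists (closure (connected_component (stratum M 1) r)).
      exact: closed_closure.
    by rewrite GE; apply/seteqP; split=> z [Cz] => [[]//|cz]; split=> //; split=> //;
      exact: W_pts (subW z Cz).
- move=> G' bG' G'F G'p; have [l dl GE] := frame_through dx fr bG' G'p.
  have [E|E] := Hk l dl; last by rewrite GE E.
  by case: G'F; rewrite GE E.
Qed.

Lemma face_bhs_sub H : bhs N H -> exists G, [/\ bhs M G, G <> F, H `<=` G &
   forall G', bhs M G' -> G' <> F -> H `<=` G' -> G' = G].
Proof.
move=> [p s1p ->]; have Wp : W p by have [c [sc cp _]] := s1p; exact: schart_pts sc cp.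
have [G [bG GF CG HG]] := face_component_sub s1p Wp.
exists G; split=> //.
  by move=> x [clx Wx]; apply: (bhs_closure bG CG); split=> //; exact: W_pts.
move=> G' bG' G'F HG'; apply: HG => //; apply: HG'; split=> //.
by apply: subset_closure; exact: connected_component_refl.
Qed.

Lemma adapted_frame d x e Gf i : schart M d -> dom d x -> frame M d x e Gf -> adapted d i ->
  W x -> crd d x ord0 i = 0 /\ F = Gf i.
Proof.
move=> sd dx fr ad Wx; have di : crd d x ord0 i = 0 by apply/ad => //; case: Wx.
split=> //; apply: (frame_locdef sd dx fr (fr_e0 fr) bF di) => y [dy _]; exact: ad.
Qed.

(** In an adapted chart, the hypersurface G of M that contains H is cut out by one coordinate, which
    survives in the induced chart of the face and vanishes on H; [separated_of_chart] then forbids H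
    to contain two coordinate hyperplanes. *)
Lemma face_good : good N.
Proof.
split=> [|c x sc cx H i j e bH ij ci cj e0 Hi Hj]; first exact: face_presm.
have Wx : W x := schart_pts sc cx.
have Hx : H x by apply: Hi => //; exact: nb_refl.
have [G [bG GF HG _]] := face_bhs_sub bH.
have [d0 [i0 [e1 [Gf [sd0 dx0 ad0 fr [FE di0]]]]]] := face_frame Wx.
have [d [sd dx ad [cE dE]]] := adapted_restr sd0 dx0 fr FE di0.
have [k dk GE] := frame_through dx0 fr bG (HG _ Hx).
have [j0 kE] : exists j0, k = lift i0 j0.
  by case: (unliftP i0 k) => [j0 ->|E]; [exists j0|case: GF; rewrite GE E].
have dx' : dom (fch d i0) x by [].
apply: (separated_of_chart (k := j0) face_presm sc cx (fch_schart sd ad) dx' _ ij ci cj e0 Hi Hj).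
move=> y [dy Wy] /HG Gy; rewrite /= mxE -kE cE.
by have [_ lk] := fr_loc fr dk; apply/(lk y (dE _ dy)); rewrite -GE.
Qed.

End FaceGood.

(** * Trivializations near a hypersurface *)

Section FaceIndex.
Variables (R : realType) (T : topologicalType) (n : nat) (M : mfd R T n.+1).
Hypothesis gM : good M.
Let pM : presm M := gM.1.
Variables (F U : set T).
Hypotheses (bF : bhs M F) (oU : relopen (pts M) U).
Let W := F `&` U.
Let N := face M F W.
Variable E : set T -> set (R * nat).

(** Only one G other than F contains H, so the union in [face_index] collapses to a single index
    set. *)
Lemma face_index_uniq H G : bhs N H -> bhs M G -> G <> F -> H `<=` G ->
  face_index M F E H = E G.
Proof.
move=> bH bG GF HG; have [G0 [bG0 GF0 HG0 uG]] := face_bhs_sub gM bF oU bH.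
apply/seteqP; split=> [sp [G1 [bG1 GF1 HG1 E1]]|sp EG]; last by exists G.
by rewrite (uG G bG GF HG) -(uG G1 bG1 GF1 HG1).
Qed.

Lemma nb_fch d i x e y : schart M d -> adapted F d i -> dom (fch F U d i) x ->
  nb (fch F U d i) x e y -> nb d x e y.
Proof.
move=> sd ad [dx Wx] [[dy Wy] b]; split=> //; have [e0 _] := b.
apply/ball_rVP => // k; case: (unliftP i k) => [j ->|->].
  by have := ball_coord b j; rewrite /= !mxE.
by have /(ad _ dx) -> := Wx.1; have /(ad _ dy) -> := Wy.1; rewrite subrr normr0.
Qed.

(** Matches the frames of M and of the face. The hypersurface of M that contains [Hf j] is some
    [Gf k]; a point of the face where only the j-th coordinate vanishes identifies k as
    [lift i j]. *)
Lemma face_frame_sub d i x e Gf e' Hf j : schart M d -> adapted F d i -> dom d x -> W x ->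
  frame M d x e Gf -> frame N (fch F U d i) x e' Hf -> crd d x ord0 (lift i j) = 0 ->
  [/\ bhs N (Hf j), bhs M (Gf (lift i j)), Gf (lift i j) <> F & Hf j `<=` Gf (lift i j)].
Proof.
move=> sd ad dx Wx fr fr' dj.
have gN := face_good gM bF oU.
have sf := fch_schart gM bF oU sd ad.
have dx' : dom (fch F U d i) x by [].
have dj' : crd (fch F U d i) x ord0 j = 0 by rewrite /= mxE.
have [di FE] := adapted_frame bF sd dx fr ad Wx.
have [bH lH] := fr_loc fr' dj'; have [bG lG] := fr_loc fr dj.
have GF : Gf (lift i j) <> F.
  rewrite FE => /(frame_inj sd dx fr dj di) E'.
  by have := neq_lift i j; rewrite E' eqxx.
split=> //.
have [G [bG' GF' HG' _]] := face_bhs_sub gM bF oU bH.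
suff -> : Gf (lift i j) = G by [].
have Hx : Hf j x by apply/(lH x) => //; exact: nb_refl (fr_e0 fr') dx'.
have [k dk GE] := frame_through dx fr bG' (HG' _ Hx).
have [j' kE] : exists j', k = lift i j'.
  by case: (unliftP i k) => [j0 ->|E']; [exists j0|case: GF'; rewrite GE FE E'].
have [y [ny' ny] py] := frame_piece sf dx' fr' (fr_e0 fr) dj'.
have Hy : Hf j y by apply/(lH y ny')/py.
have nyd := nb_fch sd ad dx' ny.
have [_ lk] := fr_loc fr dk.
have dky : crd d y ord0 k = 0 by apply/(lk y nyd); rewrite -GE; exact: HG'.
suff -> : j = j' by rewrite -kE GE.
by apply/esym/py; rewrite /= mxE -kE.
Qed.

Lemma face_index_frame d i x e Gf e' Hf j : schart M d -> adapted F d i -> dom d x -> W x ->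
  frame M d x e Gf -> frame N (fch F U d i) x e' Hf -> crd d x ord0 (lift i j) = 0 ->
  face_index M F E (Hf j) = E (Gf (lift i j)).
Proof.
move=> sd ad dx Wx fr fr' dj.
by have [bH bG GF HG] := face_frame_sub sd ad dx Wx fr fr' dj; exact: face_index_uniq.
Qed.

End FaceIndex.

Section TrivChart.
Variables (R : realType) (T : topologicalType) (n : nat) (M : mfd R T n.+1).
Hypothesis gM : good M.
Let pM : presm M := gM.1.
Variables (F U : set T) (pr : T -> T) (rho : T -> R).
Hypotheses (bF : bhs M F) (tr : trivialization M F U pr rho).

Lemma triv_open : relopen (pts M) U. Proof. by case: tr. Qed.

(** Puts a trivialization into coordinates: rho becomes coordinate 0, and pr the map that sets it to
    0. *)
Lemma triv_chart x : U x -> exists D, [/\ schart M D, dom D x, dom D `<=` U, adapted F D ord0 &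
  [/\ forall y, crd D y ord0 ord0 = rho y,
      forall y, dom D y -> dom D (pr y),
      forall y, dom D y -> crd D (pr y) = ins ord0 (col' ord0 (crd D y)) &
      forall y j, U y -> crd D y ord0 (lift ord0 j) = crd (fch F U D ord0) (pr y) ord0 j ] ].
Proof.
move=> Ux; have [oU Upr Fpr _ tch] := tr.
have [Fp Up] := Upr x Ux.
have Wp : (F `&` U) (pr x) by [].
have [c ac cp] := (face_presm gM bF oU).2 _ Wp.
have sD := tch c ac.
set D := Chart _ _ in sD; exists D.
have rE y : crd D y ord0 ord0 = rho y.
  have := row_mxEl (const_mx (rho y) : 'rV[R]_1) (crd c (pr y)) ord0 ord0.
  by rewrite [RHS]mxE => <-; congr (row_mx _ _ _ _); exact: val_inj.
have cE y j : crd D y ord0 (lift ord0 j) = crd c (pr y) ord0 j.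
  have <- := row_mxEr (const_mx (rho y) : 'rV[R]_1) (crd c (pr y)) ord0 j.
  by congr (row_mx _ _ _ _); exact: val_inj.
have pp y : U y -> pr (pr y) = pr y /\ rho (pr y) = 0.
  by move=> Uy; have [Fy Uy'] := Upr y Uy; exact: Fpr.
have dp y : dom D y -> dom D (pr y).
  by move=> [Uy cy]; have [_ Uy'] := Upr y Uy; have [E _] := pp y Uy; split=> //=; rewrite E.
have pE y : dom D y -> crd D (pr y) = ins ord0 (col' ord0 (crd D y)).
  move=> [Uy cy]; have [E1 E2] := pp y Uy.
  apply/rowP => k; case: (unliftP ord0 k) => [j ->|->].
    by rewrite -[LHS]/(crd D (pr y) ord0 (lift ord0 j)) cE ins_lift [RHS]mxE cE E1.
  by rewrite -[LHS]/(crd D (pr y) ord0 ord0) ins_id rE.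
split=> //.
- by move=> y [].
- move=> y dy; rewrite rE; split=> [Fy|ry].
    by have [_ ->] := Fpr y (proj1 dy) Fy.
  suff <- : pr y = y by have [] := Upr y (proj1 dy).
  apply: (schart_inj sD); rewrite ?inE //; first exact: dp.
  by rewrite pE // ins_col' // rE.
split=> // y j Uy; rewrite cE /= mxE cE.
by have [-> _] := pp y Uy.
Qed.

End TrivChart.

Section BoxTriv.
Variables (R : realType) (T : topologicalType) (n : nat) (M : mfd R T n.+1).
Hypothesis gM : good M.
Let pM : presm M := gM.1.
Variables (F : set T) (d : chart R T n.+1) (i : 'I_n.+1) (x : T) (e : R) (Gf : 'I_n.+1 -> set T).
Hypotheses (bF : bhs M F) (sd : schart M d) (dx : dom d x) (Fx : F x) (ad : adapted F d i).
Hypothesis fr : frame M d x e Gf.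
Let U := nb d x e.
Let rho y := crd d y ord0 i.
Definition boxpr (y : T) : T :=
  xget y [set y' | dom d y' /\ crd d y' = ins i (col' i (crd d y))].

Lemma nb_relopen : relopen (pts M) U.
Proof.
apply: mk_relopen => [y [dy _]|y ny]; first exact: schart_pts dy.
by have [O [oO Oy HO]] := open_in_nb sd ny; exists O; split=> // w [Ow pw]; exact: HO.
Qed.
Let oU := nb_relopen.
Let dix : crd d x ord0 i = 0. Proof. by apply/ad. Qed.

Lemma boxprP y : U y -> [/\ U (boxpr y), F (boxpr y), dom d (boxpr y) &
  crd d (boxpr y) = ins i (col' i (crd d y))].
Proof.
move=> [dy by']; have bz : ball (crd d x) e (ins i (col' i (crd d y))).
  by apply: ball_ins => //; exact: ball_col'.
have [y' dy' ey'] := fr_box fr bz (orthant_ins _ (orthant_col' _ (schart_orthant sd dy))).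
have [dp ep] : dom d (boxpr y) /\ crd d (boxpr y) = ins i (col' i (crd d y)).
  by rewrite /boxpr; case: xgetP => [_ -> []//|/(_ y') []].
split=> //; first by split=> //; rewrite ep.
by apply/ad => //; rewrite ep ins_id.
Qed.

Lemma boxpr_id y : U y -> F y -> boxpr y = y.
Proof.
move=> Uy Fy; have [_ _ dp ep] := boxprP Uy.
by apply: (schart_inj sd); rewrite ?inE ?ep //; [case: Uy|rewrite ins_col' //; apply/ad => //; case: Uy].
Qed.

(** Balls of the sup norm are products, so the ball of a frame is a collar of its part of F. To
    these trivializations the hypothesis [phg] is applied in order to obtain expansions in
    coordinates. *)
Lemma box_trivialization : trivialization M F U boxpr rho.
Proof.
have gN := face_good gM bF oU.
split.
- exact: oU.
- by move=> y Uy; have [? ? _ _] := boxprP Uy.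
- move=> y Uy Fy; split; first exact: boxpr_id.
  by apply/ad => //; case: Uy.
- exists e; first exact: fr_e0 fr.
  split=> [y [dy /ball_coord/(_ i)]|w t Fw [dw bw] t0 te].
    by rewrite dix sub0r normrN ger0_norm //; exact: (schart_orthant sd dy).
  have wi : crd d w ord0 i = 0 by apply/ad.
  have ow := schart_orthant sd dw.
  pose z := crd d w + t *: delta_mx 0 i.
  have zl k : z ord0 (lift i k) = crd d w ord0 (lift i k).
    by rewrite !mxE eqxx /= eq_sym (negbTE (neq_lift i k)) mulr0 addr0.
  have zi : z ord0 i = t by rewrite !mxE !eqxx mulr1 wi add0r.
  have [||y dy ey] := @fr_box _ _ _ _ _ _ _ _ fr z.
  + apply/ball_rVP; first exact: fr_e0 fr.
    move=> k; case: (unliftP i k) => [k' ->|->]; first by rewrite zl; exact: ball_coord bw _.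
    by rewrite zi dix sub0r normrN ger0_norm.
  + by move=> k; case: (unliftP i k) => [k' ->|->]; rewrite ?zl ?zi.
  have Uy : U y.
    split=> //; rewrite ey; apply/ball_rVP; first exact: fr_e0 fr.
    move=> k; case: (unliftP i k) => [k' ->|->]; first by rewrite zl; exact: ball_coord bw _.
    by rewrite zi dix sub0r normrN ger0_norm.
  exists y; split=> //; last by rewrite /rho ey.
  have [_ _ dp ep] := boxprP Uy.
  apply: (schart_inj sd); rewrite ?inE // ep ey; apply/rowP => k.
  rewrite -[LHS]/(ins i (col' i z) ord0 k) -[RHS]/(crd d w ord0 k).
  by case: (unliftP i k) => [k' ->|->]; [rewrite ins_lift mxE zl|rewrite ins_id wi].
move=> c ac; have sc := gN.1.1 _ ac.
have sf := fch_schart gM bF oU sd ad.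
set D := Chart _ _.
have D0 y : crd D y ord0 ord0 = rho y.
  have := row_mxEl (const_mx (rho y) : 'rV[R]_1) (crd c (boxpr y)) ord0 ord0.
  by rewrite [RHS]mxE => <-; congr (row_mx _ _ _ _); exact: val_inj.
have Dl y j : crd D y ord0 (lift ord0 j) = crd c (boxpr y) ord0 j.
  have <- := row_mxEr (const_mx (rho y) : 'rV[R]_1) (crd c (boxpr y)) ord0 j.
  by congr (row_mx _ _ _ _); exact: val_inj.
have dcW : dom c `<=` F `&` U by move=> y cy; exact: (schart_pts sc cy).
have fE y : U y -> crd (fch F U d i) (boxpr y) = col' i (crd d y).
  by move=> Uy; have [_ _ _ ep] := boxprP Uy; rewrite /= ep col'_ins.
have fd y : U y -> dom (fch F U d i) (boxpr y).
  by move=> Uy; have [? ? ? _] := boxprP Uy.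
have DU y : dom D y -> U y by case.
have Dinj : {in dom D &, injective (crd D)}.
  move=> y y'; rewrite !inE => -[Uy cy] [Uy' cy'] E.
  have E1 : crd c (boxpr y) = crd c (boxpr y') by apply/rowP => j; rewrite -!Dl E.
  have E2 : boxpr y = boxpr y' by apply: (schart_inj sc); rewrite ?inE.
  apply: (schart_inj sd); rewrite ?inE; [by case: Uy|by case: Uy'|].
  apply/rowP => k; case: (unliftP i k) => [j ->|->]; last by rewrite -[LHS]D0 -[RHS]D0 E.
  have := fE y Uy; rewrite E2 fE // => /rowP/(_ j); by rewrite !mxE.
have icD : is_chart (pts M) D.
  apply: mk_chart.
  - apply: mk_relopen => [y [[dy _] _]|y [Uy cy]]; first exact: schart_pts dy.
    have [ O1 [oO1 O1y H1]] := dom_open sc cy.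
    have [e1 e10 He1] := nb_in_open sf (fd y Uy) oO1 O1y.
    have [ O2 [oO2 O2y H2]] := open_in_nb sd (nb_refl e10 (proj1 Uy)).
    have [ O3 [oO3 O3y H3]] := open_in_nb sd Uy.
    exists (O2 `&` O3); split; [exact: openI|by []|move=> w [[O2w O3w] pw]].
    have Uw := H3 w O3w pw; split=> //; apply: H1; last by have [? ? _ _] := boxprP Uw.
    apply: He1; split; first exact: fd.
    by rewrite !fE //; apply: ball_col'; case: (H2 w O2w pw).
  - exact: Dinj.
  - move=> z [y [Uy cy] <-] k; case: (unliftP ord0 k) => [j ->|->].
      by rewrite Dl; exact: schart_orthant sc cy j.
    by rewrite D0; exact: schart_orthant sd (proj1 Uy) i.
  - move=> y O [Uy cy] oO Oy.
    have [ O3 [oO3 O3y H3]] := open_in_nb sd Uy.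
    have [e1 e10 He1] := chart_ball (proj1 sd) (proj1 Uy) (openI oO oO3) (conj Oy O3y).
    have [ O2 [oO2 O2y H2]] := open_in_nb sf (nb_refl e10 (fd y Uy)).
    have [e2 e20 He2] := chart_ball (proj1 sc) cy oO2 O2y.
    exists (Num.min e1 e2); first by rewrite lt_min e10.
    move=> z bz oz.
    have [||w [cw O2w ew]] := He2 (col' ord0 z).
    + apply: (@le_ball _ _ _ (Num.min e1 e2)); first by rewrite ge_min lexx orbT.
      apply/ball_rVP; first by rewrite lt_min e10.
      by move=> j; rewrite -Dl [X in _ - X]mxE; exact: ball_coord bz _.
    + exact: orthant_col'.
    have Ww := dcW _ cw.
    have [_ b1] := H2 w O2w Ww; rewrite fE // in b1.
    have dw : dom d w by case: Ww.2.
    (* The point w of the face supplies the tangential coordinates, z the distance to F. *)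
    pose z' : 'rV[R]_n.+1 := \row_k (if unlift i k is Some j then crd d w ord0 k else z ord0 ord0).
    have zl j : z' ord0 (lift i j) = crd d w ord0 (lift i j) by rewrite mxE liftK.
    have zi : z' ord0 i = z ord0 ord0 by rewrite mxE unlift_none.
    have [||v [dv [Ov O3v] ev]] := He1 z'.
    + apply/ball_rVP => // k; case: (unliftP i k) => [j ->|->].
        by rewrite zl; have := ball_coord b1 j; rewrite /= !mxE.
      rewrite zi; have := ball_coord bz ord0; rewrite D0 => h; apply: lt_le_trans h _.
      by rewrite ge_min lexx.
    + move=> k; case: (unliftP i k) => [j ->|->]; first by rewrite zl; exact: (schart_orthant sd dw).
      by rewrite zi; exact: oz.
    have Uv := H3 v O3v (schart_pts sd dv).
    have pv : boxpr v = w.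
      apply: (schart_inj sf); rewrite ?inE; [exact: fd|by []|rewrite fE //].
      by apply/rowP => j; rewrite /= mxE ev zl mxE.
    exists v; split=> //; first by split=> //; rewrite /= pv.
    apply/rowP => k; case: (unliftP ord0 k) => [j ->|->]; last by rewrite D0 /rho ev zi.
    by rewrite Dl pv ew mxE.
  - move=> y e1 [Uy cy] e10.
    have [ O2 [oO2 O2y H2]] := open_in_nb sc (nb_refl e10 cy).
    have [e2 e20 He2] := nb_in_open sf (fd y Uy) oO2 O2y.
    pose e3 := Num.min e1 e2; have e30 : 0 < e3 by rewrite lt_min e10.
    have [ O1 [oO1 O1y H1]] := open_in_nb sd (nb_refl e30 (proj1 Uy)).
    exists O1; split=> // w O1w [Uw cw].
    have [_ b1] := H1 w O1w (schart_pts sd (proj1 Uw)).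
    apply/ball_rVP => // k; case: (unliftP ord0 k) => [j ->|->].
      rewrite !Dl; have [|_ b2] := H2 (boxpr w) _ (dcW _ cw); last exact: ball_coord b2 j.
      apply: He2; split; first exact: fd.
      by rewrite !fE //; apply: ball_col'; apply: le_ball b1; rewrite ge_min lexx orbT.
    by rewrite !D0; apply: lt_le_trans (ball_coord b1 i) _; rewrite ge_min lexx.
have Dd : dom D `<=` dom d by move=> y [[]].
apply: (schart_via pM sd icD Dd) => k.
  case: (unliftP i k) => [j ->|->]; last first.
    apply: (@smooth_on_eq _ _ _ (fun z => z ord0 ord0)); last exact: smooth_on_coord.
    by move=> z [y [Dy _] <-]; rewrite D0 repE.
  pose g (z : 'rV[R]_n.+1) := rep c (fun w => crd (fch F U d i) w ord0 j) (\row_l z ord0 (lift ord0 l)).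
  have E y : dom D y -> \row_l crd D y ord0 (lift ord0 l) = crd c (boxpr y).
    by move=> _; apply/rowP => l; rewrite mxE Dl.
  apply: (@smooth_on_eq _ _ _ g).
    move=> z [y [Dy dy] <-]; rewrite /g E // (repE _ Dinj Dy) (repE _ (schart_inj sc) Dy.2) fE ?mxE //.
    by case: Dy.
  apply: (smooth_on_comp _ _ (schart_trans gN.1 sc sf j)) => [l|z [y [Dy dy] <-]].
    exact: smooth_on_coord.
  by rewrite E //; exists (boxpr y) => //; split; [case: Dy|apply: fd; case: Dy].
case: (unliftP ord0 k) => [j ->|->]; last first.
  apply: (@smooth_on_eq _ _ _ (fun z => z ord0 i)); last exact: smooth_on_coord.
  by move=> z [y [dy Dy] <-]; rewrite (repE _ (schart_inj sd) dy) D0.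
pose g (z : 'rV[R]_n.+1) := rep (fch F U d i) (fun w => crd c w ord0 j) (\row_l z ord0 (lift i l)).
have E y : dom D y -> \row_l crd d y ord0 (lift i l) = crd (fch F U d i) (boxpr y).
  by move=> [Uy _]; rewrite fE //; apply/rowP => l; rewrite !mxE.
apply: (@smooth_on_eq _ _ _ g).
  move=> z [y [dy Dy] <-]; rewrite /g E // (repE _ (schart_inj sf)); last by apply: fd; case: Dy.
  by rewrite (repE _ (schart_inj sd) dy) Dl.
apply: (smooth_on_comp _ _ (schart_trans gN.1 sf sc j)) => [l|z [y [dy Dy] <-]].
  exact: smooth_on_coord.
by rewrite E //; exists (boxpr y) => //; split; [apply: fd; case: Dy|case: Dy].
Qed.

End BoxTriv.

(** * Boundary defining functions in coordinates *)

Section Bdf.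
Variables (R : realType) (T : topologicalType) (n : nat) (M : mfd R T n).
Hypothesis gM : good M.
Let pM : presm M := gM.1.

(** A hypersurface that does not pass through x misses the ball of the frame, and the constant 1 is
    a defining function for it there. *)
Definition coord_bdf (d : chart R T n) x (Gf : 'I_n -> set T) (G : set T) (y : T) : R :=
  if [pick k | (crd d x ord0 k == 0) && `[< G = Gf k >]] is Some k then crd d y ord0 k else 1.

Lemma coord_bdfE d x e Gf k y : schart M d -> dom d x -> frame M d x e Gf ->
  crd d x ord0 k = 0 -> coord_bdf d x Gf (Gf k) y = crd d y ord0 k.
Proof.
move=> sd dx fr dk; rewrite /coord_bdf; case: pickP => [l /andP[/eqP dl /asboolP E]|/(_ k)].
  by rewrite (frame_inj sd dx fr dk dl E).
by rewrite dk eqxx /=; move/asboolP.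
Qed.

Lemma pderiv_coord (y : 'rV[R]_n) i j :
  pderiv i (fun z : 'rV[R]_n => z ord0 j) y = (i == j)%:R.
Proof.
rewrite /pderiv /derive; apply: lim_near_cst => //; near=> t.
rewrite /= mxE addrK !mxE /GRing.scale /= mulrA mulVf ?mul1r //; last by near: t; exact: nbhs_dnbhs_neq.
by rewrite eq_sym.
Unshelve. all: end_near. Qed.

Lemma coord_is_bdf d x e Gf G : schart M d -> dom d x -> frame M d x e Gf -> bhs M G ->
  is_bdf M (nb d x e) G (coord_bdf d x Gf G).
Proof.
move=> sd dx fr bG.
have [[k dk GE]|H] := pselect (exists2 k, crd d x ord0 k = 0 & G = Gf k).
  have E : coord_bdf d x Gf G = fun y => crd d y ord0 k.
    by apply/funext => y; rewrite GE (coord_bdfE _ sd dx fr dk).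
  have [_ lk] := fr_loc fr dk.
  rewrite E; split.
  - by apply: smooth_fun_coord => // y [].
  - by move=> y [dy _]; exact: (schart_orthant sd dy).
  - by move=> y ny; rewrite GE; split=> [?|?]; apply/(lk y ny).
  move=> y ny Gy; exists d, setT, (fun z => z ord0 k), k; split=> //.
  - by split=> //; case: ny.
  - by split=> //; exact: openT.
  - exact: Cinf_coord.
  - by rewrite pderiv_coord eqxx oner_eq0.
have E : coord_bdf d x Gf G = fun=> 1.
  apply/funext => y; rewrite /coord_bdf; case: pickP => [l /andP[/eqP dl /asboolP E]|//].
  by case: H; exists l.
have nG y : nb d x e y -> ~ G y by move=> ny Gy; apply: H; exact: fr_bhs fr _ _ bG ny Gy.
rewrite E; split=> //.
- exact: smooth_fun_cst.
- by move=> y ny; split=> [/eqP|/(nG y ny)//]; rewrite oner_eq0.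
- by move=> y /nG.
Qed.

(** Compares any smooth function that vanishes on a hypersurface with the corresponding coordinate,
    by [Cinf_vanish_le]; lower bounds in terms of such a function are thereby turned into bounds in
    coordinates. *)
Lemma smooth_vanish_le d x e Gf j (A O : set T) f : schart M d -> dom d x -> frame M d x e Gf ->
  crd d x ord0 j = 0 -> open O -> O x -> (forall y, O y -> pts M y -> A y) ->
  smooth_fun M A f -> (forall y, A y -> Gf j y -> f y = 0) ->
  exists e' C : R, [/\ 0 < e', 0 < C & forall y, nb d x e' y -> `|f y| <= C * crd d y ord0 j].
Proof.
move=> sd dx fr dj oO Ox OA sf f0.
have Ax : A x by apply: OA => //; exact: schart_pts dx.
have [Q [g [oQ Qx Cg gE]]] := smooth_ext (proj1 sd) dx Ax oO Ox OA (sf d sd).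
have [e1 [C [e10 C0 eQ Hg]]] := Cinf_vanish_le oQ Qx Cg dj.
pose e2 := Num.min e e1; have e20 : 0 < e2 by rewrite lt_min e10 (fr_e0 fr).
exists e2, C; split=> // y [dy by'].
have oy := schart_orthant sd dy.
have be : ball (crd d x) e1 (crd d y) by apply: le_ball by'; rewrite ge_min lexx orbT.
have bx : ball (crd d x) e (crd d y) by apply: le_ball by'; rewrite ge_min lexx.
have [y' [dy' Oy' ey' gy']] := gE _ (eQ _ be) oy.
have E : y' = y by apply: (schart_inj sd); rewrite ?inE.
rewrite -E -gy' -ey' E; apply: Hg => //.
set z := \row_k _.
have bz e3 : 0 < e3 -> ball (crd d x) e3 (crd d y) -> ball (crd d x) e3 z.
  move=> e30 b3; apply/ball_rVP => // k; rewrite mxE; case: eqVneq => [->|_]; last exact: ball_coord b3 k.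
  by rewrite dj subrr normr0.
have oz : orthant z by move=> k; rewrite mxE; case: eqVneq.
have [w [dw Ow ew ->]] := gE z (eQ _ (bz _ e10 be)) oz.
apply: f0; first by apply: OA => //; exact: schart_pts dw.
have [_ lj] := fr_loc fr dj; apply/(lj w).
  by split=> //; rewrite ew; apply: bz => //; exact: fr_e0 fr.
by rewrite ew mxE eqxx.
Qed.

Lemma smooth_locally_bounded (A O : set T) f x : open O -> O x -> pts M x ->
  (forall y, O y -> pts M y -> A y) -> smooth_fun M A f ->
  exists O' C, [/\ open O', O' x, 0 < C & forall y, O' y -> pts M y -> `|f y| <= C].
Proof.
move=> oO Ox px OA sf; have [d ad dx] := pM.2 x px; have sd := pM.1 _ ad.
have Ax : A x by apply: OA.
have [Q [g [oQ Qx Cg gE]]] := smooth_ext (proj1 sd) dx Ax oO Ox OA (sf d sd).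
have [e [C [e0 C0 eQ Hg]]] := Cinf_bounded oQ Qx Cg.
have [O' [oO' O'x H]] := open_in_nb sd (nb_refl e0 dx).
exists O', C; split=> // y O'y py; have [dy by'] := H y O'y py.
have [y' [dy' Oy' ey' gy']] := gE _ (eQ _ by') (schart_orthant sd dy).
have E : y' = y by apply: (schart_inj sd); rewrite ?inE.
by rewrite -E -gy' -ey' E; exact: Hg.
Qed.

End Bdf.

(** * Expansions in coordinates *)

Section Analysis.
Variable R : realType.

Lemma ln_powR_bound (a y : R) q : 0 < a -> 0 < y <= 1 -> `|ln y| ^+ q <= a^-1 ^+ q * y `^ (- (a * q%:R)).
Proof.
move=> a0 /andP[y0 y1].
have lny : ln y <= 0 by exact: ln_le0.
have H : `|ln y| <= a^-1 * y `^ (- a).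
  rewrite ler0_norm // -(ler_pM2l a0) mulrA divff ?gt_eqF // mul1r mulrN -mulNr -ln_powR.
  by apply/ltW/ln_sublinear; exact: powR_gt0.
apply: (@le_trans _ _ ((a^-1 * y `^ (- a)) ^+ q)).
  by rewrite lerXn2r // nnegrE ?mulr_ge0 ?invr_ge0 ?powR_ge0 // ltW.
by rewrite exprMn -[X in _ * X]powR_mulrn ?powR_ge0 // -powRrM mulNr.
Qed.

Lemma powR_ln_bound (s t : R) q : s < t -> exists2 C : R, 0 < C &
  forall y, 0 < y <= 1 -> y `^ t * `|ln y| ^+ q <= C * y `^ s.
Proof.
(* Each logarithm costs y^(-a), and q a is still below t - s; the successor avoids a division by
   0. *)
move=> st; pose a := (t - s) / q.+1%:R.
have a0 : 0 < a by rewrite divr_gt0 // subr_gt0.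
exists (a^-1 ^+ q); first by rewrite exprn_gt0 // invr_gt0.
move=> y y01; have [y0 y1] := andP y01.
apply: le_trans (ler_wpM2l (powR_ge0 _ _) (ln_powR_bound q a0 y01)) _.
rewrite mulrCA ler_wpM2l //; first by rewrite exprn_ge0 // invr_ge0 ltW.
rewrite -powRD; last by rewrite (gt_eqF y0) implybT.
apply: ger_powR; first by rewrite y0.
rewrite lerBrDr -lerBrDl /a mulrAC ler_pdivrMr //.
by rewrite ler_wpM2l ?ler_nat // subr_ge0 ltW.
Qed.

End Analysis.

Lemma fsum_seq (V : zmodType) (I : choiceType) (A : set I) : finite_set A ->
  exists s : seq I, [/\ uniq s, forall i, i \in s <-> A i &
    forall F : I -> V, \sum_(i \in A) F i = \sum_(i <- s) F i].
Proof.
move=> fA; exists (finmap.enum_fset (fset_set A)); split.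
- exact: finmap.fset_uniq.
- move=> i; have -> : (i \in finmap.enum_fset (fset_set A)) = (i \in A) := in_fset_set fA i.
  by split=> [/set_mem//|Ai]; apply/mem_set.
- by move=> F; rewrite fsbig_finite.
Qed.

Section Local.
Variable R : realType.

Definition pos n (y : 'rV[R]_n) := forall j, 0 < y ord0 j.

(** Neighbourhoods of p inside the open orthant, since phg functions have meaningful values at
    interior points only. *)
Definition pnear n (p : 'rV[R]_n) (P : 'rV[R]_n -> Prop) :=
  exists2 e : R, 0 < e & forall y, ball p e y -> pos y -> P y.

Lemma pnear_and n (p : 'rV[R]_n) P Q : pnear p P -> pnear p Q -> pnear p (fun y => P y /\ Q y).
Proof.
move=> [e e0 He] [f f0 Hf]; exists (Num.min e f); first by rewrite lt_min e0.
move=> y b py; split; [apply: He|apply: Hf] => //; apply: le_ball b; rewrite ge_min lexx ?orbT //.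
Qed.

Lemma pnearS n (p : 'rV[R]_n) (P Q : 'rV[R]_n -> Prop) :
  (forall y, pos y -> P y -> Q y) -> pnear p P -> pnear p Q.
Proof. by move=> PQ [e e0 He]; exists e => // y b py; apply: PQ => //; exact: He. Qed.

Lemma pnear_forall n (p : 'rV[R]_n) (I : finType) (P : I -> 'rV[R]_n -> Prop) :
  (forall i, pnear p (P i)) -> pnear p (fun y => forall i, P i y).
Proof.
move=> H; suff : forall s : seq I, pnear p (fun y => forall i, i \in s -> P i y).
  by move=> /(_ (enum I)); apply: pnearS => y _ h i; apply: h; rewrite mem_enum.
elim=> [|i s IH]; first by exists 1.
apply: pnearS (pnear_and (H i) IH) => y _ [Pi Ps] j; rewrite inE => /orP[/eqP->//|]; exact: Ps.
Qed.

Lemma pnear_le1 n (p : 'rV[R]_n) j : p ord0 j = 0 -> pnear p (fun y => y ord0 j <= 1).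
Proof.
move=> pj; exists 1 => // y /ball_coord/(_ j); rewrite pj sub0r normrN => h py.
by rewrite ltW // -(gtr0_norm (py j)).
Qed.

Lemma pnear_col' n (p : 'rV[R]_n.+1) i P : pnear (col' i p) P -> pnear p (fun y => P (col' i y)).
Proof.
move=> [e e0 He]; exists e => // y b py; apply: He; first exact: ball_col'.
by move=> j; rewrite mxE.
Qed.

(** f = O(g W^-M) near p for an unspecified M. W will be the product of the type 2 coordinates, in
    which any finite loss is harmless. *)
Definition bdd n (p : 'rV[R]_n) (W g f : 'rV[R]_n -> R) :=
  exists (C : R) (M : nat), 0 <= C /\ pnear p (fun y => `|f y| <= C * g y * W y ^- M).

Section Bdd.
Variables (n : nat) (p : 'rV[R]_n) (W g : 'rV[R]_n -> R).
Hypothesis W01 : pnear p (fun y => 0 < W y <= 1).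
Hypothesis g0 : forall y, pos y -> 0 <= g y.

Lemma invX_le (w : R) M M' : 0 < w <= 1 -> (M <= M')%N -> w ^- M <= w ^- M'.
Proof.
move=> /andP[w0 w1] MM; rewrite lef_pV2 ?posrE ?exprn_gt0 //.
by apply: ler_wiXn2l => //; exact: ltW.
Qed.

Lemma bdd_add f1 f2 : bdd p W g f1 -> bdd p W g f2 -> bdd p W g (fun y => f1 y + f2 y).
Proof.
move=> [C1 [M1 [C10 H1]]] [C2 [M2 [C20 H2]]].
exists (C1 + C2), (maxn M1 M2); split; first exact: addr_ge0.
apply: pnearS (pnear_and W01 (pnear_and H1 H2)) => y py [w01 [h1 h2]].
apply: le_trans (ler_normD _ _) _; rewrite -mulrA mulrDl; apply: lerD.
  apply: le_trans h1 _; rewrite -mulrA ler_wpM2l // ler_wpM2l ?g0 //.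
  by apply: invX_le => //; exact: leq_maxl.
apply: le_trans h2 _; rewrite -mulrA ler_wpM2l // ler_wpM2l ?g0 //.
by apply: invX_le => //; exact: leq_maxr.
Qed.

Lemma bdd0 : bdd p W g (fun=> 0).
Proof. by exists 0, 0%N; split=> //; exists 1 => // y _ _; rewrite normr0 !mul0r. Qed.

Lemma bdd_eq f1 f2 : pnear p (fun y => f1 y = f2 y) -> bdd p W g f1 -> bdd p W g f2.
Proof.
move=> E [C [M [C0 H]]]; exists C, M; split=> //.
by apply: pnearS (pnear_and E H) => y _ [->].
Qed.

Lemma bdd_sum (I : eqType) (s : seq I) (f : I -> 'rV[R]_n -> R) :
  (forall i, i \in s -> bdd p W g (f i)) -> bdd p W g (fun y => \sum_(i <- s) f i y).
Proof.
elim: s => [|i s IH] H.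
  by apply: bdd_eq bdd0; exists 1 => // y _ _; rewrite big_nil.
have Hi : bdd p W g (f i) by apply: H; rewrite mem_head.
have Hs : bdd p W g (fun y => \sum_(i <- s) f i y).
  by apply: IH => j js; apply: H; rewrite inE js orbT.
apply: bdd_eq (bdd_add Hi Hs).
by exists 1 => // y _ _; rewrite big_cons.
Qed.

Lemma bdd_fsum (I : choiceType) (A : set I) (f : I -> 'rV[R]_n -> R) : finite_set A ->
  (forall i, A i -> bdd p W g (f i)) -> bdd p W g (fun y => \sum_(i \in A) f i y).
Proof.
move=> fA H; have [s [us sA sE]] := fsum_seq R fA.
apply: (bdd_eq (f1 := fun y => \sum_(i <- s) f i y)); last first.
  by apply: bdd_sum => i /sA; exact: H.
by exists 1 => // y _ _; rewrite sE.
Qed.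

Lemma bdd_le (g' f : 'rV[R]_n -> R) (C' : R) : 0 <= C' -> pnear p (fun y => g y <= C' * g' y) ->
  bdd p W g f -> bdd p W g' f.
Proof.
move=> C'0 gg [C [M [C0 H]]]; exists (C * C'), M; split; first exact: mulr_ge0.
apply: pnearS (pnear_and (pnear_and W01 gg) H) => y py [[/andP[w0 w1] gy] h].
apply: le_trans h _; rewrite -!mulrA ler_wpM2l // mulrA ler_wpM2r //.
by rewrite invr_ge0 exprn_ge0 // ltW.
Qed.

Lemma bdd_mul (g' f f' : 'rV[R]_n -> R) : bdd p W g f -> bdd p W g' f' ->
  bdd p W (fun y => g y * g' y) (fun y => f y * f' y).
Proof.
move=> [C1 [M1 [C10 H1]]] [C2 [M2 [C20 H2]]].
exists (C1 * C2), (M1 + M2)%N; split; first exact: mulr_ge0.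
apply: pnearS (pnear_and H1 H2) => y py [h1 h2].
rewrite normrM exprD invfM.
have -> : C1 * C2 * (g y * g' y) * (W y ^- M1 * W y ^- M2) =
   (C1 * g y * W y ^- M1) * (C2 * g' y * W y ^- M2) by ring.
by apply: ler_pM.
Qed.

End Bdd.


Definition ifin (E : set (R * nat)) := forall r, finite_set [set sp | E sp /\ sp.1 <= r].

Lemma index_set_ifin E : index_set E -> ifin E.
Proof.
move=> [fs fp _ _] r.
apply: (@sub_finite_set _ _ (\bigcup_(s in [set s | s <= r /\ exists p, E (s, p)])
   ((fun p => (s, p)) @` [set p | E (s, p)]))).
  by move=> [s p] /= [Esp sr]; exists s => /=; [split=> //; exists p|exists p].
by apply: bigcup_finite => // s _; exact: finite_image.
Qed.

Lemma ifin_lower E : ifin E -> exists r : R, forall sp, E sp -> r < sp.1.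
Proof.
move=> fE; have [s [_ sA _]] := fsum_seq R (fE 0).
suff [r [r0 Hr]] : exists r : R, r < 0 /\ forall sp, sp \in s -> r < sp.1.
  exists r => sp Esp; have [sp0|] := leP sp.1 0; last exact: lt_trans.
  by apply: Hr; apply/sA.
elim: s {sA} => [|sp s [r [r0 Hr]]]; first by exists (-1); split=> //; rewrite oppr_lt0.
exists (Num.min r (sp.1 - 1)); split; first by rewrite gt_min r0.
by move=> sp'; rewrite inE gt_min => /orP[/eqP->|/Hr->//]; rewrite gtrBl ltr01 orbT.
Qed.

Lemma ifin_gap E r : ifin E -> exists2 k : R, 0 < k &
  forall sp, E sp -> r < sp.1 -> r + k < sp.1.
Proof.
move=> fE; have [s [_ sA _]] := fsum_seq R (fE (r + 1)).
suff [k [k0 k1 Hk]] : exists k : R, [/\ 0 < k, k <= 1 &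
    forall sp, sp \in s -> r < sp.1 -> r + k < sp.1].
  exists k => // sp Esp rs; have [sp1|] := leP sp.1 (r + 1); first by apply: Hk => //; apply/sA.
  by apply: le_lt_trans; rewrite lerD2l.
elim: s {sA} => [|sp s [k [k0 k1 Hk]]]; first by exists 1; split.
have [rs|rs] := leP sp.1 r.
  exists k; split=> // sp'; rewrite inE => /orP[/eqP->|/Hk//]; by rewrite ltNge rs.
exists (Num.min k ((sp.1 - r) / 2)); split.
- by rewrite lt_min k0 divr_gt0 // subr_gt0.
- by rewrite ge_min k1.
move=> sp'; rewrite inE => /orP[/eqP->|/Hk H] rs'.
  rewrite -ltrBrDl gt_min; apply/orP; right.
  by rewrite ltr_pdivrMr // mulr_natr mulr2n ltrDl subr_gt0.
by apply: le_lt_trans (H rs'); rewrite lerD2l ge_min lexx.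
Qed.

Definition pexp m (E : set (R * nat)) (a : R -> nat -> 'rV[R]_m -> R) (i : 'I_m.+1) (r : R)
    (y : 'rV[R]_m.+1) : R :=
  \sum_(sp \in [set sp | E sp /\ sp.1 <= r])
    a sp.1 sp.2 (col' i y) * (y ord0 i `^ sp.1) * ln (y ord0 i) ^+ sp.2.

(* Germ at p of an iterated expansion in the coordinates vanishing at p. *)
Fixpoint lphg n : 'rV[R]_n -> ('I_n -> set (R * nat)) -> ('rV[R]_n -> R) -> Prop :=
  match n with
  | 0 => fun _ _ _ => True
  | m.+1 => fun p E u =>
    ((forall i, p ord0 i <> 0) -> exists C : R, pnear p (fun y => `|u y| <= C)) /\
    forall i, p ord0 i = 0 -> exists a : R -> nat -> 'rV[R]_m -> R,
      (forall s q, E i (s, q) -> lphg (col' i p) (fun j => E (lift i j)) (a s q)) /\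
      exists N : nat, exists2 e : R, 0 < e & forall r, exists C : R, forall y, ball p e y -> pos y ->
        `|u y - pexp (E i) a i r y| <=
          C * (y ord0 i `^ r) * \prod_(j | (j != i) && (p ord0 j == 0)) y ord0 j ^- N
  end.

Lemma lphg_ext n (p : 'rV[R]_n) E E' u : (forall i, p ord0 i = 0 -> E i = E' i) ->
  lphg p E u -> lphg p E' u.
Proof.
elim: n p E E' u => [//|n IH] p E E' u EE /= [ub H]; split=> // i pi.
have [a [Ha Hr]] := H i pi; exists a; rewrite -EE //; split=> // s q Esq.
by apply: IH (Ha s q Esq) => j; rewrite mxE; exact: EE.
Qed.

(** The condition [inf_ge0] imposed on every element rather than on the infimum; for index sets the
    two agree. *)
Definition nneg (E : set (R * nat)) := forall s q, E (s, q) -> 0 < s \/ (s = 0 /\ q = 0%N).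

Definition wgt n (p : 'rV[R]_n) (t : 'I_n -> bool) (y : 'rV[R]_n) : R :=
  \prod_(j | t j && (p ord0 j == 0)) y ord0 j.

Lemma wgt01 n (p : 'rV[R]_n) t : pnear p (fun y => 0 < wgt p t y <= 1).
Proof.
have : pnear p (fun y => forall j, p ord0 j = 0 -> y ord0 j <= 1).
  apply: pnear_forall => j; have [pj|pj] := pselect (p ord0 j = 0); last by exists 1.
  by apply: pnearS (pnear_le1 pj) => y _ ?.
apply: pnearS => y py H; apply/andP; split; first by apply: prodr_gt0 => j _; exact: py.
apply: prodr_ile1 => j /andP[_ /eqP pj]; rewrite (ltW (py j)) /=; exact: H.
Qed.


Lemma wgt_lift n (p : 'rV[R]_n.+1) (t : 'I_n.+1 -> bool) i y : ~~ t i ->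
  wgt p t y = wgt (col' i p) (t \o lift i) (col' i y).
Proof.
move=> ni; rewrite /wgt big_mkcond (bigD1_ord i) //= (negbTE ni) /= mul1r [RHS]big_mkcond.
by apply: eq_bigr => j _; rewrite !mxE.
Qed.

Lemma bdd_lift n (p : 'rV[R]_n.+1) (t : 'I_n.+1 -> bool) i g f : ~~ t i ->
  bdd (col' i p) (wgt (col' i p) (t \o lift i)) g f ->
  bdd p (wgt p t) (fun y => g (col' i y)) (fun y => f (col' i y)).
Proof.
move=> ti [C [M [C0 H]]]; exists C, M; split=> //.
by apply: pnearS (pnear_col' H) => y py h; rewrite (wgt_lift _ _ ti).
Qed.

Lemma pnear_le1_all n (p : 'rV[R]_n) : pnear p (fun y => forall j, p ord0 j = 0 -> y ord0 j <= 1).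
Proof.
apply: pnear_forall => j; have [pj|pj] := pselect (p ord0 j = 0); last by exists 1.
by apply: pnearS (pnear_le1 pj) => y _ ?.
Qed.

(** Where y_i is the smallest of the type 1 coordinates, those with [t j] false, a negative power of
    any other type 1 coordinate is at most the same power of y_i. There are at most n of them, and
    the type 2 factors form the weight. *)
Lemma prod_min_bound n (p : 'rV[R]_n) (t : 'I_n -> bool) i N (y : 'rV[R]_n) : pos y ->
  (forall j, p ord0 j = 0 -> y ord0 j <= 1) -> p ord0 i = 0 ->
  (forall j, p ord0 j = 0 -> ~~ t j -> y ord0 i <= y ord0 j) ->
  \prod_(j | (j != i) && (p ord0 j == 0)) y ord0 j ^- N <=
    y ord0 i ^- (N * n) * wgt p t y ^- N.
Proof.
move=> py y1 pi ymin.
have -> : y ord0 i ^- (N * n) * wgt p t y ^- N =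
   \prod_j (y ord0 i ^- N * (if t j && (p ord0 j == 0) then y ord0 j ^- N else 1)).
  rewrite big_split /= prodr_const card_ord exprM exprVn; congr (_ * _).
  by rewrite -big_mkcond /= prodfV prodrXl.
rewrite big_mkcond; apply: ler_prod => j _.
have inv1 k : p ord0 k = 0 -> 1 <= y ord0 k ^- N.
  move=> pk; rewrite invf_ge1 ?exprn_gt0 ?py //; apply: exprn_ile1; [exact: ltW|exact: y1].
case: ifP => [/andP[ji pj]|_]; last first.
  rewrite ler01 /= -[leLHS]mulr1; apply: ler_pM => //; first exact: inv1.
  by case: ifP => // /andP[_ /eqP/inv1].
rewrite invr_ge0 exprn_ge0 ?(ltW (py _)) //= pj andbT.
case: ifP => [tj|/negbT tj].
  by rewrite ler_peMl ?inv1 // invr_ge0 exprn_ge0 // ltW.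
rewrite mulr1 lef_pV2 ?posrE ?exprn_gt0 ?py // lerXn2r ?nnegrE ?(ltW (py _)) //.
by apply: ymin => //; exact/eqP.
Qed.

(** At every point one of the type 1 coordinates is the smallest. So finitely many bounds, each
    valid where its own coordinate is the smallest, combine by addition. *)
Lemma bdd_argmin n (p : 'rV[R]_n) (t : 'I_n -> bool) g (u : 'rV[R]_n -> R) :
  (forall y, pos y -> 0 <= g y) -> (exists2 i, p ord0 i = 0 & ~~ t i) ->
  (forall i, p ord0 i = 0 -> ~~ t i -> exists (f : 'rV[R]_n -> R), bdd p (wgt p t) g f /\
    pnear p (fun y => (forall j, p ord0 j = 0 -> ~~ t j -> y ord0 i <= y ord0 j) ->
      `|u y| <= `|f y|)) ->
  bdd p (wgt p t) g u.
Proof.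
move=> g0 [i0 pi0 ti0] H.
have /choice[f Hf] : forall i, exists f : 'rV[R]_n -> R, bdd p (wgt p t) g f /\
   (p ord0 i = 0 -> ~~ t i -> pnear p (fun y => (forall j, p ord0 j = 0 -> ~~ t j -> y ord0 i <= y ord0 j) ->
      `|u y| <= `|f y|)).
  move=> i; have [[pi ti]|ni] := pselect (p ord0 i = 0 /\ ~~ t i).
    by have [f [bf nf]] := H i pi ti; exists f.
  by exists (fun=> 0); split=> [|pi ti]; [exact: bdd0|case: ni].
have [C [M [C0 B]]] : bdd p (wgt p t) g (fun y => \sum_i `|f i y|).
  apply: (bdd_sum (wgt01 p t)) => // i _; have [[C [M [C0 b]]] _] := Hf i.
  by exists C, M; split=> //; apply: pnearS b => y _; rewrite normr_id.
exists C, M; split=> //.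
have N : pnear p (fun y => forall i, p ord0 i = 0 -> ~~ t i ->
   (forall j, p ord0 j = 0 -> ~~ t j -> y ord0 i <= y ord0 j) -> `|u y| <= `|f i y|).
  apply: pnear_forall => i; have [[pi ti]|ni] := pselect (p ord0 i = 0 /\ ~~ t i).
    by apply: pnearS ((Hf i).2 pi ti) => y _ h _ _; exact: h.
  by exists 1 => // y _ _ pi ti; case: ni.
apply: pnearS (pnear_and B N) => y py [b h]; apply: le_trans b.
have P0 : (p ord0 i0 == 0) && ~~ t i0 by rewrite pi0 eqxx.
case: (@Order.TotalTheory.arg_minP _ _ _ i0 (fun i => (p ord0 i == 0) && ~~ t i) (fun i => y ord0 i) P0) => i /andP[/eqP pi ti] Hmin.
apply: (le_trans (h i pi ti _)).
  by move=> j pj tj; apply: Hmin; rewrite pj eqxx.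
rewrite [leRHS]ger0_norm; last by apply: sumr_ge0.
by rewrite (bigD1 i) //= lerDl sumr_ge0.
Qed.

Lemma bdd_wgt n (p : 'rV[R]_n) (t : 'I_n -> bool) (g : 'rV[R]_n -> R) (C : R) N :
  (forall y, pos y -> 0 <= g y) -> bdd p (wgt p t) g (fun y => C * g y * wgt p t y ^- N).
Proof.
move=> g0; exists `|C|, N; split=> //; apply: pnearS (wgt01 p t) => y py /andP[w0 _].
by rewrite !normrM [ `|g y|]ger0_norm ?g0 // [ `|_ ^- N|]ger0_norm // invr_ge0 exprn_ge0 // ltW.
Qed.

(** The surplus y_i^(r - s) pays for the N n negative powers of y_i in [prod_min_bound]. *)
Lemma remainder_le n (p : 'rV[R]_n) (t : 'I_n -> bool) i N (C r s : R) :
  p ord0 i = 0 -> s + (N * n)%:R <= r ->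
  pnear p (fun y => (forall j, p ord0 j = 0 -> ~~ t j -> y ord0 i <= y ord0 j) ->
    C * (y ord0 i `^ r) * \prod_(j | (j != i) && (p ord0 j == 0)) y ord0 j ^- N <=
    `|C| * y ord0 i `^ s * wgt p t y ^- N).
Proof.
move=> pi sr.
apply: pnearS (pnear_le1_all p) => y py y1 ymin.
have Q0 : 0 <= \prod_(j | (j != i) && (p ord0 j == 0)) y ord0 j ^- N.
  by apply: prodr_ge0 => j _; rewrite invr_ge0 exprn_ge0 // ltW.
apply: (@le_trans _ _ (`|C| * (y ord0 i `^ r) * \prod_(j | (j != i) && (p ord0 j == 0)) y ord0 j ^- N)).
  by rewrite ler_wpM2r // ler_wpM2r ?powR_ge0 // ler_norm.
apply: le_trans (ler_wpM2l _ (prod_min_bound N py y1 pi ymin)) _.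
  by rewrite mulr_ge0 ?powR_ge0.
rewrite mulrA ler_wpM2r ?invr_ge0 ?exprn_ge0 ?prodr_ge0 //; first by move=> j _; rewrite ltW.
rewrite -mulrA ler_wpM2l // -powR_invn ?(ltW (py _)) // -powRD; last by rewrite (gt_eqF (py i)) implybT.
by apply: ger_powR; [rewrite py y1|rewrite lerBrDr].
Qed.

Lemma bdd_term n (p : 'rV[R]_n.+1) (t : 'I_n.+1 -> bool) i (g a : 'rV[R]_n -> R) (s d : R) q :
  p ord0 i = 0 -> ~~ t i -> (d < s \/ d = 0 /\ s = 0 /\ q = 0%N) ->
  bdd (col' i p) (wgt (col' i p) (t \o lift i)) g a ->
  bdd p (wgt p t) (fun y => g (col' i y) * y ord0 i `^ d)
    (fun y => a (col' i y) * (y ord0 i `^ s) * ln (y ord0 i) ^+ q).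
Proof.
move=> pi ti ds /(bdd_lift ti) ba.
have bl : bdd p (wgt p t) (fun y => y ord0 i `^ d) (fun y => y ord0 i `^ s * ln (y ord0 i) ^+ q).
  have [C C0 HC] : exists2 C : R, 0 < C & forall y, 0 < y <= 1 -> y `^ s * `|ln y| ^+ q <= C * y `^ d.
    case: ds => [ds|[-> [-> ->]]]; first exact: powR_ln_bound.
    by exists 1 => // y _; rewrite expr0 mulr1 mul1r.
  exists C, 0%N; split; first exact: ltW.
  apply: pnearS (pnear_le1 pi) => y py y1.
  by rewrite expr0 invr1 mulr1 normrM normrX [ `|_ `^ _|]ger0_norm ?powR_ge0 // HC // py.
by apply: bdd_eq (bdd_mul ba bl); exists 1 => // y _ _; rewrite mulrA.
Qed.

(** Where y_i is the smallest type 1 coordinate, u is expanded at the i-th hypersurface. The terms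
    are under control because the exponents are nonnegative and the coefficients are treated by
    induction; the negative powers of the other type 1 coordinates in the remainder are repaid by
    y_i^r with r = N times the dimension. *)
Lemma lphg_bdd n (p : 'rV[R]_n) (t : 'I_n -> bool) E u :
  (forall i, p ord0 i = 0 -> ifin (E i)) ->
  (forall i, p ord0 i = 0 -> ~~ t i -> nneg (E i)) ->
  lphg p E u -> bdd p (wgt p t) (fun=> 1) u.
Proof.
elim: n p t E u => [|n IH] p t E u fE nE.
  move=> _; exists `|u p|, 0%N; split=> //; exists 1 => // y _ _.
  by rewrite expr0 invr1 !mulr1 (_ : y = p) //; apply/rowP => -[].
move=> [ub H].
have [[i0 pi0]|none] := pselect (exists i, p ord0 i = 0); last first.
  have [|C HC] := ub; first by move=> i pi; apply: none; exists i.
  exists `|C|, 0%N; split=> //; apply: pnearS HC => y py h.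
  by rewrite expr0 invr1 !mulr1; apply: le_trans h (ler_norm _).
(* Without a type 1 coordinate the crude bound suffices: at an order r below all exponents the
   partial expansion is empty, and every coordinate vanishing at p occurs in the weight. *)
have [[i1 pi1 ti1]|allt] := pselect (exists2 i, p ord0 i = 0 & ~~ t i); last first.
  have [a [_ [N [e e0 Hr]]]] := H i0 pi0.
  have [r Hrr] := ifin_lower (fE i0 pi0).
  have [C HC] := Hr r.
  have tt j : p ord0 j = 0 -> t j by move=> pj; apply: contrapT => /negP tj; apply: allt; exists j.
  have [m rm] : exists m : nat, - m%:R <= r.
    have := archi_boundP (normr_ge0 r) => h; exists (Num.bound `|r|).
    by rewrite lerNl ltW //; apply: le_lt_trans h; rewrite -normrN ler_norm.
  exists `|C|, (m + N)%N; split=> //.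
  have HC' : pnear p (fun y => `|u y - pexp (E i0) a i0 r y| <=
          C * (y ord0 i0 `^ r) * \prod_(j | (j != i0) && (p ord0 j == 0)) y ord0 j ^- N).
    by exists e.
  apply: pnearS (pnear_and HC' (pnear_le1_all p)) => y py [h y1].
  have p0 : pexp (E i0) a i0 r y = 0.
    rewrite /pexp (_ : [set sp | _] = set0) ?fsbig_set0 //.
    by apply/seteqP; split=> // sp [/= /Hrr h1 h2]; move: h1; rewrite ltNge h2.
  rewrite p0 subr0 in h; apply: le_trans h _; rewrite mulr1 exprD invfM.
  have WE : wgt p t y = y ord0 i0 * \prod_(j | (j != i0) && (p ord0 j == 0)) y ord0 j.
    rewrite /wgt (bigD1 i0) /=; last by rewrite pi0 eqxx tt.
    congr (_ * _); apply: eq_bigl => j; rewrite andbC; congr (_ && _).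
    by case: eqP => [/tt->//|]; rewrite ?andbF.
  have P01 (S : pred 'I_n.+1) : 0 < \prod_(j | S j && (p ord0 j == 0)) y ord0 j <= 1.
    apply/andP; split; first by apply: prodr_gt0 => j _; exact: py.
    by apply: prodr_ile1 => j /andP[_ /eqP pj]; rewrite (ltW (py j)) /=; exact: y1.
  have /andP[W0 W1] := P01 t; rewrite -/(wgt p t y) in W0 W1.
  have /andP[Q0 Q1] := P01 (fun j => j != i0).
  pose Q := \prod_(j | (j != i0) && (p ord0 j == 0)) y ord0 j; rewrite -/Q in Q0 Q1 WE.
  have -> : \prod_(j | (j != i0) && (p ord0 j == 0)) y ord0 j ^- N = Q ^- N.
    by rewrite prodfV prodrXl.
  apply: (@le_trans _ _ (`|C| * (y ord0 i0 `^ r * Q ^- N))).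
    by rewrite mulrA ler_wpM2r ?invr_ge0 ?exprn_ge0 ?(ltW Q0) // ler_wpM2r ?powR_ge0 // ler_norm.
  have inv_le (w v : R) k : 0 < w -> w <= v -> v ^- k <= w ^- k.
    move=> w0 wv; have v0 := lt_le_trans w0 wv.
    by rewrite lef_pV2 ?posrE ?exprn_gt0 // lerXn2r // nnegrE ltW.
  rewrite ler_wpM2l //; apply: ler_pM; rewrite ?powR_ge0 ?invr_ge0 ?exprn_ge0 ?(ltW Q0) //.
    apply: le_trans (inv_le _ (y ord0 i0) m W0 _).
      by rewrite -powR_invn ?(ltW (py _)) //; apply: ger_powR => //; rewrite py y1.
    by rewrite WE ler_piMr // ltW.
  by apply: inv_le => //; rewrite WE ler_piMl ?y1 // ltW.
apply: (bdd_argmin (t := t)) => [//||i pi ti]; first by exists i1.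
have [a [Ha [N [e e0 Hr]]]] := H i pi.
have [C HC] := Hr (N * n.+1)%:R.
have nf := @remainder_le _ p t i N C (N * n.+1)%:R 0 pi _.
have {}nf := nf (eq_ind_r (fun z => z <= _) (lexx _) (add0r _)).
have bf := @bdd_wgt _ p t (fun=> 1) `|C| N (fun _ _ => ler01).
have bs : bdd p (wgt p t) (fun=> 1) (pexp (E i) a i (N * n.+1)%:R).
  apply: (bdd_fsum (wgt01 p t)) => [//||[s q] [/= Es sr]]; first exact: fE.
  have b1 : bdd (col' i p) (wgt (col' i p) (t \o lift i)) (fun=> 1) (a s q).
    apply: IH (Ha s q Es) => j; rewrite mxE => pj; first exact: fE.
    by move=> tj; apply: nE.
  have ds : 0 < s \/ 0 = 0 :> R /\ s = 0 /\ q = 0%N.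
    by case: (nE i pi ti s q Es) => [s0|[-> ->]]; [left|right].
  apply: (bdd_le (wgt01 p t) (C' := 1) ler01 _ (bdd_term pi ti ds b1)).
  by exists 1 => // y _ _; rewrite powRr0 !mul1r.
have bn g h : bdd p (wgt p t) g h -> bdd p (wgt p t) g (fun y => `|h y|).
  by move=> [C1 [M [C10 b]]]; exists C1, M; split=> //; apply: pnearS b => y _; rewrite normr_id.
pose f (y : 'rV[R]_n.+1) := `|C| * 1 * wgt p t y ^- N.
exists (fun y => `|pexp (E i) a i (N * n.+1)%:R y| + `|f y|); split.
  by apply: (bdd_add (wgt01 p t)) => //; apply: bn.
have HC' : pnear p (fun y => `|u y - pexp (E i) a i (N * n.+1)%:R y| <=
          C * (y ord0 i `^ (N * n.+1)%:R) * \prod_(j | (j != i) && (p ord0 j == 0)) y ord0 j ^- N).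
  by exists e.
apply: pnearS (pnear_and HC' nf) => y py [h1 h2] ymin.
rewrite [leRHS]ger0_norm ?addr_ge0 // -[u y](subrK (pexp (E i) a i (N * n.+1)%:R y)) addrC.
apply: le_trans (ler_normD _ _) _; rewrite lerD2l.
by apply: le_trans h1 _; apply: le_trans (h2 ymin) _; rewrite powRr0; exact: ler_norm.
Qed.

(** One step towards the i-th hypersurface; the difference between u and its leading coefficient is
    recovered as a telescoping sum over such steps. *)
Definition halve n (i : 'I_n) (y : 'rV[R]_n) : 'rV[R]_n :=
  \row_j (if j == i then y ord0 j / 2 else y ord0 j).

Lemma halve_pos n i (y : 'rV[R]_n) : pos y -> pos (halve i y).
Proof. by move=> py j; rewrite mxE; case: ifP => _; rewrite ?divr_gt0. Qed.

Lemma halve_ball n i (p y : 'rV[R]_n) e : p ord0 i = 0 -> ball p e y -> ball p e (halve i y).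
Proof.
move=> pi b; have [e0 _] := b; apply/ball_rVP => // j; rewrite mxE.
have := ball_coord b j; case: eqP => [->|//]; rewrite pi !sub0r !normrN normrM => h.
have h2 : `|(2 : R)^-1| <= 1 by rewrite ger0_norm ?invr_ge0 ?ler0n // invf_le1 ?ltr0n // ler1n.
by apply: le_lt_trans h; rewrite ler_piMr.
Qed.

Lemma col'_halve n i (y : 'rV[R]_n.+1) : col' i (halve i y) = col' i y.
Proof. by apply/rowP => j; rewrite !mxE eq_sym (negbTE (neq_lift i j)). Qed.

Lemma col'_halve_lift n g i (y : 'rV[R]_n.+1) :
  col' g (halve (lift g i) y) = halve i (col' g y).
Proof. by apply/rowP => j; rewrite !mxE (inj_eq (@lift_inj _ g)). Qed.

(** The difference cancels the coefficient of y_i^0 before any limit is taken, and loses nothing at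
    type 1 hypersurfaces. As in [lphg_bdd], one expands at the smallest type 1 coordinate y_g. If g
    = i, the term with s = 0 cancels and the others are of order y_i^d; otherwise the difference
    passes to the coefficients, which are treated by induction. The remainder is of order y_g^d, and
    y_g <= y_i. *)
Lemma lphg_halve n (p : 'rV[R]_n) (t : 'I_n -> bool) E u i (d : R) : 0 < d ->
  (forall i, p ord0 i = 0 -> ifin (E i)) ->
  (forall i, p ord0 i = 0 -> ~~ t i -> nneg (E i)) ->
  p ord0 i = 0 -> ~~ t i ->
  (forall s q, E i (s, q) -> d < s \/ (s = 0 /\ q = 0%N)) ->
  lphg p E u ->
  bdd p (wgt p t) (fun y => y ord0 i `^ d) (fun y => u y - u (halve i y)).
Proof.
move=> d0; elim: n p t E u i => [|n IH] p t E u i fE nE pi ti Ed.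
  by have := ltn_ord i.
move=> [_ H].
apply: (bdd_argmin (t := t)) => [y py||g pg tg]; first exact: powR_ge0.
  by exists i.
have [a [Ha [N [e e0 Hr]]]] := H g pg.
pose r : R := d + (N * n.+1)%:R.
have [C HC] := Hr r.
(* Halving one coordinate enlarges the product of negative powers by at most 2^N. *)
pose C2 := `|C| * (1 + 2 ^+ N).
have nf := @remainder_le _ p t g N C2 r d pg (lexx _).
have gi0 (y : 'rV[R]_n.+1) : pos y -> 0 <= y ord0 i `^ d by move=> _; exact: powR_ge0.
have bf := @bdd_wgt _ p t (fun y => y ord0 i `^ d) `|C2| N gi0.
pose f (y : 'rV[R]_n.+1) := `|C2| * y ord0 i `^ d * wgt p t y ^- N.
pose D y := pexp (E g) a g r y - pexp (E g) a g r (halve i y).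
pose S y := \sum_(sp \in [set sp | E g sp /\ sp.1 <= r])
   (a sp.1 sp.2 (col' g y) * (y ord0 g `^ sp.1) * ln (y ord0 g) ^+ sp.2 -
    a sp.1 sp.2 (col' g (halve i y)) * (halve i y ord0 g `^ sp.1) * ln (halve i y ord0 g) ^+ sp.2).
have sum_eq y : S y = D y.
  by rewrite /S /D /pexp; have [s [_ _ sE]] := fsum_seq R (fE g pg r); rewrite !sE sumrB.
have bD : bdd p (wgt p t) (fun y => y ord0 i `^ d) D.
  apply: (bdd_eq (f1 := S)); first by exists 1 => // y _ _; exact: sum_eq y.
  apply: (bdd_fsum (wgt01 p t)) => [//||[s q] [/= Es sr]]; first exact: fE.
  have IHa := Ha s q Es.
  have fE' j : col' g p ord0 j = 0 -> ifin (E (lift g j)) by rewrite mxE => pj; exact: fE.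
  have nE' j : col' g p ord0 j = 0 -> ~~ (t \o lift g) j -> nneg (E (lift g j)).
    by rewrite mxE => pj; exact: nE.
  move: pi ti Ed; case: (unliftP g i) => [i' iE|iE] pi ti Ed.
    have ba : bdd (col' g p) (wgt (col' g p) (t \o lift g)) (fun z => z ord0 i' `^ d)
        (fun z => a s q z - a s q (halve i' z)).
      by apply: (IH _ _ _ _ _ fE' nE' _ _ _ IHa); [rewrite mxE -iE|rewrite /= -iE|rewrite -iE].
    have ds : 0 < s \/ 0 = 0 :> R /\ s = 0 /\ q = 0%N.
      by case: (nE g pg tg s q Es) => [s0|[-> ->]]; [left|right].
    apply: (bdd_eq (f1 := fun y => (a s q (col' g y) - a s q (halve i' (col' g y))) *
       y ord0 g `^ s * ln (y ord0 g) ^+ q)).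
      exists 1 => // y _ _; rewrite !mulrBl iE col'_halve_lift [halve _ _ ord0 g]mxE.
      by rewrite (negbTE (neq_lift g i')).
    apply: (bdd_le (wgt01 p t) (C' := 1) ler01 _ (bdd_term pg tg ds ba)).
    by exists 1 => // y _ _; rewrite powRr0 mulr1 mul1r mxE iE.
  have ba : bdd (col' g p) (wgt (col' g p) (t \o lift g)) (fun=> 1) (a s q).
    exact: lphg_bdd fE' nE' IHa.
  have [[-> ->]|sq] := pselect (s = 0 /\ q = 0%N).
    apply: bdd_eq (bdd0 _ _ _); exists 1 => // y _ _.
    by rewrite iE col'_halve !powRr0 !expr0 subrr.
  have ds : d < s \/ d = 0 /\ s = 0 /\ q = 0%N.
    by rewrite -iE in Es; case: (Ed s q Es) => [?|//]; left.
  pose Tm y := a s q (col' g y) * y ord0 g `^ s * ln (y ord0 g) ^+ q.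
  have bT : bdd p (wgt p t) (fun y => y ord0 i `^ d) Tm.
    apply: (bdd_le (wgt01 p t) (C' := 1) ler01 _ (bdd_term pg tg ds ba)).
    by exists 1 => // y _ _; rewrite !mul1r iE.
  have bTh : bdd p (wgt p t) (fun y => y ord0 i `^ d) (fun y => - Tm (halve i y)).
    have [C3 [M [C30 [e3 e30 H3]]]] := bT; exists C3, M; split=> //; exists e3 => // y b py.
    rewrite normrN; apply: le_trans (H3 _ (halve_ball pi b) (halve_pos i py)) _.
    have -> : wgt p t (halve i y) = wgt p t y.
      apply: eq_bigr => j /andP[tj _]; rewrite mxE; case: eqP => // ji.
      by rewrite ji (negbTE ti) in tj.
    rewrite ler_wpM2r ?invr_ge0 ?exprn_ge0 ?prodr_ge0 //; first by move=> j _; exact: ltW.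
    rewrite ler_wpM2l // mxE eqxx; apply: ge0_ler_powR; rewrite ?nnegrE ?divr_ge0 ?ltW //.
    by rewrite ltr_pdivrMr // ltr_pMr // ltr1n.
  by apply: bdd_eq (bdd_add (wgt01 p t) gi0 bT bTh); exists 1.
have bn h : bdd p (wgt p t) (fun y => y ord0 i `^ d) h ->
    bdd p (wgt p t) (fun y => y ord0 i `^ d) (fun y => `|h y|).
  by move=> [C1 [M [C10 b]]]; exists C1, M; split=> //; apply: pnearS b => y _; rewrite normr_id.
exists (fun y => `|D y| + `|f y|); split.
  by apply: (bdd_add (wgt01 p t)) => //; apply: bn.
pose rem (y : 'rV[R]_n.+1) := C * (y ord0 g `^ r) * \prod_(j | (j != g) && (p ord0 j == 0)) y ord0 j ^- N.
have HC' : pnear p (fun y => `|u y - pexp (E g) a g r y| <= rem y /\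
    `|u (halve i y) - pexp (E g) a g r (halve i y)| <= rem (halve i y)).
  by exists e => // y b py; split; apply: HC => //; [exact: halve_ball|exact: halve_pos].
apply: pnearS (pnear_and HC' nf) => y py [[h1 h2] h3] ymin.
rewrite [leRHS]ger0_norm ?addr_ge0 //.
have -> : u y - u (halve i y) = D y + ((u y - pexp (E g) a g r y) -
   (u (halve i y) - pexp (E g) a g r (halve i y))) by rewrite /D; ring.
apply: le_trans (ler_normD _ _) _; rewrite lerD2l.
apply: le_trans (ler_normB _ _) _.
have r0 : 0 <= r by apply: addr_ge0; [exact: ltW|exact: ler0n].
pose P (z : 'rV[R]_n.+1) := \prod_(j | (j != g) && (p ord0 j == 0)) z ord0 j ^- N.
have P0 z : pos z -> 0 <= P z.
  by move=> pz; apply: prodr_ge0 => j _; rewrite invr_ge0 exprn_ge0 // ltW.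
have Ph : P (halve i y) <= 2 ^+ N * P y.
  have i2 : 1 <= (2 : R) ^+ N by rewrite exprn_ege1 // ler1n.
  have [Pi|nPi] := boolP ((i != g) && (p ord0 i == 0)); last first.
    rewrite -[leLHS]mul1r; apply: ler_pM; rewrite ?P0 //; first exact: halve_pos.
    rewrite le_eqVlt; apply/orP; left; apply/eqP; apply: eq_bigr => j Pj; rewrite mxE.
    by case: eqP => // ji; rewrite ji (negbTE nPi) in Pj.
  have PE z : P z = z ord0 i ^- N *
      \prod_(j | ((j != g) && (p ord0 j == 0)) && (j != i)) z ord0 j ^- N.
    by rewrite /P (bigD1 i).
  have hi : halve i y ord0 i = y ord0 i / 2 by rewrite mxE eqxx.
  rewrite !PE hi exprMn invfM exprVn invrK mulrA [2 ^+ N * _]mulrC.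
  rewrite le_eqVlt; apply/orP; left; apply/eqP; congr (_ * _).
  by apply: eq_bigr => j /andP[_ ji]; rewrite mxE (negbTE ji).
have gh : halve i y ord0 g `^ r <= y ord0 g `^ r.
  apply: ge0_ler_powR => //; rewrite ?nnegrE ?(ltW (halve_pos i py g)) ?(ltW (py g)) //.
  by rewrite mxE; case: eqP => // _; rewrite ler_pdivrMr // ler_pMr // ler1n.
have remle : `|u y - pexp (E g) a g r y| + `|u (halve i y) - pexp (E g) a g r (halve i y)| <=
    C2 * y ord0 g `^ r * P y.
  apply: le_trans (lerD h1 h2) _; rewrite /rem -/(P y) -/(P (halve i y)) /C2.
  rewrite mulrDr mulr1 !mulrDl; apply: lerD.
    by rewrite -!mulrA ler_wpM2r ?ler_norm // mulr_ge0 ?powR_ge0 ?P0.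
  apply: (@le_trans _ _ (`|C| * (halve i y ord0 g `^ r * P (halve i y)))).
    by rewrite -mulrA ler_wpM2r ?ler_norm // mulr_ge0 ?powR_ge0 ?P0 //; exact: halve_pos.
  rewrite -!mulrA ler_wpM2l // mulrCA; apply: ler_pM; rewrite ?powR_ge0 ?P0 //; exact: halve_pos.
apply: le_trans remle _; apply: le_trans (h3 ymin) _.
apply: le_trans (ler_norm _); rewrite /f.
rewrite ler_wpM2r ?invr_ge0 ?exprn_ge0 ?prodr_ge0 //; first by move=> j _; exact: ltW.
rewrite ler_wpM2l //; apply: ge0_ler_powR; rewrite ?nnegrE; [exact: ltW|exact: ltW|exact: ltW|exact: ymin].
Qed.

End Local.

(** * From the definition on the manifold to expansions in coordinates *)

Section PhgLocal.
Variables (R : realType) (T : topologicalType).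

(** Image of a compact box of the orthant under the inverse of the chart. *)
Lemma compact_box n (M : mfd R T n) d x e Gf e1 : schart M d -> dom d x -> frame M d x e Gf ->
  0 <= e1 < e -> compact [set y | dom d y /\ forall j, `|crd d x ord0 j - crd d y ord0 j| <= e1].
Proof.
move=> sd dx fr /andP[e10 e1e].
pose A (i : 'I_n) : set R := `[Num.max 0 (crd d x ord0 i - e1), crd d x ord0 i + e1]%classic.
pose B : set 'rV[R]_n := [set z | forall i, A i (z ord0 i)].
have cB : compact B by apply: rV_compact => i; exact: segment_compact.
have BP z : B z <-> orthant z /\ forall j, `|crd d x ord0 j - z ord0 j| <= e1.
  have AP i : A i (z ord0 i) <-> 0 <= z ord0 i /\ `|crd d x ord0 i - z ord0 i| <= e1.
    rewrite /A /= in_itv /= ge_max distrC ler_norml lerBrDl addrC lerBlDl.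
    by split=> [/andP[/andP[-> ->] ->]//|[-> /andP[-> ->]]].
  split=> [H|[H1 H2] i]; last by apply/AP; split; [exact: H1|exact: H2].
  by split=> i; have /AP[] := H i.
pose g z := xget x [set y | dom d y /\ crd d y = z].
have gP z : B z -> dom d (g z) /\ crd d (g z) = z.
  move=> /BP[oz bz]; have [|y dy ey] := fr_box fr _ oz.
    apply/ball_rVP; first exact: fr_e0 fr.
    by move=> j; apply: le_lt_trans e1e.
  by rewrite /g; case: xgetP => [_ -> []//|/(_ y) []].
have cg : {within B, continuous g}.
  apply/subspace_continuousP => z /gP[dz ez] Q; rewrite nbhsE => -[O [oO Oz] OQ].
  have [e2 e20 He2] := chart_ball (proj1 sd) dz oO Oz.
  suff : \forall w \near z, B w -> Q (g w) by [].
  apply/nbhs_ballP; exists e2 => //= w bw Bw; have [dw ew] := gP w Bw.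
  have [|y [dy Oy ey]] := He2 w _ ((proj1 (proj1 (BP w) Bw))); first by rewrite ez.
  by apply: OQ; rewrite -(schart_inj sd (x := y) (y := g w)) ?inE // ey.
have := continuous_compact cg cB.
suff -> : g @` B = [set y | dom d y /\ forall j, `|crd d x ord0 j - crd d y ord0 j| <= e1] by [].
apply/seteqP; split=> [y [z Bz <-]|y [dy by']] /=.
  by have [dz ez] := gP z Bz; split=> //; rewrite ez; have /BP[] := Bz.
have By : B (crd d y) by apply/BP; split=> //; exact: (schart_orthant sd dy).
exists (crd d y) => //; have [dg eg] := gP _ By.
by apply: (schart_inj sd); rewrite ?inE.
Qed.

Lemma rep_dom n (M : mfd R T n) d (f : T -> R) x : schart M d -> dom d x -> rep d f (crd d x) = f x.
Proof. by move=> sd dx; rewrite (repE _ (schart_inj sd) dx). Qed.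

Lemma phg_smooth n (M : mfd R T n) E u : phg M E u -> smooth_fun M (interior_pts M) u.
Proof. by case: n M => [|n] M //= []. Qed.

(** [phg] is applied to the collar of the i-th hypersurface in a frame, with coordinates as defining
    functions, a closed box as compact set and no vector fields. The k hypersurfaces that it returns
    may repeat, so each of the k factors is bounded by the product over all other vanishing
    coordinates, which turns N into N k. *)
Lemma phg_lphg n (M : mfd R T n) E u d x e Gf : good M -> index_family M E -> phg M E u ->
  schart M d -> dom d x -> frame M d x e Gf ->
  lphg (crd d x) (fun i => E (Gf i)) (rep d u).
Proof.
elim: n M E u d x e Gf => [//|n IH] M E u d x e Gf gM iE [su hu] sd dx fr; split.
  move=> nz; have ix : interior_pts M x.
    apply/(interiorE gM.1 sd dx) => i; rewrite lt0r (schart_orthant sd dx i) andbT.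
    by apply/eqP; exact: nz.
  have [O [g [oO Ox Cg gf]]] := su d sd (crd d x) (ex_intro2 _ _ x (conj ix dx) erefl).
  have [e1 [C [e10 C0 eO Hg]]] := Cinf_bounded oO Ox Cg.
  exists C; exists (Num.min e e1); first by rewrite lt_min e10 (fr_e0 fr).
  move=> y b py.
  have b1 : ball (crd d x) e1 y by apply: le_ball b; rewrite ge_min lexx orbT.
  have [|x' dx' ex'] := fr_box fr (le_ball _ b) (fun j => ltW (py j)); first by rewrite ge_min lexx.
  have ix' : interior_pts M x' by apply/(interiorE gM.1 sd dx') => i; rewrite ex'.
  by rewrite -gf //; [exact: Hg|exact: eO|exists x'].
move=> i di; have [bF lF] := fr_loc fr di; pose F := Gf i.
have [d' [sd' dx' ad' [cE dE]]] := adapted_restr sd dx fr (erefl F) di.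
have di' : crd d' x ord0 i = 0 by rewrite cE.
have Fx : F x by apply/(ad' x).
have [e' [Gf' fr']] := good_frame gM sd' dx'.
have GG j : crd d x ord0 j = 0 -> Gf' j = Gf j.
  move=> dj; have [bG lG] := fr_loc fr dj; apply/esym.
  apply: (frame_locdef sd' dx' fr' (fr_e0 fr) bG); first by rewrite cE.
  by move=> y [dy by']; rewrite cE; apply: lG; split; [case: (dE y dy)|rewrite -cE].
pose U := nb d' x e'.
have tr := box_trivialization gM bF sd' dx' Fx ad' fr'.
have [a [Ha Hr]] := hu F U _ _ bF tr.
have oU : relopen (pts M) U := nb_relopen x e' sd'.
have gN := face_good gM bF oU.
have sf := fch_schart gM bF oU sd' ad'.
have Ux : U x by exact: nb_refl (fr_e0 fr') dx'.
have fx : dom (fch F U d' i) x by [].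
have [e2 [Hf fr2]] := good_frame gN sf fx.
exists (fun s q => rep (fch F U d' i) (a s q)); split.
  move=> s q Esq; have := IH _ _ _ _ _ _ _ gN _ (Ha s q Esq) sf fx fr2.
  rewrite /= cE => H; apply: lphg_ext (H _) => [j|H' bH].
    rewrite mxE => dj; rewrite -GG //.
    by apply: (face_index_frame gM bF oU E sd' ad' dx' _ fr' fr2); rewrite ?cE.
  have [G [bG GF HG _]] := face_bhs_sub gM bF oU bH.
  by rewrite (face_index_uniq gM bF oU E bH bG GF HG); exact: iE.
pose rhos := coord_bdf d' x Gf'.
have hrhos G : bhs M G -> is_bdf M U G (rhos G) by move=> bG; exact: (coord_is_bdf gM sd' dx' fr' bG).
(* Below e', so that the closed box lies in the collar, and at most 1/2, so that the coordinates
   vanishing at x stay below 1. *)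
pose e3 := Num.min (e' / 2) 2^-1.
have e'0 := fr_e0 fr'.
have e30 : 0 < e3 by rewrite lt_min invr_gt0 ltr0n divr_gt0.
have e3e : e3 < e' by rewrite gt_min ltr_pdivrMr // ltr_pMr // ltr1n.
pose K := [set y | dom d' y /\ forall j, `|crd d' x ord0 j - crd d' y ord0 j| <= e3].
have cK : compact K by apply: (compact_box sd' dx' fr'); rewrite (ltW e30) e3e.
have KU : K `<=` U.
  by move=> y [dy Hy]; split=> //; apply/ball_rVP => // j; apply: le_lt_trans (Hy j) e3e.
have [k [G [HG Hk]]] := Hr rhos hrhos K cK KU.
have [|N HN] := Hk [::]; first by [].
exists (N * k)%N, e3 => // r; have [C HC] := HN r; exists `|C| => y b py.
have b' : ball (crd d' x) e' y by rewrite cE; apply: le_ball b; exact: ltW.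
have [x' dx2 ex'] := fr_box fr' b' (fun j => ltW (py j)).
have Ux' : U x' by split=> //; rewrite ex'.
have Kx' : K x' by split=> // j; rewrite ex' cE; exact/ltW/(ball_coord b).
have ix' : interior_pts M x' by apply/(interiorE gM.1 sd' dx2) => j; rewrite ex'.
have dx3 : dom d x' by case: (dE _ dx2).
have yE : crd d x' = y by rewrite -cE.
have [Up Fp dp ep] := boxprP sd' dx' Fx ad' fr' Ux'.
have -> : rep d u y = u x' by rewrite -yE (rep_dom _ sd dx3).
have -> : pexp (E (Gf i)) (fun s q => rep (fch F U d' i) (a s q)) i r y =
    partial_expansion (E F) a (boxpr d' i) (fun y => crd d' y ord0 i) r x'.
  apply: eq_fsbigr => -[s q] _ /=; rewrite ex'; congr (_ * _ * _).
  have <- : crd (fch F U d' i) (boxpr d' i x') = col' i y by rewrite /= ep col'_ins ex'.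
  by rewrite (rep_dom _ sf).
apply: le_trans (HC x' Kx' ix') _; rewrite ex'.
have P0 : 0 <= \prod_(i0 < k) rhos (G i0) x' ^- N.
  apply: prodr_ge0 => l _; rewrite invr_ge0 exprn_ge0 //.
  by have [bG _ _] := HG l; have [_ h _ _] := hrhos _ bG; exact: h.
apply: (@le_trans _ _ (`|C| * (y ord0 i `^ r) * \prod_(i0 < k) rhos (G i0) x' ^- N)).
  by rewrite ler_wpM2r // ler_wpM2r ?powR_ge0 // ler_norm.
rewrite ler_wpM2l ?mulr_ge0 ?powR_ge0 //.
have y1 j : crd d x ord0 j = 0 -> y ord0 j <= 1.
  move=> dj; have := ball_coord b j; rewrite dj sub0r normrN gtr0_norm // => h.
  apply: ltW; apply: lt_trans h _; rewrite gt_min; apply/orP; right.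
  by rewrite invf_lt1 // ltr1n.
have inv1 j m : crd d x ord0 j = 0 -> 1 <= y ord0 j ^- m.
  move=> pj; rewrite invf_ge1 ?exprn_gt0 ?py //; apply: exprn_ile1; [exact: ltW|exact: y1].
pose Q := \prod_(j | (j != i) && (crd d x ord0 j == 0)) y ord0 j ^- N.
have -> : \prod_(j | (j != i) && (crd d x ord0 j == 0)) y ord0 j ^- (N * k) = \prod_(l < k) Q.
  rewrite prodr_const card_ord /Q -prodrXl; apply: eq_bigr => j _.
  by rewrite exprM exprVn.
apply: ler_prod => l _; have [bG GF _] := HG l.
rewrite invr_ge0 exprn_ge0 /=; last by have [_ h _ _] := hrhos _ bG; exact: h.
have Q1 (S : pred 'I_n.+1) : 1 <= \prod_(j | S j && (crd d x ord0 j == 0)) y ord0 j ^- N.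
  elim/big_rec: _ => // j z /andP[_ /eqP pj] z1; rewrite -[leLHS]mulr1.
  by apply: ler_pM => //; exact: inv1.
have [[j dj GE]|none] := pselect (exists2 j, crd d' x ord0 j = 0 & G l = Gf' j); last first.
  rewrite /rhos /coord_bdf; case: pickP => [j /andP[/eqP dj /asboolP E']|_].
    by case: none; exists j.
  by rewrite expr1n invr1; exact: Q1.
rewrite GE /rhos (coord_bdfE _ sd' dx' fr' dj) ex' /Q (bigD1 j) /=.
  rewrite ler_peMr ?invr_ge0 ?exprn_ge0 ?(ltW (py _)) //.
  rewrite (eq_bigl (fun l => ((l != i) && (l != j)) && (crd d x ord0 l == 0))); first exact: Q1.
  by move=> m /=; rewrite andbAC.
rewrite cE in dj; rewrite dj eqxx andbT; apply/eqP => ji.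
by apply: GF; rewrite GE ji GG.
Qed.

End PhgLocal.

(** * Growth, decay and leading terms *)

Section Decay.
Variable R : realType.

Lemma half_powR_lt1 (d : R) : 0 < d -> 2^-1 `^ d < 1.
Proof.
move=> d0; have h : 2^-1 < 1 :> R by rewrite invf_lt1 // ltr1n.
have := gt0_ltr_powR d0; move=> /(_ 2^-1 1); rewrite !nnegrE invr_ge0 !ler0n ler01 h powR1.
by apply.
Qed.

Lemma half_powRX (y d : R) k : 0 <= y -> (y / 2 ^+ k) `^ d = y `^ d * (2^-1 `^ d) ^+ k.
Proof.
move=> y0; have h : 0 <= 2^-1 :> R by rewrite invr_ge0.
rewrite powRM ?invr_ge0 ?exprn_ge0 //; congr (_ * _).
rewrite -exprVn -(powR_mulrn k h) -(powR_mulrn k (powR_ge0 2^-1 d)).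
by rewrite -(powRrM 2^-1 k%:R) -(powRrM 2^-1 d) mulrC.
Qed.

(** The k-th power of z/k <= exp(z/k). *)
Lemma expRN_le_pow (z : R) k : 0 < z -> expR (- z) <= k%:R ^+ k * z ^- k.
Proof.
move=> z0; case: k => [|k]; first by rewrite expr0 mul1r invr1 -expR0 ler_expR oppr_le0 ltW.
have k0 : 0 < k.+1%:R :> R by rewrite ltr0n.
have H : (z / k.+1%:R) ^+ k.+1 <= expR z.
  have -> : expR z = expR (z / k.+1%:R) ^+ k.+1.
    by rewrite -expRM_natl mulrCA divff ?mulr1 // gt_eqF.
  rewrite lerXn2r ?nnegrE ?divr_ge0 ?expR_ge0 ?(ltW z0) ?(ltW k0) //.
  by apply: le_trans (expR_ge1Dx _); rewrite lerDr.
rewrite expRN -[_ * _]invrK lef_pV2 ?posrE ?expR_gt0 //; last first.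
  by rewrite invr_gt0 mulr_gt0 ?exprn_gt0 ?invr_gt0 ?exprn_gt0.
by rewrite invfM invrK mulrC -exprVn -exprMn.
Qed.

Lemma expRN_powR_decay (c eps : R) m : 0 < c -> 0 < eps -> exists2 C : R, 0 < C &
  forall y, 0 < y <= 1 -> expR (- (c * y `^ (- eps))) <= C * y ^+ m.
Proof.
move=> c0 e0; have [k km] : exists k : nat, m%:R <= eps * k%:R.
  have := archi_boundP (divr_ge0 (ler0n R m) (ltW e0)) => h.
  by exists (Num.bound (m%:R / eps)); rewrite mulrC -ler_pdivrMr // ltW.
exists (k.+1%:R ^+ k.+1 * c ^- k.+1).
  by rewrite mulr_gt0 ?invr_gt0 ?exprn_gt0.
move=> y y01; have [y0 y1] := andP y01.
have z0 : 0 < c * y `^ (- eps) by rewrite mulr_gt0 // powR_gt0.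
apply: le_trans (expRN_le_pow k.+1 z0) _.
rewrite -mulrA ler_wpM2l ?exprn_ge0 // exprMn invfM ler_wpM2l ?invr_ge0 ?exprn_ge0 ?(ltW c0) //.
rewrite -powR_mulrn ?powR_ge0 // -powRrM mulNr powRN invrK -powR_mulrn ?(ltW y0) //.
apply: ger_powR => //; apply: le_trans km _.
by rewrite ler_wpM2l ?(ltW e0) // ler_nat.
Qed.

(** Each type 2 coordinate gives decay faster than all its powers. Where y_j is the smallest of
    them, the weight is at least y_j^n, so decay like y_j^(n l) is decay like the l-th power of the
    weight. One neighbourhood serves all l; only the constant depends on l. *)
Lemma exp_decay n (p : 'rV[R]_n) t v : bdd p (wgt p t) (fun=> 1) v ->
  (forall j, p ord0 j = 0 -> t j -> exists c eps : R, [/\ 0 < c, 0 < eps &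
     pnear p (fun y => c * y ord0 j `^ (- eps) <= v y)]) ->
  exists C : nat -> R, (forall l, 0 < C l) /\
    pnear p (fun y => forall l, expR (- v y) <= C l * wgt p t y ^+ l).
Proof.
move=> bv lb.
have [[j0 pj0 tj0]|none] := pselect (exists2 j, p ord0 j = 0 & t j); last first.
  have w1 y : wgt p t y = 1.
    by apply: big1 => j /andP[tj /eqP pj]; case: none; exists j.
  have [C [M [C0 H]]] := bv; exists (fun=> expR C); split=> [l|]; first exact: expR_gt0.
  apply: pnearS H => y py; rewrite w1 !expr1n invr1 !mulr1 => h l; rewrite expr1n mulr1 ler_expR.
  by apply: le_trans h; rewrite -normrN; exact: ler_norm.
have H j : exists C : nat -> R, (forall l, 0 < C l) /\ pnear p (fun y => p ord0 j = 0 -> t j ->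
    forall l, expR (- v y) <= C l * y ord0 j ^+ (n * l)).
  have [[pj tj]|no] := pselect (p ord0 j = 0 /\ t j); last first.
    by exists (fun=> 1); split=> //; exists 1 => // y _ _ pj tj; case: no.
  have [c [eps [c0 e0 h]]] := lb j pj tj.
  have [C HC] := choice (fun l => let: ex_intro2 C C0 HC := expRN_powR_decay (n * l) c0 e0 in
    ex_intro (fun C => 0 < C /\ forall y, 0 < y <= 1 -> expR (- (c * y `^ (- eps))) <= C * y ^+ (n * l)) C (conj C0 HC)).
  exists C; split=> [l|]; first exact: (HC l).1.
  apply: pnearS (pnear_and h (pnear_le1 pj)) => y py [h1 y1] _ _ l.
  apply: le_trans ((HC l).2 (y ord0 j) _); last by rewrite py.
  by rewrite ler_expR lerN2.
have [Cf HC] := choice H.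
exists (fun l => \sum_j Cf j l); split=> [l|].
  apply: lt_le_trans ((HC j0).1 l) _; rewrite (bigD1 j0) //= lerDl.
  by apply: sumr_ge0 => j _; exact/ltW/(HC j).1.
apply: pnearS (pnear_and (pnear_le1_all p) (pnear_forall (fun j => (HC j).2))) => y py [y1 h] l.
pose P := [pred j | t j && (p ord0 j == 0)].
have Pj0 : P j0 by rewrite /= tj0 pj0 eqxx.
have [j /andP[tj /eqP pj] jmin] := @arg_minP _ _ _ j0 P (fun j => y ord0 j) Pj0.
apply: le_trans (h j pj tj l) _; apply: ler_pM.
- exact/ltW/(HC j).1.
- by rewrite exprn_ge0 ?(ltW (py _)).
- by rewrite (bigD1 j) //= lerDl; apply: sumr_ge0 => k _; exact/ltW/(HC k).1.
rewrite exprM lerXn2r ?nnegrE ?exprn_ge0 ?(ltW (py _)) ?prodr_ge0 //; first by move=> k _; exact: ltW.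
have -> : wgt p t y = \prod_k (if P k then y ord0 k else 1) by rewrite /wgt big_mkcond.
have -> : y ord0 j ^+ n = \prod_(k < n) y ord0 j by rewrite prodr_const card_ord.
apply: ler_prod => k _; rewrite (ltW (py _)) /=; case: ifP => [Pk|_]; last exact: y1.
exact: jmin.
Qed.

End Decay.

Section Lower.
Variables (R : realType) (T : topologicalType).

(** The type 2 hypothesis in a form that passes to faces: local near each point, and with some
    smooth function vanishing on G in place of a global defining function. *)
Definition lower_bound n (M : mfd R T n) (tau : set T -> Prop) (u : T -> R) :=
  forall G x0, bhs M G -> tau G -> G x0 -> exists (O : set T) (f : T -> R) (c eps : R),
    [/\ open O /\ O x0, 0 < c /\ 0 < eps, smooth_fun M (O `&` pts M) f,
        forall x, O x -> pts M x -> G x -> f x = 0 &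
        forall x, O x -> interior_pts M x -> 0 < f x /\ c * f x `^ (- eps) <= u x].

Definition nonneg_off n (M : mfd R T n) (tau : set T -> Prop) (E : set T -> set (R * nat)) :=
  forall G, bhs M G -> ~ tau G -> nneg (E G).

Section Gen.
Variables (n : nat) (M : mfd R T n) (tau : set T -> Prop) (u : T -> R).
Hypothesis gM : good M.

Lemma pnear_point d x e Gf P : schart M d -> dom d x -> frame M d x e Gf ->
  (exists2 e1, 0 < e1 & forall y, nb d x e1 y -> interior_pts M y -> P (crd d y)) ->
  pnear (crd d x) P.
Proof.
move=> sd dx fr [e1 e10 H]; exists (Num.min e e1); first by rewrite lt_min e10 (fr_e0 fr).
move=> y b py; have [|x' dx' ex'] := fr_box fr (le_ball _ b) (fun j => ltW (py j)).
  by rewrite ge_min lexx.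
rewrite -ex'; apply: H; last by apply/(interiorE gM.1 sd dx') => i; rewrite ex'.
by split=> //; rewrite ex'; apply: le_ball b; rewrite ge_min lexx orbT.
Qed.

Lemma point_pnear d x P : schart M d -> dom d x -> pnear (crd d x) P ->
  exists O, [/\ open O, O x & forall y, O y -> interior_pts M y -> dom d y /\ P (crd d y)].
Proof.
move=> sd dx [e e0 H]; have [O [oO Ox HO]] := open_in_nb sd (nb_refl e0 dx).
exists O; split=> // y Oy iy; have py : pts M y by case: iy => c [sc cy _]; exact: schart_pts cy.
have [dy by'] := HO y Oy py; split=> //; apply: H => //.
exact/(interiorE gM.1 sd dy).
Qed.

Lemma lower_bound_frame d x e Gf j : lower_bound M tau u ->
  schart M d -> dom d x -> frame M d x e Gf ->
  crd d x ord0 j = 0 -> tau (Gf j) -> exists c eps : R, [/\ 0 < c, 0 < eps &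
     pnear (crd d x) (fun y => c * y ord0 j `^ (- eps) <= rep d u y)].
Proof.
move=> LB sd dx fr dj tj; have [bG lG] := fr_loc fr dj.
have Gx : Gf j x by apply/lG => //; exact: nb_refl (fr_e0 fr) dx.
have [O [f [c [eps [[oO Ox] [c0 e0] sf f0 Hf]]]]] := LB _ x bG tj Gx.
have [//|y [Oy py]|e1 [C [e10 C0 HC]]] := smooth_vanish_le sd dx fr dj oO Ox _ sf (f := f).
  exact: f0.
have [e2 e20 H2] := nb_in_open sd dx oO Ox.
exists (c * C `^ (- eps)), eps; split=> //; first by rewrite mulr_gt0 // powR_gt0.
apply: (pnear_point sd dx fr); exists (Num.min e1 e2); first by rewrite lt_min e10.
move=> y ny iy; have n1 : nb d x e1 y by apply: nb_sub ny; rewrite ge_min lexx.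
have Oy : O y by apply: H2; apply: nb_sub ny; rewrite ge_min lexx orbT.
have [fy uy] := Hf y Oy iy; have dy := ny.1.
have yj : 0 < crd d y ord0 j by move/(interiorE gM.1 sd dy): iy.
rewrite (rep_dom _ sd dy); apply: le_trans uy; rewrite -mulrA ler_wpM2l ?(ltW c0) //.
rewrite -powRM ?(ltW C0) ?(ltW yj) // !powRN lef_pV2 ?posrE ?powR_gt0 ?mulr_gt0 //.
by apply: ge0_ler_powR; rewrite ?nnegrE ?(ltW e0) ?(ltW fy) ?mulr_ge0 ?(ltW yj) ?(ltW C0) //;
  apply: le_trans (HC y n1); exact: ler_norm.
Qed.

Variable E : set T -> set (R * nat).
Hypotheses (iE : index_family M E) (hu : phg M E u) (nE : nonneg_off M tau E).
Hypothesis LB : lower_bound M tau u.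

Section Chart.
Variables (d : chart R T n) (x : T) (e : R) (Gf : 'I_n -> set T).
Hypotheses (sd : schart M d) (dx : dom d x) (fr : frame M d x e Gf).
Let p := crd d x.
Definition typ j := `[< tau (Gf j) >].

Lemma chart_ifin i : p ord0 i = 0 -> ifin (E (Gf i)).
Proof. by move=> pi; apply: index_set_ifin; apply: iE; case: (fr_loc fr pi). Qed.

Lemma chart_nneg i : p ord0 i = 0 -> ~~ typ i -> nneg (E (Gf i)).
Proof. by move=> pi /asboolPn ti; apply: nE => //; case: (fr_loc fr pi). Qed.

Lemma chart_bdd : bdd p (wgt p typ) (fun=> 1) (rep d u).
Proof.
exact: (lphg_bdd chart_ifin chart_nneg (phg_lphg gM iE hu sd dx fr)).
Qed.

Lemma chart_decay : exists C : nat -> R, (forall l, 0 < C l) /\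
  pnear p (fun y => forall l, expR (- rep d u y) <= C l * wgt p typ y ^+ l).
Proof.
apply: (exp_decay chart_bdd) => j pj /asboolP tj.
exact: (lower_bound_frame LB sd dx fr pj tj).
Qed.

End Chart.

Lemma exp_locally_bounded x : pts M x -> exists (O : set T) (C : R), [/\ open O, O x, 0 < C &
  forall y, O y -> interior_pts M y -> expR (- u y) <= C].
Proof.
move=> px; have [d ad dx] := gM.1.2 x px; have sd := gM.1.1 _ ad.
have [e [Gf fr]] := good_frame gM sd dx.
have [C [C0 H]] := chart_decay sd dx fr.
have [O [oO Ox HO]] := point_pnear sd dx H.
exists O, (C 0%N); split=> // y Oy iy; have [dy] := HO y Oy iy.
by move=> /(_ 0%N); rewrite (rep_dom _ sd dy) expr0 mulr1.
Qed.

End Gen.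

Definition inear n (M : mfd R T n) (x0 : T) (P : T -> Prop) :=
  exists O : set T, [/\ open O, O x0 & forall y, O y -> interior_pts M y -> P y].

Lemma inear_and n (M : mfd R T n) x0 P Q : inear M x0 P -> inear M x0 Q -> inear M x0 (fun y => P y /\ Q y).
Proof.
move=> [O [oO Ox HO]] [O' [oO' Ox' HO']]; exists (O `&` O'); split=> //; first exact: openI.
by move=> y [Oy Oy'] iy; split; [exact: HO|exact: HO'].
Qed.

Lemma inearS n (M : mfd R T n) x0 (P Q : T -> Prop) : (forall y, interior_pts M y -> P y -> Q y) ->
  inear M x0 P -> inear M x0 Q.
Proof. by move=> PQ [O [oO Ox HO]]; exists O; split=> // y Oy iy; apply: PQ => //; exact: HO. Qed.

(** The remainder clause of [phg], for one trivialization and one choice of defining functions. *)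
Definition conormal_expansion n (M : mfd R T n.+1) (F U : set T) (pr : T -> T) (rho : T -> R)
    (rhos : set T -> T -> R) (EF : set (R * nat)) (u : T -> R) (a : R -> nat -> T -> R) :=
  forall K : set T, compact K -> K `<=` U ->
  exists (k : nat) (G : 'I_k -> set T),
    (forall i, [/\ bhs M (G i), G i <> F & G i `&` F !=set0]) /\
    forall Vs : seq ((T -> R) -> (T -> R)),
    (forall j, (j < size Vs)%N -> tangent_field M U (nth id Vs j)) ->
    exists N : nat, forall r : R, exists C : R,
    forall x, K x -> interior_pts M x ->
      `|foldr (fun V f => V f)
          (fun z => u z - partial_expansion EF a pr rho r z) Vs x|
      <= C * (rho x `^ r) * \prod_(i < k) rhos (G i) x ^- N.

Definition face_type n (M : mfd R T n) (F : set T) (tau : set T -> Prop) (H : set T) :=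
  exists G, [/\ bhs M G, G <> F, H `<=` G & tau G].

Lemma smooth_fun_prod n (M : mfd R T n) (A : set T) (I : Type) (r : seq I) (F : I -> T -> R) :
  (forall i, smooth_fun M A (F i)) -> smooth_fun M A (fun x => \prod_(i <- r) F i x).
Proof.
move=> sF; elim: r => [|i r IH].
  by apply: smooth_fun_eq (@smooth_fun_cst _ _ _ M A 1) => // x _; rewrite big_nil.
by apply: smooth_fun_eq (smooth_fun_mul (sF i) IH) => // x _; rewrite big_cons.
Qed.

Lemma smooth_locally_pos n (M : mfd R T n) (A O : set T) f x : presm M -> open O -> O x -> pts M x ->
  (forall y, O y -> pts M y -> A y) -> smooth_fun M A f -> 0 < f x ->
  exists (O' : set T) (c : R), [/\ open O', O' x, 0 < c & forall y, O' y -> pts M y -> c <= f y].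
Proof.
move=> pM oO Ox px OA sf fx; have [d ad dx] := pM.2 x px; have sd := pM.1 _ ad.
have Ax : A x by apply: OA.
have [Q [g [oQ Qx Cg gE]]] := smooth_ext (proj1 sd) dx Ax oO Ox OA (sf d sd).
have [/= cg _] := Cg [::] _ Qx; have {}cg : g z @[z --> crd d x] --> g (crd d x) := cg.
have gx : g (crd d x) = f x.
  have [y [dy _ ey ->]] := gE _ Qx (schart_orthant sd dx).
  by congr f; apply: (schart_inj sd); rewrite ?inE.
have : \forall z \near crd d x, Q z /\ f x / 2 < g z.
  near=> z; split; near: z; first exact: open_nbhs_nbhs.
  apply: (cvgr_gt (g (crd d x)) cg); rewrite gx.
  by rewrite ltr_pdivrMr // ltr_pMr // ltr1n.
move=> /nbhs_ballP[e /= e0 H].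
have [O' [oO' O'x HO]] := open_in_nb sd (nb_refl e0 dx).
exists O', (f x / 2); split=> //; first by rewrite divr_gt0.
move=> y O'y py; have [dy by'] := HO y O'y py; have [Qy gy] := H _ by'.
have [y' [dy' Oy' ey' gy']] := gE _ Qy (schart_orthant sd dy).
have E : y' = y by apply: (schart_inj sd); rewrite ?inE.
by rewrite -E -gy' -ey' E ltW.
Unshelve. all: by end_near. Qed.

(** * The leading coefficient at a type 1 hypersurface *)

Section Face.
Variables (n : nat) (M : mfd R T n.+1).
Hypothesis gM : good M.
Variables (F U : set T) (pr : T -> T) (rho : T -> R).
Hypotheses (bF : bhs M F) (tr : trivialization M F U pr rho).
Let oU := triv_open tr.
Let N := face M F (F `&` U).
Let gN : good N := face_good gM bF oU.

Lemma triv_near x (O : set T) : U x -> open O -> O (pr x) ->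
  exists O', [/\ open O', O' x & forall y, O' y -> pts M y -> U y /\ O (pr y)].
Proof.
move=> Ux oO Ox; have [D [sD Dx DU aD [D0 Dp Dpr _]]] := triv_chart gM bF tr Ux.
have [e e0 He] := nb_in_open sD (Dp x Dx) oO Ox.
have [O' [oO' O'x H]] := open_in_nb sD (nb_refl e0 Dx).
exists O'; split=> // y O'y py; have [Dy by'] := H y O'y py; split; first exact: DU.
apply: He; split; first exact: Dp.
by rewrite !Dpr //; apply: ball_ins; rewrite ?ins_id // col'_ins; exact: ball_col'.
Qed.

Lemma triv_interior x : U x -> interior_pts M x -> interior_pts N (pr x).
Proof.
move=> Ux ix; have [D [sD Dx DU aD [D0 Dp Dpr _]]] := triv_chart gM bF tr Ux.
have sf := fch_schart gM bF oU sD aD.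
have [_ Up _ _ _] := tr; have [Fp Upx] := Up x Ux.
have dp : dom (fch F U D ord0) (pr x) by split; [exact: Dp|split].
apply/(interiorE gN.1 sf dp) => j; rewrite mxE Dpr // ins_lift mxE.
by move/(interiorE gM.1 sD Dx): ix.
Qed.

Lemma face_pts_triv x : F x -> U x -> pr x = x.
Proof. by move=> Fx Ux; have [_ _ h _ _] := tr; case: (h x Ux Fx). Qed.


Lemma face_type_nonneg (tau : set T -> Prop) E : nonneg_off M tau E ->
  nonneg_off N (face_type M F tau) (face_index M F E).
Proof.
move=> nE H bH nH; have [G [bG GF HG _]] := face_bhs_sub gM bF oU bH.
rewrite (face_index_uniq gM bF oU E bH bG GF HG); apply: nE => // tG.
by apply: nH; exists G.
Qed.

Lemma face_index_family E : index_family M E -> index_family N (face_index M F E).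
Proof.
move=> iE H bH; have [G [bG GF HG _]] := face_bhs_sub gM bF oU bH.
by rewrite (face_index_uniq gM bF oU E bH bG GF HG); exact: iE.
Qed.

Section Limit.
Variables (tau : set T -> Prop) (E : set T -> set (R * nat)) (u : T -> R).
Hypotheses (iE : index_family M E) (hu : phg M E u) (nE : nonneg_off M tau E).
Hypotheses (LB : lower_bound M tau u) (ntF : ~ tau F).
Variables (rhos : set T -> T -> R) (a : R -> nat -> T -> R).
Hypothesis (hrhos : forall G, bhs M G -> is_bdf M U G (rhos G)).
Hypothesis (Ha : forall s p, E F (s, p) -> phg N (face_index M F E) (a s p)).
Hypothesis Hr : conormal_expansion M F U pr rho rhos (E F) u a.
Variable delta : R.
Hypothesis (d0 : 0 < delta) (Hd : forall s q, E F (s, q) -> delta < s \/ (s = 0 /\ q = 0%N)).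

Definition lead (x : T) : R := if `[< E F (0, 0%N) >] then a 0 0%N x else 0.

Lemma pexp_lead x : partial_expansion (E F) a pr rho delta x = lead (pr x).
Proof.
rewrite /partial_expansion /lead; case: asboolP => [E0|nE0].
  rewrite (_ : [set sp | _] = [set (0, 0%N)]).
    by rewrite fsbig_set1 /= powRr0 expr0 !mulr1.
  apply/seteqP; split=> [[s q] [/= Es sd]|_ ->] /=; last by split=> //; exact: ltW.
  by case: (Hd Es) => [|[-> ->]//]; rewrite ltNge sd.
rewrite (_ : [set sp | _] = set0) ?fsbig_set0 //.
apply/seteqP; split=> // -[s q] [/= Es sd].
case: (Hd Es) => [|[s0 q0]]; first by rewrite ltNge sd.
by apply: nE0; rewrite -s0 -q0.
Qed.

Section AtChart.
Variables (x0 : T) (D : chart R T n.+1) (e : R) (Gf : 'I_n.+1 -> set T).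
Hypotheses (Fx : F x0) (sD : schart M D) (Dx : dom D x0) (DU : dom D `<=` U) (aD : adapted F D ord0).
Hypotheses (D0 : forall y, crd D y ord0 ord0 = rho y) (Dp : forall y, dom D y -> dom D (pr y)).
Hypothesis Dpr : forall y, dom D y -> crd D (pr y) = ins ord0 (col' ord0 (crd D y)).
Hypothesis fr : frame M D x0 e Gf.
Let p := crd D x0.
Let p0 : p ord0 ord0 = 0.
Proof. exact/(aD Dx). Qed.
Let c := fch F U D ord0.

Lemma iter_halveE k (y : 'rV[R]_n.+1) j :
  iter k (halve ord0) y ord0 j = if j == ord0 then y ord0 j / 2 ^+ k else y ord0 j.
Proof.
elim: k => [|k IH] /=; first by rewrite expr0 divr1; case: ifP.
by rewrite mxE IH; case: eqP => // _; rewrite exprSr invfM mulrA.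
Qed.

Lemma iter_halve_col' k (y : 'rV[R]_n.+1) : col' ord0 (iter k (halve ord0) y) = col' ord0 y.
Proof. by elim: k => //= k IH; rewrite col'_halve. Qed.

Lemma rep_fch f y : dom D y -> rep c f (col' ord0 (crd D y)) = f (pr y).
Proof.
move=> dy; have sf := fch_schart gM bF oU sD aD.
have [_ Up _ _ _] := tr; have [Fp Upx] := Up y (DU dy).
have dp : dom c (pr y) by split; [exact: Dp|split].
by rewrite -(rep_dom f sf dp) /= Dpr // col'_ins.
Qed.

(** Iterated halving moves a point to its projection z on F. As z lies on no other hypersurface, the
    defining functions in the remainder bound stay away from 0 near z; the remainder of order delta,
    whose truncation is the leading coefficient alone, is then O(2^(-k delta)). This is pointwise in
    y only; uniform bounds come from [lphg_halve]. *)
Lemma halve_limit : exists2 e1 : R, 0 < e1 & forall y, ball p e1 y -> pos y ->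
  (fun k => rep D u (iter k (halve ord0) y)) @ \oo --> rep c lead (col' ord0 y).
Proof.
have e0 := fr_e0 fr; have e20 : 0 < e / 2 by rewrite divr_gt0.
have e2e : e / 2 < e by rewrite ltr_pdivrMr // ltr_pMr // ltr1n.
pose K := [set y | dom D y /\ forall j, `|crd D x0 ord0 j - crd D y ord0 j| <= e / 2].
have cK : compact K by apply: (compact_box sD Dx fr); rewrite (ltW e20).
have KU : K `<=` U by move=> y [dy _]; exact: DU.
have [k [G [HG Hk]]] := Hr cK KU.
have [|N0 HN] := Hk [::]; first by [].
have [C HC] := HN delta.
exists (e / 2) => // y b py.
pose h l := iter l (halve ord0) y.
have bh l : ball p (e / 2) (h l).
  by rewrite /h; elim: l => //= l IH; exact: halve_ball.
have ph l : pos (h l) by rewrite /h; elim: l => //= l IH; exact: halve_pos.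
have Hx l : exists x, [/\ dom D x, crd D x = h l, K x & interior_pts M x].
  have [|x dx ex] := fr_box fr (le_ball (ltW e2e) (bh l)); first by move=> j; exact/ltW/ph.
  exists x; split=> //; last by apply/(interiorE gM.1 sD dx) => j; rewrite ex; exact: ph.
  by split=> // j; rewrite ex; exact/ltW/(ball_coord (bh l)).
have [x [dx ex Kx ix]] := Hx 0%N; rewrite /h /= in ex.
pose z := pr x.
have dz : dom D z := Dp dx.
have [_ Up _ _ _] := tr; have [Fz Uz] := Up x (DU dx).
have ez : crd D z = ins ord0 (col' ord0 y) by rewrite /z Dpr // ex.
have nG i : 0 < rhos (G i) z.
  have [bG GF _] := HG i; have [_ h0 hz _] := hrhos bG.
  rewrite lt0r h0 // andbT; apply/eqP => /hz -/(_ Uz) Gz.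
  have nz : nb D x0 e z.
    split=> //; rewrite ez; apply: ball_ins => //; apply: ball_col'.
    exact: (le_ball (ltW e2e) b).
  have [j pj GE] := fr_bhs fr bG nz Gz.
  have [_ lj] := fr_loc fr pj; rewrite GE in Gz; move/(lj z nz): Gz; rewrite ez.
  case: (unliftP ord0 j) pj GE => [j' ->|->] pj GE.
    by rewrite ins_lift mxE => yj; have := py (lift ord0 j'); rewrite yj ltxx.
  move=> _; apply: GF; rewrite GE.
  by have [_ ->] := adapted_frame bF sD Dx fr aD (conj Fx (DU Dx)).
pose f w := \prod_(i < k) rhos (G i) w.
have sf : smooth_fun M U f.
  by apply: smooth_fun_prod => i; have [bG _ _] := HG i; have [] := hrhos bG.
have fz : 0 < f z by apply: prodr_gt0.
have [ O1 [oO1 O1z HO1]] := dom_open sD dz.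
have [O [c0 [oO Oz c00 Hc0]]] : exists (O' : set T) (c : R),
    [/\ open O', O' z, 0 < c & forall y, O' y -> pts M y -> c <= f y].
  apply: (smooth_locally_pos gM.1 oO1 O1z _ _ sf fz); first exact: schart_pts dz.
  by move=> w Ow pw; apply: DU; exact: HO1.
have [e3 e30 He3] := nb_in_open sD dz oO Oz.
have q0 : 0 <= 2^-1 `^ delta by exact: powR_ge0.
pose q : R := 2^-1 `^ delta.
have q1 : q < 1 := half_powR_lt1 d0.
pose B := `|C| * y ord0 ord0 `^ delta * c0 ^- N0.
have q20 : 0 <= 2^-1 :> R by rewrite invr_ge0.
have cvgq (A : R) : (fun l => A * q ^+ l) @ \oo --> (0 : R).
  rewrite -(mulr0 A); apply: cvgMr; apply: cvg_expr.
  by rewrite ger0_norm.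
have ev : \forall l \near \oo, `|rep D u (h l) - rep c lead (col' ord0 y)| <= B * q ^+ l.
  have : \forall l \near \oo, y ord0 ord0 * 2^-1 ^+ l < e3.
    have H : (fun l => y ord0 ord0 * 2^-1 ^+ l) @ \oo --> (0 : R).
      rewrite -(mulr0 (y ord0 ord0)); apply: cvgMr; apply: cvg_expr.
      by rewrite ger0_norm // invf_lt1 // ltr1n.
    exact: (cvgr_lt 0 H).
  apply: filterS => l hl.
  have [xl [dxl exl Kxl ixl]] := Hx l.
  have Oxl : O xl.
    apply: He3; split=> //; rewrite ez exl; apply/ball_rVP => // j; rewrite iter_halveE.
    case: (unliftP ord0 j) => [j' ->|->].
      by rewrite eq_sym (negbTE (neq_lift ord0 j')) ins_lift mxE subrr normr0.
    by rewrite eqxx ins_id sub0r normrN gtr0_norm ?divr_gt0 ?exprn_gt0 ?py // -exprVn.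
  have prl : rep c lead (col' ord0 y) = lead (pr xl).
    by rewrite -(iter_halve_col' l) -/(h l) -exl rep_fch.
  rewrite prl -exl (rep_dom _ sD dxl) -pexp_lead.
  apply: le_trans (HC xl Kxl ixl) _.
  have -> : rho xl `^ delta = y ord0 ord0 `^ delta * q ^+ l.
    by rewrite -D0 exl iter_halveE eqxx half_powRX // ltW.
  have pxl : pts M xl := schart_pts sD dxl.
  have -> : \prod_(i < k) rhos (G i) xl ^- N0 = f xl ^- N0.
    by rewrite /f prodfV prodrXl.
  have fx := Hc0 _ Oxl pxl; have fx0 := lt_le_trans c00 fx.
  rewrite /B -!mulrA; apply: (@le_trans _ _ (`|C| * (y ord0 ord0 `^ delta * (q ^+ l * f xl ^- N0)))).
    by rewrite ler_wpM2r ?ler_norm // !mulr_ge0 ?powR_ge0 ?exprn_ge0 ?invr_ge0 ?exprn_ge0 ?(ltW fx0).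
  rewrite ler_wpM2l // ler_wpM2l ?powR_ge0 // mulrC ler_wpM2r ?exprn_ge0 //.
  rewrite lef_pV2 ?posrE ?exprn_gt0 // lerXn2r // nnegrE; exact: ltW.
apply/cvgrPdist_le => eps eps0; rewrite /=.
near=> l; rewrite distrC; apply: (@le_trans _ _ (B * q ^+ l)); near: l; first exact: ev.
exact: (cvgr_le 0 (cvgq B)).
Unshelve. all: by end_near. Qed.


Lemma ext_pt (t : R) (z : 'rV[R]_n) (e1 : R) : 0 < t < e1 -> ball (col' ord0 p) e1 z -> pos z ->
  exists y : 'rV[R]_n.+1, [/\ ball p e1 y, pos y & col' ord0 y = z].
Proof.
move=> /andP[t0 te] bz pz.
exists (\row_k (if unlift ord0 k is Some m then z ord0 m else t)); split.
- apply/ball_rVP => [|j]; first exact: lt_trans t0 te.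
  rewrite mxE; case: unliftP => [m ->|->]; last by rewrite p0 sub0r normrN gtr0_norm.
  by have := ball_coord bz m; rewrite mxE.
- by move=> j; rewrite mxE; case: unliftP.
- by apply/rowP => j; rewrite !mxE liftK.
Qed.

Lemma face_typ e' Hf j : frame N c x0 e' Hf -> col' ord0 p ord0 j = 0 ->
  typ (face_type M F tau) Hf j = typ tau Gf (lift ord0 j).
Proof.
move=> fr2; rewrite mxE => pj.
have [bH bG GF HG] := face_frame_sub gM bF oU sD aD Dx (conj Fx (DU Dx)) fr fr2 pj.
apply/asboolP/asboolP => [[G [bG' GF' HG' tG]]|tG]; last by exists (Gf (lift ord0 j)).
have [G0 [_ _ _ uG]] := face_bhs_sub gM bF oU bH.
by rewrite (uG _ bG GF HG) -(uG _ bG' GF' HG').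
Qed.

Lemma lead_bdd e' Hf : frame N c x0 e' Hf ->
  bdd (col' ord0 p) (wgt (col' ord0 p) (typ (face_type M F tau) Hf)) (fun=> 1) (rep c lead).
Proof.
move=> fr2; have sf := fch_schart gM bF oU sD aD.
have fx : dom c x0 by split=> //; split=> //; exact: DU.
have [E0|nE0] := pselect (E F (0, 0%N)).
  have -> : lead = a 0 0%N by apply/funext => x; rewrite /lead asboolT.
  exact: (chart_bdd gN (face_index_family iE) (Ha E0) (face_type_nonneg nE) sf fx fr2).
have -> : lead = fun=> 0 by apply/funext => x; rewrite /lead asboolF.
apply: bdd_eq (bdd0 _ _ _); exists 1 => // y _ _.
by rewrite /rep; case: xgetP => // v -> [].
Qed.

End AtChart.

(** Halving the distance to F leaves the other coordinates unchanged, so the lower bound of u in the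
    coordinate belonging to H survives the limit of [halve_limit]. *)
Lemma lead_lower : lower_bound N (face_type M F tau) lead.
Proof.
move=> H x1 bH tH Hx1; have [Fx Ux] : (F `&` U) x1 := bhs_pts bH Hx1.
have [D [sD Dx DU aD [D0 Dp Dpr _]]] := triv_chart gM bF tr Ux.
have [e [Gf fr]] := good_frame gM sD Dx.
have sf := fch_schart gM bF oU sD aD; set c := fch F U D ord0 in sf.
have fx : dom c x1 by split.
have [e' [Hf fr2]] := good_frame gN sf fx.
have [j cj HE] := frame_through fx fr2 bH Hx1.
have tj : tau (Gf (lift ord0 j)).
  by apply/asboolP; rewrite -/(typ tau Gf _) -(face_typ Fx sD Dx DU aD fr fr2 cj); apply/asboolP; rewrite -HE.
have dj : crd D x1 ord0 (lift ord0 j) = 0 by move: cj; rewrite mxE.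
have [cc [eps [cc0 eps0 [e2 e20 h2]]]] := lower_bound_frame gM LB sD Dx fr dj tj.
have [e1 e10 h1] := halve_limit Fx sD Dx DU aD D0 Dp Dpr fr.
pose e3 := Num.min e1 (Num.min e2 e'); have e30 : 0 < e3 by rewrite !lt_min e10 e20 (fr_e0 fr2).
have [O [oO Ox HO]] := open_in_nb sf (nb_refl e30 fx).
exists O, (fun y => crd c y ord0 j), cc, eps; split=> //.
- by apply: (smooth_fun_coord gN.1) => // y [Oy py]; case: (HO y Oy py).
- move=> y Oy py Hy; have [_ lj] := fr_loc fr2 cj.
  by apply/(lj y); rewrite -?HE //; apply: nb_sub (HO y Oy py); rewrite !ge_min lexx !orbT.
move=> y Oy iy; have py : pts N y by case: iy => c' [sc' cy _]; exact: schart_pts cy.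
have [dy by'] := HO y Oy py.
have pz : pos (crd c y) by exact/(interiorE gN.1 sf dy).
split=> //.
have [|w [bw pw ew]] := ext_pt Fx Dx aD (t := e3 / 2) _ by' pz.
  by rewrite divr_gt0 // ltr_pdivrMr // ltr_pMr // ltr1n.
have bw1 : ball (crd D x1) e1 w by apply: le_ball bw; rewrite ge_min lexx.
have bw2 : ball (crd D x1) e2 w by apply: le_ball bw; rewrite !ge_min lexx !orbT.
have := h1 w bw1 pw; rewrite ew (rep_dom _ sf dy) => lim.
apply: (cvgr_to_ge lim); near=> k.
have -> : crd c y ord0 j = iter k (halve ord0) w ord0 (lift ord0 j).
  by rewrite iter_halveE eq_sym (negbTE (neq_lift ord0 j)) -ew mxE.
have p0 : crd D x1 ord0 ord0 = 0 by exact/(aD _ Dx).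
apply: h2; first by elim: (k) => //= l IH; exact: halve_ball.
by elim: (k) => //= l IH; exact: halve_pos.
Unshelve. all: by end_near. Qed.

Lemma face_inear x0 c P : U x0 -> schart N c -> dom c (pr x0) -> pnear (crd c (pr x0)) P ->
  inear M x0 (fun y => [/\ U y, dom c (pr y) & P (crd c (pr y))]).
Proof.
move=> Ux sc cx H; have [O [oO Ox HO]] := point_pnear gN sc cx H.
have [O' [oO' Ox' HO']] := triv_near Ux oO Ox.
exists O'; split=> // y Oy iy; have py : pts M y by case: iy => c' [sc' cy _]; exact: schart_pts cy.
have [Uy Oy'] := HO' y Oy py.
by have [] := HO _ Oy' (triv_interior Uy iy).
Qed.

(* The weight is the product of the coordinates of pr x that vanish on a type 2 hypersurface. *)
Lemma face_weight x0 : U x0 -> exists q : T -> R, [/\ inear M x0 (fun y => U y /\ 0 < q y <= 1),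
  forall a0, phg N (face_index M F E) a0 -> exists (C : R) (m : nat), 0 <= C /\
    inear M x0 (fun y => `|a0 (pr y)| <= C * q y ^- m),
  exists C : nat -> R, (forall m, 0 < C m) /\
    inear M x0 (fun y => forall m, expR (- lead (pr y)) <= C m * q y ^+ m) &
  F x0 -> (exists (C : R) (m : nat), 0 <= C /\
      inear M x0 (fun y => `|u y - lead (pr y)| <= C * rho y `^ delta * q y ^- m)) /\
    exists C : nat -> R, (forall m, 0 < C m) /\
      inear M x0 (fun y => forall m, expR (- u y) <= C m * q y ^+ m)].
Proof.
move=> Ux.
have [D [sD Dx DU aD [D0 Dp Dpr _]]] := triv_chart gM bF tr Ux.
have [_ Up _ _ _] := tr; have [Fz Uz] := Up x0 Ux.
have sf := fch_schart gM bF oU sD aD; set c := fch F U D ord0 in sf.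
have Dz := Dp x0 Dx.
have fz : dom c (pr x0) by split.
have [e' [Hf fr2]] := good_frame gN sf fz.
have [e [Gf fr]] := good_frame gM sD Dz.
pose t' := typ (face_type M F tau) Hf.
pose w := wgt (crd c (pr x0)) t'.
exists (fun y => w (crd c (pr y))); split.
- by apply: inearS (face_inear Ux sf fz (wgt01 _ t')) => y iy [].
- move=> a0 ha; have [C [m [C0 H]]] := chart_bdd gN (face_index_family iE) ha (face_type_nonneg nE) sf fz fr2.
  exists C, m; split=> //; apply: inearS (face_inear Ux sf fz H) => y iy [Uy dp h].
  by move: h; rewrite mulr1 (rep_dom _ sf dp).
- have [|C [C0 H]] := exp_decay (lead_bdd Fz sD Dz DU aD fr2).
    move=> j pj /asboolP tj.
    exact: (lower_bound_frame gN lead_lower sf fz fr2 pj tj).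
  exists C; split=> //; apply: inearS (face_inear Ux sf fz H) => y iy [Uy dp h] m.
  by have := h m; rewrite (rep_dom _ sf dp).
move=> Fx; have zx := face_pts_triv Fx Ux; rewrite zx in fr fr2 fz Dz.
set p := crd D x0.
have p0 : p ord0 ord0 = 0 by exact/(aD _ Dx).
pose t := typ tau Gf.
have t0 : ~~ t ord0.
  by apply/asboolPn; have [_ <-] := adapted_frame bF sD Dx fr aD (conj Fx Ux).
(* F is of type 1, so the weight in the coordinates of M does not contain rho and is pulled back
   from F. *)
have wE y : dom D y -> w (crd c (pr y)) = wgt p t (crd D y).
  move=> dy; rewrite (wgt_lift _ _ t0) /w zx /= Dpr // col'_ins; apply: eq_bigl => j /=.
  by case: eqP => [pj|]; rewrite ?andbF // /t' (face_typ Fx sD Dx DU aD fr fr2 pj).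
split; last first.
  have [C2 [C20 H2]] := chart_decay gM iE hu nE LB sD Dx fr.
  exists C2; split=> //; have [O [oO Ox HO]] := point_pnear gM sD Dx H2.
  exists O; split=> // y Oy iy m; have [dy] := HO y Oy iy.
  by move=> /(_ m); rewrite (rep_dom _ sD dy) (wE _ dy).
have [|C1 [M1 [C10 H1]]] := lphg_halve d0 (chart_ifin iE fr) (chart_nneg nE fr) p0 t0 _
  (phg_lphg gM iE hu sD Dx fr).
  by move=> s q Es; apply: Hd; have [_ ->] := adapted_frame bF sD Dx fr aD (conj Fx Ux).
have [e1 e10 h1] := halve_limit Fx sD Dx DU aD D0 Dp Dpr fr.
pose q : R := 2^-1 `^ delta.
have q0 : 0 <= q by exact: powR_ge0.
have q1 : q < 1 := half_powR_lt1 d0.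
pose C4 := C1 / (1 - q).
have C40 : 0 <= C4 by rewrite divr_ge0 // subr_ge0 ltW.
(* The halving estimates form a geometric series of ratio q = 2^-delta, and [C4] carries the factor
   1/(1 - q); letting k tend to infinity bounds u minus its leading coefficient. *)
have tele : pnear p (fun y => forall k, `|rep D u y - rep D u (iter k (halve ord0) y)| <=
    C4 * y ord0 ord0 `^ delta * wgt p t y ^- M1 * (1 - q ^+ k)).
  have [e2 e20 he2] := H1; exists e2 => // y b py; elim=> [|k IH] /=.
    by rewrite !subrr normr0 mulr0.
  set h := iter k _ y in IH *.
  have bh : ball p e2 h by rewrite /h; elim: (k) => //= l IHl; exact: halve_ball.
  have ph : pos h by rewrite /h; elim: (k) => //= l IHl; exact: halve_pos.
  have wh : wgt p t h = wgt p t y.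
    apply: eq_bigr => j /andP[tj _]; rewrite iter_halveE; case: eqP => // j0.
    by rewrite j0 (negbTE t0) in tj.
  have hE : h ord0 ord0 `^ delta = y ord0 ord0 `^ delta * q ^+ k.
    by rewrite /h iter_halveE eqxx half_powRX // ltW.
  have := he2 h bh ph; rewrite wh hE => hh.
  rewrite -[_ - _](subrKA (rep D u h)); apply: le_trans (ler_normD _ _) _.
  apply: le_trans (lerD IH hh) _.
  rewrite le_eqVlt; apply/orP; left; apply/eqP.
  have nq : 1 - q != 0 by rewrite gt_eqF // subr_gt0.
  by rewrite /C4 exprS; move: (_ ^- M1) (q ^+ k) (_ `^ delta) => W Q Y; field.
have near1 : pnear p (fun y => `|rep D u y - rep c lead (col' ord0 y)| <=
    C4 * y ord0 ord0 `^ delta * wgt p t y ^- M1).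
  have h1' : pnear p (fun y => (fun k => rep D u (iter k (halve ord0) y)) @ \oo --> rep c lead (col' ord0 y)).
    by exists e1.
  apply: pnearS (pnear_and h1' (pnear_and tele (wgt01 p t))).
  move=> y py [lim [tl /andP[w0 w1]]].
  have lim' : (fun k => `|rep D u y - rep D u (iter k (halve ord0) y)|) @ \oo -->
     `|rep D u y - rep c lead (col' ord0 y)|.
    by apply: cvg_norm; apply: cvgB => //; exact: cvg_cst.
  apply: (cvgr_to_le lim'); near=> k; apply: le_trans (tl k) _.
  rewrite ler_piMr ?mulr_ge0 ?powR_ge0 ?invr_ge0 ?exprn_ge0 ?(ltW w0) //.
    by rewrite subr_ge0 ltW.
  by rewrite gerBl exprn_ge0.
exists C4, M1; split=> //.
have [O [oO Ox HO]] := point_pnear gM sD Dx near1.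
exists O; split=> // y Oy iy; have [dy] := HO y Oy iy.
by rewrite (rep_dom _ sD dy) (rep_fch sD DU aD Dp Dpr) // D0 (wE _ dy).
Unshelve. all: by end_near. Qed.

End Limit.

(** At points of F, rho is a factor of the weight in [chart_decay]; off F, rho is bounded below and
    local boundedness of exp(-u) suffices. *)
Lemma type2_decay (tau : set T -> Prop) (E : set T -> set (R * nat)) u m x0 :
  index_family M E -> phg M E u -> nonneg_off M tau E -> lower_bound M tau u -> tau F -> U x0 ->
  exists2 C : R, 0 <= C & inear M x0 (fun y => U y /\ expR (- u y) <= C * rho y ^+ m).
Proof.
move=> iE hu nE LB tF Ux.
have [D [sD Dx DU aD [D0 Dp Dpr _]]] := triv_chart gM bF tr Ux.
have [e [Gf fr]] := good_frame gM sD Dx.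
have [Fx|nFx] := pselect (F x0).
  have [C' [C'0 H']] := chart_decay gM iE hu nE LB sD Dx fr.
  pose C := C' m; have C0 : 0 < C by exact: C'0.
  have H : pnear (crd D x0) (fun y => expR (- rep D u y) <= C * wgt (crd D x0) (typ tau Gf) y ^+ m).
    by apply: pnearS H' => y _ /(_ m).
  have [d0 FG] := adapted_frame bF sD Dx fr aD (conj Fx Ux).
  have [O [oO Ox HO]] := point_pnear gM sD Dx (pnear_and H (pnear_le1_all (crd D x0))).
  exists C; first exact: ltW.
  exists O; split=> // y Oy iy; have [dy [le y1]] := HO y Oy iy; split; first exact: DU.
  rewrite (rep_dom _ sD dy) in le; apply: le_trans le _; rewrite ler_wpM2l ?(ltW C0) //.
  have yp j : 0 <= crd D y ord0 j by exact: (schart_orthant sD dy).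
  rewrite lerXn2r ?nnegrE ?prodr_ge0 //; first by rewrite -D0.
  rewrite /wgt (bigD1 ord0) /=; last by rewrite d0 eqxx andbT; apply/asboolP; rewrite -FG.
  rewrite D0 ler_piMr -?D0 //; apply: prodr_ile1 => j /andP[/andP[_ /eqP pj] _].
  by rewrite yp; exact: y1.
have [O [C [oO Ox C0 H]]] := exp_locally_bounded gM iE hu nE LB (schart_pts sD Dx).
have rx : 0 < crd D x0 ord0 ord0.
  rewrite lt0r (schart_orthant sD Dx) andbT; apply/eqP => rx; apply: nFx.
  by apply/(aD _ Dx).
have r20 : 0 < crd D x0 ord0 ord0 / 2 by rewrite divr_gt0.
have [O' [oO' Ox' HO']] := open_in_nb sD (nb_refl r20 Dx).
exists (C / (crd D x0 ord0 ord0 / 2) ^+ m).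
  by rewrite divr_ge0 ?exprn_ge0 ?(ltW C0) ?(ltW r20) //.
exists (O `&` O'); split=> //; first exact: openI.
move=> y [Oy Oy'] iy; have py : pts M y by case: iy => c [sc cy _]; exact: schart_pts cy.
have [dy by'] := HO' y Oy' py; split; first exact: DU.
apply: le_trans (H y Oy iy) _; rewrite mulrAC ler_pdivlMr ?exprn_gt0 //.
rewrite ler_wpM2l ?(ltW C0) // lerXn2r ?nnegrE ?(ltW r20) //; first by rewrite -D0; exact: (schart_orthant sD dy).
have := ball_coord by' ord0; rewrite D0 => /ltW; rewrite ler_norml => /andP[_].
by rewrite D0; move: (rho x0) (rho y) => A B; lra.
Qed.

End Face.
End Lower.

(** * Derivative estimates *)

Section Fields.
Variables (R : realType) (T : topologicalType) (n : nat) (M : mfd R T n).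
Hypothesis pM : presm M.
Variable U : set T.
Hypothesis oU : relopen (pts M) U.
Let Om := U `&` interior_pts M.

Lemma image_open c : schart M c -> open (crd c @` (Om `&` dom c)).
Proof.
move=> sc; rewrite openE => _ [x [[Ux ix] cx] <-].
have [UM HU] := relopenE oU; have [O [oO Ox OU]] := HU x Ux.
have [e e0 He] := chart_ball (proj1 sc) cx oO Ox.
have cp : forall j, 0 < crd c x ord0 j by exact/(interiorE pM sc cx).
have [m m0 hm] : exists2 m : R, 0 < m & forall j, m <= crd c x ord0 j.
  (* The inverse of this sum is a common positive lower bound of the coordinates, even if there are
     none. *)
  pose S := 1 + \sum_j (crd c x ord0 j)^-1.
  have S0 : 0 < S by rewrite ltr_wpDr // sumr_ge0 // => j _; rewrite invr_ge0 ltW.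
  exists S^-1; first by rewrite invr_gt0.
  move=> j; rewrite -[leRHS]invrK lef_pV2 ?posrE ?invr_gt0 // /S (bigD1 j) //=.
  rewrite addrCA lerDl addr_ge0 ?sumr_ge0 // => k _; rewrite invr_ge0 ltW //.
apply/nbhs_ballP; exists (Num.min e m) => /=; first by rewrite lt_min e0.
move=> z bz; have pz j : 0 < z ord0 j.
  have := ball_coord bz j; rewrite lt_min => /andP[_]; rewrite ltr_norml => /andP[_].
  by have := hm j; move: (crd c x ord0 j) (z ord0 j) => a b; lra.
have [||y [cy Oy ey]] := He z; first by apply: le_ball bz; rewrite ge_min lexx.
  by move=> j; exact: ltW.
have Uy : U y by apply: OU; split=> //; exact: schart_pts cy.
exists y => //; split=> //; split=> //.
by apply/(interiorE pM sc cy) => j; rewrite ey.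
Qed.

(** Near an interior point the image of the chart is open, so the smooth extension provided by
    [smooth_fun] is the function itself. *)
Lemma rep_smooth c f x : schart M c -> smooth_fun M Om f -> Om x -> dom c x ->
  exists O, [/\ open O, O (crd c x), O `<=` crd c @` (Om `&` dom c) & Cinf O (rep c f)].
Proof.
move=> sc sf Ox cx; have S : (crd c @` (Om `&` dom c)) (crd c x) by exists x.
have [O1 [g [oO1 O1x Cg gE]]] := sf c sc _ S.
pose O := O1 `&` crd c @` (Om `&` dom c).
have oO : open O by apply: openI => //; exact: image_open.
exists O; split=> //; first by move=> z [].
have Cg' : Cinf O g by apply: Cinf_sub Cg => z [].
have E l : forall y, O y -> foldr (@pderiv R n) g l y = foldr (@pderiv R n) (rep c f) l y.
  elim: l => [|i l IH] y Oy /=; first by case: Oy; exact: gE.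
  exact: (pderiv_eq_on i oO IH Oy).
move=> l y Oy; have [c1 c2] := Cg' l y Oy.
have nE : \forall z \near y, foldr (@pderiv R n) g l z = foldr (@pderiv R n) (rep c f) l z.
  by near=> z; apply: E; near: z; exact: open_nbhs_nbhs.
split.
  suff : foldr (@pderiv R n) (rep c f) l z @[z --> y] --> foldr (@pderiv R n) (rep c f) l y by [].
  by rewrite -(E l y Oy); exact: cvg_trans (near_eq_cvg nE) c1.
by move=> i; exact: near_eq_derivable nE (c2 i).
Unshelve. all: by end_near. Qed.

(** The properties of tangent fields on which the estimates rest. [dv_ext] is not automatic, because
    a field acts on total functions, whose values off [Om] are arbitrary. *)
Record derivation (V : (T -> R) -> (T -> R)) : Prop := Derivation {
  dv_smooth : forall f, smooth_fun M Om f -> smooth_fun M Om (V f);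
  dv_ext : forall f g, smooth_fun M Om f -> smooth_fun M Om g ->
    (forall x, Om x -> f x = g x) -> forall x, Om x -> V f x = V g x;
  dv_add : forall f g, smooth_fun M Om f -> smooth_fun M Om g ->
    forall x, Om x -> V (fun y => f y + g y) x = V f x + V g x;
  dv_mul : forall f g, smooth_fun M Om f -> smooth_fun M Om g ->
    forall x, Om x -> V (fun y => f y * g y) x = f x * V g x + V f x * g x;
  dv_cst : forall c x, Om x -> V (fun=> c) x = 0;
  dv_exp : forall f, smooth_fun M Om f ->
    forall x, Om x -> V (fun y => expR (f y)) x = expR (f x) * V f x }.

Lemma om_chart x : Om x -> exists2 c, schart M c & dom c x.
Proof.
move=> [Ux _]; have [UM _] := relopenE oU.
by have [c ac cx] := pM.2 x (UM x Ux); exists c => //; exact: pM.1.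
Qed.

Lemma tangent_derivation V : tangent_field M U V -> derivation V.
Proof.
move=> tV.
have point x : Om x -> exists c b, [/\ schart M c, dom c x &
    forall f, smooth_fun M Om f -> V f x = \sum_j b j * pderiv j (rep c f) (crd c x)].
  move=> Ox; have [c sc cx] := om_chart Ox; have [b [_ _ Hb]] := tV c sc.
  exists c, (b x ord0); split=> // f sf; case: Ox => Ux ix; exact: Hb.
have rep_eq c f g x : schart M c -> smooth_fun M Om f -> smooth_fun M Om g -> Om x -> dom c x ->
    exists O, [/\ open O, O (crd c x), Cinf O (rep c f), Cinf O (rep c g) &
      forall z, O z -> exists y, [/\ Om y, dom c y & crd c y = z]].
  move=> sc sf sg Ox cx; have [O1 [o1 x1 i1 c1]] := rep_smooth sc sf Ox cx.
  have [O2 [o2 x2 i2 c2]] := rep_smooth sc sg Ox cx.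
  exists (O1 `&` O2); split=> //; first exact: openI.
  - by apply: Cinf_sub c1 => z [].
  - by apply: Cinf_sub c2 => z [].
  by move=> z [/i1 [y [Oy cy] <-] _]; exists y.
split.
- move=> f sf; apply: (smooth_funP pM) => x Ox px.
  have [c sc cx] := om_chart Ox; have [b [sb _ Hb]] := tV c sc.
  have [UM HU] := relopenE oU; have [O [oO Ox' OU]] := HU x (proj1 Ox).
  exists c, setT; split=> //; first exact: openT.
  rewrite setIT; set S := crd c @` _.
  have Sb j : smooth_on S (rep c (fun x => b x ord0 j)).
    by apply: smooth_on_sub (sb j c sc) => _ [y [[Uy _] cy] <-]; exists y.
  have Sp j : smooth_on S (pderiv j (rep c f)).
    move=> _ [y [Oy cy] <-]; have [O1 [o1 y1 i1 c1]] := rep_smooth sc sf Oy cy.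
    by exists O1, (pderiv j (rep c f)); split=> //; exact: Cinf_pderiv.
  have : smooth_on S (fun z => \sum_j rep c (fun x => b x ord0 j) z * pderiv j (rep c f) z).
    elim: (index_enum _) => [|j s IH].
      by apply: smooth_on_eq (@smooth_on_cst _ _ S 0) => // z _; rewrite big_nil.
    apply: smooth_on_eq (smooth_on_add (smooth_on_mul (Sb j) (Sp j)) IH) => // z _.
    by rewrite big_cons.
  apply: smooth_on_eq => // _ [y [[Uy iy] cy] <-].
  rewrite (rep_dom _ sc cy) (Hb f sf y Uy cy iy).
  by apply: eq_bigr => j _; rewrite (rep_dom _ sc cy).
- move=> f g sf sg fg x Ox; have [c [b [sc cx Hb]]] := point x Ox.
  have [O [oO Ocx cf cg OE]] := rep_eq c f g x sc sf sg Ox cx.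
  rewrite !Hb //; apply: eq_bigr => j _; congr (_ * _).
  apply: (pderiv_eq_on j oO _ Ocx) => z /OE[y [Oy cy <-]].
  by rewrite !(rep_dom _ sc cy) fg.
- move=> f g sf sg x Ox; have [c [b [sc cx Hb]]] := point x Ox.
  have [O [oO Ocx cf cg OE]] := rep_eq c f g x sc sf sg Ox cx.
  rewrite !Hb //; last exact: smooth_fun_add.
  rewrite -big_split; apply: eq_bigr => j _ /=; rewrite -mulrDr; congr (_ * _).
  have -> : pderiv j (rep c (fun y => f y + g y)) (crd c x) = pderiv j (rep c f \+ rep c g) (crd c x).
    apply: (pderiv_eq_on j oO _ Ocx) => z /OE[y [Oy cy <-]].
    by rewrite /= !(rep_dom _ sc cy).
  by rewrite /pderiv deriveD //; [have [_] := cf [::] _ Ocx|have [_] := cg [::] _ Ocx]; exact.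
- move=> f g sf sg x Ox; have [c [b [sc cx Hb]]] := point x Ox.
  have [O [oO Ocx cf cg OE]] := rep_eq c f g x sc sf sg Ox cx.
  rewrite !Hb //; last exact: smooth_fun_mul.
  rewrite mulr_sumr mulr_suml -big_split; apply: eq_bigr => j _ /=.
  have -> : pderiv j (rep c (fun y => f y * g y)) (crd c x) = pderiv j (rep c f * rep c g) (crd c x).
    apply: (pderiv_eq_on j oO _ Ocx) => z /OE[y [Oy cy <-]].
    by rewrite /GRing.mul /= !(rep_dom _ sc cy).
  rewrite /pderiv deriveM; [|by have [_] := cf [::] _ Ocx; exact|by have [_] := cg [::] _ Ocx; exact].
  rewrite !(rep_dom _ sc cx) /GRing.scale /=.
  by move: (b j) ('D_ _ _ _) ('D_ _ _ _) => B X Y; ring.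
- move=> c0 x Ox; have [c [b [sc cx Hb]]] := point x Ox.
  rewrite Hb; last exact: smooth_fun_cst.
  apply: big1 => j _; have sk := @smooth_fun_cst _ _ _ M Om c0.
  have [O [oO Ocx cf _ OE]] := rep_eq c _ _ x sc sk sk Ox cx.
  have -> : pderiv j (rep c (fun=> c0)) (crd c x) = pderiv j (fun=> c0) (crd c x).
    by apply: (pderiv_eq_on j oO _ Ocx) => z /OE[y [Oy cy <-]]; rewrite (rep_dom _ sc cy).
  by rewrite /pderiv derive_cst mulr0.
- move=> f sf x Ox; have [c [b [sc cx Hb]]] := point x Ox.
  have [O [oO Ocx cf _ OE]] := rep_eq c f f x sc sf sf Ox cx.
  rewrite !Hb //; last exact: smooth_fun_exp.
  rewrite mulr_sumr; apply: eq_bigr => j _; rewrite mulrCA; congr (_ * _).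
  have -> : pderiv j (rep c (fun y => expR (f y))) (crd c x) = pderiv j (expR \o rep c f) (crd c x).
    by apply: (pderiv_eq_on j oO _ Ocx) => z /OE[y [Oy cy <-]]; rewrite /= !(rep_dom _ sc cy).
  have [_ ->] := pderiv_comp1 j (@derivable_expR R _) (Cinf_differentiable oO cf Ocx).
  by rewrite derive1E (congr1 (fun g => g _) (@derive_expR R)) (rep_dom _ sc cx).
Qed.

End Fields.

(** * Classes of functions with a loss for every derivative *)

Section Classes.
Variables (R : realType) (T : topologicalType) (n : nat) (M : mfd R T n) (U : set T).
Let Om := U `&` interior_pts M.
Variable L : set ((T -> R) -> (T -> R)).
Hypothesis dL : forall V, L V -> derivation M U V.
Variables (A : set T) (p : T -> R).
Hypotheses (AO : A `<=` Om) (p0 : forall x, A x -> 0 < p x).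
Local Notation sm := (smooth_fun M Om).

(* f = O(g) on A, and every derivation in L costs a factor 1/p, up to order k. *)
Fixpoint cls (k : nat) (g f : T -> R) : Prop :=
  (exists C, forall x, A x -> `|f x| <= C * g x) /\
  match k with
  | 0 => True
  | k'.+1 => forall V, L V -> cls k' (fun x => g x / p x) (V f)
  end.

Lemma cls_bound k g f : cls k g f -> exists C, forall x, A x -> `|f x| <= C * g x.
Proof. by case: k => [|k] []. Qed.

Lemma cls_pred k g f : cls k.+1 g f -> cls k g f.
Proof.
elim: k g f => [|k IH] g f [bf H]; split=> // V LV; exact/IH/H.
Qed.

Lemma cls_sub k k' g f : (k' <= k)%N -> cls k g f -> cls k' g f.
Proof.
move=> /subnK <-; elim: (k - k')%N => [//|l IH]; rewrite addSn => /cls_pred; exact: IH.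
Qed.

Lemma cls_ext k g f f' : sm f -> sm f' -> (forall x, Om x -> f x = f' x) -> cls k g f -> cls k g f'.
Proof.
elim: k g f f' => [|k IH] g f f' sf sf' E [[C H] H2]; split=> //.
- by exists C => x Ax; rewrite -E ?H //; exact: AO.
- by exists C => x Ax; rewrite -E ?H //; exact: AO.
- move=> V LV; apply: IH (H2 V LV); [exact: dv_smooth (dL LV) _ sf|exact: dv_smooth (dL LV) _ sf'|].
  exact: (dv_ext (dL LV) sf sf' E).
Qed.

Lemma cls_le k g g' f B : (forall x, A x -> 0 <= g x /\ g x <= B * g' x) -> cls k g f -> cls k g' f.
Proof.
elim: k g g' f => [|k IH] g g' f gg [[C H] H2].
  split=> //; exists (`|C| * B) => x Ax; apply: le_trans (H x Ax) _; have [h1 h2] := gg x Ax.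
  apply: (@le_trans _ _ (`|C| * g x)); first by rewrite ler_wpM2r ?ler_norm.
  by rewrite -mulrA ler_wpM2l.
split.
  exists (`|C| * B) => x Ax; apply: le_trans (H x Ax) _; have [h1 h2] := gg x Ax.
  apply: (@le_trans _ _ (`|C| * g x)); first by rewrite ler_wpM2r ?ler_norm.
  by rewrite -mulrA ler_wpM2l.
move=> V LV; apply: IH (H2 V LV) => x Ax; have [h1 h2] := gg x Ax; have p1 := p0 Ax.
by rewrite divr_ge0 ?(ltW p1) // mulrA ler_wpM2r ?invr_ge0 ?(ltW p1).
Qed.

Lemma cls_eqw k g g' f : (forall x, A x -> g x = g' x) -> cls k g f -> cls k g' f.
Proof.
elim: k g g' f => [|k IH] g g' f E [[C H] H2]; (split; [by exists C => x Ax; rewrite -E ?H|]) => //.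
by move=> V LV; apply: IH (H2 V LV) => x Ax; rewrite E.
Qed.

Lemma cls_add k g f f' : sm f -> sm f' -> cls k g f -> cls k g f' -> cls k g (fun x => f x + f' x).
Proof.
elim: k g f f' => [|k IH] g f f' sf sf' [[C H] H2] [[C' H'] H2'].
  split=> //; exists (C + C') => x Ax; apply: le_trans (ler_normD _ _) _.
  by rewrite mulrDl lerD ?H ?H'.
split.
  exists (C + C') => x Ax; apply: le_trans (ler_normD _ _) _.
  by rewrite mulrDl lerD ?H ?H'.
move=> V LV; have dV := dL LV; apply: cls_ext (IH _ _ _ _ _ (H2 V LV) (H2' V LV)).
- by apply: smooth_fun_add; apply: (dv_smooth dV).
- by apply: (dv_smooth dV); apply: smooth_fun_add.
- by move=> x Ox; rewrite (dv_add dV).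
- exact: dv_smooth dV _ sf.
- exact: dv_smooth dV _ sf'.
Qed.

Lemma cls_mul k g g' f f' : sm f -> sm f' -> cls k g f -> cls k g' f' ->
  cls k (fun x => g x * g' x) (fun x => f x * f' x).
Proof.
elim: k g g' f f' => [|k IH] g g' f f' sf sf' Hf Hf'.
  have [[C H] H2] := Hf; have [[C' H'] H2'] := Hf'.
  split=> //; exists (C * C') => x Ax; rewrite normrM mulrACA.
  by apply: ler_pM; rewrite ?H ?H'.
have [[C H] H2] := Hf; have [[C' H'] H2'] := Hf'; split.
  exists (C * C') => x Ax; rewrite normrM mulrACA.
  by apply: ler_pM; rewrite ?H ?H'.
move=> V LV; have dV := dL LV; have sV := dv_smooth dV sf; have sV' := dv_smooth dV sf'.
apply: cls_ext (cls_add _ _ (cls_eqw _ (IH _ _ _ _ sf sV' (cls_pred Hf) (H2' V LV)))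
  (cls_eqw _ (IH _ _ _ _ sV sf' (H2 V LV) (cls_pred Hf')))).
- by apply: smooth_fun_add; apply: smooth_fun_mul.
- by apply: (dv_smooth dV); apply: smooth_fun_mul.
- by move=> x Ox; rewrite (dv_mul dV).
- exact: smooth_fun_mul.
- exact: smooth_fun_mul.
- by move=> x Ax; rewrite mulrA.
- by move=> x Ax; rewrite mulrAC.
Qed.

Lemma cls_cst k g c : (exists C, forall x, A x -> `|c| <= C * g x) -> cls k g (fun=> c).
Proof.
have z k' g' : cls k' g' (fun=> 0).
  have b0 g1 : exists C, forall x, A x -> `|0 : R| <= C * g1 x by exists 0 => x _; rewrite normr0 mul0r.
  elim: k' g' => [|k' IH] g'; split=> //; try exact: b0.
  move=> V LV; have dV := dL LV; apply: cls_ext (IH _).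
  - exact: smooth_fun_cst.
  - by apply: (dv_smooth dV); exact: smooth_fun_cst.
  - by move=> x Ox; rewrite (dv_cst dV).
case: k => [|k] H; split=> // V LV; have dV := dL LV; apply: cls_ext (z _ _).
- exact: smooth_fun_cst.
- by apply: (dv_smooth dV); exact: smooth_fun_cst.
- by move=> x Ox; rewrite (dv_cst dV).
Qed.

Lemma cls_scale k g c f : sm f -> cls k g f -> cls k g (fun x => c * f x).
Proof.
move=> sf H; apply: cls_eqw (cls_mul (@smooth_fun_cst _ _ _ M Om c) sf (@cls_cst k (fun=> 1) c _) H).
  by move=> x _; rewrite mul1r.
by exists `|c| => x _; rewrite mulr1.
Qed.

Lemma cls_sum k g (I : Type) (r : seq I) (f : I -> T -> R) : (forall i, sm (f i)) ->
  (forall i, cls k g (f i)) -> cls k g (fun x => \sum_(i <- r) f i x).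
Proof.
move=> sf H; elim: r => [|i r IH].
  have -> : (fun x => \sum_(i <- [::]) f i x) = (fun=> 0) by apply/funext => x; rewrite big_nil.
  by apply: cls_cst; exists 0 => x _; rewrite normr0 mul0r.
have -> : (fun x => \sum_(j <- i :: r) f j x) = (fun x => f i x + \sum_(j <- r) f j x).
  by apply/funext => x; rewrite big_cons.
by apply: cls_add => //; exact: smooth_fun_sum.
Qed.

Definition words k (g f : T -> R) := forall w : seq ((T -> R) -> (T -> R)),
  (size w <= k)%N -> (forall j, (j < size w)%N -> L (nth id w j)) ->
  exists C, forall x, A x -> `|foldr (fun V h => V h) f w x| <= C * g x.

Lemma words_step k g f V : L V -> words k.+1 g f -> words k g (V f).
Proof.
move=> LV H w sw Lw; have [||C HC] := H (rcons w V).
- by rewrite size_rcons.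
- move=> j; rewrite size_rcons ltnS nth_rcons => jw.
  by case: ltnP => [/Lw//|wj]; rewrite eqn_leq jw wj.
by exists C => x /HC; rewrite foldr_rcons.
Qed.

Lemma cls_words k g0 g1 f B B0 : 0 <= B -> 0 <= B0 -> (forall x, A x -> 0 <= g1 x /\ 0 <= g0 x) ->
  (forall x, A x -> p x <= B0) ->
  (exists C, forall x, A x -> `|f x| <= C * g0 x) ->
  (forall x, A x -> g1 x <= B * (g0 x / p x)) ->
  words k g1 f -> cls k g0 f.
Proof.
move=> Bge B0ge g10 pB; elim: k f g0 B Bge g10 => [//|k IH] f g0 B Bge g10 bf g01 wf; split=> // V LV.
have wV := words_step LV wf; apply: (IH _ _ (B * B0) _ _ _ _ wV).
- exact: mulr_ge0.
- move=> x Ax; have [h1 h2] := g10 x Ax; split=> //; rewrite divr_ge0 ?(ltW (p0 Ax)) //.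
- have [//|//|C HC] := wV [::]; exists (`|C| * B) => x Ax.
  apply: le_trans (HC x Ax) _; rewrite -mulrA.
  apply: (@le_trans _ _ (`|C| * g1 x)); first by rewrite ler_wpM2r ?ler_norm ?(g10 x Ax).1.
  by rewrite ler_wpM2l ?g01.
move=> x Ax; apply: le_trans (g01 x Ax) _; have [h1 h2] := g10 x Ax; have px := p0 Ax.
rewrite -mulrA ler_wpM2l // mulrCA -mulrA ler_wpM2l // mulrCA.
by rewrite mulrCA ler_peMr ?invr_ge0 ?(ltW px) // ler_pdivlMr // mul1r pB.
Qed.

Lemma cls_unwords k g f : cls k g f -> forall w : seq ((T -> R) -> (T -> R)),
  (size w <= k)%N -> (forall j, (j < size w)%N -> L (nth id w j)) ->
  exists C, forall x, A x -> `|foldr (fun V h => V h) f w x| <= C * (g x * p x ^- size w).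
Proof.
move=> + w; elim/last_ind: w k g f => [|w V IH] k g f H sw Lw.
  by have [C HC] := cls_bound H; exists C => x Ax; rewrite expr0 invr1 mulr1 HC.
rewrite size_rcons in sw Lw; case: k H sw => [//|k] [_ H] sw.
have LV : L V by have := Lw (size w) (ltnSn _); rewrite nth_rcons ltnn eqxx.
have [|C HC] := IH k _ _ (H V LV) sw.
  by move=> j jw; have := Lw j (ltnW jw); rewrite nth_rcons jw.
exists C => x Ax; rewrite foldr_rcons size_rcons; apply: le_trans (HC x Ax) _.
by rewrite -[g x / p x / _]mulrA -invfM -exprS.
Qed.

(* Covers exp(-u), and the Taylor terms and Taylor remainders of exp(-a) exp(-(u - a)). *)
Lemma cls_chain (h : nat -> T -> R) (f : nat -> T -> R) (al : ((T -> R) -> (T -> R)) -> T -> R)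
    (be : nat -> ((T -> R) -> (T -> R)) -> T -> R) (B : R) k :
  (forall j, sm (f j)) -> (forall j x, A x -> 0 <= h j x) ->
  (forall j x, A x -> h j x <= B * h j.-1 x) ->
  (forall j, exists C, forall x, A x -> `|f j x| <= C * h j x) ->
  (forall V, L V -> sm (al V)) -> (forall j V, L V -> sm (be j V)) ->
  (forall V, L V -> cls k.-1 (fun x => (p x)^-1) (al V)) ->
  (forall j V, L V -> cls k.-1 (fun x => (p x)^-1) (be j V)) ->
  (forall j V, L V -> forall x, Om x -> V (f j) x = al V x * f j x + be j V x * f j.-1 x) ->
  forall j, cls k (h (j - k)%N) (f j).
Proof.
move=> sf h0 hB bf sal sbe; elim: k => [|k IH] cal cbe Vf j.
  by split=> //; have [C HC] := bf j; exists C => x Ax; rewrite subn0 HC.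
have {IH} IH j' : cls k (h (j' - k)%N) (f j').
  by apply: IH => // V' *; [case: k cal {cbe Vf} => [|k] cal; [exact: cal|exact/cls_pred/cal] | ];
  case: k cbe {cal Vf} => [|k] cbe; [exact: cbe|exact/cls_pred/cbe].
have step l i : (i <= l)%N -> exists B', forall x, A x -> 0 <= h l x /\ h l x <= B' * h i x.
  move=> il; exists (`|B| ^+ (l - i)) => x Ax; split; first exact: h0.
  have hB' l' : h l' x <= `|B| * h l'.-1 x.
    by apply: le_trans (hB l' x Ax) _; rewrite ler_wpM2r ?ler_norm // h0.
  rewrite -{1}(subnKC il); elim: (l - i)%N => [|m IHm]; first by rewrite addn0 expr0 mul1r.
  by rewrite addnS exprS -mulrA; apply: le_trans (hB' _) _; rewrite /= ler_wpM2l.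
have le1 : (j - k.+1 <= j - k)%N by rewrite leq_sub2l.
have [B' HB'] := step _ _ le1.
split.
  have [C HC] := cls_bound (cls_le HB' (IH j)); by exists C.
(* A derivative multiplies [f j] by a coefficient or steps down to [f j.-1], so k derivatives reach
   no lower than index j - k; the weights h increase, up to constants, as the index decreases. *)
move=> V LV; have dV := dL LV.
have c1 : cls k (fun x => (p x)^-1 * h (j - k.+1)%N x) (fun x => al V x * f j x).
  by apply: cls_mul => //; [exact: sal|exact: cal|exact: cls_le HB' (IH j)].
have c2 : cls k (fun x => (p x)^-1 * h (j - k.+1)%N x) (fun x => be j V x * f j.-1 x).
  apply: cls_mul => //; [exact: sbe|exact: cbe|].
  have le2 : (j - k.+1 <= j.-1 - k)%N by rewrite -subn1 -subnDA add1n.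
  by have [B2' HB2'] := step _ _ le2; exact: cls_le HB2' (IH j.-1).
apply: cls_ext (cls_eqw _ (cls_add _ _ c1 c2)).
- by apply: smooth_fun_add; apply: smooth_fun_mul => //; [exact: sal|exact: sbe].
- exact: dv_smooth dV _ (sf j).
- by move=> x Ox; rewrite Vf.
- by move=> x _; rewrite mulrC.
- by apply: smooth_fun_mul => //; exact: sal.
- by apply: smooth_fun_mul => //; exact: sbe.
Qed.

End Classes.

(** * Index sets and formal series *)

Lemma fsum_filter (V : zmodType) (I : choiceType) (A : set I) (s : seq I) (f : I -> V) : uniq s ->
  (forall i, A i -> i \in s) -> \sum_(i \in A) f i = \sum_(i <- s | `[< A i >]) f i.
Proof.
move=> us As; have fA : finite_set A.
  by apply: (sub_finite_set (B := [set` s])) => [i /As//|]; exact: finite_seq.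
have [s' [us' s'A ->]] := fsum_seq V fA; rewrite -[RHS]big_filter.
apply: perm_big; apply: uniq_perm => //; first exact: filter_uniq.
move=> i; rewrite mem_filter; apply/idP/andP => [/s'A Ai|[/asboolP Ai _]]; last exact/s'A.
by split; [exact/asboolP|exact: As].
Qed.

Section Series.
Variable R : realType.
Implicit Types (E : set (R * nat)) (a b : R -> nat -> R).

Definition psum E a (t l r : R) : R :=
  \sum_(sp \in [set sp | E sp /\ sp.1 <= r]) a sp.1 sp.2 * (t `^ sp.1) * l ^+ sp.2.

Definition addp (x y : R * nat) : R * nat := (x.1 + y.1, (x.2 + y.2)%N).

(** Coefficients of the Cauchy product of two expansions. *)
Definition conv E1 E2 a b (s : R) (q : nat) : R :=
  \sum_(xy \in [set xy : (R * nat) * (R * nat) | [/\ E1 xy.1, E2 xy.2 & addp xy.1 xy.2 = (s, q)]])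
    a xy.1.1 xy.1.2 * b xy.2.1 xy.2.2.

Lemma psum_seq E a t l r (s : seq (R * nat)) : uniq s -> (forall x, E x -> x.1 <= r -> x \in s) ->
  psum E a t l r = \sum_(x <- s | `[< E x /\ x.1 <= r >]) a x.1 x.2 * (t `^ x.1) * l ^+ x.2.
Proof. by move=> us Es; rewrite /psum (fsum_filter (s := s)) // => x [Ex xr]; exact: Es. Qed.

Lemma conv_finite E1 E2 z : ifin E1 -> ifin E2 ->
  finite_set [set xy : (R * nat) * (R * nat) | [/\ E1 xy.1, E2 xy.2 & addp xy.1 xy.2 = z]].
Proof.
move=> f1 f2; have [m1 h1] := ifin_lower f1; have [m2 h2] := ifin_lower f2.
apply: (sub_finite_set (B := [set sp | E1 sp /\ sp.1 <= z.1 - m2] `*` [set sp | E2 sp /\ sp.1 <= z.1 - m1])).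
  move=> [x y] [/= Ex Ey <-]; split=> /=; split=> //.
    by have := h2 y Ey; rewrite /=; move: (x.1) (y.1) => X Y; lra.
  by have := h1 x Ex; rewrite /=; move: (x.1) (y.1) => X Y; lra.
by apply: finite_setX.
Qed.

(** Next to a term of exponent [x.1] the second factor is truncated at r - [x.1]. Here r1 is any
    bound for the exponents of the first factor that can occur. *)
Lemma psum_conv E1 E2 E3 a b t l r r1 : ifin E1 -> ifin E2 -> ifin E3 -> 0 < t ->
  (forall x y, E1 x -> E2 y -> E3 (addp x y)) ->
  (forall x y, E1 x -> E2 y -> x.1 + y.1 <= r -> x.1 <= r1) ->
  psum E3 (conv E1 E2 a b) t l r =
  \sum_(x \in [set x | E1 x /\ x.1 <= r1]) a x.1 x.2 * (t `^ x.1) * l ^+ x.2 * psum E2 b t l (r - x.1).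
Proof.
move=> f1 f2 f3 t0 E12 Er.
have [m1 h1] := ifin_lower f1.
have [s1 [u1 in1 ->]] := fsum_seq R (f1 r1).
have [s2 [u2 in2 _]] := fsum_seq R (f2 (r - m1)).
have [s3 [u3 in3 e3]] := fsum_seq R (f3 r).
pose F (x y : R * nat) := a x.1 x.2 * b y.1 y.2 * (t `^ (x.1 + y.1)) * l ^+ (x.2 + y.2).
transitivity (\sum_(x <- s1) \sum_(y <- s2 | x.1 + y.1 <= r) F x y); last first.
  apply: eq_big_seq => x /in1[Ex xr]; rewrite (psum_seq _ _ _ u2); last first.
    move=> y Ey yr; apply/in2; split=> //; apply: le_trans yr _.
    by rewrite lerD2l lerN2 ltW // h1.
  rewrite mulr_sumr; rewrite big_seq_cond [RHS]big_seq_cond; apply: eq_big => y.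
    apply/andP/andP => -[ys H]; split=> //; have [Ey _] := (in2 y).1 ys.
      by apply/asboolP; split=> //; rewrite lerBrDl.
    by move/asboolP: H => [_]; rewrite lerBrDl.
  move=> _; rewrite /F powRD; last by rewrite (gt_eqF t0) implybT.
  by rewrite exprD; ring.
rewrite /psum e3.
transitivity (\sum_(z <- s3) \sum_(x <- s1) \sum_(y <- s2 | addp x y == z) F x y).
  apply: eq_big_seq => -[s q] /in3[Ez zr]; rewrite /= in zr *.
  rewrite /conv (fsum_filter (s := [seq (x, y) | x <- s1, y <- s2])); last 2 first.
  - by apply: allpairs_uniq => // -[x y] [x' y'] _ _ [-> ->].
  - move=> [x y] [/= Ex Ey [exy _]]; apply/allpairsP; exists (x, y); split=> //=.
      by apply/in1; split=> //; apply: (Er _ y) => //; rewrite exy.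
    apply/in2; split=> //; have := h1 x Ex; move: exy zr; move: (x.1) (y.1) => X Y; lra.
  rewrite big_mkcond big_allpairs /= !mulr_suml; apply: eq_big_seq => x /in1[Ex _].
  rewrite [RHS]big_mkcond !mulr_suml; apply: eq_big_seq => y /in2[Ey _] /=.
  case: asboolP => [[_ _ exy]|H].
    rewrite exy eqxx /F; case: exy => -> ->; by [].
  case: eqP => [exy|]; last by rewrite !mul0r.
  by case: H.
rewrite exchange_big; apply: eq_big_seq => x /in1[Ex _] /=.
rewrite (eq_bigr (fun z => \sum_(y <- s2) if addp x y == z then F x y else 0)); last first.
  by move=> z _; rewrite big_mkcond.
rewrite exchange_big [RHS]big_mkcond; apply: eq_big_seq => y /in2[Ey _] /=.
rewrite -big_mkcond; case: ifP => xy.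
  rewrite (eq_bigl (pred1 (addp x y))); last by move=> z; rewrite /= eq_sym.
  rewrite -big_filter filter_pred1_uniq ?big_seq1 //.
  by apply/in3; split=> //=; exact: E12.
rewrite big_seq_cond big_pred0 // => z; apply/andP => -[/in3[_ zr] /eqP ez].
by move: xy; rewrite -ez /= in zr; rewrite zr.
Qed.

(** No exponent lies strictly between s - kap s and s, so the difference of the two truncations
    collects exactly the terms of exponent s, with all their logarithms. *)
Lemma psum_group E r (kap : R -> R) : ifin E ->
  (forall s, 0 < kap s) -> (forall s x, E x -> x.1 < s -> x.1 <= s - kap s) ->
  exists ss : seq R, (forall s, s \in ss -> s <= r /\ exists q, E (s, q)) /\
  forall a t l (g : R -> R),
    \sum_(x \in [set x | E x /\ x.1 <= r]) a x.1 x.2 * (t `^ x.1) * l ^+ x.2 * g x.1 =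
    \sum_(s <- ss) (psum E a t l s - psum E a t l (s - kap s)) * g s.
Proof.
move=> fE k0 kE; have [s1 [u1 in1 e1]] := fsum_seq R (fE r).
exists (undup [seq x.1 | x <- s1]); split.
  by move=> s; rewrite mem_undup => /mapP[[x q] /in1[Ex xr] ->]; split=> //; exists q.
move=> a t l g; rewrite e1.
pose F (x : R * nat) := a x.1 x.2 * (t `^ x.1) * l ^+ x.2.
transitivity (\sum_(s <- undup [seq x.1 | x <- s1]) \sum_(x <- s1) if x.1 == s then F x * g s else 0).
  rewrite exchange_big; apply: eq_big_seq => x xs /=; rewrite -big_mkcond.
  rewrite (eq_bigl (pred1 x.1)); last by move=> z; rewrite /= eq_sym.
  rewrite -big_filter filter_pred1_uniq ?undup_uniq ?big_seq1 // mem_undup.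
  by apply/mapP; exists x.
apply: eq_big_seq => s; rewrite mem_undup => /mapP[x0 /in1[E0 x0r] sE].
have sr : s <= r by rewrite sE.
rewrite !(psum_seq _ _ _ u1); last 2 first.
- move=> x Ex xs; apply/in1; split=> //; apply: le_trans xs _.
  by apply: le_trans sr; rewrite gerBl ltW.
- by move=> x Ex xs; apply/in1; split=> //; exact: le_trans xs sr.
rewrite [X in (X - _) * _]big_mkcond [X in (_ - X) * _]big_mkcond -sumrB mulr_suml.
apply: eq_big_seq => x /in1[Ex xr]; rewrite -/(F x).
have ks := k0 s; case: eqVneq => [xs|nxs].
  rewrite asboolT; last by rewrite xs.
  by rewrite asboolF ?subr0 // xs => -[_]; rewrite lerBrDl gerDr leNgt k0.
have -> : `[< E x /\ x.1 <= s >] = `[< E x /\ x.1 <= s - kap s >].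
  apply/asboolP/asboolP => -[_ xs]; split=> //; last by apply: le_trans xs _; rewrite gerBl ltW.
  by apply: kE => //; rewrite lt_neqAle nxs.
by rewrite subrr mul0r.
Qed.

Lemma ifin_gap_below E s : ifin E -> exists2 k : R, 0 < k & forall x, E x -> x.1 < s -> x.1 <= s - k.
Proof.
move=> fE; have [l [ul inl _]] := fsum_seq R (fE s).
suff [k k0 H] : exists2 k : R, 0 < k & forall x, x \in l -> x.1 < s -> x.1 <= s - k.
  by exists k => // x Ex xs; apply: H => //; apply/inl; split=> //; exact: ltW.
elim: l {ul inl} => [|x l [k k0 IH]]; first by exists 1.
have [xs|xs] := ltP x.1 s; last first.
  by exists k => // y; rewrite inE => /orP[/eqP->|/IH//]; rewrite ltNge xs.
exists (Num.min k (s - x.1)); first by rewrite lt_min k0 subr_gt0.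
move=> y; rewrite inE => /orP[/eqP-> _|yl ys].
  by rewrite lerBrDr -lerBrDl ge_min lexx orbT.
by apply: le_trans (IH y yl ys) _; rewrite lerD2l lerN2 ge_min lexx.
Qed.

Lemma psum_gap E a t l r k : (forall x, E x -> r < x.1 -> r + k < x.1) ->
  forall r', r <= r' <= r + k -> psum E a t l r' = psum E a t l r.
Proof.
move=> H r' /andP[rr' r'k]; congr (\sum_(sp \in _) _); apply/seteqP; split=> x [Ex xr]; split=> //.
  by rewrite leNgt; apply/negP => rx; have := H x Ex rx; rewrite ltNge (le_trans xr).
exact: le_trans xr rr'.
Qed.

(** The generator (1, 0) makes the set stable under s -> s + 1, as index sets must be; (0, 0)
    belongs to the constant term of the exponential series. *)
Inductive gen E : set (R * nat) :=
| gen_zero : gen E (0, 0%N)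
| gen_one y : gen E y -> gen E (addp (1, 0%N) y)
| gen_add x y : E x -> 0 < x.1 -> gen E y -> gen E (addp x y).

Lemma gen_nneg E : nneg (gen E).
Proof.
move=> s q; set z := (s, q); rewrite -[s]/(z.1) -[q]/(z.2); move: z => z.
by elim=> [|y _ [] h|x y _ x0 _ [] h]; [right|left|left|left|left]; rewrite /= ?ltr_wpDr ?(ltW h) ?h.1.
Qed.

Lemma gen_ge0 E z : gen E z -> 0 <= z.1.
Proof. by case: z => s q /gen_nneg[/ltW//|[-> _]]. Qed.

Lemma gen_sub E x : nneg E -> E x -> gen E x.
Proof.
move=> nE Ex; have [x0|[x0 q0]] : 0 < x.1 \/ x.1 = 0 /\ x.2 = 0%N by case: x Ex => s q /nE.
  have -> : x = addp x (0, 0%N) by rewrite /addp addr0 addn0; case: (x).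
  by apply: gen_add => //; exact: gen_zero.
by rewrite [x]surjective_pairing x0 q0; exact: gen_zero.
Qed.

Lemma addpA x y z : addp x (addp y z) = addp (addp x y) z.
Proof. by rewrite /addp /= addrA addnA. Qed.

Lemma gen_addp E x y : gen E x -> gen E y -> gen E (addp x y).
Proof.
elim=> [|x' _ IH|x1 x' Ex x0 _ IH] gy; rewrite -?addpA.
- by rewrite /addp /= add0r add0n -surjective_pairing.
- by apply: gen_one; exact: IH.
- by apply: gen_add => //; exact: IH.
Qed.

(** The exponents of all generators are at least some d > 0, so an element of exponent at most (m +
    1) d is either (0, 0) or a generator plus an element of exponent at most m d. *)
Lemma gen_ifin E : ifin E -> ifin (gen E).
Proof.
move=> fE; have [k k0 Hk] := ifin_gap 0 fE.
pose d := Num.min k 1; have d0 : 0 < d by rewrite lt_min k0 ltr01.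
have H m : finite_set [set z | gen E z /\ z.1 <= m%:R * d].
  elim: m => [|m IH].
    apply: (sub_finite_set (B := [set (0, 0%N)])) => // -[s q] [gz /=]; rewrite mul0r => s0.
    by case: (gen_nneg gz) => [|[-> ->]//]; rewrite ltNge s0.
  pose S := [set (1 : R, 0%N)] `|` [set x | E x /\ x.1 <= m.+1%:R * d].
  pose Z := [set z | gen E z /\ z.1 <= m%:R * d].
  apply: (sub_finite_set (B := [set (0, 0%N)] `|` [set addp x y | x in S & y in Z])).
    move=> z [gz]; case: gz => [|y gy|x y Ex x0 gy] zm; first by left.
      right; exists (1, 0%N); [by left|exists y => //; split=> //].
      have d1 : d <= 1 by rewrite ge_min lexx orbT.
      by move: zm; rewrite /= -natr1 mulrDl mul1r; move: (y.1) (_ * d) => Y D; lra.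
    have xd : d < x.1.
      by have := Hk x Ex x0; rewrite add0r; apply: le_lt_trans; rewrite ge_min lexx.
    have y0 := gen_ge0 gy; rewrite /= in zm.
    right; exists x; [right; split=> //|exists y => //; split=> //].
      by move: zm y0; move: (y.1) (_ * d) => Y D; lra.
    by move: zm; rewrite /= -natr1 mulrDl mul1r; move: (y.1) (_ * d) => Y D; lra.
  rewrite finite_setU; split; first exact: finite_set1.
  apply: finite_image2 => //; rewrite finite_setU; split; [exact: finite_set1|exact: fE].
move=> r; apply: sub_finite_set (H (Num.bound (`|r| / d))) => z [gz zr]; split=> //.
apply: le_trans zr _; apply: le_trans (ler_norm r) _.
rewrite -ler_pdivrMr //; apply/ltW/archi_boundP.
by rewrite divr_ge0 // ltW.
Qed.

Lemma gen_index_set E : index_set E -> index_set (gen E).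
Proof.
move=> iE; have fE := index_set_ifin iE; have fG := gen_ifin fE; have [_ _ E1 Ep] := iE; split.
- move=> r; apply: (sub_finite_set (B := fst @` [set z | gen E z /\ z.1 <= r])).
    by move=> s [sr [q gz]]; exists (s, q).
  exact: finite_image.
- move=> s; apply: (sub_finite_set (B := snd @` [set z | gen E z /\ z.1 <= s])).
    by move=> q gz; exists (s, q).
  exact: finite_image.
- move=> s q gz; have -> : (s + 1, q) = addp (1, 0%N) (s, q) by rewrite /addp /= addrC.
  exact: gen_one.
(* A logarithm is removed from a summand that has one, which E permits. *)
suff H z : gen E z -> (0 < z.2)%N -> gen E (z.1, z.2.-1) by move=> s q /H.
elim=> [//|y gy IH|x y Ex x0 gy IH] /=.
  move=> q0; have := gen_one (IH q0); by rewrite /addp /= !add0n.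
have [x20|x20] := posnP x.2.
  by rewrite x20 add0n => /IH; move=> /(gen_add Ex x0); rewrite /addp /= x20.
move=> _; have Ex' : E (x.1, x.2.-1) by apply: Ep => //; rewrite -surjective_pairing.
by have := @gen_add E (x.1, x.2.-1) y Ex' x0 gy; rewrite /addp /=; case: (x.2) x20.
Qed.

Lemma index_set0 : index_set (set0 : set (R * nat)).
Proof.
split=> //.
by move=> r; apply: (sub_finite_set (B := set0)) => // s [_ []].
Qed.

Lemma nneg_inf_ge0 E : nneg E -> inf_ge0 E.
Proof. by move=> nE s q [Es _]; exact: nE. Qed.

(** [inf_ge0] speaks of an infimum, so one has to be exhibited: among the finitely many elements of
    exponent at most s, a minimum for the order that prefers small exponents and then many
    logarithms. *)
Lemma inf_ge0_nneg E : index_set E -> inf_ge0 E -> nneg E.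
Proof.
move=> iE iz; have fE := index_set_ifin iE.
move=> s q Es.
have [l [ul inl _]] := fsum_seq R (fE s).
have sl : (s, q) \in l by apply/inl.
have [x [Ex xs xmin]] : exists x, [/\ E x, x.1 <= s &
    forall y, E y -> x.1 < y.1 \/ (y.1 = x.1 /\ (y.2 <= x.2)%N)].
  pose le (x y : R * nat) := (x.1 < y.1) || ((x.1 == y.1) && (y.2 <= x.2)%N).
  have : exists2 x, x \in l & forall y, y \in l -> le x y.
    have : l != [::] by apply: contraTneq sl => ->.
    elim: (l) => // x [|y l'] IH _.
      by exists x => [|y]; rewrite !inE // => /eqP ->; rewrite /le eqxx leqnn orbT.
    have [//|z zl zm] := IH; have [xz|xz] := boolP (le x z).
      exists x; rewrite ?mem_head // => w; rewrite in_cons => /orP[/eqP->|/zm].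
        by rewrite /le eqxx leqnn orbT.
      move: xz; rewrite /le => /orP[h|/andP[/eqP h1 h2]] /orP[h'|/andP[/eqP h1' h2']].
      - by rewrite (lt_trans h h').
      - by rewrite -h1' h.
      - by rewrite h1 h'.
      - by rewrite h1 h1' eqxx (leq_trans h2' h2) orbT.
    exists z; first by rewrite in_cons zl orbT.
    move=> w; rewrite in_cons => /orP[/eqP->|/zm//].
    move: xz; rewrite /le negb_or negb_and -leNgt -ltnNge => /andP[h1 /orP[h2|h2]].
      by rewrite lt_neqAle eq_sym h2 h1.
    by case: ltgtP h1 => //= _; rewrite ltnW.
  move=> [x /inl[Ex xs] xm]; exists x; split=> // y Ey.
  have [ys|ys] := leP y.1 s; last by left; exact: le_lt_trans xs ys.
  have /xm : y \in l by apply/inl.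
  by move=> /orP[|/andP[/eqP-> ]]; [left|right].
have ix : is_inf E x.1 x.2.
  by split=> [|s' q' /xmin//]; rewrite -surjective_pairing.
have [x0|[x0 q0]] := iz _ _ ix; [left|].
- exact: lt_le_trans x0 xs.
by have /= := xmin _ Es; rewrite x0 q0 leqn0 => -[|[-> /eqP]]; [left|right].
Qed.

End Series.

(** * Conormal remainders *)

Section Geo.
Variables (R : realType) (T : topologicalType).

Lemma interior_pts_pts n (M : mfd R T n) x : interior_pts M x -> pts M x.
Proof. by case=> c [sc cx _]; exact: schart_pts cx. Qed.

Lemma interior_not_bhs n (M : mfd R T n) G x : good M -> interior_pts M x -> bhs M G -> ~ G x.
Proof.
move=> gM ix bG Gx; have [c ac cx] := gM.1.2 x (interior_pts_pts ix); have sc := gM.1.1 _ ac.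
have [e [Gf fr]] := good_frame gM sc cx; have [i ci _] := frame_through cx fr bG Gx.
by have /(interiorE gM.1 sc cx) /(_ i) := ix; rewrite ci ltxx.
Qed.

(** Compactness as a property of near coverings, with the constant C tending to infinity as
    parameter; monotonicity in C makes the local bounds eventual. *)
Lemma compact_local_bound (K : set T) (P : R -> T -> Prop) : compact K ->
  (forall C C' x, K x -> C <= C' -> P C x -> P C' x) ->
  (forall x, K x -> exists (O : set T) (C : R), [/\ open O, O x & forall y, O y -> K y -> P C y]) ->
  exists C, forall y, K y -> P C y.
Proof.
move=> cK mP H; have := compact_near_coveringP K; case=> /(_ cK) nc _.
have [|C [_ HC]] := nc _ (+oo : set_system R) (fun C y => K y -> P C y) _.
  move=> x Kx; have [O [C [oO Ox HO]]] := H x Kx.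
  exists (O, [set C' | C <= C']); first split => /=.
  - by apply: open_nbhs_nbhs.
  - by apply: nbhs_pinfty_ge; exact: num_real.

  by move=> [y C'] [/= Oy CC'] Ky; apply: (mP C C' y Ky CC'); exact: HO.
by exists (C + 1) => y Ky; apply: HC => //; rewrite ltrDl.
Qed.

Section Triv.
Variables (n : nat) (M : mfd R T n.+1).
Hypothesis gM : good M.
Variables (F U : set T) (pr : T -> T) (rho : T -> R).
Hypotheses (bF : bhs M F) (tr : trivialization M F U pr rho).
Let oU := triv_open tr.
Let N := face M F (F `&` U).
Let gN : good N := face_good gM bF oU.
Let Om := U `&` interior_pts M.

Lemma rho_smooth : smooth_fun M U rho.
Proof.
apply: (smooth_funP gM.1) => x Ux px.
have [D [sD Dx DU aD [D0 Dp Dpr _]]] := triv_chart gM bF tr Ux.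
have [O [oO Ox HO]] := dom_open sD Dx.
exists D, O; split=> //.
have := smooth_fun_coord gM.1 (A := dom D) ord0 sD (fun _ h => h).
move=> /(_ D sD); rewrite setIid.
have -> : (fun y => crd D y ord0 ord0) = rho by apply/funext => y; rewrite D0.
by apply: smooth_on_sub => _ [y [_ Dy] <-]; exists y.
Qed.

Lemma rho_pos x : Om x -> 0 < rho x.
Proof.
move=> [Ux ix]; have [D [sD Dx DU aD [D0 Dp Dpr _]]] := triv_chart gM bF tr Ux.
by have /(interiorE gM.1 sD Dx)/(_ ord0) := ix; rewrite D0.
Qed.

Lemma pull_smooth a : smooth_fun N (interior_pts N) a -> smooth_fun M Om (fun x => a (pr x)).
Proof.
move=> sa; apply: (smooth_funP gM.1) => x [Ux ix] px.
have [D [sD Dx DU aD [D0 Dp Dpr _]]] := triv_chart gM bF tr Ux.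
have sf := fch_schart gM bF oU sD aD; set c := fch F U D ord0 in sf.
exists D, setT; split=> //; first exact: openT.
have [_ Up _ _ _] := tr.
rewrite setIT; set S := crd D @` _.
pose S' := crd c @` (interior_pts N `&` dom c).
have cp y : Om y -> dom D y -> [/\ dom c (pr y), interior_pts N (pr y) &
    crd c (pr y) = \row_j crd D y ord0 (lift ord0 j)].
  move=> [Uy iy] dy; have [Fy Uy'] := Up y Uy.
  split; [by split; [exact: Dp|split]|exact: (triv_interior gM bF tr)|].
  by apply/rowP => j; rewrite /= Dpr // col'_ins !mxE.
have : smooth_on S (fun z => rep c a (\row_j z ord0 (lift ord0 j))).
  apply: (smooth_on_comp (S' := S')) (sa c sf) => [j|_ [y [Oy dy] <-]].
    exact: smooth_on_coord.
  by have [dc ic <-] := cp y Oy dy; exists (pr y).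
apply: smooth_on_eq => _ [y [Oy dy] <-]; have [dc ic <-] := cp y Oy dy.
by rewrite (rep_dom _ sf dc) (rep_dom _ sD dy).
Qed.

Lemma term_smooth a s q : smooth_fun N (interior_pts N) a ->
  smooth_fun M Om (fun x => a (pr x) * rho x `^ s * ln (rho x) ^+ q).
Proof.
move=> sa; have sr : smooth_fun M Om rho by apply: smooth_fun_sub rho_smooth => x [].
have sl : smooth_fun M Om (fun x => ln (rho x)) by apply: smooth_fun_ln sr => x; exact: rho_pos.
apply: smooth_fun_mul.
  apply: smooth_fun_mul; first exact: pull_smooth.
  apply: smooth_fun_eq (smooth_fun_exp (smooth_fun_mul (@smooth_fun_cst _ _ _ M Om s) sl)) => x Ox.
  by rewrite /powR gt_eqF // rho_pos.
have -> : (fun x => ln (rho x) ^+ q) = fun x => \prod_(i < q) ln (rho x).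
  by apply/funext => x; rewrite prodr_const card_ord.
exact: smooth_fun_prod.
Qed.

Lemma pexp_smooth E a r : ifin E -> (forall s q, E (s, q) -> smooth_fun N (interior_pts N) (a s q)) ->
  smooth_fun M Om (partial_expansion E a pr rho r).
Proof.
move=> fE sa; have [l [ul inl el]] := fsum_seq R (fE r).
have -> : partial_expansion E a pr rho r = fun x => \sum_(sp <- l)
    (if `[< E sp >] then a sp.1 sp.2 else fun=> 0) (pr x) * rho x `^ sp.1 * ln (rho x) ^+ sp.2.
  apply/funext => x; rewrite /partial_expansion el; apply: eq_big_seq => sp /inl[Es _].
  by rewrite asboolT.
apply: smooth_fun_sum => sp; apply: term_smooth; case: asboolP => [Es|_].
  by apply: sa; rewrite -surjective_pairing.
exact: smooth_fun_cst.
Qed.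

Section Weights.
Variables (rhos : set T -> T -> R).
Hypothesis hrhos : forall G, bhs M G -> is_bdf M U G (rhos G).
Variables (k : nat) (G : 'I_k -> set T).
Hypothesis bG : forall i, bhs M (G i).

Definition bprod (x : T) : R := \prod_(i < k) rhos (G i) x.

Lemma bprod_pos x : Om x -> 0 < bprod x.
Proof.
move=> [Ux ix]; apply: prodr_gt0 => i _; have [_ h0 hz _] := hrhos (bG i).
rewrite lt0r h0 // andbT; apply/eqP => /hz -/(_ Ux); exact: (interior_not_bhs gM ix (bG i)).
Qed.

Lemma bprod_smooth : smooth_fun M U bprod.
Proof. by apply: smooth_fun_prod => i; have [] := hrhos (bG i). Qed.

Lemma bprodN x m : \prod_(i < k) rhos (G i) x ^- m = bprod x ^- m.
Proof. by rewrite /bprod prodfV prodrXl. Qed.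

Lemma weights_bounded x0 : U x0 -> exists2 B : R, 1 <= B &
  inear M x0 (fun y => [/\ U y, rho y <= B & bprod y <= B]).
Proof.
move=> Ux; have [UM HU] := relopenE oU; have [O [oO Ox OU]] := HU x0 Ux.
have OU' y : O y -> pts M y -> U y by move=> Oy py; apply: OU.
have [O1 [C1 [o1 x1 C10 H1]]] := smooth_locally_bounded gM oO Ox (UM _ Ux) OU' rho_smooth.
have [O2 [C2 [o2 x2 C20 H2]]] := smooth_locally_bounded gM oO Ox (UM _ Ux) OU' bprod_smooth.
exists (1 + C1 + C2); first by rewrite -addrA lerDl addr_ge0 ?ltW.
exists (O `&` O1 `&` O2); split=> //; first by do 2?apply: openI.
move=> y [[Oy Oy1] Oy2] iy; have py := interior_pts_pts iy; split; first exact: OU'.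
  apply: le_trans (ler_norm _) _; apply: le_trans (H1 y Oy1 py) _; move: C10 C20; lra.
apply: le_trans (ler_norm _) _; apply: le_trans (H2 y Oy2 py) _; move: C10 C20; lra.
Qed.

End Weights.

Lemma Om_rho_bprod_ge0 rhos k (G : 'I_k -> set T) r m x : (forall G, bhs M G -> is_bdf M U G (rhos G)) ->
  (forall i, bhs M (G i)) -> Om x -> 0 <= rho x `^ r * bprod rhos G x ^- m.
Proof.
move=> hr bG Ox; rewrite mulr_ge0 ?powR_ge0 ?invr_ge0 ?exprn_ge0 //.
exact/ltW/(bprod_pos hr bG Ox).
Qed.

(** The constant C may be found locally, by compactness of K. The exponent m may not: it is fixed
    before the order r and the point. *)
Lemma conormal_local rhos EF u a : (forall G, bhs M G -> is_bdf M U G (rhos G)) ->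
  (forall K, compact K -> K `<=` U -> exists (k : nat) (G : 'I_k -> set T),
    (forall i, [/\ bhs M (G i), G i <> F & G i `&` F !=set0]) /\
    forall Vs : seq ((T -> R) -> (T -> R)),
    (forall j, (j < size Vs)%N -> tangent_field M U (nth id Vs j)) ->
    exists m : nat, forall r x0, K x0 -> exists (O : set T) (C : R), [/\ open O, O x0 &
      forall x, O x -> K x -> interior_pts M x ->
      `|foldr (fun V f => V f) (fun z => u z - partial_expansion EF a pr rho r z) Vs x|
      <= C * (rho x `^ r * bprod rhos G x ^- m)]) ->
  conormal_expansion M F U pr rho rhos EF u a.
Proof.
move=> hr H K cK KU; have [k [G [HG Hk]]] := H K cK KU; exists k, G; split=> // Vs tV.
have bG i : bhs M (G i) by case: (HG i).
have [m Hm] := Hk Vs tV; exists m => r.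
have [||C HC] := compact_local_bound (P := fun C x => interior_pts M x ->
   `|foldr (fun V f => V f) (fun z => u z - partial_expansion EF a pr rho r z) Vs x|
      <= C * (rho x `^ r * bprod rhos G x ^- m)) cK.
- move=> C C' x Kx CC' h ix; apply: le_trans (h ix) _; rewrite ler_wpM2r //.
  exact: (Om_rho_bprod_ge0 _ _ hr bG (conj (KU _ Kx) ix)).
- move=> x0 Kx0; have [O [C [oO Ox HO]]] := Hm r x0 Kx0.
  by exists O, C; split=> // y Oy Ky iy; exact: HO.
by exists C => x Kx ix; rewrite bprodN -mulrA; exact: HC.
Qed.

Definition letters (Vs : seq ((T -> R) -> (T -> R))) : set ((T -> R) -> (T -> R)) :=
  [set V | exists2 j, (j < size Vs)%N & V = nth id Vs j].

(** There are finitely many words of length at most k over a finite alphabet. *)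
Lemma seq_uniform m (Q : seq 'I_m -> nat -> Prop) :
  (forall w i j, (i <= j)%N -> Q w i -> Q w j) -> (forall w, exists i, Q w i) ->
  forall k, exists i, forall w, (size w <= k)%N -> Q w i.
Proof.
move=> mQ exQ k; elim: k Q mQ exQ => [|k IH] Q mQ exQ; have [i0 Q0] := exQ [::].
  by exists i0 => w; rewrite leqn0 => /nilP ->.
have H (j : 'I_m) : exists i, forall w, (size w <= k)%N -> Q (j :: w) i.
  by apply: (IH (fun w => Q (j :: w))) => [w|w]; [exact: mQ|exact: exQ].
have [f Hf] := choice H.
exists (maxn i0 (\max_j f j)) => -[_|j w sw]; first by apply: mQ Q0; exact: leq_maxl.
apply: mQ (Hf j w sw); apply: leq_trans (leq_maxr _ _); exact: leq_bigmax.
Qed.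

Lemma letters_word Vs (w : seq ((T -> R) -> (T -> R))) :
  (forall j, (j < size w)%N -> letters Vs (nth id w j)) ->
  exists w' : seq 'I_(size Vs), w = [seq nth id Vs (val i) | i <- w'].
Proof.
elim: w => [|V w IH] H; first by exists [::].
have [|w' ->] := IH; first by move=> j jw; exact: (H j.+1).
by have [j js /= ->] := H 0%N isT; exists (Ordinal js :: w').
Qed.

(** [phg] gives an exponent for one sequence of fields, whereas the estimates below involve all
    words in these fields up to length l, with a common m. Raising the exponent is harmless as the
    defining functions are bounded on K. *)
Lemma conormal_words rhos EF u a K : (forall G, bhs M G -> is_bdf M U G (rhos G)) ->
  conormal_expansion M F U pr rho rhos EF u a -> compact K -> K `<=` U ->
  exists (k : nat) (G : 'I_k -> set T),
    (forall i, [/\ bhs M (G i), G i <> F & G i `&` F !=set0]) /\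
    forall Vs : seq ((T -> R) -> (T -> R)),
    (forall j, (j < size Vs)%N -> tangent_field M U (nth id Vs j)) ->
    forall l, exists m, forall r, words (letters Vs) (K `&` interior_pts M) l
      (fun x => rho x `^ r * bprod rhos G x ^- m)
      (fun z => u z - partial_expansion EF a pr rho r z).
Proof.
move=> hr Hr cK KU; have [k [G [HG Hk]]] := Hr K cK KU; exists k, G; split=> // Vs tV l.
have bG i : bhs M (G i) by case: (HG i).
have [B [B1 HB]] : exists B : R, 1 <= B /\ forall x, K x -> interior_pts M x -> bprod rhos G x <= B.
  have [||B HB] := compact_local_bound (P := fun B x => interior_pts M x -> bprod rhos G x <= B) cK.
  - by move=> C C' x Kx CC' h ix; exact: le_trans (h ix) CC'.
  - move=> x0 Kx0; have [B B1 [O [oO Ox HO]]] := weights_bounded hr bG (KU _ Kx0).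
    by exists O, B; split=> // y Oy Ky iy; case: (HO y Oy iy).
  exists (Num.max 1 B); rewrite le_max lexx; split=> // x Kx ix.
  by rewrite le_max HB // orbT.
pose Q (w : seq 'I_(size Vs)) m := forall r, exists C, forall x, K x -> interior_pts M x ->
  `|foldr (fun V f => V f) (fun z => u z - partial_expansion EF a pr rho r z)
     [seq nth id Vs (val i) | i <- w] x| <= C * (rho x `^ r * bprod rhos G x ^- m).
have [||m Hm] := @seq_uniform _ Q _ _ l.
- move=> w i j ij H r; have [C HC] := H r; exists (`|C| * B ^+ (j - i)) => x Kx ix.
  have Ox : Om x by split=> //; exact: KU.
  apply: le_trans (HC x Kx ix) _.
  apply: (@le_trans _ _ (`|C| * (rho x `^ r * bprod rhos G x ^- i))).
    by rewrite ler_wpM2r ?ler_norm // (Om_rho_bprod_ge0 _ _ hr bG Ox).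
  rewrite -[leRHS]mulrA ler_wpM2l // mulrCA ler_wpM2l ?powR_ge0 //.
  have b0 := bprod_pos hr bG Ox; rewrite -{2}(subnK ij) exprD invfM mulrA.
  rewrite ler_peMl ?invr_ge0 ?exprn_ge0 ?(ltW b0) // ler_pdivlMr ?exprn_gt0 // mul1r.
  by rewrite lerXn2r ?nnegrE ?(ltW b0) ?(le_trans ler01 B1) ?HB.
- move=> w; have [|m Hm] := Hk [seq nth id Vs (val i) | i <- w].
    elim: w => [//|i w IH] [|j] /=; first by move=> _; exact: tV.
    exact: IH.
  by exists m => r; have [C HC] := Hm r; exists C => x Kx ix; rewrite mulrA -bprodN; exact: HC.
exists m => r w sw Lw; have [w' E] := letters_word Lw; rewrite E in sw *.
rewrite size_map in sw; have [C HC] := Hm w' sw r.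
by exists C => x [Kx ix]; exact: HC.
Qed.

Lemma letters_tangent Vs V : (forall j, (j < size Vs)%N -> tangent_field M U (nth id Vs j)) ->
  letters Vs V -> derivation M U V.
Proof. by move=> tV [j js ->]; apply: (tangent_derivation gM.1 oU); exact: tV. Qed.

(** Two expansions come with different lists of hypersurfaces and different exponents; the lists are
    concatenated and the exponents added. *)
Lemma conormal_words2 rhos E1 E2 u v a b K : (forall G, bhs M G -> is_bdf M U G (rhos G)) ->
  conormal_expansion M F U pr rho rhos E1 u a -> conormal_expansion M F U pr rho rhos E2 v b ->
  compact K -> K `<=` U ->
  exists (k : nat) (G : 'I_k -> set T),
    (forall i, [/\ bhs M (G i), G i <> F & G i `&` F !=set0]) /\
    forall Vs : seq ((T -> R) -> (T -> R)),
    (forall j, (j < size Vs)%N -> tangent_field M U (nth id Vs j)) ->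
    forall l, exists m, forall r, words (letters Vs) (K `&` interior_pts M) l
        (fun x => rho x `^ r * bprod rhos G x ^- m)
        (fun z => u z - partial_expansion E1 a pr rho r z) /\
      words (letters Vs) (K `&` interior_pts M) l
        (fun x => rho x `^ r * bprod rhos G x ^- m)
        (fun z => v z - partial_expansion E2 b pr rho r z).
Proof.
move=> hr H1 H2 cK KU.
have [k1 [G1 [HG1 W1]]] := conormal_words hr H1 cK KU.
have [k2 [G2 [HG2 W2]]] := conormal_words hr H2 cK KU.
pose G (i : 'I_(k1 + k2)) := match fintype.split i with inl j => G1 j | inr j => G2 j end.
have HG i : [/\ bhs M (G i), G i <> F & G i `&` F !=set0] by rewrite /G; case: fintype.split.
exists (k1 + k2)%N, G; split=> // Vs tV l.
have [m1 {}W1] := W1 Vs tV l; have [m2 {}W2] := W2 Vs tV l.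
have b1 i : bhs M (G1 i) by case: (HG1 i).
have b2 i : bhs M (G2 i) by case: (HG2 i).
have bE x : bprod rhos G x = bprod rhos G1 x * bprod rhos G2 x.
  rewrite /bprod big_split_ord; congr (_ * _); apply: eq_bigr => i _; rewrite /G.
    by rewrite (unsplitK (inl i)).
  by rewrite (unsplitK (inr i)).
have [B [B1 HB]] : exists B : R, 1 <= B /\ forall x, K x -> interior_pts M x ->
    bprod rhos G1 x <= B /\ bprod rhos G2 x <= B.
  have [||B HB] := compact_local_bound (P := fun B x => interior_pts M x ->
     bprod rhos G1 x <= B /\ bprod rhos G2 x <= B) cK.
  - by move=> C C' x Kx CC' h ix; have [h1 h2] := h ix; split; exact: le_trans CC'.
  - move=> x0 Kx0; have [B B1 N1] := weights_bounded hr b1 (KU _ Kx0).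
    have [B' B1' N2] := weights_bounded hr b2 (KU _ Kx0).
    have [O [oO Ox HO]] := inear_and N1 N2.
    exists O, (Num.max B B'); split=> // y Oy Ky iy; have [[_ _ h] [_ _ h']] := HO y Oy iy.
    by rewrite !le_max h h' orbT.
  exists (Num.max 1 B); rewrite le_max lexx; split=> // x Kx ix.
  by have [h1 h2] := HB x Kx ix; rewrite !le_max h1 h2 !orbT.
have key (x y : R) i j : 0 < x <= B -> 0 < y <= B -> x ^- i <= B ^+ (j + (i + j)) * (x * y) ^- (i + j).
  move=> /andP[x0 xB] /andP[y0 yB].
  have -> : x ^- i = x ^+ j * y ^+ (i + j) * (x * y) ^- (i + j).
    rewrite exprMn invfM [x ^+ (i + j)]exprD; have := expf_neq0 i (lt0r_neq0 x0).
    have := expf_neq0 j (lt0r_neq0 x0); have := expf_neq0 (i + j) (lt0r_neq0 y0).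
    move=> h1 h2 h3; rewrite mulrACA divff // mulr1 invfM mulrCA divff // mulr1.
    by [].
  rewrite ler_wpM2r ?invr_ge0 ?exprn_ge0 ?mulr_ge0 ?(ltW x0) ?(ltW y0) //.
  rewrite [B ^+ _]exprD; apply: ler_pM; rewrite ?exprn_ge0 ?(ltW x0) ?(ltW y0) //.
    by rewrite lerXn2r // nnegrE ltW // (lt_le_trans x0).
  by rewrite lerXn2r // nnegrE ltW // (lt_le_trans y0).
exists (m1 + m2)%N => r; split=> w sw Lw.
  have [C HC] := W1 r w sw Lw; exists (`|C| * B ^+ (m2 + (m1 + m2))) => x [Kx ix].
  have Ox : Om x by split=> //; exact: KU.
  have [h1 h2] := HB x Kx ix; have p1 := bprod_pos hr b1 Ox; have p2 := bprod_pos hr b2 Ox.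
  apply: le_trans (HC x (conj Kx ix)) _.
  apply: (@le_trans _ _ (`|C| * (rho x `^ r * bprod rhos G1 x ^- m1))).
    by rewrite ler_wpM2r ?ler_norm // (Om_rho_bprod_ge0 _ _ hr b1 Ox).
  rewrite -[leRHS]mulrA ler_wpM2l // mulrCA ler_wpM2l ?powR_ge0 // bE.
  by apply: key; rewrite ?p1 ?p2.
have [C HC] := W2 r w sw Lw; exists (`|C| * B ^+ (m1 + (m2 + m1))) => x [Kx ix].
have Ox : Om x by split=> //; exact: KU.
have [h1 h2] := HB x Kx ix; have p1 := bprod_pos hr b1 Ox; have p2 := bprod_pos hr b2 Ox.
apply: le_trans (HC x (conj Kx ix)) _.
apply: (@le_trans _ _ (`|C| * (rho x `^ r * bprod rhos G2 x ^- m2))).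
  by rewrite ler_wpM2r ?ler_norm // (Om_rho_bprod_ge0 _ _ hr b2 Ox).
rewrite -[leRHS]mulrA ler_wpM2l // mulrCA ler_wpM2l ?powR_ge0 // bE (mulrC (bprod rhos G1 x)) (addnC m1 m2).
by apply: key; rewrite ?p1 ?p2.
Qed.

End Triv.
End Geo.

(** * Products of polyhomogeneous functions *)

Section Algebra.
Variables (R : realType) (T : topologicalType).

Lemma words_sub (L : set ((T -> R) -> (T -> R))) (A A' : set T) k (g f : T -> R) :
  A' `<=` A -> words L A k g f -> words L A' k g f.
Proof. by move=> AA H w sw Lw; have [C HC] := H w sw Lw; exists C => x /AA; exact: HC. Qed.

Section Words1.
Variables (n : nat) (M : mfd R T n) (U : set T) (L : set ((T -> R) -> (T -> R))) (A : set T).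
Hypothesis dL : forall V, L V -> derivation M U V.
Hypothesis AO : A `<=` U `&` interior_pts M.

Lemma words_cls k g f : (forall x, A x -> 0 <= g x) -> words L A k g f -> cls L A (fun=> 1) k g f.
Proof.
move=> g0 w; apply: (cls_words (fun _ _ => ltr01) ler01 ler01 _ _ _ _ w) => //.
- by move=> x Ax; rewrite !g0.
- by have [//|//|C HC] := w [::]; exists C.
- by move=> x Ax; rewrite mul1r divr1.
Qed.

End Words1.

Lemma cls_letters (A : set T) (p g f : T -> R) (Vs : seq ((T -> R) -> (T -> R))) :
  cls (letters Vs) A p (size Vs) g f ->
  exists C, forall x, A x -> `|foldr (fun V h => V h) f Vs x| <= C * (g x * p x ^- size Vs).
Proof. by move=> H; apply: (cls_unwords H) => // j js; exists j. Qed.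

Lemma powR_le_shift (t B x y : R) : 0 < t <= B -> x <= y -> t `^ y <= B `^ (y - x) * t `^ x.
Proof.
move=> /andP[t0 tB] xy; have -> : t `^ y = t `^ (y - x) * t `^ x.
  by rewrite -powRD ?subrK // (gt_eqF t0) implybT.
rewrite ler_wpM2r ?powR_ge0 //; apply: ge0_ler_powR; rewrite ?nnegrE ?subr_ge0 ?(ltW t0) //.
exact: le_trans (ltW t0) tB.
Qed.

Lemma gap_fun E (k : R) : ifin E -> 0 < k -> exists kap : R -> R, (forall s, 0 < kap s <= k) /\
  forall s x, E x -> x.1 < s -> x.1 <= s - kap s.
Proof.
move=> fE k0.
have [f Hf] := choice (fun s => (fun h => ex_intro (fun k' => 0 < k' /\ forall x, E x -> x.1 < s -> x.1 <= s - k')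
  (s2val h) (conj (s2valP h) (s2valP' h))) (cid2 (ifin_gap_below s fE))).
exists (fun s => Num.min k (f s)); split=> [s|s x Ex xs].
  by rewrite lt_min k0 (Hf s).1 ge_min lexx.
by apply: le_trans ((Hf s).2 x Ex xs) _; rewrite lerD2l lerN2 ge_min lexx orbT.
Qed.

Definition ifam n (M : mfd R T n) (E : set T -> set (R * nat)) := forall G, bhs M G -> ifin (E G).

Lemma face_ifam n (M : mfd R T n.+1) F U E : good M -> bhs M F -> relopen (pts M) U ->
  ifam M E -> ifam (face M F (F `&` U)) (face_index M F E).
Proof.
move=> gM bF oU iE H bH; have [G [bG GF HG _]] := face_bhs_sub gM bF oU bH.
by rewrite (face_index_uniq gM bF oU E bH bG GF HG); exact: iE.
Qed.

Lemma phg_ext n (M : mfd R T n) E E' u : (forall G, bhs M G -> E G = E' G) ->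
  phg M E u -> phg M E' u.
Proof.
case: n M => [//|n] M EE [su H]; split=> // F U pr rho bF tr.
have fE : face_index M F E = face_index M F E'.
  apply/funext => H0; apply/seteqP; split=> sp [G [bG GF HG EG]]; exists G; split=> //.
    by rewrite -EE.
  by rewrite EE.
by have := H F U pr rho bF tr; rewrite -(EE F bF) fE.
Qed.

Lemma phg_lin n (M : mfd R T n) E u v c : good M -> ifam M E -> phg M E u -> phg M E v ->
  phg M E (fun x => u x + c * v x).
Proof.
elim: n M E u v => [|n IH] M E u v gM iE hu hv.
  by apply: smooth_fun_add => //; apply: smooth_fun_mul => //; exact: smooth_fun_cst.
have su := phg_smooth hu; have sv := phg_smooth hv.
split; first by apply: smooth_fun_add => //; apply: smooth_fun_mul => //; exact: smooth_fun_cst.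
move=> F U pr rho bF tr; have oU := triv_open tr; have gN := face_good gM bF oU.
have [_ Hu] := hu; have [a [Ha Hau]] := Hu F U pr rho bF tr.
have [_ Hv] := hv; have [b [Hb Hbv]] := Hv F U pr rho bF tr.
exists (fun s q x => a s q x + c * b s q x); split.
  move=> s q Es; apply: IH => //; [exact: face_ifam|exact: Ha|exact: Hb].
move=> rhos hr; apply: (conormal_local gM hr) => K cK KU.
have [k [G [HG W]]] := conormal_words2 gM bF tr hr (Hau rhos hr) (Hbv rhos hr) cK KU.
exists k, G; split=> // Vs tV; have [m {}W] := W Vs tV (size Vs).
have bG i : bhs M (G i) by case: (HG i).
exists m => r x0 Kx0; exists setT.
pose A := K `&` interior_pts M.
have AO : A `<=` U `&` interior_pts M by move=> x [/KU].
have dL V : letters Vs V -> derivation M U V by exact: (letters_tangent gM tr tV).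
pose g x := rho x `^ r * bprod rhos G x ^- m.
have g0 x : A x -> 0 <= g x by move=> /AO Ox; exact: (Om_rho_bprod_ge0 gM rho r m hr bG Ox).
have [W1 W2] := W r.
have sp E' a' : ifin (E F) -> E' = E F -> (forall s q, E' (s, q) -> phg (face M F (F `&` U)) (face_index M F E) (a' s q)) ->
    smooth_fun M (U `&` interior_pts M) (partial_expansion E' a' pr rho r).
  move=> fE -> Ha'; apply: (pexp_smooth gM bF tr r fE) => s q Es; exact: (phg_smooth (Ha' s q Es)).
have sr1 : smooth_fun M (U `&` interior_pts M) (fun z => u z - partial_expansion (E F) a pr rho r z).
  have -> : (fun z => u z - partial_expansion (E F) a pr rho r z) =
     (fun z => u z + (-1) * partial_expansion (E F) a pr rho r z) by apply/funext => z; rewrite mulN1r.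
  apply: smooth_fun_add; first by apply: smooth_fun_sub su => x [].
  apply: smooth_fun_mul; first exact: smooth_fun_cst.
  by apply: sp => //; exact: iE.
have sr2 : smooth_fun M (U `&` interior_pts M) (fun z => v z - partial_expansion (E F) b pr rho r z).
  have -> : (fun z => v z - partial_expansion (E F) b pr rho r z) =
     (fun z => v z + (-1) * partial_expansion (E F) b pr rho r z) by apply/funext => z; rewrite mulN1r.
  apply: smooth_fun_add; first by apply: smooth_fun_sub sv => x [].
  apply: smooth_fun_mul; first exact: smooth_fun_cst.
  by apply: sp => //; exact: iE.
have E0 : (fun z => u z + c * v z - partial_expansion (E F) (fun s q x => a s q x + c * b s q x) pr rho r z) =
    (fun z => (u z - partial_expansion (E F) a pr rho r z) + c * (v z - partial_expansion (E F) b pr rho r z)).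
  apply/funext => z; rewrite /partial_expansion; have [l [ul inl el]] := fsum_seq R (iE F bF r).
  rewrite !el mulrBr -addrACA -opprD mulr_sumr -big_split; congr (_ - _).
  by apply: eq_bigr => sp' _ /=; ring.
have : cls (letters Vs) A (fun=> 1) (size Vs) g
    (fun z => (u z - partial_expansion (E F) a pr rho r z) + c * (v z - partial_expansion (E F) b pr rho r z)).
  apply: (cls_add dL AO) => //.
  - by apply: smooth_fun_mul => //; exact: smooth_fun_cst.
  - exact: words_cls.
  - by apply: (cls_scale dL AO) => //; exact: words_cls.
move=> /cls_letters[C HC]; exists C; split=> //; first exact: openT.
move=> x _ Kx ix; rewrite E0; apply: le_trans (HC x (conj Kx ix)) _.
by rewrite expr1n invr1 mulr1.
Qed.

Lemma phg_zero n (M : mfd R T n) E : good M -> phg M E (fun=> 0).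
Proof.
elim: n M E => [|n IH] M E gM; first exact: smooth_fun_cst.
split; first exact: smooth_fun_cst.
move=> F U pr rho bF tr; have oU := triv_open tr.
exists (fun _ _ _ => 0); split; first by move=> s q _; apply: IH; exact: (face_good gM bF oU).
move=> rhos hr; apply: (conormal_local gM hr) => K cK KU.
exists 0%N, (fun=> F); split; first by case.
move=> Vs tV; exists 0%N => r x0 Kx0; exists setT.
have dL V : letters Vs V -> derivation M U V by exact: (letters_tangent gM tr tV).
have AO : (K `&` interior_pts M) `<=` U `&` interior_pts M by move=> x [/KU].
have E0 : (fun z => 0 - partial_expansion (E F) (fun _ _ _ => 0) pr rho r z) = (fun=> 0).
  apply/funext => z; rewrite sub0r /partial_expansion fsbig1 ?oppr0 // => sp _.
  by rewrite !mul0r.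
have c0 : cls (letters Vs) (K `&` interior_pts M) (fun=> 1) (size Vs) (fun=> 0) (fun=> 0 : R).
  by apply: (cls_cst dL (fun=> 1) AO); exists 0 => x _; rewrite normr0 mul0r.
have [C HC] := cls_letters c0.
exists 0; split=> //; first exact: openT.
move=> x _ Kx ix; rewrite E0 mul0r; apply: le_trans (HC x (conj Kx ix)) _.
by rewrite mul0r mulr0.
Qed.

Lemma phg_sum n (M : mfd R T n) E (I : eqType) (r : seq I) (f : I -> T -> R) : good M -> ifam M E ->
  (forall i, i \in r -> phg M E (f i)) -> phg M E (fun x => \sum_(i <- r) f i x).
Proof.
move=> gM iE; elim: r => [|i r IH] H.
  have -> : (fun x => \sum_(i <- [::]) f i x) = (fun=> 0) by apply/funext => x; rewrite big_nil.
  exact: phg_zero.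
have -> : (fun x => \sum_(j <- i :: r) f j x) = (fun x => f i x + 1 * \sum_(j <- r) f j x).
  by apply/funext => x; rewrite big_cons mul1r.
apply: phg_lin => //; first by apply: H; rewrite mem_head.
by apply: IH => j jr; apply: H; rewrite in_cons jr orbT.
Qed.


Section Remainders.
Variables (n : nat) (M : mfd R T n.+1).
Hypothesis gM : good M.
Variables (F U : set T) (pr : T -> T) (rho : T -> R).
Hypotheses (bF : bhs M F) (tr : trivialization M F U pr rho).
Let N := face M F (F `&` U).
Local Notation Om := (U `&` interior_pts M).
Local Notation sm := (smooth_fun M Om).

Definition remainder (E : set (R * nat)) (a : R -> nat -> T -> R) (u : T -> R) r x :=
  u x - partial_expansion E a pr rho r x.

Lemma smooth_fun_sub2 f g : sm f -> sm g -> sm (fun x => f x - g x).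
Proof.
move=> sf sg; have -> : (fun x => f x - g x) = (fun x => f x + (-1) * g x).
  by apply/funext => x; rewrite mulN1r.
by apply: smooth_fun_add => //; apply: smooth_fun_mul => //; exact: smooth_fun_cst.
Qed.

Lemma rem_smooth E a u r : ifin E -> (forall s q, E (s, q) -> smooth_fun N (interior_pts N) (a s q)) ->
  sm u -> sm (remainder E a u r).
Proof. by move=> fE sa su; apply: smooth_fun_sub2 => //; exact: (pexp_smooth gM bF tr). Qed.

Definition convf E1 E2 (a b : R -> nat -> T -> R) s q x :=
  conv E1 E2 (fun s q => a s q x) (fun s q => b s q x) s q.

Lemma partial_expansion_psum E a r x :
  partial_expansion E a pr rho r x = psum E (fun s q => a s q (pr x)) (rho x) (ln (rho x)) r.
Proof. by []. Qed.

(* Abel summation by exponents: individual terms of an expansion are not controlled by the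
   remainders, but the sums of the terms of equal exponent are differences of remainders. *)
Lemma rem_mul E1 E2 E3 a b u v r r1 (kap : R -> R) : ifin E1 -> ifin E2 -> ifin E3 ->
  (forall s, 0 < kap s) -> (forall s x, E1 x -> x.1 < s -> x.1 <= s - kap s) ->
  (forall x y, E1 x -> E2 y -> E3 (addp x y)) ->
  (forall x y, E1 x -> E2 y -> x.1 + y.1 <= r -> x.1 <= r1) ->
  exists ss : seq R, (forall s, s \in ss -> s <= r1 /\ exists q, E1 (s, q)) /\
  forall x, Om x -> remainder E3 (convf E1 E2 a b) (fun y => u y * v y) r x =
    remainder E1 a u r1 x * v x +
    \sum_(s <- ss) (remainder E1 a u (s - kap s) x - remainder E1 a u s x) * remainder E2 b v (r - s) x.
Proof.
move=> f1 f2 f3 k0 kE E12 Er; have [ss [Hss E]] := psum_group r1 f1 k0 kE.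
exists ss; split=> // x Ox; rewrite /remainder !partial_expansion_psum.
have r0 := rho_pos gM bF tr Ox.
rewrite (psum_conv _ _ _ f1 f2 f3 r0 E12 Er).
rewrite (E (fun s q => a s q (pr x)) _ _ (fun s => psum E2 (fun s q => b s q (pr x)) (rho x) (ln (rho x)) (r - s))).
have -> : psum E1 (fun s q => a s q (pr x)) (rho x) (ln (rho x)) r1 =
   \sum_(s <- ss) (psum E1 (fun s q => a s q (pr x)) (rho x) (ln (rho x)) s -
     psum E1 (fun s q => a s q (pr x)) (rho x) (ln (rho x)) (s - kap s)).
  have := E (fun s q => a s q (pr x)) (rho x) (ln (rho x)) (fun=> 1).
  rewrite -[X in _ = X -> _]mulr_suml mulr1 => <-; by apply: eq_fsbigr => sp _; rewrite mulr1.
rewrite mulrBl mulr_suml -addrA; congr (_ + _); rewrite -[X in _ = _ + X]opprK -opprD; congr (- _).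
rewrite -sumrN -big_split; apply: eq_bigr => s _ /=.
rewrite !partial_expansion_psum; set P := psum _ _ _ _ s; set P' := psum _ _ _ _ (s - _); set Q := psum E2 _ _ _ _.
by ring.
Qed.

End Remainders.

(** The coefficients are Cauchy products, polyhomogeneous by induction. In [rem_mul] at order r' the
    summand of exponent s has order (s - kap s) + (r' - s) = r' - kap s, so r' has to exceed r by at
    least kap s; the gap in the exponents after r provides the room. *)
Lemma phg_mul n (M : mfd R T n) E1 E2 E3 u v : good M -> ifam M E1 -> ifam M E2 -> ifam M E3 ->
  (forall G, bhs M G -> forall x y, E1 G x -> E2 G y -> E3 G (addp x y)) ->
  phg M E1 u -> phg M E2 v -> phg M E3 (fun x => u x * v x).
Proof.
elim: n M E1 E2 E3 u v => [|n IH] M E1 E2 E3 u v gM i1 i2 i3 E12 hu hv.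
  exact: smooth_fun_mul.
have su := phg_smooth hu; have sv := phg_smooth hv.
split; first exact: smooth_fun_mul.
move=> F U pr rho bF tr; have oU := triv_open tr; have gN := face_good gM bF oU.
have [_ Hu] := hu; have [a [Ha Hau]] := Hu F U pr rho bF tr.
have [_ Hv] := hv; have [b [Hb Hbv]] := Hv F U pr rho bF tr.
have f1 := i1 F bF; have f2 := i2 F bF; have f3 := i3 F bF.
exists (convf (E1 F) (E2 F) a b); split.
  move=> s q Es; have [l [ul inl el]] := fsum_seq R (conv_finite (s, q) f1 f2).
  have -> : convf (E1 F) (E2 F) a b s q =
      fun x => \sum_(xy <- l) (a xy.1.1 xy.1.2 x * b xy.2.1 xy.2.2 x).
    by apply/funext => x; rewrite /convf /conv el.
  apply: phg_sum => //; first exact: face_ifam.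
  move=> [[s1 q1] [s2 q2]] /inl[/= Es1 Es2 _].
  apply: (IH _ _ _ _ _ _ gN (face_ifam gM bF oU i1) (face_ifam gM bF oU i2) (face_ifam gM bF oU i3) _ (Ha _ _ Es1) (Hb _ _ Es2)).
  move=> H bH x y; have [G [bG GF HG _]] := face_bhs_sub gM bF oU bH.
  by rewrite !(face_index_uniq gM bF oU _ bH bG GF HG); exact: E12.
move=> rhos hr; apply: (conormal_local gM hr) => K cK KU.
have [k [G [HG W]]] := conormal_words2 gM bF tr hr (Hau rhos hr) (Hbv rhos hr) cK KU.
exists k, G; split=> // Vs tV; have [m {}W] := W Vs tV (size Vs).
have bG i : bhs M (G i) by case: (HG i).
exists (m + m)%N => r x0 Kx0.
have [B B1 [O [oO Ox0 HO]]] := weights_bounded gM bF tr hr bG (KU _ Kx0).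
pose A := K `&` interior_pts M `&` O.
have AO : A `<=` U `&` interior_pts M by move=> x [[/KU Ux ix] _].
have AK : A `<=` K `&` interior_pts M by move=> x [].
have rB x : A x -> 0 < rho x <= B.
  by move=> Ax; rewrite (rho_pos gM bF tr (AO x Ax)) /=; case: Ax => [[_ ix] Ox]; case: (HO x Ox ix).
have dL V : letters Vs V -> derivation M U V by exact: (letters_tangent gM tr tV).
pose g r x := rho x `^ r * bprod rhos G x ^- m.
have g0 r' x : A x -> 0 <= g r' x by move=> /AO Ox; exact: (Om_rho_bprod_ge0 gM rho r' m hr bG Ox).
have sa s q : E1 F (s, q) -> smooth_fun (face M F (F `&` U)) (interior_pts (face M F (F `&` U))) (a s q).
  by move=> Es; exact: (phg_smooth (Ha s q Es)).
have sb s q : E2 F (s, q) -> smooth_fun (face M F (F `&` U)) (interior_pts (face M F (F `&` U))) (b s q).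
  by move=> Es; exact: (phg_smooth (Hb s q Es)).
have su' : smooth_fun M (U `&` interior_pts M) u by apply: smooth_fun_sub su => x [].
have sv' : smooth_fun M (U `&` interior_pts M) v by apply: smooth_fun_sub sv => x [].
have s1 r' : smooth_fun M (U `&` interior_pts M) (remainder pr rho (E1 F) a u r').
  exact: (rem_smooth gM bF tr).
have s2 r' : smooth_fun M (U `&` interior_pts M) (remainder pr rho (E2 F) b v r').
  exact: (rem_smooth gM bF tr).
have c1 r' : cls (letters Vs) A (fun=> 1) (size Vs) (g r') (remainder pr rho (E1 F) a u r').
  by apply: words_cls => //; [exact: g0|exact: words_sub AK (W r').1].
have c2 r' : cls (letters Vs) A (fun=> 1) (size Vs) (g r') (remainder pr rho (E2 F) b v r').
  by apply: words_cls => //; [exact: g0|exact: words_sub AK (W r').2].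
have gle r1 r2 x : r2 <= r1 -> A x -> 0 <= g r1 x /\ g r1 x <= B `^ (r1 - r2) * g r2 x.
  move=> r21 Ax; split; first exact: g0.
  rewrite /g mulrA ler_wpM2r ?invr_ge0 ?exprn_ge0 ?(ltW (bprod_pos gM hr bG (AO _ Ax))) //.
  by apply: powR_le_shift => //; exact: rB.
have [k1 k10 Hk1] := ifin_gap r f3.
have [kap [kap0 kapE]] := gap_fun f1 k10.
have [m2 Hm2] := ifin_lower f2.
(* No exponent of the product lies above r and up to r', so both truncations agree. With r1 = r' -
   m2 the term containing v, which is its own remainder of order m2, has order r'. *)
pose r' := r + k1; pose r1 := r' - m2.
have [|//|ss [Hss RE]] := @rem_mul _ _ gM F U pr rho bF tr (E1 F) (E2 F) (E3 F) a b u v r' r1 kap f1 f2 f3 _ kapE (E12 F bF).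
- by move=> s; case/andP: (kap0 s).
- move=> x y _ /Hm2 ym; rewrite /r1; move: ym; move: (x.1) (y.1) => X Y; lra.
pose h x := g r x * bprod rhos G x ^- m.
have hE r2 r3 x : g r2 x * g r3 x = rho x `^ r2 * rho x `^ r3 * (bprod rhos G x ^- m * bprod rhos G x ^- m).
  by rewrite /g mulrACA.
have hle r2 r3 : r <= r2 + r3 -> forall x, A x -> 0 <= g r2 x * g r3 x /\
   g r2 x * g r3 x <= B `^ (r2 + r3 - r) * h x.
  move=> rr x Ax; split; first by rewrite mulr_ge0 ?g0.
  have /andP[rx0 rxB] := rB x Ax.
  rewrite hE -powRD ?(gt_eqF rx0) ?implybT // /h /g !mulrA; do 2!rewrite ler_wpM2r ?invr_ge0 ?exprn_ge0 ?(ltW (bprod_pos gM hr bG (AO _ Ax))) //.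
  by apply: powR_le_shift => //; exact: rB.
have v2 : cls (letters Vs) A (fun=> 1) (size Vs) (g m2) v.
  apply: (cls_ext dL AO (s2 m2) sv' _ (c2 m2)) => x _; rewrite /remainder /partial_expansion.
  rewrite (_ : [set sp | _] = set0) ?fsbig_set0 ?subr0 //.
  by apply/seteqP; split=> // sp [/= /Hm2 h1 h2]; move: h1; rewrite ltNge h2.
have cm : cls (letters Vs) A (fun=> 1) (size Vs) h
   (fun x => remainder pr rho (E1 F) a u r1 x * v x +
    \sum_(s <- ss) (remainder pr rho (E1 F) a u (s - kap s) x - remainder pr rho (E1 F) a u s x) * remainder pr rho (E2 F) b v (r' - s) x).
  apply: (cls_add dL AO).
  - exact: smooth_fun_mul.
  - by apply: smooth_fun_sum => s; apply: smooth_fun_mul => //; exact: smooth_fun_sub2.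
  - apply: (cls_le (fun _ _ => ltr01) (hle r1 m2 _)); first by rewrite /r1 subrK /r' lerDl ltW.
    exact: (cls_mul dL AO).
  apply: (cls_sum dL AO) => s; first by apply: smooth_fun_mul => //; exact: smooth_fun_sub2.
  have /andP[ks0 ksk] := kap0 s.
  apply: (cls_le (fun _ _ => ltr01) (hle (s - kap s) (r' - s) _)).
    by rewrite /r'; move: ksk; move: (kap s) => X; lra.
  apply: (cls_mul dL AO) => //; first exact: smooth_fun_sub2.
  have c1' : cls (letters Vs) A (fun=> 1) (size Vs) (g (s - kap s)) (remainder pr rho (E1 F) a u s).
    by apply: (cls_le (fun _ _ => ltr01) (gle s (s - kap s) ^~ _) (c1 s)); rewrite gerBl ltW.
  have -> : (fun x => remainder pr rho (E1 F) a u (s - kap s) x - remainder pr rho (E1 F) a u s x) =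
     (fun x => remainder pr rho (E1 F) a u (s - kap s) x + (-1) * remainder pr rho (E1 F) a u s x).
    by apply/funext => x; rewrite mulN1r.
  apply: (cls_add dL AO) => //; first by apply: smooth_fun_mul => //; exact: smooth_fun_cst.
  exact: (cls_scale dL AO).
have sc : smooth_fun M (U `&` interior_pts M) (remainder pr rho (E3 F) (convf (E1 F) (E2 F) a b) (fun y => u y * v y) r').
  apply: smooth_fun_eq (smooth_fun_add (smooth_fun_mul (s1 r1) sv') (smooth_fun_sum ss _)) => [x Ox|s].
    by rewrite RE.
  apply: smooth_fun_mul; [exact: smooth_fun_sub2|exact: s2].
have {}cm : cls (letters Vs) A (fun=> 1) (size Vs) h (remainder pr rho (E3 F) (convf (E1 F) (E2 F) a b) (fun y => u y * v y) r').
  apply: (cls_ext dL AO _ sc _ cm); last by move=> x Ox; rewrite RE.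
  apply: smooth_fun_add; first exact: smooth_fun_mul.
  by apply: smooth_fun_sum => s; apply: smooth_fun_mul => //; exact: smooth_fun_sub2.
have [C HC] := cls_letters cm; exists O, C; split=> // x Ox Kx ix.
have -> : (fun z => u z * v z - partial_expansion (E3 F) (convf (E1 F) (E2 F) a b) pr rho r z) =
    remainder pr rho (E3 F) (convf (E1 F) (E2 F) a b) (fun y => u y * v y) r'.
  apply/funext => z; rewrite /remainder !partial_expansion_psum (psum_gap _ _ _ Hk1) //.
  by rewrite /r' lexx lerDl ltW.
apply: le_trans (HC x (conj (conj Kx ix) Ox)) _.
by rewrite expr1n invr1 mulr1 /h /g -mulrA -invfM -exprD.
Qed.

End Algebra.

(** * Taylor remainders of the exponential *)

Section Taylor.
Variable R : realType.

Definition exp_rem J (z : R) := expR z - \sum_(j < J) z ^+ j / (j`!)%:R.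

Lemma exp_remS J z : exp_rem J.+1 z = exp_rem J z - z ^+ J / (J`!)%:R.
Proof. by rewrite /exp_rem big_ord_recr /= opprD addrA. Qed.

(** The truncated predecessor is intended: for J = 0 the remainder is exp, which is its own
    derivative. *)
Lemma is_derive_exp_rem J (z : R) : is_derive z 1 (exp_rem J) (exp_rem J.-1 z).
Proof.
elim: J => [|J IH].
  have -> : exp_rem 0 = expR by apply/funext => x; rewrite /exp_rem big_ord0 subr0.
  exact: is_derive_expR.
have -> : exp_rem J.+1 = exp_rem J - (fun z => (J`!)%:R^-1 *: z ^+ J).
  by apply/funext => x; rewrite exp_remS /= mulrC.
case: J IH => [|J] IH /=.
  have -> : exp_rem 0 - (fun z => (0`!)%:R^-1 *: z ^+ 0) = exp_rem 0 - cst 1.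
    by apply/funext => x; rewrite /= !fctE expr0 fact0 invr1 scale1r.
  by apply: is_derive_eq; rewrite subr0.
have -> : exp_rem J.+1 z = exp_rem J z - (J.+1`!)%:R^-1 *: (z ^+ J *+ J.+1).
  rewrite exp_remS; congr (_ - _); rewrite factS natrM invfM -(mulr_natr (z ^+ J)) /GRing.scale /=.
  have h : J.+1%:R != 0 :> R by rewrite pnatr_eq0.
  have f0 : (J`!)%:R != 0 :> R by rewrite pnatr_eq0 -lt0n fact_gt0.
  by move: (z ^+ J) (J.+1%:R) ((J`!)%:R) h f0 => Z a b h f0; field; rewrite h f0.
have -> : (fun z : R => (J.+1`!)%:R^-1 *: z ^+ J.+1) = (J.+1`!)%:R^-1 *: ((@id R : R -> R) ^+ J.+1).
  by apply/funext => x; rewrite /GRing.scale /= exprfctE.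
have hx : is_derive z 1 ((@id R : R -> R) ^+ J.+1) (z ^+ J *+ J.+1).
  by apply: is_derive_eq; rewrite /= /GRing.scale /= mulr1 mulr_natl.
by apply: is_derive_eq.
Qed.

Lemma exp_rem0 J : exp_rem J.+1 0 = 0.
Proof.
rewrite /exp_rem big_ord_recl /= expR0 expr0 fact0 divr1 big1 ?addr0 ?subrr // => j _.
by rewrite expr0n /= mul0r.
Qed.

(** Induction on J by the mean value theorem between 0 and z; at an intermediate point c, exp c is
    at most the larger of 1 and exp z. *)
Lemma exp_rem_max J z : `|exp_rem J z| <= `|z| ^+ J * Num.max 1 (expR z).
Proof.
elim: J z => [|J IH] z.
  by rewrite /exp_rem big_ord0 subr0 expr0 mul1r ger0_norm ?expR_ge0 // le_max lexx orbT.
have mvt (a b : R) : a <= b -> exists2 c, c \in `[a, b]%R & exp_rem J.+1 b - exp_rem J.+1 a = exp_rem J c * (b - a).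
  move=> ab; apply: (MVT_segment ab) => [x _|]; first exact: is_derive_exp_rem.
  apply: continuous_subspaceT => x; apply: differentiable_continuous.
  by apply/derivable1_diffP; have [] := is_derive_exp_rem J.+1 x.
have [c [cz ez E]] : exists c, [/\ `|c| <= `|z|, expR c <= Num.max 1 (expR z) & `|exp_rem J.+1 z| = `|exp_rem J c| * `|z|].
  have [z0|z0] := leP 0 z.
    have [c] := mvt 0 z z0; rewrite in_itv /= exp_rem0 !subr0 => /andP[c0 cz] E.
    exists c; split; [by rewrite !ger0_norm| |by rewrite E normrM].
    by rewrite le_max ler_expR cz orbT.
  have [c] := mvt z 0 (ltW z0); rewrite in_itv /= exp_rem0 !sub0r => /andP[c0 cz] E.
  exists c; split; [by rewrite !ler0_norm ?(ltW z0) // lerN2| |by rewrite -[LHS]normrN E normrM normrN].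
  by rewrite le_max -expR0 ler_expR cz.
rewrite E exprSr mulrAC ler_wpM2r //; apply: le_trans (IH c) _.
apply: ler_pM; rewrite ?exprn_ge0 //; first by rewrite le_max ler01.
  by rewrite lerXn2r ?nnegrE.
by rewrite ge_max ez le_max lexx.
Qed.

Lemma exp_rem_bound J z : `|exp_rem J z| <= `|z| ^+ J * (1 + expR z).
Proof.
apply: le_trans (exp_rem_max J z) _; rewrite ler_wpM2l ?exprn_ge0 //.
by rewrite ge_max lerDl expR_ge0 lerDr ler01.
Qed.

Lemma powR_ln_bound_le (B s d : R) q : 1 <= B -> d < s \/ d = s /\ q = 0%N -> exists2 C : R, 0 < C &
  forall y, 0 < y <= B -> y `^ s * `|ln y| ^+ q <= C * y `^ d.
Proof.
move=> B1 [ds|[-> ->]]; last by exists 1 => // y _; rewrite expr0 mulr1 mul1r.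
have [C C0 HC] := powR_ln_bound q ds.
have B0 : 0 < B by exact: lt_le_trans B1.
exists (C + B `^ (s - d) * `|ln B| ^+ q); first by rewrite ltr_wpDr // mulr_ge0 ?powR_ge0 ?exprn_ge0.
move=> y /andP[y0 yB]; have [y1|y1] := leP y 1.
  apply: le_trans (HC y _) _; first by rewrite y0.
  by rewrite ler_wpM2r ?powR_ge0 // lerDl mulr_ge0 ?powR_ge0 ?exprn_ge0.
apply: (@le_trans _ _ (B `^ (s - d) * `|ln B| ^+ q * y `^ d)); last first.
  by rewrite ler_wpM2r ?powR_ge0 // lerDr ltW.
have -> : y `^ s = y `^ (s - d) * y `^ d.
  by rewrite -powRD ?subrK // (gt_eqF y0) implybT.
rewrite mulrAC ler_wpM2r ?powR_ge0 //; apply: ler_pM; rewrite ?powR_ge0 ?exprn_ge0 //.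
  by apply: ge0_ler_powR; rewrite ?nnegrE ?subr_ge0 ?(ltW ds) ?(ltW y0) ?(ltW B0).
rewrite lerXn2r ?nnegrE // !ger0_norm ?ln_ge0 ?(ltW y1) //.
by rewrite ler_ln.
Qed.

End Taylor.

(** * Weighted estimates for the exponential *)

Section Weights.
Variables (R : realType) (T : topologicalType) (n : nat) (M : mfd R T n.+1).
Hypothesis gM : good M.
Variables (F U : set T) (pr : T -> T) (rho : T -> R).
Hypotheses (bF : bhs M F) (tr : trivialization M F U pr rho).
Local Notation Om := (U `&` interior_pts M).
Local Notation sm := (smooth_fun M Om).
Variable L : set ((T -> R) -> (T -> R)).
Hypothesis dL : forall V, L V -> derivation M U V.
Variables (A : set T) (P q : T -> R) (B : R).
Hypotheses (AO : A `<=` Om) (B1 : 1 <= B).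
Hypothesis rB : forall t, A t -> 0 < rho t <= B.
Hypothesis PB : forall t, A t -> 0 < P t <= B.
Hypothesis qB : forall t, A t -> 0 < q t <= 1.

(* P will be a product of defining functions of the hypersurfaces meeting F, q a
   weight pulled back from F, and [loss] the price of one tangent derivative. *)
Definition weight (x y z : R) (t : T) : R := rho t `^ x * P t `^ y * q t `^ z.

Local Notation W := weight.

Lemma W_gt0 x y z t : A t -> 0 < W x y z t.
Proof.
move=> At; have /andP[r0 _] := rB At; have /andP[p0 _] := PB At; have /andP[q0 _] := qB At.
by rewrite !mulr_gt0 ?powR_gt0.
Qed.

Lemma W_mul x y z x' y' z' t : A t -> W x y z t * W x' y' z' t = W (x + x') (y + y') (z + z') t.
Proof.
move=> At; have /andP[r0 _] := rB At; have /andP[p0 _] := PB At; have /andP[q0 _] := qB At.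
rewrite /weight !powRD ?(gt_eqF r0) ?(gt_eqF p0) ?(gt_eqF q0) ?implybT //.
by move: (rho t `^ x) (P t `^ y) (q t `^ z) (rho t `^ x') (P t `^ y') (q t `^ z') => a b c a' b' c'; ring.
Qed.

Lemma W0 t : W 0 0 0 t = 1.
Proof. by rewrite /weight !powRr0 !mulr1. Qed.

Lemma W_inv x y z t : A t -> (W x y z t)^-1 = W (- x) (- y) (- z) t.
Proof.
move=> At; have w0 := W_gt0 x y z At; apply: (mulfI (lt0r_neq0 w0)).
by rewrite divff ?gt_eqF // W_mul // !subrr W0.
Qed.

Lemma W_exp x y z t k : A t -> W x y z t ^+ k = W (x * k%:R) (y * k%:R) (z * k%:R) t.
Proof.
move=> At; elim: k => [|k IH]; first by rewrite !mulr0 W0.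
by rewrite exprS IH W_mul // -[k.+1]add1n !natrD !mulrDr !mulr1.
Qed.

Lemma W_powR x y z t c : A t -> W x y z t `^ c = W (x * c) (y * c) (z * c) t.
Proof.
move=> At; have /andP[r0 _] := rB At; have /andP[p0 _] := PB At; have /andP[q0 _] := qB At.
by rewrite /weight !powRrM !powRM ?mulr_ge0 ?powR_ge0.
Qed.

Lemma W_le x y z x' y' z' : x' <= x -> y' <= y -> z' <= z -> exists C, forall t, A t ->
  0 <= W x y z t /\ W x y z t <= C * W x' y' z' t.
Proof.
move=> xx yy zz; exists (B `^ (x - x') * B `^ (y - y')) => t At; split; first exact/ltW/W_gt0.
have /andP[r0 _] := rB At; have /andP[p0 _] := PB At; have /andP[q0 q1] := qB At.
have h1 : rho t `^ x <= B `^ (x - x') * rho t `^ x' by exact: powR_le_shift (rB At) xx.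
have h2 : P t `^ y <= B `^ (y - y') * P t `^ y' by exact: powR_le_shift (PB At) yy.
have h3 : q t `^ z <= q t `^ z' by apply: ger_powR => //; rewrite q0.
apply: (@le_trans _ _ ((B `^ (x - x') * rho t `^ x') * (B `^ (y - y') * P t `^ y') * q t `^ z')).
  by apply: ler_pM => //; rewrite ?mulr_ge0 ?powR_ge0 //; apply: ler_pM; rewrite ?powR_ge0.
by rewrite /weight le_eqVlt; apply/orP; left; apply/eqP; ring.
Qed.

Section Eta.
Variables (eta : R) (m : nat).
Hypotheses (eta0 : 0 < eta).
(** P^m is what the remainder bounds charge for derivatives. The factor rho^eta, with eta at will,
    makes room for logarithms and for bounds of an order just below an exponent. *)
Definition loss t := W eta m%:R 0 t.
Local Notation p := loss.

Lemma p_gt0 t : A t -> 0 < p t. Proof. exact: W_gt0. Qed.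

Local Notation C := (cls L A p).

Lemma clsW_le k x y z x' y' z' f : x' <= x -> y' <= y -> z' <= z ->
  C k (W x y z) f -> C k (W x' y' z') f.
Proof. by move=> xx yy zz; have [D HD] := W_le xx yy zz; exact: (cls_le p_gt0 HD). Qed.

Lemma clsW_mul k x y z x' y' z' f f' : sm f -> sm f' -> C k (W x y z) f -> C k (W x' y' z') f' ->
  C k (W (x + x') (y + y') (z + z')) (fun t => f t * f' t).
Proof.
move=> sf sf' h h'; apply: cls_eqw (cls_mul dL AO sf sf' h h') => t At.
exact: W_mul.
Qed.

(** Keeps a good bound of f although only weaker ones are known for its derivatives, as long as one
    loss covers the difference. *)
Lemma clsW_words k x y z x1 y1 z1 f : x - eta <= x1 -> y - m%:R <= y1 -> z <= z1 ->
  (exists D, forall t, A t -> `|f t| <= D * W x y z t) ->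
  words L A k (W x1 y1 z1) f -> C k (W x y z) f.
Proof.
move=> xx yy zz bf wf.
have [D1 HD1] := W_le xx yy zz.
have [D2 HD2] := W_le (ltW eta0) (ler0n R m) (lexx (0 : R)).
apply: (cls_words p_gt0 (B := `|D1|) (B0 := `|D2|) _ _ _ _ bf _ wf) => //.
- by move=> t At; split; exact/ltW/W_gt0.
- by move=> t At; have [_ h] := HD2 t At; apply: le_trans h _; rewrite W0 mulr1 ler_norm.
move=> t At; rewrite /loss W_inv // W_mul // subr0; have [h0 h] := HD1 t At.
by apply: le_trans h _; rewrite ler_wpM2r ?ler_norm // ltW // W_gt0.
Qed.

Lemma clsW_ext k x y z f f' : sm f -> sm f' -> (forall t, Om t -> f t = f' t) ->
  C k (W x y z) f -> C k (W x y z) f'.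
Proof. exact: (cls_ext dL AO). Qed.

Lemma clsW_add k x y z f f' : sm f -> sm f' -> C k (W x y z) f -> C k (W x y z) f' ->
  C k (W x y z) (fun t => f t + f' t).
Proof. exact: (cls_add dL AO). Qed.

Lemma clsW_sum k x y z (I : eqType) (r : seq I) (f : I -> T -> R) : (forall i, sm (f i)) ->
  (forall i, i \in r -> C k (W x y z) (f i)) -> C k (W x y z) (fun t => \sum_(i <- r) f i t).
Proof.
move=> sf; elim: r => [|i r IH] H.
  have -> : (fun t => \sum_(i <- [::]) f i t) = (fun=> 0) by apply/funext => x'; rewrite big_nil.
  by apply: (cls_cst dL _ AO); exists 0 => t _; rewrite normr0 mul0r.
have -> : (fun t => \sum_(j <- i :: r) f j t) = (fun t => f i t + \sum_(j <- r) f j t).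
  by apply/funext => t; rewrite big_cons.
apply: clsW_add => //; first exact: smooth_fun_sum.
  by apply: H; rewrite mem_head.
by apply: IH => j jr; apply: H; rewrite in_cons jr orbT.
Qed.

Lemma clsW_word Vs x y z f : L = letters Vs -> C (size Vs) (W x y z) f ->
  exists D, forall t, A t -> `|foldr (fun V h => V h) f Vs t| <=
    D * W (x - eta * (size Vs)%:R) (y - m%:R * (size Vs)%:R) z t.
Proof.
move=> -> /cls_letters[D HD]; exists D => t At; apply: le_trans (HD t At) _.
by rewrite /loss W_exp // W_inv // W_mul // mul0r subr0.
Qed.

End Eta.
End Weights.

Section Derivations.
Variables (R : realType) (T : topologicalType) (n : nat) (M : mfd R T n) (U : set T).
Local Notation Om := (U `&` interior_pts M).
Local Notation sm := (smooth_fun M Om).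
Variable V : (T -> R) -> (T -> R).
Hypothesis dV : derivation M U V.

Lemma dv_scale c f x : sm f -> Om x -> V (fun y => c * f y) x = c * V f x.
Proof.
move=> sf Ox; rewrite (dv_mul dV) ?(dv_cst dV) ?mul0r ?addr0 //; exact: smooth_fun_cst.
Qed.

Lemma dv_lin c f g x : sm f -> sm g -> Om x -> V (fun y => f y + c * g y) x = V f x + c * V g x.
Proof.
move=> sf sg Ox; rewrite (dv_add dV) ?dv_scale //.
by apply: smooth_fun_mul => //; exact: smooth_fun_cst.
Qed.

Lemma smooth_fun_pow f j : sm f -> sm (fun y => f y ^+ j).
Proof.
move=> sf; have -> : (fun y => f y ^+ j) = fun y => \prod_(i < j) f y.
  by apply/funext => y; rewrite prodr_const card_ord.
exact: smooth_fun_prod.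
Qed.

Lemma dv_pow f j x : sm f -> Om x -> V (fun y => f y ^+ j) x = j%:R * f x ^+ j.-1 * V f x.
Proof.
move=> sf Ox; elim: j => [|j IH]; first by rewrite !mul0r (dv_cst dV).
have -> : (fun y => f y ^+ j.+1) = (fun y => f y * f y ^+ j) by apply/funext => y; rewrite exprS.
rewrite (dv_mul dV) ?IH //; last exact: smooth_fun_pow.
case: j {IH} => [|j] /=; first by rewrite expr0; ring.
by rewrite exprS -[j.+2]add1n natrD; ring.
Qed.

Lemma dv_expN f x : sm f -> Om x -> V (fun y => expR (- f y)) x = - V f x * expR (- f x).
Proof.
move=> sf Ox; have -> : (fun y => expR (- f y)) = (fun y => expR ((-1) * f y)).
  by apply/funext => y; rewrite mulN1r.
rewrite (dv_exp dV) ?dv_scale // ?mulN1r; first by rewrite mulrC.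
by apply: smooth_fun_mul => //; exact: smooth_fun_cst.
Qed.

End Derivations.

(** v = v^(1 - th) v^th, and each factor is bounded on its own. *)
Lemma interpolate (R : realType) (v X Y th : R) : 0 <= v -> 0 < th -> th <= 1 -> v <= X -> v <= Y ->
  v <= X `^ (1 - th) * Y `^ th.
Proof.
move=> v0 t0 t1 vX vY; have [->|vn] := eqVneq v 0; first by rewrite mulr_ge0 ?powR_ge0.
have X0 := le_trans v0 vX; have Y0 := le_trans v0 vY.
rewrite -{1}[v]powRr1 // -{1}[1](subrK th) powRD ?vn ?implybT //.
by apply: ler_pM; rewrite ?powR_ge0 // ge0_ler_powR ?nnegrE ?subr_ge0 // ltW.
Qed.

Lemma smooth_fun_expN (R : realType) (T : topologicalType) n (M : mfd R T n) (A : set T) f : smooth_fun M A f ->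
  smooth_fun M A (fun x => expR (- f x)).
Proof.
move=> sf; apply: smooth_fun_exp; have -> : (fun x => - f x) = (fun x => (-1) * f x).
  by apply/funext => x; rewrite mulN1r.
by apply: smooth_fun_mul => //; exact: smooth_fun_cst.
Qed.

(** * The Taylor expansion at a type 1 hypersurface *)

Section Type1.
Variables (R : realType) (T : topologicalType) (n : nat) (M : mfd R T n.+1).
Hypothesis gM : good M.
Variables (F U : set T) (pr : T -> T) (rho : T -> R).
Hypotheses (bF : bhs M F) (tr : trivialization M F U pr rho).
Let N := face M F (F `&` U).
Local Notation Om := (U `&` interior_pts M).
Local Notation sm := (smooth_fun M Om).
Variables (EF : set (R * nat)) (a : R -> nat -> T -> R) (l0 u : T -> R).
Hypotheses (fE : ifin EF) (nE : nneg EF) (su : sm u).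
Hypothesis sa : forall s q, EF (s, q) -> smooth_fun N (interior_pts N) (a s q).
Hypothesis l0E : l0 = if `[< EF (0, 0%N) >] then a 0 0%N else fun=> 0.

Definition Epos (E : set (R * nat)) : set (R * nat) := [set x | E x /\ 0 < x.1].
Local Notation Ep := (Epos EF).
(* u = lp + ut splits off the leading coefficient at F, exp (- u) has the Taylor
   expansion \sum_j tcoef j * Q j in ut, and Bc j are the coefficients of the
   expansion of Q j at F. *)
Definition lp x := l0 (pr x).
Definition ut x := u x - lp x.
Definition Q j x := expR (- lp x) * ut x ^+ j.
Fixpoint Bc j : R -> nat -> T -> R :=
  if j is j'.+1 then convf Ep (gen EF) a (Bc j')
  else fun s q x => if (s == 0) && (q == 0%N) then expR (- l0 x) else 0.

Lemma Ep_ifin : ifin Ep.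
Proof. by move=> r; apply: sub_finite_set (fE r) => x [[]]. Qed.

Lemma lp_smooth : sm lp.
Proof.
apply: (pull_smooth gM bF tr (a := l0)); rewrite l0E; case: asboolP => [E0|_]; first exact: sa.
exact: smooth_fun_cst.
Qed.

Lemma ut_smooth : sm ut. Proof. exact: smooth_fun_sub2 lp_smooth. Qed.

Lemma expN_smooth f : sm f -> sm (fun x => expR (- f x)).
Proof. exact: smooth_fun_expN. Qed.

Lemma Q_smooth j : sm (Q j).
Proof.
apply: smooth_fun_mul; first exact: expN_smooth lp_smooth.
exact: smooth_fun_pow ut_smooth.
Qed.

Lemma Ep_smooth s q : Ep (s, q) -> smooth_fun N (interior_pts N) (a s q).
Proof. by move=> [Es _]; exact: sa. Qed.

Lemma Bc_smooth j s q : gen EF (s, q) -> smooth_fun N (interior_pts N) (Bc j s q).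
Proof.
elim: j s q => [|j IH] s q /=.
  move=> _; case: ((s == 0) && (q == 0%N)); last exact: smooth_fun_cst.
  rewrite l0E; case: asboolP => [E0|_]; last exact: smooth_fun_cst.
  apply: smooth_fun_exp; have -> : (fun x => - a 0 0%N x) = (fun x => (-1) * a 0 0%N x).
    by apply/funext => x; rewrite mulN1r.
  by apply: smooth_fun_mul; [exact: smooth_fun_cst|exact: sa].
move=> _; have [l [ul inl el]] := fsum_seq R (conv_finite (s, q) Ep_ifin (gen_ifin fE)).
have -> : convf Ep (gen EF) a (Bc j) s q = fun x => \sum_(xy <- l)
    ((if `[< Ep xy.1 >] then a xy.1.1 xy.1.2 else fun=> 0) x *
     (if `[< gen EF xy.2 >] then Bc j xy.2.1 xy.2.2 else fun=> 0) x).
  apply/funext => x; rewrite /convf /conv el; apply: eq_big_seq => xy /inl[h1 h2 _].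
  by rewrite !asboolT.
apply: smooth_fun_sum => -[[s1 q1] [s2 q2]]; apply: smooth_fun_mul.
  by case: asboolP => [/Ep_smooth//|_]; exact: smooth_fun_cst.
by case: asboolP => [/IH//|_]; exact: smooth_fun_cst.
Qed.

Definition tcoef (i : nat) : R := (-1) ^+ i / (i`!)%:R.

(** The coefficient of the whole Taylor series at exponent s. As the exponents of [ut] exceed delta,
    only the Taylor terms with j <= s/delta contribute ([Bc_zero]), so the sum is finite and does
    not depend on the Taylor order ([bcE]). *)
Definition bc (delta : R) s q x := \sum_(j < (Num.bound (`|s| / delta)).+1) tcoef j * Bc j s q x.

Lemma Bc_zero delta j s q x : (forall y, Ep y -> delta < y.1) -> s < delta * j%:R -> Bc j s q x = 0.
Proof.
move=> Hd; elim: j s q => [|j IH] s q /=.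
  by rewrite mulr0 => s0; rewrite (lt_eqF s0).
move=> sj; rewrite /convf /conv fsbig1 // => -[y z] /= [Ey _ e].
case: e => e1 _; rewrite IH ?mulr0 //.
move: sj (Hd y Ey); rewrite -e1 -natr1 mulrDr mulr1; move: (y.1) (z.1) (delta * j%:R) => b c d; lra.
Qed.

Lemma bcE delta J s q x : 0 < delta -> (forall y, Ep y -> delta < y.1) -> s < delta * J%:R ->
  bc delta s q x = \sum_(j < J) tcoef j * Bc j s q x.
Proof.
move=> d0 Hd.
have aux J1 i : s < delta * J1%:R ->
    \sum_(j < J1 + i) tcoef j * Bc j s q x = \sum_(j < J1) tcoef j * Bc j s q x.
  move=> sJ; elim: i => [|i IH]; first by rewrite addn0.
  rewrite addnS big_ord_recr /= IH (@Bc_zero delta) ?mulr0 ?addr0 //.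
  by apply: (lt_le_trans sJ); rewrite ler_pM2l // ler_nat leq_addr.
move=> sJ; rewrite /bc; set J0 := (Num.bound _).+1.
have sJ0 : s < delta * J0%:R.
  have := archi_boundP (divr_ge0 (normr_ge0 s) (ltW d0)); rewrite ltr_pdivrMr // mulrC => h.
  apply: (le_lt_trans (ler_norm s)); apply: (lt_le_trans h).
  by rewrite ler_pM2l // ler_nat.
by case: (leqP J0 J) => [|/ltnW] /subnKC <-; rewrite aux.
Qed.

Lemma bc_smooth delta s q : gen EF (s, q) -> smooth_fun N (interior_pts N) (bc delta s q).
Proof.
move=> g; apply: smooth_fun_sum => j; apply: smooth_fun_mul; first exact: smooth_fun_cst.
exact: Bc_smooth.
Qed.

Lemma pexp_bc delta J r x : 0 < delta -> (forall y, Ep y -> delta < y.1) -> r < delta * J%:R ->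
  partial_expansion (gen EF) (bc delta) pr rho r x =
  \sum_(j < J) tcoef j * partial_expansion (gen EF) (Bc j) pr rho r x.
Proof.
move=> d0 Hd rJ; have [l [ul inl _]] := fsum_seq R (gen_ifin fE r).
have lin y : gen EF y -> y.1 <= r -> y \in l by move=> *; apply/inl.
rewrite partial_expansion_psum (psum_seq _ _ _ ul lin).
under [RHS]eq_bigr do rewrite partial_expansion_psum (psum_seq _ _ _ ul lin) mulr_sumr.
rewrite exchange_big /=; apply: eq_bigr => y /asboolP[_ yr].
rewrite (bcE _ _ d0 Hd (le_lt_trans yr rJ)) !mulr_suml; apply: eq_bigr => j _.
by rewrite !mulrA.
Qed.

Lemma pexp_split r x : 0 <= r ->
  partial_expansion EF a pr rho r x = lp x + partial_expansion Ep a pr rho r x.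
Proof.
move=> r0; rewrite !partial_expansion_psum; have [l [ul inl _]] := fsum_seq R (fE r).
rewrite !(psum_seq _ _ _ ul); last 2 first.
- by move=> y [Ey _] yr; apply/inl.
- by move=> y Ey yr; apply/inl.
pose f (y : R * nat) := a y.1 y.2 (pr x) * rho x `^ y.1 * ln (rho x) ^+ y.2.
have -> : lp x = \sum_(y <- l) if y == (0, 0%N) then f y else 0.
  rewrite -big_mkcond; rewrite /lp l0E; case: asboolP => [E0|nE0].
    rewrite -big_filter filter_pred1_uniq ?big_seq1 //; last by apply/inl.
    by rewrite /f /= powRr0 expr0 !mulr1.
  by rewrite big_seq_cond big_pred0 // => y; apply/andP => -[/inl[Ey _] /eqP y0]; apply: nE0; rewrite -y0.
rewrite [in LHS]big_mkcond [in X in _ = _ + X]big_mkcond -big_split; apply: eq_big_seq => y /inl[Ey yr] /=.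
rewrite asboolT //; have [y0|ny0] := eqVneq y (0, 0%N).
  by rewrite asboolF ?addr0 // => -[[_]]; rewrite y0 ltxx.
rewrite asboolT ?add0r //; split=> //; split=> //.
case: (y) Ey ny0 => s q /nE[//|[-> ->]]; by rewrite eqxx.
Qed.

(** For r >= 0 the leading term cancels; for r < 0 the truncation of [ut] is empty, and passing from
    u to [ut] is itself truncation at order 0. Thus [ut] inherits the bounds of u with the same
    m. *)
Lemma rem_shift r : remainder pr rho Ep a ut r = remainder pr rho EF a u (Num.max r 0).
Proof.
apply/funext => x; rewrite /remainder; have m0 : 0 <= Num.max r 0 by rewrite le_max lexx orbT.
rewrite (pexp_split _ m0) /ut opprD addrA; congr (_ - _).
have [r0|r0] := leP 0 r; first by [].
rewrite !partial_expansion_psum /psum; congr (\sum_(_ \in _) _).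
apply/seteqP; split=> y [[Ey y0] yr]; split=> //; first exact: le_trans yr (ltW r0).
by move: y0; rewrite ltNge yr.
Qed.

Lemma rem_ut r : r <= 0 -> remainder pr rho Ep a ut r = ut.
Proof.
move=> r0; apply/funext => x; rewrite /remainder /partial_expansion (_ : [set sp | _] = set0) ?fsbig_set0 ?subr0 //.
apply/seteqP; split=> // y [[Ey y0] yr]; move: y0; rewrite ltNge.
by rewrite (le_trans yr r0).
Qed.


Section Bounds.
Variable L : set ((T -> R) -> (T -> R)).
Hypothesis dL : forall V, L V -> derivation M U V.
Variables (A : set T) (P q : T -> R) (B : R).
Hypotheses (AO : A `<=` Om) (B1 : 1 <= B).
Hypothesis rB : forall t, A t -> 0 < rho t <= B.
Hypothesis PB : forall t, A t -> 0 < P t <= B.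
Hypothesis qB : forall t, A t -> 0 < q t <= 1.
Local Notation W := (weight rho P q).
Variables (m l : nat).
Hypothesis Hw : forall r, words L A l.+1 (W r (- m%:R) 0) (remainder pr rho EF a u r).

Lemma words_diff k x y z f f' : sm f -> sm f' -> words L A k (W x y z) f -> words L A k (W x y z) f' ->
  words L A k (W x y z) (fun t => f t - f' t).
Proof.
move=> sf sf' h h' w sw Lw.
have W0 t : A t -> 0 <= W x y z t by move=> At; exact/ltW/(W_gt0 rB PB qB).
have c1 := words_cls W0 h; have c2 := words_cls W0 h'.
have c : cls L A (fun=> 1) k (W x y z) (fun t => f t + (-1) * f' t).
  apply: (cls_add dL AO) => //; last exact: (cls_scale dL AO).
  by apply: smooth_fun_mul => //; exact: smooth_fun_cst.
have -> : (fun t => f t - f' t) = (fun t => f t + (-1) * f' t) by apply/funext => t; rewrite mulN1r.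
have [D HD] := cls_unwords c sw Lw; exists D => t At; apply: le_trans (HD t At) _.
by rewrite expr1n invr1 mulr1.
Qed.

Lemma words_W_le k x y z x' y' z' f : x' <= x -> y' <= y -> z' <= z ->
  words L A k (W x y z) f -> words L A k (W x' y' z') f.
Proof.
move=> xx yy zz H w sw Lw; have [D HD] := H w sw Lw.
have [D' HD'] := W_le rB PB qB xx yy zz; exists (`|D| * D') => t At.
apply: le_trans (HD t At) _; have [h0 h1] := HD' t At.
apply: (@le_trans _ _ (`|D| * W x y z t)); first by rewrite ler_wpM2r ?ler_norm.
by rewrite -mulrA ler_wpM2l.
Qed.

Lemma words_shift r : words L A l.+1 (W r (- m%:R) 0) (remainder pr rho Ep a ut r).
Proof. by rewrite rem_shift; apply: words_W_le (Hw _); rewrite // le_max lexx. Qed.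

Section Eta.
Variable eta : R.
Hypothesis e0 : 0 < eta.
Local Notation p := (loss rho P q eta m).
Local Notation C := (cls L A p).

Lemma cls_derivative f V : L V -> words L A l.+1 (W (- eta) (- m%:R) 0) f ->
  C l (fun t => (p t)^-1) (V f).
Proof.
move=> LV wf; have wV := words_step LV wf.
apply: (cls_eqw (g := W (- eta) (- m%:R) 0)).
  by move=> t At; rewrite /loss (W_inv rB PB qB) // oppr0.
apply: (clsW_words rB PB qB e0 _ _ _ _ wV) => //.
- by rewrite lerBlDr lerDl ltW.
- by rewrite lerBlDr lerDl.
by have [//|//|D HD] := wV [::]; exists D.
Qed.

(** At order -eta the partial expansion of u is empty, as no exponent is negative. *)
Lemma words_u : words L A l.+1 (W (- eta) (- m%:R) 0) u.
Proof.
suff <- : remainder pr rho EF a u (- eta) = u by exact: Hw.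
apply/funext => x; rewrite /remainder /partial_expansion (_ : [set sp | _] = set0) ?fsbig_set0 ?subr0 //.
apply/seteqP; split=> // -[s i] [/= Es sr]; have := nE Es.
by case=> [s0|[s0 _]]; move: sr; rewrite leNgt => /negP[]; [apply: lt_trans s0|rewrite s0]; rewrite oppr_lt0.
Qed.

Lemma words_ut : words L A l.+1 (W (- eta) (- m%:R) 0) ut.
Proof. by rewrite -(@rem_ut (- eta)) ?oppr_le0 ?(ltW e0) //; exact: words_shift. Qed.

Lemma words_lp : words L A l.+1 (W (- eta) (- m%:R) 0) lp.
Proof.
have -> : lp = fun t => u t - ut t by apply/funext => t; rewrite /ut subKr.
exact: words_diff ut_smooth words_u words_ut.
Qed.

(** [cls_chain] for a constant sequence: a derivative reproduces exp(-f) with the factor -V f. *)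
Lemma cls_expN f x y z : sm f -> words L A l.+1 (W (- eta) (- m%:R) 0) f ->
  (exists D, forall t, A t -> expR (- f t) <= D * W x y z t) -> C l (W x y z) (fun t => expR (- f t)).
Proof.
move=> sf wf [D HD].
have := @cls_chain _ _ _ M U L dL A p AO (p_gt0 rB PB qB eta m) (fun=> W x y z)
  (fun=> fun t => expR (- f t)) (fun V t => - V f t) (fun _ _ => fun=> 0) 1 l.
move=> /(_ _ _ _ _ _ _ _ _ _ 0%N); apply.
- by move=> _; exact: expN_smooth.
- by move=> _ t At; exact/ltW/(W_gt0 rB PB qB).
- by move=> _ t At; rewrite mul1r.
- by move=> _; exists D => t At; rewrite ger0_norm ?expR_ge0 ?HD.
- move=> V LV; have sV := dv_smooth (dL LV) sf.
  have -> : (fun t => - V f t) = (fun t => (-1) * V f t) by apply/funext => t; rewrite mulN1r.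
  by apply: smooth_fun_mul => //; exact: smooth_fun_cst.
- by move=> _ V LV; exact: smooth_fun_cst.
- move=> V LV; apply: (cls_sub (leq_pred l)); have sV := dv_smooth (dL LV) sf.
  have -> : (fun t => - V f t) = (fun t => (-1) * V f t) by apply/funext => t; rewrite mulN1r.
  by apply: (cls_scale dL AO) => //; exact: cls_derivative.
- move=> _ V LV; apply: (cls_cst dL _ AO); exists 0 => t At; by rewrite normr0 mul0r.
move=> _ V LV t Ot; by rewrite (dv_expN (dL LV)) // mul0r addr0.
Qed.


Section Expansion.
Variable rmax : R.
Hypothesis Hcoef : forall x, Ep x -> x.1 <= rmax -> exists (D : R) (i : nat), 0 <= D /\
  forall t, A t -> `|a x.1 x.2 (pr t)| <= D * q t ^- i.
Variable Cl : nat -> R.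
Hypothesis Hl : forall t, A t -> forall i, expR (- lp t) <= Cl i * q t ^+ i.

(** f = O(rho^x P^y) up to a power of q, which is not recorded because exp(-[lp]) will absorb it. *)
Definition Ob (x y : R) (f : T -> R) := exists D z : R, [/\ 0 <= D, z <= 0 & forall t, A t -> `|f t| <= D * W x y z t].

Lemma Ob_le x y x' y' f : x' <= x -> y' <= y -> Ob x y f -> Ob x' y' f.
Proof.
move=> xx yy [D [z [D0 z0 H]]]; have [D' HD'] := W_le rB PB qB xx yy (lexx z).
exists (D * `|D'|), z; split=> //; first by rewrite mulr_ge0.
move=> t At; apply: le_trans (H t At) _; have [h0 h1] := HD' t At.
rewrite -mulrA ler_wpM2l //; apply: le_trans h1 _.
by rewrite ler_wpM2r ?ler_norm // ltW // (W_gt0 rB PB qB).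
Qed.

Lemma Ob_add x y f f' : Ob x y f -> Ob x y f' -> Ob x y (fun t => f t + f' t).
Proof.
move=> [D [z [D0 z0 H]]] [D' [z' [D'0 z'0 H']]].
have zm : Num.min z z' <= z by rewrite ge_min lexx.
have zm' : Num.min z z' <= z' by rewrite ge_min lexx orbT.
have [E HE] := W_le rB PB qB (lexx x) (lexx y) zm.
have [E' HE'] := W_le rB PB qB (lexx x) (lexx y) zm'.
exists (D * `|E| + D' * `|E'|), (Num.min z z'); split=> [||t At].
- by rewrite addr_ge0 ?mulr_ge0.
- by rewrite (le_trans zm).
have w0 := W_gt0 rB PB qB x y (Num.min z z') At.
apply: le_trans (ler_normD _ _) _; rewrite mulrDl; apply: lerD.
  apply: le_trans (H t At) _; have [h0 h1] := HE t At; rewrite -mulrA ler_wpM2l //.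
  by apply: le_trans h1 _; rewrite ler_wpM2r ?ler_norm // ltW.
apply: le_trans (H' t At) _; have [h0 h1] := HE' t At; rewrite -mulrA ler_wpM2l //.
by apply: le_trans h1 _; rewrite ler_wpM2r ?ler_norm // ltW.
Qed.

Lemma Ob_opp x y f : Ob x y f -> Ob x y (fun t => - f t).
Proof. by move=> [D [z [D0 z0 H]]]; exists D, z; split=> // t At; rewrite normrN H. Qed.

Lemma Ob_ext x y f f' : (forall t, A t -> f t = f' t) -> Ob x y f -> Ob x y f'.
Proof. by move=> E [D [z [D0 z0 H]]]; exists D, z; split=> // t At; rewrite -E // H. Qed.

Lemma Ob_sum x y (I : eqType) (s : seq I) f : (forall i, i \in s -> Ob x y (f i)) ->
  Ob x y (fun t => \sum_(i <- s) f i t).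
Proof.
elim: s => [|i s IH] H.
  by exists 0, 0; split=> // t At; rewrite big_nil normr0 mul0r.
apply: (Ob_ext (f := fun t => f i t + \sum_(j <- s) f j t)); first by move=> t At; rewrite big_cons.
apply: Ob_add; first by apply: H; rewrite mem_head.
by apply: IH => j js; apply: H; rewrite in_cons js orbT.
Qed.

Lemma q_pow i t : A t -> q t ^- i = W 0 0 (- i%:R) t.
Proof.
move=> At; have /andP[q0 _] := qB At.
by rewrite /weight !powRr0 !mul1r powRN powR_mulrn // ltW.
Qed.

Lemma Ob_term x d : Ep x -> x.1 <= rmax -> d < x.1 ->
  Ob d 0 (fun t => a x.1 x.2 (pr t) * (rho t `^ x.1) * ln (rho t) ^+ x.2).
Proof.
move=> Ex xr dx; have [D [i [D0 HD]]] := Hcoef Ex xr.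
have [E E0 HE] := @powR_ln_bound_le _ B x.1 d x.2 B1 (or_introl dx).
exists (D * E), (- i%:R); split=> [||t At]; first by rewrite mulr_ge0 // ltW.
  by rewrite oppr_le0.
rewrite -mulrA normrM normrM [ `|_ `^ _|]ger0_norm ?powR_ge0 // normrX.
have -> : W d 0 (- i%:R) t = q t ^- i * rho t `^ d.
  by rewrite q_pow // /weight !powRr0 !mul1r mulr1 mulrC.
by rewrite mulrACA; apply: ler_pM; rewrite ?mulr_ge0 ?powR_ge0 ?exprn_ge0 ?HD ?HE ?rB.
Qed.

Lemma pexp_diff r1 r2 : r1 <= r2 -> r2 <= rmax ->
  Ob r1 0 (fun t => partial_expansion Ep a pr rho r2 t - partial_expansion Ep a pr rho r1 t).
Proof.
move=> r12 rm; have [s [us ins es]] := fsum_seq R (Ep_ifin r2).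
apply: (Ob_ext (f := fun t => \sum_(x <- s)
   if r1 < x.1 then a x.1 x.2 (pr t) * (rho t `^ x.1) * ln (rho t) ^+ x.2 else 0)).
  move=> t At; rewrite !partial_expansion_psum !(psum_seq _ _ _ us); last 2 first.
  - by move=> x Ex xr; apply/ins; split=> //; exact: le_trans xr r12.
  - by move=> x Ex xr; apply/ins.
  rewrite [X in _ = X - _]big_mkcond [X in _ = _ - X]big_mkcond -sumrB; apply: eq_big_seq => x /ins[Ex xr].
  rewrite asboolT //; case: leP => [xr1|xr1]; first by rewrite asboolT ?subrr.
  by rewrite asboolF ?subr0 // => -[_].
apply: Ob_sum => x /ins[Ex xr]; case: ltP => [xr1|_]; first by apply: Ob_term => //; exact: le_trans xr rm.
by exists 0, 0; split=> // t At; rewrite normr0 mul0r.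
Qed.

Lemma rem_smooth_ut r : sm (remainder pr rho Ep a ut r).
Proof. exact: (rem_smooth gM bF tr r Ep_ifin Ep_smooth ut_smooth). Qed.

(** The block of terms with exponents above s - kap and up to s. The bounds of the coefficients give
    rho^(s - eta) without any loss in P, eta being at least kap; the derivatives are those of the
    two remainders whose difference it is. *)
Lemma cls_jump s kap : s <= rmax -> 0 < kap <= eta -> exists2 z : R, z <= 0 &
  C l (W (s - eta) 0 z) (fun t => remainder pr rho Ep a ut (s - kap) t - remainder pr rho Ep a ut s t).
Proof.
move=> sr /andP[k0 ke]; have sk : s - kap <= s by rewrite gerBl ltW.
have [D [z [D0 z0 H]]] : Ob (s - eta) 0
    (fun t => remainder pr rho Ep a ut (s - kap) t - remainder pr rho Ep a ut s t).
  apply: (@Ob_le (s - kap) 0) => //; first by rewrite lerD2l lerN2.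
  apply: Ob_ext (pexp_diff sk sr) => t At; rewrite /remainder; ring.
have w1 : words L A l.+1 (W (s - kap) (- m%:R) 0)
    (fun t => remainder pr rho Ep a ut (s - kap) t - remainder pr rho Ep a ut s t).
  apply: words_diff; [exact: rem_smooth_ut|exact: rem_smooth_ut|exact: words_shift|].
  exact: words_W_le (words_shift s).
exists z => //; apply: (cls_sub (leqnSn l)); apply: (clsW_words rB PB qB e0 _ _ z0 _ w1).
- by rewrite -addrA lerD2l -opprD lerN2; apply: le_trans ke _; rewrite lerDl ltW.
- by rewrite sub0r.
by exists D.
Qed.

Lemma cls_lead z : C l (W 0 0 z) (fun t => expR (- lp t)).
Proof.
apply: cls_expN; [exact: lp_smooth|exact: words_lp|].
have [i iz] : exists i : nat, z <= i%:R.
  by exists (Num.bound `|z|); exact/ltW/(le_lt_trans (ler_norm z))/archi_boundP.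
have [D HD] := W_le rB PB qB (lexx (0 : R)) (lexx (0 : R)) iz.
exists (`|Cl i| * D) => t At; apply: le_trans (Hl At i) _; have [h0 h1] := HD t At.
have -> : q t ^+ i = W 0 0 i%:R t.
  by have /andP[q0 _] := qB At; rewrite /weight !powRr0 !mul1r powR_mulrn // ltW.
apply: (@le_trans _ _ (`|Cl i| * W 0 0 i%:R t)); first by rewrite ler_wpM2r ?ler_norm.
by rewrite -mulrA ler_wpM2l.
Qed.

Lemma trunc0 r t : partial_expansion (gen EF) (Bc 0) pr rho r t = if 0 <= r then expR (- lp t) else 0.
Proof.
rewrite partial_expansion_psum; have [s [us ins _]] := fsum_seq R (gen_ifin fE r).
rewrite (psum_seq _ _ _ us); last by move=> x Ex xr; apply/ins.
rewrite big_seq_cond (eq_bigr (fun x => if x == (0, 0%N) then expR (- lp t) else 0)); last first.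
  move=> -[x i] _ /=; rewrite -pair_eqE /pair_eq /=; case: ifP => [/andP[/eqP-> /eqP->]|_]; last by rewrite !mul0r.
  by rewrite powRr0 expr0 !mulr1.
rewrite -big_mkcondr /=; case: ifP => r0.
  rewrite (eq_bigl (fun x => (x \in s) && (x == (0, 0%N)))); last first.
    move=> x; case: eqP => [->|]; rewrite ?andbF // !andbT.
    by case xs: (_ \in s) => //=; apply/asboolP; move/ins: xs.
  rewrite -big_seq_cond -big_filter filter_pred1_uniq ?big_seq1 //.
  by apply/ins; split=> //; exact: gen_zero.
rewrite big_pred0 // => x; apply/andP => -[/andP[/ins[_ xr] _] /eqP xE].
by move: xr; rewrite xE /= r0.
Qed.

Lemma trunc_smooth j r : sm (partial_expansion (gen EF) (Bc j) pr rho r).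
Proof. exact: (pexp_smooth gM bF tr r (gen_ifin fE) (@Bc_smooth j)). Qed.

Lemma gen_step x y : Ep x -> gen EF y -> gen EF (addp x y).
Proof. by move=> [Ex x0]; exact: gen_add. Qed.

Lemma gen_le x y r : Ep x -> gen EF y -> x.1 + y.1 <= r -> x.1 <= r.
Proof. by move=> _ /gen_ge0 y0; apply: le_trans; rewrite lerDl. Qed.

Section Away.
Variable c0 : R.
Hypotheses (c00 : 0 < c0) (Hc : forall t, A t -> c0 <= rho t).

(** Where rho is bounded above and below, all its powers are comparable. *)
Lemma W_away x y z x' : exists D, forall t, A t -> 0 <= W x y z t /\ W x y z t <= D * W x' y z t.
Proof.
have [xx|xx] := leP x' x; first exact: (W_le rB PB qB xx (lexx y) (lexx z)).
exists ((c0 `^ (x' - x))^-1) => t At; split; first exact/ltW/(W_gt0 rB PB qB).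
have /andP[r0 rb] := rB At; have d0 : 0 < x' - x by rewrite subr_gt0.
rewrite /weight 2!mulrA; do 2!rewrite ler_wpM2r ?powR_ge0 //.
rewrite mulrC ler_pdivlMr ?powR_gt0 //.
have -> : rho t `^ x' = rho t `^ x * rho t `^ (x' - x) by rewrite -powRD ?(gt_eqF r0) ?implybT // addrC subrK.
rewrite ler_wpM2l ?powR_ge0 //; apply: ge0_ler_powR; rewrite ?nnegrE ?(ltW d0) ?(ltW c00) ?(ltW r0) //.
exact: Hc.
Qed.

(** The recursion in j is [rem_mul] for the zero functions, whose remainders are the negated
    truncations; the block of one exponent is rewritten as a difference of two remainders of [ut] in
    order to use [cls_jump]. *)
Lemma trunc_away j r z : r <= rmax -> C l (W 0 0 z) (partial_expansion (gen EF) (Bc j) pr rho r).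
Proof.
elim: j r z => [|j IH] r z rr.
  have [r0|r0] := boolP (0 <= r).
    have -> : partial_expansion (gen EF) (Bc 0) pr rho r = (fun t => expR (- lp t)).
      by apply/funext => t; rewrite trunc0 r0.
    exact: cls_lead.
  have -> : partial_expansion (gen EF) (Bc 0) pr rho r = (fun=> 0).
    by apply/funext => t; rewrite trunc0 (negbTE r0).
  by apply: (cls_cst dL _ AO); exists 0 => t At; rewrite normr0 mul0r.
have [kap [kap0 kapE]] := gap_fun Ep_ifin e0.
have k0 s : 0 < kap s by case/andP: (kap0 s).
have [ss [Hss E]] := rem_mul gM bF tr a (Bc j) (fun=> 0) (fun=> 0) Ep_ifin (gen_ifin fE) (gen_ifin fE) k0 kapE
  gen_step (fun x y Ex Gy => @gen_le x y r Ex Gy).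
apply: (clsW_ext dL AO (f := fun t => \sum_(s <- ss)
   (remainder pr rho Ep a ut (s - kap s) t - remainder pr rho Ep a ut s t) * partial_expansion (gen EF) (Bc j) pr rho (r - s) t)).
- by apply: smooth_fun_sum => s; apply: smooth_fun_mul; [apply: smooth_fun_sub2; exact: rem_smooth_ut|exact: trunc_smooth].
- exact: trunc_smooth.
- move=> t Ot; have H := E t Ot; rewrite {1}/remainder mul0r sub0r mulr0 add0r in H.
  apply: oppr_inj; rewrite [RHS](H : - partial_expansion (gen EF) (Bc j.+1) pr rho r t = _).
  by rewrite -sumrN; apply: eq_bigr => s _; rewrite /remainder; ring.
apply: (clsW_sum dL AO) => [s|s sss].
  by apply: smooth_fun_mul; [apply: smooth_fun_sub2; exact: rem_smooth_ut|exact: trunc_smooth].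
have [sr [i [Es s0]]] := Hss s sss.
have [z1 z10 c1] := cls_jump (le_trans sr rr) (kap0 s).
have c2 : C l (W 0 0 (z - z1)) (partial_expansion (gen EF) (Bc j) pr rho (r - s)).
  by apply: IH; apply: le_trans rr; rewrite gerBl ltW.
have := clsW_mul dL AO rB PB qB _ _ c1 c2; rewrite !addr0 (addrC z1) subrK.
have [D HD] := W_away (s - eta) 0 z 0.
move=> H; apply: (cls_le (p_gt0 rB PB qB eta m) HD); apply: H.
  by apply: smooth_fun_sub2; exact: rem_smooth_ut.
exact: trunc_smooth.
Qed.

(** Away from F no cancellation is involved: exp(-u) and the finitely many truncations are each in
    the class of bounded functions, and any power of rho can be supplied. *)
Lemma cls_away delta r : 0 < delta -> (forall y, Ep y -> delta < y.1) -> r <= rmax ->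
  (exists D, forall t, A t -> expR (- u t) <= D) ->
  C l (W (r + eta * l%:R) (- m%:R) 0) (remainder pr rho (gen EF) (bc delta) (fun t => expR (- u t)) r).
Proof.
move=> d0 Hd rr [D HD].
have c1 : C l (W 0 0 0) (fun t => expR (- u t)).
  by apply: cls_expN => //; [exact: words_u|exists D => t At; rewrite W0 mulr1 HD].
pose J := (Num.bound (`|r| / delta)).+1.
have rJ : r < delta * J%:R.
  have := archi_boundP (divr_ge0 (normr_ge0 r) (ltW d0)); rewrite ltr_pdivrMr // mulrC => h.
  apply: (le_lt_trans (ler_norm r)); apply: (lt_le_trans h).
  by rewrite ler_pM2l // ler_nat.
have st j : sm (fun t => - tcoef j * partial_expansion (gen EF) (Bc j) pr rho r t).
  by apply: smooth_fun_mul; [exact: smooth_fun_cst|exact: trunc_smooth].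
have c2 : C l (W 0 0 0) (remainder pr rho (gen EF) (bc delta) (fun t => expR (- u t)) r).
  apply: (clsW_ext dL AO (f := fun t => expR (- u t) + \sum_(j < J) - tcoef j * partial_expansion (gen EF) (Bc j) pr rho r t)).
  - by apply: smooth_fun_add; [exact: expN_smooth|apply: smooth_fun_sum => j; exact: st].
  - exact: (rem_smooth gM bF tr r (gen_ifin fE) (@bc_smooth delta) (expN_smooth su)).
  - move=> t _; rewrite /remainder (pexp_bc _ d0 Hd rJ) -sumrN; congr (_ + _).
    by apply: eq_bigr => j _; rewrite mulNr.
  apply: (clsW_add dL AO) => //; first exact: expN_smooth.
    by apply: smooth_fun_sum => j; exact: st.
  apply: (clsW_sum dL AO) => // j _; apply: (cls_scale dL AO); first exact: trunc_smooth.
  exact: trunc_away.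
have [E HE] := W_away 0 0 0 (r + eta * l%:R).
apply: (clsW_le rB PB qB (lexx _) _ (lexx _)); last exact: (cls_le (p_gt0 rB PB qB eta m) HE c2).
by rewrite oppr_le0.
Qed.

End Away.

Section Near.
Variables (delta : R) (Dg : R) (ig : nat) (Cu : nat -> R).
Hypotheses (d0 : 0 < delta) (Dg0 : 0 <= Dg).
Hypothesis Hg : forall t, A t -> `|ut t| <= Dg * rho t `^ delta * q t ^- ig.
Hypothesis Hu : forall t, A t -> forall i, expR (- u t) <= Cu i * q t ^+ i.

Lemma Ob_ut : Ob delta 0 ut.
Proof.
exists Dg, (- ig%:R); split=> // [|t At]; first by rewrite oppr_le0.
by apply: le_trans (Hg At) _; rewrite -mulrA ler_wpM2l // q_pow // /weight !powRr0 !mulr1 !mul1r.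
Qed.

(* The weights P^-(theta m) cost an arbitrarily small power of P, at the price of an
   expansion to the higher order rmax. *)
Lemma cls_rem theta r : 0 < theta <= 1 -> r <= rmax * theta -> r <= rmax -> 0 <= rmax -> exists2 z : R, z <= 0 &
  C l (W r (- (theta * m%:R)) z) (remainder pr rho Ep a ut r).
Proof.
move=> /andP[t0 t1] rt rr rm0.
have p0 t : partial_expansion Ep a pr rho 0 t = 0.
  have := congr1 (fun f => f t) (rem_ut (lexx 0)); rewrite /remainder => /eqP.
  by rewrite subr_eq addrC -subr_eq subrr => /eqP <-.
(* At order [rmax] there are two bounds: this one, without gain in rho and without loss in P, and
   [H2], with the full gain and the loss P^-m. They are interpolated with exponent theta. *)
have ob1 : Ob 0 0 (remainder pr rho Ep a ut rmax).
  apply: Ob_ext (Ob_add (Ob_le (ltW d0) (lexx _) Ob_ut) (Ob_opp (pexp_diff rm0 (lexx _)))) => t At.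
  by rewrite p0 subr0.
have [D1 [z1 [D10 z10 H1]]] := ob1.
have [//|//|D2 H2] := words_shift rmax (w := [::]).
have ob : Ob r (- (theta * m%:R)) (remainder pr rho Ep a ut r).
  have tm0 : - (theta * m%:R) <= 0 by rewrite oppr_le0 mulr_ge0 // ltW.
  apply: (Ob_ext (f := fun t => remainder pr rho Ep a ut rmax t +
     (partial_expansion Ep a pr rho rmax t - partial_expansion Ep a pr rho r t))).
    by move=> t At; rewrite /remainder; ring.
  apply: Ob_add; last exact: Ob_le (lexx _) tm0 (pexp_diff rr (lexx _)).
  apply: (@Ob_le (rmax * theta) (- (theta * m%:R))) => //.
  exists (D1 `^ (1 - theta) * `|D2| `^ theta), (z1 * (1 - theta)); split=> [||t At].
  - by rewrite mulr_ge0 ?powR_ge0.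
  - by rewrite mulr_le0_ge0 // subr_ge0.
  have w1 := W_gt0 rB PB qB 0 0 z1 At; have w2 := W_gt0 rB PB qB rmax (- m%:R) 0 At.
  have b2 : `|remainder pr rho Ep a ut rmax t| <= `|D2| * W rmax (- m%:R) 0 t.
    by apply: le_trans (H2 t At) _; rewrite ler_wpM2r ?ler_norm // ltW.
  apply: le_trans (interpolate _ t0 t1 (H1 t At) b2) _ => //.
  rewrite (powRM _ D10 (ltW w1)) (powRM _ (normr_ge0 _) (ltW w2)) !(W_powR rB PB qB) // mulrACA (W_mul rB PB qB) //.
  by rewrite !mul0r !add0r addr0 mulNr [m%:R * _]mulrC.
have [D [z [D0 z0 H]]] := ob; exists z => //.
apply: (cls_sub (leqnSn l)); apply: (clsW_words rB PB qB e0 _ _ z0 _ (words_shift r)).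
- by rewrite gerBl ltW.
- by rewrite gerDr oppr_le0 mulr_ge0 // ltW.
by exists D.
Qed.


Lemma nat_ge (z : R) : exists i : nat, z <= i%:R.
Proof. by exists (Num.bound `|z|); exact/ltW/(le_lt_trans (ler_norm z))/archi_boundP. Qed.

Lemma derivative_smooth f V : L V -> sm f -> sm (V f).
Proof. by move=> LV; exact: (dv_smooth (dL LV)). Qed.

Lemma opp_smooth f : sm f -> sm (fun t => - f t).
Proof.
move=> sf; have -> : (fun t => - f t) = (fun t => (-1) * f t) by apply/funext => t; rewrite mulN1r.
by apply: smooth_fun_mul => //; exact: smooth_fun_cst.
Qed.

Lemma cls_opp k g f : sm f -> C k g f -> C k g (fun t => - f t).
Proof.
move=> sf H; have -> : (fun t => - f t) = (fun t => (-1) * f t) by apply/funext => t; rewrite mulN1r.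
exact: (cls_scale dL AO).
Qed.

Lemma qX i t : A t -> q t ^+ i = W 0 0 i%:R t.
Proof.
by move=> At; have /andP[q0 _] := qB At; rewrite /weight !powRr0 !mul1r powR_mulrn // ltW.
Qed.

Lemma Hg_W j t : A t -> `|ut t| ^+ j <= Dg ^+ j * W (delta * j%:R) 0 (- (ig%:R * j%:R)) t.
Proof.
move=> At; have h : `|ut t| <= Dg * W delta 0 (- ig%:R) t.
  apply: le_trans (Hg At) _; rewrite -mulrA ler_wpM2l // q_pow //.
  by rewrite /weight !powRr0 !mulr1 !mul1r.
apply: (@le_trans _ _ ((Dg * W delta 0 (- ig%:R) t) ^+ j)).
  by rewrite lerXn2r // nnegrE; exact: le_trans (normr_ge0 _) h.
by rewrite exprMn (W_exp rB PB qB) // mul0r mulNr.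
Qed.

(** exp(-[lp]) decays faster than every power of q, so it absorbs what ut^j loses and leaves any z;
    derivatives lead back to [Q j] and [Q j.-1], as [cls_chain] asks. *)
Lemma cls_Q z j : C l (W 0 0 z) (Q j).
Proof.
have := @cls_chain _ _ _ M U L dL A p AO (p_gt0 rB PB qB eta m) (fun=> W 0 0 z)
  Q (fun V t => - V lp t) (fun j V t => j%:R * V ut t) 1 l.
move=> /(_ _ _ _ _ _ _ _ _ _ j); apply.
- exact: Q_smooth.
- by move=> _ t At; exact/ltW/(W_gt0 rB PB qB).
- by move=> _ t At; rewrite mul1r.
- move=> i; have [k hk] := nat_ge (z + ig%:R * i%:R).
  have zk : z <= k%:R - ig%:R * i%:R by rewrite lerBrDr.
  have di : 0 <= delta * i%:R by rewrite mulr_ge0 // ltW.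
  have [D HD] := W_le rB PB qB di (lexx (0 : R)) zk.
  exists (`|Cl k| * Dg ^+ i * D) => t At; have [h0 h1] := HD t At.
  rewrite normrM normrX ger0_norm ?expR_ge0 //.
  apply: (@le_trans _ _ ((`|Cl k| * q t ^+ k) * (Dg ^+ i * W (delta * i%:R) 0 (- (ig%:R * i%:R)) t))).
    apply: ler_pM; rewrite ?expR_ge0 ?exprn_ge0 ?Hg_W //.
    apply: le_trans (Hl At k) _; rewrite ler_wpM2r ?ler_norm //.
    by rewrite exprn_ge0 // ltW //; case/andP: (qB At).
  rewrite (qX k At); have -> : `|Cl k| * W 0 0 k%:R t * (Dg ^+ i * W (delta * i%:R) 0 (- (ig%:R * i%:R)) t) =
      `|Cl k| * Dg ^+ i * (W 0 0 k%:R t * W (delta * i%:R) 0 (- (ig%:R * i%:R)) t) by rewrite mulrACA.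
  rewrite (W_mul rB PB qB _ _ _ _ _ _ At) !add0r -[leRHS]mulrA; apply: ler_wpM2l => //.
  by rewrite mulr_ge0 ?exprn_ge0.
- by move=> V LV; apply: opp_smooth; apply: derivative_smooth => //; exact: lp_smooth.
- move=> i V LV; apply: smooth_fun_mul; first exact: smooth_fun_cst.
  by apply: derivative_smooth => //; exact: ut_smooth.
- move=> V LV; apply: (cls_sub (leq_pred l)); apply: cls_opp.
    by apply: derivative_smooth => //; exact: lp_smooth.
  by apply: cls_derivative => //; exact: words_lp.
- move=> i V LV; apply: (cls_sub (leq_pred l)); apply: (cls_scale dL AO).
    by apply: derivative_smooth => //; exact: ut_smooth.
  by apply: cls_derivative => //; exact: words_ut.
move=> i V LV t Ot; rewrite (dv_mul (dL LV)) //.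
- by rewrite (dv_expN (dL LV) lp_smooth) // (dv_pow (dL LV) _ ut_smooth) // /Q; ring.
- exact: expN_smooth lp_smooth.
- exact: smooth_fun_pow ut_smooth.
Qed.

Definition RJ J t := expR (- u t) - \sum_(i < J) tcoef i * Q i t.

Lemma RJ_S J : RJ J.+1 = fun t => RJ J t + (- tcoef J) * Q J t.
Proof. by apply/funext => t; rewrite /RJ big_ord_recr /= opprD addrA mulNr. Qed.

Lemma RJ_smooth J : sm (RJ J).
Proof.
elim: J => [|J IH].
  have -> : RJ 0 = fun t => expR (- u t) by apply/funext => t; rewrite /RJ big_ord0 subr0.
  exact: expN_smooth.
rewrite RJ_S; apply: smooth_fun_add => //; apply: smooth_fun_mul; last exact: Q_smooth.
exact: smooth_fun_cst.
Qed.

Lemma tcoefS i : tcoef i.+1 * i.+1%:R = - tcoef i.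
Proof.
rewrite /tcoef factS natrM exprS invfM; have h : i.+1%:R != 0 :> R by rewrite pnatr_eq0.
have f0 : (i`!)%:R != 0 :> R by rewrite pnatr_eq0 -lt0n fact_gt0.
by move: ((-1) ^+ i) (i.+1%:R) ((i`!)%:R) h f0 => Z x y h f0; field; rewrite h f0.
Qed.

(** The derivative of a Taylor remainder is the preceding remainder. For J = 0 the predecessor is
    again 0, and the two terms add up to -V u exp(-u). *)
Lemma dv_RJ V J t : L V -> Om t -> V (RJ J) t = - V lp t * RJ J t + - V ut t * RJ J.-1 t.
Proof.
move=> LV Ot; have dV := dL LV.
elim: J => [|J IH].
  have E0 : RJ 0 = fun t => expR (- u t) by apply/funext => x; rewrite /RJ big_ord0 subr0.
  have uE : u = fun y => lp y + ut y by apply/funext => y; rewrite /ut addrC subrK.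
  rewrite /= E0 (dv_expN dV) //; have -> : V u t = V lp t + V ut t.
    by rewrite {1}uE (dv_add dV) //; [exact: lp_smooth|exact: ut_smooth].
  by rewrite opprD mulrDl.
rewrite {1}RJ_S (dv_lin dV) //; last 2 first.
- exact: RJ_smooth.
- exact: Q_smooth.
have -> : V (Q J) t = - V lp t * Q J t + J%:R * V ut t * Q J.-1 t.
  rewrite (dv_mul dV) //; last 2 first.
  - exact: expN_smooth lp_smooth.
  - exact: smooth_fun_pow ut_smooth.
  by rewrite (dv_expN dV lp_smooth) // (dv_pow dV _ ut_smooth) // /Q; ring.
rewrite IH RJ_S /=; have -> : RJ J t = RJ J.-1 t + tcoef J * J%:R * Q J.-1 t.
  case: J {IH} => [|J]; first by rewrite mulr0 mul0r addr0.
  by rewrite tcoefS RJ_S.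
by ring.
Qed.

(** [RJ J] is exp(-lp) times the Taylor remainder at -ut, hence at most |ut|^J (exp(-lp) + exp(-u)).
    The power i = ig J of q, lost by |ut|^J, is recovered from both exponentials. *)
Lemma RJ_bound J : exists D, forall t, A t -> `|RJ J t| <= D * W (delta * J%:R) 0 0 t.
Proof.
pose i := (ig * J)%N; exists (Dg ^+ J * (`|Cl i| + `|Cu i|)) => t At.
have -> : RJ J t = expR (- lp t) * exp_rem J (- ut t).
  have uE : - u t = - lp t + - ut t by rewrite -opprD /ut addrC subrK.
  rewrite /RJ /exp_rem mulrBr uE expRD; congr (_ - _).
  rewrite mulr_sumr; apply: eq_bigr => k _; rewrite /Q /tcoef [in RHS]exprNn; ring.
rewrite normrM ger0_norm ?expR_ge0 //.
apply: (@le_trans _ _ (`|ut t| ^+ J * (expR (- lp t) + expR (- u t)))).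
  apply: (@le_trans _ _ (expR (- lp t) * (`|ut t| ^+ J * (1 + expR (- ut t))))).
    by rewrite ler_wpM2l ?expR_ge0 // -[ `|ut t|]normrN exp_rem_bound.
  have -> : - u t = - lp t + - ut t by rewrite -opprD /ut addrC subrK.
  by rewrite expRD le_eqVlt; apply/orP; left; apply/eqP; ring.
apply: (@le_trans _ _ ((Dg ^+ J * W (delta * J%:R) 0 (- (ig%:R * J%:R)) t) * ((`|Cl i| + `|Cu i|) * q t ^+ i))).
  apply: ler_pM; rewrite ?exprn_ge0 ?addr_ge0 ?expR_ge0 ?Hg_W //.
  have qi : 0 <= q t ^+ i by rewrite exprn_ge0 // ltW //; case/andP: (qB At).
  rewrite mulrDl; apply: lerD; [apply: le_trans (Hl At i) _|apply: le_trans (Hu At i) _];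
    by rewrite ler_wpM2r ?ler_norm.
by rewrite qX // mulrACA (W_mul rB PB qB) // !addr0 /i natrM addNr.
Qed.

(** Each derivative may lower the Taylor order by one, whence J - l. *)
Lemma cls_RJ J : C l (W (delta * (J - l)%N%:R) 0 0) (RJ J).
Proof.
have := @cls_chain _ _ _ M U L dL A p AO (p_gt0 rB PB qB eta m) (fun j => W (delta * j%:R) 0 0)
  RJ (fun V t => - V lp t) (fun _ V t => - V ut t) (B `^ delta) l.
move=> /(_ _ _ _ _ _ _ _ _ _ J); apply.
- exact: RJ_smooth.
- by move=> j t At; exact/ltW/(W_gt0 rB PB qB).
- move=> j t At; rewrite /weight !powRr0 !mulr1.
  case: j => [|j] /=.
    rewrite mulr0 powRr0 mulr1 -[leLHS](powRr0 B); apply: ler_powR => //; exact: ltW.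
  apply: le_trans (@powR_le_shift _ _ B (delta * j%:R) _ (rB At) _) _.
    by rewrite ler_wpM2l ?(ltW d0) // ler_nat.
  by rewrite -mulrBr -natrB // subSnn mulr1.
- exact: RJ_bound.
- by move=> V LV; apply: opp_smooth; apply: derivative_smooth => //; exact: lp_smooth.
- by move=> i V LV; apply: opp_smooth; apply: derivative_smooth => //; exact: ut_smooth.
- move=> V LV; apply: (cls_sub (leq_pred l)); apply: cls_opp.
    by apply: derivative_smooth => //; exact: lp_smooth.
  by apply: cls_derivative => //; exact: words_lp.
- move=> i V LV; apply: (cls_sub (leq_pred l)); apply: cls_opp.
    by apply: derivative_smooth => //; exact: ut_smooth.
  by apply: cls_derivative => //; exact: words_ut.
by move=> j V LV t Ot; exact: dv_RJ.
Qed.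

Lemma remQ_smooth j r : sm (remainder pr rho (gen EF) (Bc j) (Q j) r).
Proof. exact: (rem_smooth gM bF tr r (gen_ifin fE) (@Bc_smooth j) (@Q_smooth j)). Qed.

(** Induction on j through [rem_mul] with first factor [ut]. Every factor costs at most eta in the
    power of rho, because of the blocks of terms of one exponent, and theta m in the power of P,
    because of the remainders of [ut]. *)
Lemma cls_remQ theta r0 : 0 < theta <= 1 -> r0 <= rmax * theta -> r0 <= rmax -> 0 <= rmax ->
  forall j r z, r <= r0 ->
  C l (W (r - eta * j%:R) (- (theta * m%:R * j%:R)) z) (remainder pr rho (gen EF) (Bc j) (Q j) r).
Proof.
move=> t01 rt rm rm0; have [t0 t1] := andP t01; elim=> [|j IH] r z rr.
  rewrite !mulr0 subr0 oppr0; have [r00|r00] := boolP (0 <= r).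
    have -> : remainder pr rho (gen EF) (Bc 0) (Q 0) r = (fun=> 0).
      by apply/funext => t; rewrite /remainder trunc0 r00 /Q expr0 mulr1 subrr.
    by apply: (cls_cst dL _ AO); exists 0 => t At; rewrite normr0 mul0r.
  have -> : remainder pr rho (gen EF) (Bc 0) (Q 0) r = Q 0.
    by apply/funext => t; rewrite /remainder trunc0 (negbTE r00) subr0.
  apply: (clsW_le rB PB qB _ _ _ (cls_Q z 0)) => //.
  by rewrite -ltNge in r00; exact: ltW.
have [kap [kap0 kapE]] := gap_fun Ep_ifin e0.
have k0 s : 0 < kap s by case/andP: (kap0 s).
have [ss [Hss E]] := rem_mul gM bF tr a (Bc j) ut (Q j) Ep_ifin (gen_ifin fE) (gen_ifin fE) k0 kapE
  gen_step (fun x y Ex Gy => @gen_le x y r Ex Gy).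
have mj : 0 <= theta * m%:R * j%:R by rewrite !mulr_ge0 // ltW.
have mS : theta * m%:R * j.+1%:R = theta * m%:R * j%:R + theta * m%:R by rewrite -natr1 mulrDr mulr1.
have eS : eta * j.+1%:R = eta * j%:R + eta by rewrite -natr1 mulrDr mulr1.
have m0 : 0 <= theta * m%:R by rewrite mulr_ge0 // ltW.
have ej : 0 <= eta * j%:R by rewrite mulr_ge0 // ltW.
apply: (clsW_ext dL AO (f := fun t => remainder pr rho Ep a ut r t * Q j t + \sum_(s <- ss)
   (remainder pr rho Ep a ut (s - kap s) t - remainder pr rho Ep a ut s t) * remainder pr rho (gen EF) (Bc j) (Q j) (r - s) t)).
- apply: smooth_fun_add; first by apply: smooth_fun_mul; [exact: rem_smooth_ut|exact: Q_smooth].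
  by apply: smooth_fun_sum => s; apply: smooth_fun_mul; [apply: smooth_fun_sub2; exact: rem_smooth_ut|exact: remQ_smooth].
- exact: remQ_smooth.
- move=> t Ot; rewrite -(E t Ot) /remainder; congr (_ - _).
  by rewrite /Q exprS mulrCA.
apply: (clsW_add dL AO).
- by apply: smooth_fun_mul; [exact: rem_smooth_ut|exact: Q_smooth].
- by apply: smooth_fun_sum => s; apply: smooth_fun_mul; [apply: smooth_fun_sub2; exact: rem_smooth_ut|exact: remQ_smooth].
- have [z1 z10 c1] := cls_rem t01 (le_trans rr rt) (le_trans rr rm) rm0.
  have := clsW_mul dL AO rB PB qB (@rem_smooth_ut r) (@Q_smooth j) c1 (cls_Q (z - z1) j).
  rewrite !addr0 (addrC z1) subrK; apply: (clsW_le rB PB qB) => //.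
    by rewrite eS gerBl addr_ge0 // ltW.
  by rewrite mS lerN2 lerDr.
apply: (clsW_sum dL AO) => [s|s sss].
  by apply: smooth_fun_mul; [apply: smooth_fun_sub2; exact: rem_smooth_ut|exact: remQ_smooth].
have [sr [i [Es s0]]] := Hss s sss; rewrite /= in s0.
have [z1 z10 c1] := cls_jump (le_trans (le_trans sr rr) rm) (kap0 s).
have c2 := IH (r - s) (z - z1) _.
have {}c2 := c2 (le_trans _ rr).
have rs : r - s <= r by rewrite gerBl ltW.
have := clsW_mul dL AO rB PB qB (smooth_fun_sub2 (@rem_smooth_ut (s - kap s)) (@rem_smooth_ut s))
  (@remQ_smooth j (r - s)) c1 (c2 rs).
rewrite (addrC z1) subrK; apply: (clsW_le rB PB qB) => //.
  by rewrite eS; lra.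
by rewrite mS; lra.
Qed.

(** exp(-u) is [RJ J] plus the Taylor terms, which are truncated at r + kap instead of r: there are
    no exponents in between, and the gain kap pays for the losses eta. By theta J <= 1 no Taylor
    term loses more than P^-m, however large J is. *)
Lemma cls_near theta r kap J : 0 < theta <= 1 -> (forall y, Ep y -> delta < y.1) -> 0 <= kap ->
  (forall x, gen EF x -> r < x.1 -> r + kap < x.1) ->
  r + kap < delta * J%:R -> r + kap <= rmax * theta -> r + kap <= rmax -> 0 <= rmax ->
  theta * J%:R <= 1 -> eta * (J%:R + l%:R) <= kap -> r + eta * l%:R <= delta * (J - l)%N%:R ->
  C l (W (r + eta * l%:R) (- m%:R) 0) (remainder pr rho (gen EF) (bc delta) (fun t => expR (- u t)) r).
Proof.
move=> t01 Hd k0 gapr rJ rt rm rm0 tJ ek rd; have [t0 t1] := andP t01.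
have sr j : sm (fun t => tcoef j * remainder pr rho (gen EF) (Bc j) (Q j) (r + kap) t).
  by apply: smooth_fun_mul; [exact: smooth_fun_cst|exact: remQ_smooth].
apply: (clsW_ext dL AO (f := fun t => RJ J t +
  \sum_(j < J) tcoef j * remainder pr rho (gen EF) (Bc j) (Q j) (r + kap) t)).
- by apply: smooth_fun_add; [exact: RJ_smooth|apply: smooth_fun_sum => j; exact: sr].
- exact: (rem_smooth gM bF tr r (gen_ifin fE) (@bc_smooth delta) (expN_smooth su)).
- move=> t _; rewrite /remainder; under eq_bigr do rewrite mulrBr.
  rewrite big_split /= sumrN -(pexp_bc _ d0 Hd rJ) /RJ.
  rewrite [in RHS]partial_expansion_psum -(psum_gap (k := kap) _ _ _ gapr (r' := r + kap)) ?lerDl ?k0 ?lexx //.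
  by rewrite -partial_expansion_psum addrA subrK.
apply: (clsW_add dL AO); [exact: RJ_smooth|by apply: smooth_fun_sum => j; exact: sr| |].
  by apply: (clsW_le rB PB qB _ _ _ (cls_RJ J)); rewrite ?oppr_le0.
apply: (clsW_sum dL AO) => // j _; apply: (cls_scale dL AO); first exact: remQ_smooth.
have jJ : j%:R <= J%:R :> R by rewrite ler_nat ltnW.
apply: (clsW_le rB PB qB _ _ _ (cls_remQ t01 rt rm rm0 j 0 (lexx _))) => //.
  have : eta * j%:R <= eta * J%:R by rewrite ler_pM2l.
  by move: ek; rewrite mulrDr; lra.
rewrite lerN2 mulrAC -[leRHS]mul1r ler_wpM2r //; apply: le_trans tJ.
by rewrite ler_wpM2l // ltW.
Qed.

End Near.
End Expansion.
End Eta.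
End Bounds.
End Type1.

(** * Expansion of the exponential *)

Section Local.
Variables (R : realType) (T : topologicalType).

Lemma inear_pt n (M : mfd R T n) x0 P : inear M x0 P -> exists O, [/\ open O, O x0 &
  forall y, (O `&` interior_pts M) y -> P y].
Proof. by case=> O [oO Ox H]; exists O; split=> // y [Oy iy]; exact: H. Qed.

Lemma inear_seq n (M : mfd R T n) x0 (I : eqType) (s : seq I) (Q : I -> R -> nat -> T -> Prop) :
  (forall i, i \in s -> exists D j, 0 <= D /\ inear M x0 (Q i D j)) ->
  exists O, [/\ open O, O x0 & forall i, i \in s -> exists D j, 0 <= D /\
    forall y, (O `&` interior_pts M) y -> Q i D j y].
Proof.
elim: s => [|i s IH] H; first by exists setT; split=> //; exact: openT.
have [|O [oO Ox HO]] := IH; first by move=> j js; apply: H; rewrite inE js orbT.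
have [D [j [D0 /inear_pt[O' [oO' Ox' H']]]]] := H i (mem_head _ _).
exists (O `&` O'); split=> [|//|k]; first exact: openI.
rewrite inE => /orP[/eqP->|/HO[D' [j' [D'0 H2]]]].
  by exists D, j; split=> // y [[_ O'y] iy]; exact: H'.
by exists D', j'; split=> // y [[Oy _] iy]; exact: H2.
Qed.

Lemma W_nat (rho P q : T -> R) r k t : 0 <= P t -> weight rho P q r (- k%:R) 0 t = rho t `^ r * P t ^- k.
Proof. by move=> P0; rewrite /weight powRr0 mulr1 powRN powR_mulrn. Qed.

Section Step.
Variables (n : nat) (M : mfd R T n.+1).
Hypothesis gM : good M.
Variables (F U : set T) (pr : T -> T) (rho : T -> R).
Hypotheses (bF : bhs M F) (tr : trivialization M F U pr rho).
Let N := face M F (F `&` U).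
Local Notation Om := (U `&` interior_pts M).
Variables (tau : set T -> Prop) (E : set T -> set (R * nat)) (u : T -> R).
Hypotheses (iE : index_family M E) (hu : phg M E u) (nE : nonneg_off M tau E).
Hypothesis LB : lower_bound M tau u.
Variables (rhos : set T -> T -> R) (a : R -> nat -> T -> R).
Hypothesis hrhos : forall G, bhs M G -> is_bdf M U G (rhos G).
Hypothesis Hr : conormal_expansion M F U pr rho rhos (E F) u a.

Lemma words_W (L : set ((T -> R) -> (T -> R))) (A A' : set T) l r m k (G : 'I_k -> set T) q f :
  A `<=` A' -> A `<=` Om -> (forall i, bhs M (G i)) ->
  words L A' l (fun x => rho x `^ r * bprod rhos G x ^- m) f ->
  words L A l (weight rho (bprod rhos G) q r (- m%:R) 0) f.
Proof.
move=> AA AO bG H w sw Lw; have [C HC] := H w sw Lw; exists C => x Ax.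
rewrite W_nat; first exact: HC (AA x Ax).
exact/ltW/(bprod_pos gM hrhos bG)/AO.
Qed.

(** There is nothing to expand: [cls_expN] turns the decay of exp(-u) to a sufficiently high order i
    into bounds of order r for its derivatives. *)
Lemma type2_expansion b : tau F -> conormal_expansion M F U pr rho rhos set0 (fun x => expR (- u x)) b.
Proof.
move=> tF; apply: (conormal_local gM hrhos) => K cK KU.
have [k [G [HG HV]]] := conormal_words gM bF tr hrhos Hr cK KU.
have bG i : bhs M (G i) by case: (HG i).
exists k, G; split=> // Vs tV; have [m Hm] := HV Vs tV (size Vs).+1.
exists (m * (size Vs).+1)%N => r x0 Kx.
have [B B1 nB] := weights_bounded gM bF tr hrhos bG (KU _ Kx).
have [r0 Hr0] := ifin_lower (index_set_ifin (iE bF)).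
(* -eta lies below all exponents at F, so u is its own remainder of that order. Here eta is not
   small, and the power i of rho pays for it. *)
pose eta := `|r0| + 1; have e0 : 0 < eta by rewrite ltr_wpDl.
have [i Hi] : exists i : nat, r + eta * (size Vs)%:R <= i%:R.
  by exists (Num.bound (`|r + eta * (size Vs)%:R|)); apply: le_trans (ler_norm _) (ltW (archi_boundP _)).
have [C C0 nC] := type2_decay gM bF tr i iE hu nE LB tF (KU _ Kx).
have [O [oO Ox HO]] := inear_pt (inear_and nB nC).
pose A := K `&` interior_pts M `&` O; pose q : T -> R := fun=> 1.
have AO : A `<=` Om by move=> x [[Kx' ix] _]; split=> //; exact: KU.
have HA x : A x -> [/\ rho x <= B, bprod rhos G x <= B & expR (- u x) <= C * rho x ^+ i].
  by move=> [[_ ix] Ox']; case: (HO x (conj Ox' ix)) => -[_ ? ?] [_ ?].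
have rB x : A x -> 0 < rho x <= B by move=> Ax; case: (HA x Ax) => -> _ _; rewrite (rho_pos gM bF tr (AO _ Ax)).
have PB x : A x -> 0 < bprod rhos G x <= B.
  by move=> Ax; case: (HA x Ax) => _ -> _; rewrite (bprod_pos gM hrhos bG (AO _ Ax)).
have qB x : A x -> 0 < q x <= 1 by rewrite /q ltr01 lexx.
pose L := letters Vs; have dL V : L V -> derivation M U V by exact: (letters_tangent gM tr tV).
have su : smooth_fun M Om u by apply: smooth_fun_sub (phg_smooth hu) => x [].
have wu : words L A (size Vs).+1 (weight rho (bprod rhos G) q (- eta) (- m%:R) 0) u.
  have <- : (fun z => u z - partial_expansion (E F) a pr rho (- eta) z) = u.
    apply/funext => x; rewrite /partial_expansion (_ : [set sp | _] = set0) ?fsbig_set0 ?subr0 //.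
    apply/seteqP; split=> // sp [/Hr0 h1 h2]; have := lt_le_trans h1 h2; rewrite /eta.
    have := ler_norm (- r0); rewrite normrN; lra.
  by apply: words_W (Hm _) => // x [].
have bu : exists D, forall t, A t -> expR (- u t) <= D * weight rho (bprod rhos G) q i%:R 0 0 t.
  exists C => t At; case: (HA t At) => _ _ /le_trans; apply; rewrite /weight !powRr0 !mulr1 powR_mulrn //.
  by case/andP: (rB t At) => /ltW.
have c1 := cls_expN dL AO rB PB qB e0 su wu bu.
have [D HD] := clsW_word rB PB qB (erefl L) c1.
have [D' HD'] : exists D', forall t, A t -> 0 <= weight rho (bprod rhos G) q (i%:R - eta * (size Vs)%:R) (0 - m%:R * (size Vs)%:R) 0 t /\
   weight rho (bprod rhos G) q (i%:R - eta * (size Vs)%:R) (0 - m%:R * (size Vs)%:R) 0 t <=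
   D' * weight rho (bprod rhos G) q r (- (m * (size Vs).+1)%N%:R) 0 t.
  apply: (W_le rB PB qB) => //; first by rewrite lerBrDr.
  by rewrite sub0r lerN2 -natrM ler_nat leq_mul2l leqnSn orbT.
exists O, (`|D| * D'); split=> // x Ox' Kx' ix; have Ax : A x by [].
have [h0 h1] := HD' x Ax.
have -> : (fun z => expR (- u z) - partial_expansion set0 b pr rho r z) = fun z => expR (- u z).
  apply/funext => z; rewrite /partial_expansion (_ : [set sp | _] = set0) ?fsbig_set0 ?subr0 //.
  by apply/seteqP; split=> // sp [].
apply: le_trans (HD x Ax) _; rewrite -(W_nat _ q); last by case/andP: (PB x Ax) => /ltW.
apply: (@le_trans _ _ (`|D| * weight rho (bprod rhos G) q (i%:R - eta * (size Vs)%:R) (0 - m%:R * (size Vs)%:R) 0 x)).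
  by rewrite ler_wpM2r ?ler_norm.
by rewrite -mulrA ler_wpM2l.
Qed.

Lemma rho_away x0 : U x0 -> ~ F x0 -> exists2 c : R, 0 < c & inear M x0 (fun y => c <= rho y).
Proof.
move=> Ux nFx; have [D [sD Dx DU aD [D0 _ _ _]]] := triv_chart gM bF tr Ux.
have rx : 0 < rho x0.
  rewrite -D0 lt0r (schart_orthant sD Dx) andbT; apply/eqP => rx; apply: nFx.
  by apply/(aD _ Dx).
have [O [oO Ox HO]] := dom_open sD Dx.
have [|O' [c [oO' Ox' c0 Hc]]] := smooth_locally_pos gM.1 oO Ox (schart_pts sD Dx) _ (rho_smooth gM bF tr) rx.
  by move=> y Oy py; apply: DU; exact: HO.
by exists c => //; exists O'; split=> // y Oy iy; apply: Hc => //; exact: interior_pts_pts iy.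
Qed.

Lemma type1_expansion delta : ~ tau F ->
  (forall s p, E F (s, p) -> phg N (face_index M F E) (a s p)) ->
  0 < delta -> (forall s q, E F (s, q) -> delta < s \/ (s = 0 /\ q = 0%N)) ->
  conormal_expansion M F U pr rho rhos (gen (E F)) (fun x => expR (- u x)) (bc (E F) a (lead F E a) delta).
Proof.
move=> ntF Ha d0 Hd; apply: (conormal_local gM hrhos) => K cK KU.
have [k [G [HG HV]]] := conormal_words gM bF tr hrhos Hr cK KU.
have bG i : bhs M (G i) by case: (HG i).
exists k, G; split=> // Vs tV; have [m Hm] := HV Vs tV (size Vs).+1.
(* One m for the remainder and one more for each derivative; this depends on K and the fields, but
   not on r or x0. *)
exists (m * (size Vs).+1)%N => r x0 Kx; set l := size Vs in Hm *.
have Ux := KU _ Kx; have px : pts M x0 by case: (relopenE (triv_open tr)) => /(_ _ Ux).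
have [B B1 nB] := weights_bounded gM bF tr hrhos bG Ux.
have fE := index_set_ifin (iE bF); have nF := nE bF ntF.
have [kap kap0 gapr] := ifin_gap r (gen_ifin fE).
have Hd' y : Epos (E F) y -> delta < y.1.
  by case: y => s i [/= /Hd[//|[-> _]]]; rewrite ltxx.
(* delta J0 exceeds r + kap + l, which leaves the order r after all losses. *)
pose J0 := (Num.bound ((`|r| + kap + l%:R) / delta)).+1.
have hJ0 : `|r| + kap + l%:R < delta * J0%:R.
  have h : 0 <= (`|r| + kap + l%:R) / delta by rewrite divr_ge0 ?addr_ge0 // ltW.
  have := archi_boundP h; rewrite ltr_pdivrMr // mulrC => /lt_le_trans; apply.
  by rewrite ler_pM2l // ler_nat.
(* The l additional Taylor terms make up for l derivatives, which lower the order of the Taylor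
   remainder to J0; theta J <= 1 is what [cls_near] asks for. *)
pose J := (J0 + l)%N; pose theta : R := (J.+1%:R)^-1.
have J1 : 1 <= J.+1%:R :> R by rewrite ler1n.
have t01 : 0 < theta <= 1 by rewrite invr_gt0 ltr0n /= invf_le1 ?ltr0n.
have r_le := ler_norm r; have r_ge := normr_ge0 r.
(* Small enough for J + l losses of eta to fit into the gap kap. *)
pose eta := Num.min 1 (kap / (J%:R + l%:R + 1)).
have Jl : 0 < J%:R + l%:R + 1 :> R by rewrite ltr_wpDl // addr_ge0.
have e0 : 0 < eta by rewrite lt_min ltr01 divr_gt0.
have e1 : eta <= 1 by rewrite ge_min lexx.
have ek : eta * (J%:R + l%:R) <= kap.
  apply: (@le_trans _ _ (eta * (J%:R + l%:R + 1))); first by rewrite ler_pM2l // lerDl.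
  by rewrite -ler_pdivlMr // ge_min lexx orbT.
(* Chosen so that rmax theta = |r| + kap, the order that interpolation leaves over. *)
pose rmax := (`|r| + kap) * J.+1%:R.
have rk0 : 0 <= `|r| + kap by rewrite addr_ge0 // ltW.
have rm0 : 0 <= rmax by rewrite mulr_ge0.
have rkm : r + kap <= rmax.
  by apply: (@le_trans _ _ (`|r| + kap)); [rewrite lerD2r|rewrite ler_peMr].
have rm : r <= rmax by apply: le_trans rkm; rewrite lerDl ltW.
have rt : r + kap <= rmax * theta by rewrite /rmax mulfK ?pnatr_eq0 // lerD2r.
have [q [nq Hq Hl HFx]] := face_weight gM bF tr iE hu nE LB ntF hrhos Ha Hr d0 Hd Ux.
have [Cl [_ nCl]] := Hl.
have [l1 [_ l1A _]] := fsum_seq R (fE rmax).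
have [|O1 [oO1 Ox1 H1]] := @inear_seq _ M x0 _ [seq y <- l1 | `[< E F y >]]
    (fun y D j t => `|a y.1 y.2 (pr t)| <= D * q t ^- j).
  by move=> [s i]; rewrite mem_filter => /andP[/asboolP Ey _]; exact/Hq/Ha.
have [ O2 [oO2 Ox2 H2]] := inear_pt (inear_and nB (inear_and nq nCl)).
pose L := letters Vs; have dL V : L V -> derivation M U V by exact: (letters_tangent gM tr tV).
have su : smooth_fun M Om u by apply: smooth_fun_sub (phg_smooth hu) => x [].
have sa s i : E F (s, i) -> smooth_fun N (interior_pts N) (a s i) by move=> /Ha/phg_smooth.
have l0E : lead F E a = if `[< E F (0, 0%N) >] then a 0 0%N else fun=> 0.
  by apply/funext => x; rewrite /lead; case: asboolP.
suff [A [O [oO Ox AE AO HA]]] : exists A O, [/\ open O, O x0, forall x, O x -> K x -> interior_pts M x -> A x,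
   A `<=` Om /\ (forall x, A x -> 0 < bprod rhos G x) & exists C, forall t, A t ->
   `|foldr (fun V h => V h) (remainder pr rho (gen (E F)) (bc (E F) a (lead F E a) delta) (fun x => expR (- u x)) r) Vs t| <=
    C * weight rho (bprod rhos G) q r (- (m * l.+1)%N%:R) 0 t].
  have [C HC] := HA; exists O, C; split=> // x Ox' Kx' ix; have Ax := AE x Ox' Kx' ix.
  apply: le_trans (HC x Ax) _; rewrite W_nat //.
  by case: AO => _ /(_ x Ax)/ltW.
pose base O := K `&` interior_pts M `&` (O1 `&` O2 `&` O).
have H O : open O -> O x0 -> (base O `<=` Om /\ (forall x, base O x -> 0 < bprod rhos G x)) /\
    [/\ forall x, base O x -> 0 < rho x <= B, forall x, base O x -> 0 < bprod rhos G x <= B,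
     forall x, base O x -> 0 < q x <= 1,
     (forall x, Epos (E F) x -> x.1 <= rmax -> exists (D : R) (i : nat), 0 <= D /\
        forall t, base O t -> `|a x.1 x.2 (pr t)| <= D * q t ^- i) &
     (forall t, base O t -> forall i, expR (- lp pr (lead F E a) t) <= Cl i * q t ^+ i) /\
     forall r, words L (base O) l.+1 (weight rho (bprod rhos G) q r (- m%:R) 0) (remainder pr rho (E F) a u r)].
  move=> oO Ox; have AO : base O `<=` Om by move=> x [[Kx' ix] _]; split=> //; exact: KU.
  have bp x : base O x -> 0 < bprod rhos G x by move/AO; exact: (bprod_pos gM hrhos bG).
  have h2 x : base O x -> [/\ U x, rho x <= B & bprod rhos G x <= B] /\ (U x /\ 0 < q x <= 1) /\
     (forall i, expR (- lead F E a (pr x)) <= Cl i * q x ^+ i).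
    by move=> [[_ ix] [[_ x2] _]]; exact: H2.
  split=> //; split.
  - by move=> x Ax; rewrite (rho_pos gM bF tr (AO _ Ax)); case: (h2 x Ax) => -[].
  - by move=> x Ax; rewrite bp //; case: (h2 x Ax) => -[].
  - by move=> x Ax; case: (h2 x Ax) => _ [[]].
  - move=> y [Ey _] yr; have [|D [j [D0 HD]]] := H1 y.
      by rewrite mem_filter asboolT //=; apply/l1A.
    by exists D, j; split=> // t [[_ it] [[t1 _] _]]; exact: HD.
  split; first by move=> t At; case: (h2 t At) => _ [_].
  by move=> r'; apply: words_W (Hm r') => // x [].
have fin A : (forall t, A t -> 0 < rho t <= B) -> (forall t, A t -> 0 < bprod rhos G t <= B) ->
    (forall t, A t -> 0 < q t <= 1) ->
    cls L A (loss rho (bprod rhos G) q eta m) l (weight rho (bprod rhos G) q (r + eta * l%:R) (- m%:R) 0)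
      (remainder pr rho (gen (E F)) (bc (E F) a (lead F E a) delta) (fun x => expR (- u x)) r) ->
    exists C, forall t, A t ->
   `|foldr (fun V h => V h) (remainder pr rho (gen (E F)) (bc (E F) a (lead F E a) delta) (fun x => expR (- u x)) r) Vs t| <=
    C * weight rho (bprod rhos G) q r (- (m * l.+1)%N%:R) 0 t.
  move=> rB PB qB c; have [D HD] := clsW_word rB PB qB (erefl L) c.
  exists D => t At; move: (HD t At); rewrite -/l addrK.
  by rewrite mulnS natrD natrM opprD.
(* Near a point of F the Taylor expansion is used, near other points the lower bound of rho. *)
have [Fx|nFx] := pselect (F x0).
  have [[Dg [ig [Dg0 nDg]]] [Cu [_ nCu]]] := HFx Fx.
  have [ O3 [oO3 Ox3 H3]] := inear_pt (inear_and nDg nCu).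
  have [AO [rB PB qB Hcoef [Hcl Hw]]] := H O3 oO3 Ox3.
  exists (base O3), (O1 `&` O2 `&` O3); split=> //; first by apply: openI => //; exact: openI.
  apply: fin => //.
  have Hg t : base O3 t -> `|ut pr (lead F E a) u t| <= Dg * rho t `^ delta * q t ^- ig.
    by move=> [[_ it] [_ t3]]; case: (H3 t (conj t3 it)).
  have Hu t : base O3 t -> forall i, expR (- u t) <= Cu i * q t ^+ i.
    by move=> [[_ it] [_ t3]]; case: (H3 t (conj t3 it)).
  have J0J : (J - l = J0)%N by rewrite addnK.
  have dJ : delta * J0%:R <= delta * J%:R by rewrite ler_pM2l // ler_nat leq_addr.
  have el : eta * l%:R <= l%:R by rewrite ler_piMl.
  have l0 : 0 <= l%:R :> R by [].
  apply: (cls_near gM bF tr fE nF su sa l0E dL AO.1 B1 rB PB qB Hw e0 Hcoef Hcl d0 Dg0 Hg Hu t01 Hd' (ltW kap0) gapr _ rt rkm rm0 _ ek).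
  - by move: hJ0 dJ r_le l0; move: (delta * _) (delta * J%:R) => X Y; lra.
  - by rewrite mulrC ler_pdivrMr ?ltr0n // mul1r ler_nat.
  - by rewrite J0J; move: hJ0 kap0 r_le el; move: (delta * _) (eta * _) => X Y; lra.
have [c c0 nc] := rho_away Ux nFx.
have [ O4 [C [oO4 Ox4 C0 nC]]] := exp_locally_bounded gM iE hu nE LB px.
have [ O3 [oO3 Ox3 H3]] := inear_pt nc.
have [|//|AO [rB PB qB Hcoef [Hcl Hw]]] := H (O3 `&` O4); first exact: openI.
exists (base (O3 `&` O4)), (O1 `&` O2 `&` (O3 `&` O4)); split=> //; first by do ?apply: openI.
apply: fin => //.
have Hc t : base (O3 `&` O4) t -> c <= rho t by move=> [[_ it] [_ [t3 _]]]; exact: H3.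
apply: (cls_away gM bF tr fE nF su sa l0E dL AO.1 B1 rB PB qB Hw e0 Hcoef Hcl c0 Hc d0 Hd' rm).
by exists C => t [[_ it] [_ [_ t4]]]; exact: nC.
Qed.

End Step.
End Local.

(** * Polyhomogeneity of the coefficients and the induction on the dimension *)

Section Exponential.
Variables (R : realType) (T : topologicalType).

Definition expfam (tau : set T -> Prop) (E : set T -> set (R * nat)) (G : set T) : set (R * nat) :=
  if `[< tau G >] then set0 else gen (E G).

Lemma expfam_index_family n (M : mfd R T n) tau E : index_family M E -> index_family M (expfam tau E).
Proof.
move=> iE G bG; rewrite /expfam; case: ifP => _; first exact: index_set0.
exact/gen_index_set/iE.
Qed.

Lemma phg_scale n (M : mfd R T n) E u c : good M -> ifam M E -> phg M E u -> phg M E (fun x => c * u x).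
Proof.
move=> gM fE hu; have := phg_lin c gM fE (phg_zero E gM) hu.
by congr (phg M E _); apply/funext => x; rewrite add0r.
Qed.

Section Coefficients.
Variables (n : nat) (M : mfd R T n.+1).
Hypothesis gM : good M.
Variables (F U : set T) (tau : set T -> Prop) (E : set T -> set (R * nat)).
Hypotheses (bF : bhs M F) (oU : relopen (pts M) U) (iE : index_family M E) (nE : nonneg_off M tau E).
Local Notation N := (face M F (F `&` U)).
Local Notation Psi := (face_index M F (expfam tau E)).

(** The construction of the index family commutes with passing to a face, as H lies in a single G
    other than F. *)
Lemma face_expfam H : bhs N H -> expfam (face_type M F tau) (face_index M F E) H = Psi H.
Proof.
move=> bH; have [G [bG GF HG uG]] := face_bhs_sub gM bF oU bH.
rewrite (face_index_uniq gM bF oU _ bH bG GF HG) /expfam (face_index_uniq gM bF oU _ bH bG GF HG).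
congr (if _ then _ else _); apply: asbool_equiv_eq; split=> [[G' [bG' G'F HG' tG']]|tG]; last by exists G.
by rewrite -(uG G').
Qed.

Let fP : ifam N Psi.
Proof. exact: (face_ifam gM bF oU (fun G bG => index_set_ifin (expfam_index_family tau iE bG))). Qed.

(** The index sets of the exponential absorb those of u: at type 2 hypersurfaces they are empty,
    elsewhere E G lies in the semigroup, which is closed under addition. *)
Lemma face_expfam_mul f g : phg N (face_index M F E) f -> phg N Psi g -> phg N Psi (fun x => f x * g x).
Proof.
have fE := face_ifam gM bF oU (fun G bG => index_set_ifin (iE bG)).
apply: (phg_mul (face_good gM bF oU) fE fP fP).
move=> H bH x y; have [G [bG GF HG uG]] := face_bhs_sub gM bF oU bH.
rewrite !(face_index_uniq gM bF oU _ bH bG GF HG) /expfam; case: asboolP => [_ _ []|tG Ex].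
by move=> gy; apply: gen_addp => //; apply: gen_sub => //; exact: nE.
Qed.

Variables (a : R -> nat -> T -> R) (l0 : T -> R).
Hypothesis Ha : forall s p, E F (s, p) -> phg N (face_index M F E) (a s p).
Hypothesis Hl : phg N Psi (fun x => expR (- l0 x)).

Lemma Bc_phg j s q : phg N Psi (Bc (E F) a l0 j s q).
Proof.
have gN : good N by exact: face_good.
have fE : ifin (Epos (E F)) by exact: (Ep_ifin (index_set_ifin (iE bF))).
elim: j s q => [|j IH] s q /=.
  by case: ((s == 0) && (q == 0%N)) => //; exact: phg_zero.
have [l [_ inl el]] := fsum_seq R (conv_finite (s, q) fE (gen_ifin (index_set_ifin (iE bF)))).
have -> : convf (Epos (E F)) (gen (E F)) a (Bc (E F) a l0 j) s q =
    fun x => \sum_(xy <- l) a xy.1.1 xy.1.2 x * Bc (E F) a l0 j xy.2.1 xy.2.2 x.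
  by apply/funext => x; rewrite /convf /conv el.
apply: (phg_sum (f := fun xy x => a xy.1.1 xy.1.2 x * Bc (E F) a l0 j xy.2.1 xy.2.2 x) gN fP) => xy /inl[[Ex _] _ _].
by apply: face_expfam_mul => //; apply: Ha; case: (xy.1) Ex.
Qed.

Lemma bc_phg delta s q : phg N Psi (bc (E F) a l0 delta s q).
Proof.
have gN : good N by exact: face_good.
rewrite /bc; set J := (Num.bound _).+1.
apply: (phg_sum (f := fun (j : 'I_J) x => tcoef R j * Bc (E F) a l0 j s q x) gN fP) => j _.
exact: (phg_scale _ gN fP (Bc_phg _ _ _)).
Qed.

End Coefficients.

(** The predicate tau is arbitrary because on a face the type 2 hypersurfaces are those induced from
    M ([face_type]), and their bounds are known in the form [lower_bound] only. In dimension 0 the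
    claim is mere smoothness. *)
Theorem phg_exp n (M : mfd R T n) tau E u : good M -> index_family M E -> phg M E u ->
  nonneg_off M tau E -> lower_bound M tau u -> phg M (expfam tau E) (fun x => expR (- u x)).
Proof.
elim: n M tau E u => [|n IH] M tau E u gM iE hu nE LB; have su := phg_smooth hu.
  exact: smooth_fun_expN su.
split; first exact: smooth_fun_expN su.
move=> F U pr rho bF tr; have oU := triv_open tr; have [_ /(_ F U pr rho bF tr)[a [Ha Hr]]] := hu.
have gN := face_good gM bF oU; have fE := index_set_ifin (iE F bF).
have [tF|ntF] := pselect (tau F).
  have -> : expfam tau E F = set0 by rewrite /expfam asboolT.
  (* The index set is empty, so any coefficients serve. *)
  exists a; split=> // rhos hrhos.
  exact: (type2_expansion gM bF tr iE hu nE LB hrhos (Hr rhos hrhos) a tF).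
have EF : expfam tau E F = gen (E F) by rewrite /expfam asboolF.
rewrite EF.
(* Without defining functions on U the expansion is vacuous, but the coefficients must
   still be polyhomogeneous. *)
have [[rhos0 hrhos0]|nrhos] := pselect (exists rhos : set T -> T -> R, forall G, bhs M G -> is_bdf M U G (rhos G)); last first.
  exists (fun _ _ _ => 0); split=> [s p _|rhos hrhos]; first exact: phg_zero.
  by case: nrhos; exists rhos.
have [delta d0 Hd0] := ifin_gap 0 fE.
have Hd s q : E F (s, q) -> delta < s \/ (s = 0 /\ q = 0%N).
  by move=> Es; case: (nE F bF ntF s q Es) => [s0|]; [left; have := Hd0 _ Es s0; rewrite add0r|right].
exists (bc (E F) a (lead F E a) delta); split=> [s p _|rhos hrhos]; last first.
  exact: (type1_expansion gM bF tr iE hu nE LB hrhos (Hr rhos hrhos) ntF Ha d0 Hd).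
apply: (bc_phg gM bF oU iE nE Ha).
apply: (phg_ext (face_expfam gM tau E bF oU)).
apply: IH => //.
- exact: (face_index_family gM bF tr iE).
- rewrite /lead; case: asboolP => [E0|_]; first exact: Ha.
  exact: phg_zero.
- exact: (face_type_nonneg gM bF tr nE).
- exact: (lead_lower gM bF tr LB hrhos0 (Hr rhos0 hrhos0) d0 Hd).
Qed.

End Exponential.

Theorem theoremB7 (R : realType) (T : topologicalType) (n : nat)
    (X : mfd R T n) (hX : manifold_with_corners X)
    (rho : set T -> T -> R)
    (hrho : forall F, bhs X F -> is_bdf X setT F (rho F))
    (E : set T -> set (R * nat)) (hE : index_family X E)
    (u : T -> R) (hu : phg X E u)
    (h12 : forall F, bhs X F -> type1 E F \/ type2 X rho u F) :
  exists E' : set T -> set (R * nat),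
    [/\ index_family X E',
        forall F, bhs X F -> inf_ge0 (E' F),
        forall F, bhs X F -> type2 X rho u F -> E' F = set0 &
        phg X E' (fun x => expR (- u x))].
Proof.
have [_ XT Xs Xc Xe] := hX.
have pX : presm X by split=> // x _; exact: Xc.
have gX : good X by split=> // c x; exact: embedded_separated.
have nE : nonneg_off X (type2 X rho u) E.
  by move=> G bG nG; case: (h12 G bG) => // /inf_ge0_nneg; apply; exact: hE.
(* The defining function of G itself serves as the vanishing function; it is positive at interior
   points, which lie on no hypersurface. *)
have LB : lower_bound X (type2 X rho u) u.
  move=> G x0 bG [c [eps [c0 e0 [O [oO GO HO]]]]] Gx; have [rs r0 rG _] := hrho G bG.
  exists O, (rho G), c, eps; split=> //.
  - by split=> //; exact: GO.
  - exact: (smooth_fun_sub _ rs).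
  - by move=> x _ _ Gx'; exact/rG.
  - move=> x Ox ix; split; last exact: HO.
    rewrite lt0r r0 // andbT; apply/eqP => /rG Gx'.
    by apply: (interior_not_bhs gX ix bG); exact: Gx'.
exists (expfam (type2 X rho u) E); split.
- exact: expfam_index_family.
- move=> F bF; apply: nneg_inf_ge0; rewrite /expfam; case: ifP => _; [by move=> ? ? []|exact: gen_nneg].
- by move=> F bF tF; rewrite /expfam asboolT.
- exact: phg_exp.
Qed.
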